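(* In the setting fixed in the context, let $x^*_{\rm p.o.}(\epsilon)$ be the initial datum of the periodic orbit obtained by continuation, so that $\Upsilon(x^*_{\rm p.o.};\epsilon,q_1(0))=0$ and $\|x^*_{\rm p.o.}-x^*\|\le c_0|\epsilon|^{r+1-\alpha}$ with $2\alpha<r+1$. Consider the monodromy matrix $\Phi(T;H^{(r)},x^*_{\rm p.o.})$ and its approximation $\exp(L(\epsilon)T)$, with $L_{22}(\epsilon)$ positive definite. Then for $|\epsilon|$ small enough the following holds true: 1. there exists a positive constant $c_A$ such that $$\Phi(T;H^{(r)},x^*_{\rm p.o.})=\exp(L(\epsilon)T)+A,\qquad\text{with}\quad\|A\|_{\rm op}\leq c_A|\epsilon|^{r+1-\alpha};$$ 2. $\Sigma(\Phi(T;H^{(r)},x^*_{\rm p.o.}))=\Sigma_{11}\cup\Sigma_{22}$, where $\Sigma_{11}$ is close to $\Sigma(\exp(L_{11}(\epsilon)T))$ and includes at least two elements equal to $1$, while $\Sigma_{22}$ is close to $\Sigma(\exp(L_{22}(\epsilon)T))$ and all its elements lie on the unit circle.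
   Context: Notation: $\Sigma(\cdot)$ is the spectrum (with multiplicity), $\|\cdot\|_{\rm op}$ the operator norm; $|\lambda|\gtrsim|\epsilon|^\alpha$ means $|\lambda|\ge c|\epsilon|^\alpha$ with $c>0$ independent of $\epsilon$. ''Close to'' means that the two sets are deformations of one another, their distance vanishing as $\epsilon\to0$. Variables and function classes. Let $n=n_1+n_2$. Canonical variables are $\hat q=(q_1,q)\in\mathbb T\times\mathbb T^{n_1-1}$ (angles), $\hat p=(p_1,p)\in\mathbb R\times\mathbb R^{n_1-1}$ near $0$ (conjugate actions), and Cartesian variables $(\xi,\eta)$ near $0$ in $\mathbb C^{2n_2}$ ($\eta_j$ conjugate to $\xi_j$). $\mathcal P_\ell$ is the set of analytic functions of $(\hat p,\hat q,\xi,\eta)$, with Fourier expansion in $\hat q$, that are sums of functions homogeneous polynomial of degree $l$ in $\hat p$ and of degree $m$ in $(\xi,\eta)$, with $2l+m=\ell$. Original Hamiltonian. $H^{(0)}=\omega p_1+\sum_{j=1}^{n_2}\mathbf{i}\,\Omega_j\xi_j\eta_j+\sum_{\ell>2}f_\ell^{(0,0)}(\hat p,\xi,\eta)+\sum_{s>0}\sum_{\ell\ge0}f_\ell^{(0,s)}(\hat p,\hat q,\xi,\eta)$, analytic in all variables and in the small parameter $\epsilon$, $f_\ell^{(0,s)}\in\mathcal P_\ell$ of order $\mathcal O(\epsilon^s)$; the $\epsilon$-independent part is of the form $h_0(\hat p)+g_0(\xi,\eta)$. Standing assumptions: (H1) there is $m>0$ with $m\sum_i|v_i|\le\sum_i|\sum_jC_{0,ij}v_j|$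 for all $v\in\mathbb R^{n_1}$, where $C_{0,ij}=\partial^2f_4^{(0,0)}/\partial\hat p_i\partial\hat p_j|_{\hat p=0}$; (H2) $\|f_\ell^{(0,s)}\|\le E2^{-\ell}|\epsilon|^s$ for some $E>0$ in the weighted norm $\sum|g_{i,m_1,m_2,k}|\rho^{|i|}R^{|m_1|+|m_2|}e^{|k|\sigma}$ of the Taylor–Fourier coefficients, for fixed $\rho,\sigma,R>0$; (H3) $k_1\omega\pm\Omega_j\ne0$ for all $k_1\in\mathbb Z$, and $k_1\omega\pm\Omega_l\pm\Omega_k\ne0$ for all $k_1\in\mathbb Z\setminus\{0\}$, all indices and signs. Normal form. For $r\ge1$ and a parameter $q^*\in\mathbb T^{n_1-1}$, for $\epsilon$ small, $H^{(r)}=H^{(0)}\circ\Phi^{(r)}$ denotes the Hamiltonian obtained from $H^{(0)}$ by an analytic canonical transformation $\Phi^{(r)}$ (depending on $q^*$) that brings it in normal form up to order $r$: $$H^{(r)}=\omega p_1+\sum_{j}\mathbf{i}\,\Omega_j\xi_j\eta_j+\sum_{\ell>2}f_\ell^{(r,0)}(\hat p,\xi,\eta)+\sum_{s=1}^r\bigl(f_0^{(r,s)}+f_2^{(r,s)}+f_3^{(r,s)}+f_4^{(r,s)}\bigr)+\sum_{s>r}\sum_{\ell=0}^4f_\ell^{(r,s)}+\sum_{s>0}\sum_{\ell>4}f_\ell^{(r,s)},$$ with $f_\ell^{(r,s)}\in\mathcal P_\ell$ of order $\mathcal O(\epsilon^s)$, depending on $q^*$, and, for $1\le s\le r$: $f_0^{(r,s)}=f_0^{(r,s)}(q;q^*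 )$ is independent of $q_1$; $f_2^{(r,s)}$ is independent of $q_1$ and vanishes at $\xi=\eta=0,\ q=q^*$; $f_3^{(r,s)}$ is independent of $\hat p$; $f_4^{(r,s)}|_{\xi=\eta=0}$ is independent of $q_1$. The truncated normal form $Z^{(r)}$ is $H^{(r)}$ with all terms $f_\ell^{(r,s)}$, $s>r$, removed. Approximate periodic orbit. The parameter $q^*=q^*(\epsilon)$ is chosen as a solution of $\sum_{s=1}^r\nabla_qf_0^{(r,s)}(q;q^* )|_{q=q^*}=0$. With $x=(q,\hat p,\xi,\eta)$, the point $x^*=(q^*,0,0,0)$ is then a relative equilibrium of $Z^{(r)}$: $(\omega t+q_1(0),x^* )$ is a periodic solution of $Z^{(r)}$ with period $T=2\pi/\omega$. True periodic orbit. For $x(0)$ in a neighbourhood $\mathcal U(x^* )\subset\mathbb R^{2n-1}$, let $(q_1(t),q(t),\hat p(t),\xi(t),\eta(t))$ solve the Hamilton equations of $H^{(r)}$ with initial datum $(q_1(0),x(0))$ and set $\Upsilon(x(0);\epsilon,q_1(0))=(q_1(T)-q_1(0)-\omega T,\ q(T)-q(0),\ p(T)-p(0),\ \xi(T)-\xi(0),\ \eta(T)-\eta(0))$. The continuation is under the following hypotheses: $\|\Upsilon(x^*;\epsilon,q_1(0))\|\le c_1|\epsilon|^{r+1}$, and for small $\epsilon\neq0$ the matrix $N_{11}(\epsilon)=(\exp(L_{11}(\epsilon)T)-\mathrm{Id})_\flat$ is invertible with $|\lambda|\gtrsim|\epsilon|^\alpha$ for all $\lambda\in\Sigma(N_{11}(\epsilon))$,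 where $\alpha>0$, $2\alpha<r+1$ ($A_\flat$ is $A$ with the first column, that of $q_1$, and the $(n_1+1)$-th row, that of $p_1$, removed). Under these hypotheses, for small $\epsilon$, $x^*_{\rm p.o.}(\epsilon)$ is the unique zero of $\Upsilon$ with $\|x^*_{\rm p.o.}-x^*\|\le c_0|\epsilon|^{r+1-\alpha}$. Matrices. $\Phi(t;H,x_0)$ is the fundamental matrix (with $\Phi(0)=\mathrm{Id}$) of the variational equation $\dot\Phi=DX_H(\phi^t(x_0))\Phi$ along the orbit with initial datum $(q_1(0),x_0)$, $X_H$ being the Hamiltonian vector field. $L(\epsilon)=DX_{Z^{(r)}}(x^* )$ is constant in time and block diagonal, $L=\mathrm{diag}(L_{11},L_{22})$ with respect to $(\hat q,\hat p)$ and $(\xi,\eta)$: $$L_{11}=\begin{pmatrix}D_\#^\top&C\\-B_\#&-D_\#\end{pmatrix},\qquad L_{22}=\begin{pmatrix}E^\top&F\\-G&-E\end{pmatrix},$$ where, evaluated at $(\omega t+q_1(0),x^* )$, $B=D_q^2Z^{(r)}$, $D=D^2_{q\hat p}Z^{(r)}$, $C=D^2_{\hat p}Z^{(r)}$, $G=D^2_\xi Z^{(r)}$, $E=D^2_{\xi\eta}Z^{(r)}$, $F=D^2_\eta Z^{(r)}$; $B_\#$ is $B$ with a zero row added at the top and a zero column at the left, and $D_\#$ is $D$ (of size $(n_1-1)\times n_1$) with a zero row added at the top. At $\epsilon=0$: $B=D=G=F=0$, $E=\mathrm{diag}(\mathbf{i}\,\Omega_j)$. ''$L_{22}(\epsilon)$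 positive definite'' means that the transverse oscillators all rotate in the same direction, i.e. $\Omega_j>0$ for $j=1,\dots,n_2$. *)

(* Defs.v *)
Set Warnings "-all".
From HB Require Import structures.
From mathcomp Require Import all_boot all_order all_algebra.
From mathcomp Require Import complex.
From mathcomp Require Import all_classical all_reals all_analysis.

Set Implicit Arguments.
Unset Strict Implicit.
Unset Printing Implicit Defensive.

Import Order.TTheory GRing.Theory Num.Theory.
Import numFieldNormedType.Exports.

Local Open Scope classical_set_scope.
Local Open Scope ring_scope.
Local Open Scope complex_scope.

Section ComplexMatrices.
Variable R : realType.

(* The limit is taken in [R[i]^o], which carries the topology of [R[i]]. *)
Definition climn (u : nat -> R[i]) : R[i] := limn (u : nat -> R[i]^o).

Definition cexp (w : R[i]) : R[i] :=
  (expR (complex.Re w))%:C * (cos (complex.Im w) +i* sin (complex.Im w)).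

Definition l2norm (m : nat) (v : 'cV[R[i]]_m) : R :=
  Num.sqrt (\sum_i Normc.normc (v i 0) ^+ 2).

Definition opnorm (m n : nat) (A : 'M[R[i]]_(m, n)) : R :=
  sup [set l2norm (A *m v) | v in [set v : 'cV[R[i]]_n | l2norm v <= 1]].

Definition expmx (m : nat) (A : 'M[R[i]]_m) : 'M[R[i]]_m :=
  \matrix_(i, j) climn (fun N => (\sum_(k < N) (k`!%:R)^-1 *: (A ^+ k)) i j).

(* The eigenvalues, repeated according to their algebraic multiplicity. *)
Definition spectrum (m : nat) (A : 'M[R[i]]_m) : seq R[i] :=
  sval (closed_field_poly_normal (char_poly A)).

Definition matched_within (e : R) (s t : seq R[i]) : Prop :=
  exists2 t', perm_eq t' t & all2 (fun x y => `|x - y| <= e%:C) s t'.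

(* Two families of finite multisets of complex numbers: same cardinality, and
   bottleneck matching distance vanishing as the parameter tends to 0. *)
Definition close_to (s t : R -> seq R[i]) : Prop :=
  forall e : R, 0 < e -> \forall eps \near (0 : R), matched_within e (s eps) (t eps).

Definition has_time_derivative (f : R -> R[i]) (t : R) (w : R[i]) : Prop :=
  is_derive t 1 (fun s => complex.Re (f s)) (complex.Re w) /\
  is_derive t 1 (fun s => complex.Im (f s)) (complex.Im w).

End ComplexMatrices.

Section Calculus.
Variables (R : realType) (m : nat).

Definition partial (j : 'I_m) (F : 'cV[R[i]]_m -> R[i]) (z : 'cV[R[i]]_m) : R[i] :=
  'D_(delta_mx j 0 : 'cV[R[i]^o]_m) (F : 'cV[R[i]^o]_m -> R[i]^o) z.

Definition gradient (F : 'cV[R[i]]_m -> R[i]) (z : 'cV[R[i]]_m) : 'cV[R[i]]_m :=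
  \col_j partial j F z.

Definition hessian (F : 'cV[R[i]]_m -> R[i]) (z : 'cV[R[i]]_m) : 'M[R[i]]_m :=
  \matrix_(i, j) partial i (partial j F) z.

Definition jacobian_mx (F : 'cV[R[i]]_m -> 'cV[R[i]]_m) (z : 'cV[R[i]]_m) :
    'M[R[i]]_m :=
  \matrix_(i, j) partial j (fun w => F w i 0) z.

Definition holomorphic_at (F : 'cV[R[i]]_m -> 'cV[R[i]]_m) (z : 'cV[R[i]]_m) : Prop :=
  differentiable (F : 'cV[R[i]^o]_m -> 'cV[R[i]^o]_m) (nbhs (z : 'cV[R[i]^o]_m)).

Definition invariant_along (dom : set 'cV[R[i]]_m) (F : 'cV[R[i]]_m -> R[i])
    (v : 'cV[R[i]]_m) : Prop :=
  forall (z : 'cV[R[i]]_m) (a : R[i]),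
    dom z -> dom (z + a *: v) -> F (z + a *: v) = F z.

End Calculus.

(* [n1 = 1 + d] with [d = n_1 - 1].  A phase point is the column
   [((q_1, q), (p_1, p)), (xi, eta)]; angles are represented by their lifts to
   the real line (or, for the analytic extension, to a complex strip). *)

Notation phase R d n2 := ('cV[R[i]]_(((1 + d) + (1 + d)) + (n2 + n2))) (only parsing).

(* The variables [x = (q, (p_1, p), (xi, eta))]. *)
Notation reduced R d n2 := ('cV[R[i]]_((d + (1 + d)) + (n2 + n2))) (only parsing).

Section PhaseSpace.
Variables (R : realType) (d n2 : nat).
Implicit Types (z : phase R d n2) (x : reduced R d n2).

Definition idx_qhat (j : 'I_(1 + d)) : 'I_(((1 + d) + (1 + d)) + (n2 + n2)) :=
  lshift (n2 + n2) (lshift (1 + d) j).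
Definition idx_phat (j : 'I_(1 + d)) : 'I_(((1 + d) + (1 + d)) + (n2 + n2)) :=
  lshift (n2 + n2) (rshift (1 + d) j).
Definition idx_xi (j : 'I_n2) : 'I_(((1 + d) + (1 + d)) + (n2 + n2)) :=
  rshift ((1 + d) + (1 + d)) (lshift n2 j).
Definition idx_eta (j : 'I_n2) : 'I_(((1 + d) + (1 + d)) + (n2 + n2)) :=
  rshift ((1 + d) + (1 + d)) (rshift n2 j).
Definition first_idx : 'I_(1 + d) := lshift d ord0.
Definition other_idx (j : 'I_d) : 'I_(1 + d) := rshift 1 j.

Definition qhat z (j : 'I_(1 + d)) : R[i] := z (idx_qhat j) 0.
Definition phat z (j : 'I_(1 + d)) : R[i] := z (idx_phat j) 0.
Definition xi z (j : 'I_n2) : R[i] := z (idx_xi j) 0.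
Definition eta z (j : 'I_n2) : R[i] := z (idx_eta j) 0.

(* The real phase space.  The reality condition [eta = - i conj xi] says that
   the canonical variables [x = (xi + i eta)/sqrt 2] and
   [y = i (xi - i eta)/sqrt 2] are real; then
   [i Omega xi eta = Omega (x^2 + y^2)/2]. *)
Definition real_point z : Prop :=
  [/\ forall j, complex.Im (qhat z j) = 0,
      forall j, complex.Im (phat z j) = 0 &
      forall j, eta z j = - ('i * (xi z j)^*)].

Definition insert_q1 (q1 : R) x : phase R d n2 :=
  col_mx (col_mx (col_mx (q1%:C)%:M (usubmx (usubmx x))) (dsubmx (usubmx x)))
         (dsubmx x).

Definition real_reduced x : Prop := real_point (insert_q1 0 x).

Definition reduced_of_q (q : 'cV[R]_d) : reduced R d n2 :=
  col_mx (col_mx (map_mx (fun t : R => t%:C) q) 0) 0.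

Definition angle_shift (k : 'I_(1 + d) -> int) : phase R d n2 :=
  col_mx (col_mx (\col_j (2 * pi * (k j)%:~R)%:C) 0) 0.

Definition sympl (m : nat) : 'M[R[i]]_(m + m) := block_mx 0 1%:M (- 1%:M) 0.

Definition Jmx : 'M[R[i]]_(((1 + d) + (1 + d)) + (n2 + n2)) :=
  block_mx (sympl (1 + d)) 0 0 (sympl n2).

Definition ham_field (H : phase R d n2 -> R[i]) z : phase R d n2 :=
  Jmx *m gradient H z.

Definition Dham_field (H : phase R d n2 -> R[i]) z :
    'M[R[i]]_(((1 + d) + (1 + d)) + (n2 + n2)) :=
  Jmx *m hessian H z.

Definition polydomain (rho sigma rad : R) : set (phase R d n2) :=
  [set z | [/\ forall j, `|complex.Im (qhat z j)| < sigma,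
               forall j, Normc.normc (phat z j) < rho,
               forall j, Normc.normc (xi z j) < rad &
               forall j, Normc.normc (eta z j) < rad]].

Definition is_orbit (H : phase R d n2 -> R[i]) (dom : set (phase R d n2)) (T : R)
    (z : R -> phase R d n2) : Prop :=
  forall t, 0 <= t <= T ->
    [/\ dom (z t), real_point (z t) &
        forall i, has_time_derivative (fun s => z s i 0) t (ham_field H (z t) i 0)].

Definition is_fundamental_matrix (H : phase R d n2 -> R[i]) (T : R)
    (z : R -> phase R d n2)
    (M : R -> 'M[R[i]]_(((1 + d) + (1 + d)) + (n2 + n2))) : Prop :=
  M 0 = 1%:M /\
  forall t, 0 <= t <= T -> forall i j,
    has_time_derivative (fun s => M s i j) t ((Dham_field H (z t) *m M t) i j).

(* [(q_1(T) - q_1(0) - omega T, q(T) - q(0), p(T) - p(0), xi(T) - xi(0),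
   eta(T) - eta(0))]: the action [p_1] is left out. *)
Definition displacement (omega T : R) (z : R -> phase R d n2) :
    'cV[R[i]]_(((1 + d) + d) + (n2 + n2)) :=
  let dz := z T - z 0 in
  let dqhat := usubmx (usubmx dz) in
  let dphat := dsubmx (usubmx dz) in
  col_mx (col_mx (dqhat - col_mx ((omega * T)%:C)%:M 0) (dsubmx dphat))
         (dsubmx dz).

(* [A_flat]: the column of [q_1] and the row of [p_1] are removed. *)
Definition flat (A : 'M[R[i]]_((1 + d) + (1 + d))) :
    'M[R[i]]_(((1 + d) + (1 + d)).-1) :=
  row' (rshift (1 + d) first_idx) (col' (lshift (1 + d) first_idx) A).

Section Blocks.
Variables (H : phase R d n2 -> R[i]) (z : phase R d n2).
Let hqp : 'M[R[i]]_((1 + d) + (1 + d)) := ulsubmx (hessian H z).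
Let hxe : 'M[R[i]]_(n2 + n2) := drsubmx (hessian H z).

Definition blockB : 'M[R[i]]_d := drsubmx (ulsubmx hqp).
Definition blockD : 'M[R[i]]_(d, 1 + d) := dsubmx (ursubmx hqp).
Definition blockC : 'M[R[i]]_(1 + d) := drsubmx hqp.
Definition blockG : 'M[R[i]]_n2 := ulsubmx hxe.
Definition blockE : 'M[R[i]]_n2 := ursubmx hxe.
Definition blockF : 'M[R[i]]_n2 := drsubmx hxe.

Definition sharpB : 'M[R[i]]_(1 + d) := block_mx 0 0 0 blockB.
Definition sharpD : 'M[R[i]]_(1 + d) := col_mx 0 blockD.

Definition L11_of : 'M[R[i]]_((1 + d) + (1 + d)) :=
  block_mx sharpD^T blockC (- sharpB) (- sharpD).
Definition L22_of : 'M[R[i]]_(n2 + n2) :=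
  block_mx blockE^T blockF (- blockG) (- blockE).
End Blocks.

End PhaseSpace.

(* The index [(i, m1, m2, k)] of the monomial
   [phat^i xi^m1 eta^m2 exp (i k . qhat)]. *)
Definition tfindex (d n2 : nat) : Type :=
  ({ffun 'I_(1 + d) -> nat} * {ffun 'I_n2 -> nat} * {ffun 'I_n2 -> nat}
   * {ffun 'I_(1 + d) -> int})%type.

Definition tfseries (R : realType) (d n2 : nat) : Type := tfindex d n2 -> R[i].

Section TaylorFourier.
Variables (R : realType) (d n2 : nat).
Implicit Types (g : tfseries R d n2) (z : phase R d n2).

Definition tfdeg (x : tfindex d n2) : nat :=
  let: (i, m1, m2, _) := x in
  (2 * (\sum_j i j) + (\sum_j m1 j + \sum_j m2 j))%N.

Definition tfmonomial (x : tfindex d n2) z : R[i] :=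
  let: (i, m1, m2, k) := x in
  (\prod_j phat z j ^+ i j) * (\prod_j xi z j ^+ m1 j) * (\prod_j eta z j ^+ m2 j)
  * cexp ('i * \sum_j (k j)%:~R * qhat z j).

Definition tfweight (rho sigma rad : R) (x : tfindex d n2) : R :=
  let: (i, m1, m2, k) := x in
  rho ^+ (\sum_j i j)%N * rad ^+ (\sum_j m1 j + \sum_j m2 j)%N
  * expR ((\sum_j absz (k j))%N%:R * sigma).

Definition tfnorm (rho sigma rad : R) g : \bar R :=
  (\esum_(x in [set: tfindex d n2])
     (Normc.normc (g x) * tfweight rho sigma rad x)%:E)%E.

(* The sum of the series; [pickle_inv] enumerates the countable index set, and
   the order is irrelevant where the series converges absolutely. *)
Definition tfeval g z : R[i] :=
  climn (fun N => \sum_(n < N)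
    if pickle_inv n is Some x then g x * tfmonomial x z else 0).

(* The component in the class [P_l]. *)
Definition tfpart (l : nat) g : tfseries R d n2 :=
  fun x => if tfdeg x == l then g x else 0.

Definition ham_linear (omega : R) (Omega : 'I_n2 -> R) z : R[i] :=
  omega%:C * phat z (first_idx d) + \sum_j 'i * (Omega j)%:C * xi z j * eta z j.

Definition ham (omega : R) (Omega : 'I_n2 -> R) (f0 : tfseries R d n2)
    (f : nat -> tfseries R d n2) z : R[i] :=
  ham_linear omega Omega z + tfeval f0 z
  + climn (fun N => \sum_(1 <= s < N) tfeval (f s) z).

Definition ham_trunc (r : nat) (omega : R) (Omega : 'I_n2 -> R)
    (f0 : tfseries R d n2) (f : nat -> tfseries R d n2) z : R[i] :=
  ham_linear omega Omega z + tfeval f0 z + \sum_(1 <= s < r.+1) tfeval (f s) z.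

(* The terms of order 0 in the small parameter start at degree 3 and are of the
   form [h0 (phat) + g0 (xi, eta)]. *)
Definition split_order_zero (dom : set (phase R d n2)) (f0 : tfseries R d n2) : Prop :=
  (forall x, (tfdeg x <= 2)%N -> f0 x = 0) /\
  exists (h0 : ('I_(1 + d) -> R[i]) -> R[i])
         (g0 : ('I_n2 -> R[i]) -> ('I_n2 -> R[i]) -> R[i]),
    forall z, dom z -> tfeval f0 z = h0 (phat z) + g0 (xi z) (eta z).

End TaylorFourier.

(* [f0] is the part of order 0 in [eps]; [f s eps], for [s > 0], collects the
   terms [f_l^(0,s)], [l >= 0], which are recovered by [tfpart]. *)

Section OriginalHamiltonian.
Variables (R : realType) (d n2 : nat).
Variables (omega : R) (Omega : 'I_n2 -> R).
Variables (f0 : tfseries R d n2) (f : nat -> R -> tfseries R d n2).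
Variables (rho sigma rad : R).

Definition H0_of (eps : R) : phase R d n2 -> R[i] :=
  ham omega Omega f0 (fun s => f s eps).

Definition C0_of : 'M[R[i]]_(1 + d) := blockC (tfeval (tfpart 4 f0)) 0.

Definition analytic_in_eps : Prop :=
  exists (rho' sigma' rad' delta K : R) (a : nat -> tfseries R d n2),
    [/\ [/\ 0 < rho', 0 < sigma', 0 < rad' & 0 < delta],
        forall k, (tfnorm rho' sigma' rad' (a k) <= (K * delta ^- k)%:E)%E &
        forall eps z, `|eps| < delta -> polydomain rho' sigma' rad' z ->
          H0_of eps z = climn (fun N => \sum_(k < N) eps%:C ^+ k * tfeval (a k) z)].

Record original_hamiltonian : Prop := {
  oh_radii : [/\ 0 < rho, 0 < sigma & 0 < rad];
  oh_omega : 0 < omega;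
  oh_order_zero : split_order_zero (polydomain rho sigma rad) f0;
  oh_analytic : analytic_in_eps;
  oh_real : \forall eps \near (0 : R), forall z,
    polydomain rho sigma rad z -> real_point z -> complex.Im (H0_of eps z) = 0;
  oh_twist : exists2 m : R, 0 < m &
    forall v : 'cV[R]_(1 + d),
      (m * \sum_i `|v i 0|)%:C <= \sum_i `|\sum_j C0_of i j * (v j 0)%:C|;
  oh_bound : exists2 E : R, 0 < E &
    (forall l, (tfnorm rho sigma rad (tfpart l f0) <= (E * 2 ^- l)%:E)%E) /\
    \forall eps \near (0 : R), forall l s, (0 < s)%N ->
      (tfnorm rho sigma rad (tfpart l (f s eps)) <= (E * 2 ^- l * `|eps| ^+ s)%:E)%E;
  oh_melnikov1 : forall (k1 : int) (j : 'I_n2),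
    k1%:~R * omega + Omega j != 0 /\ k1%:~R * omega - Omega j != 0;
  oh_melnikov2 : forall (k1 : int) (j k : 'I_n2) (a b : bool), k1 != 0 ->
    k1%:~R * omega + (-1) ^+ a * Omega j + (-1) ^+ b * Omega k != 0
}.

End OriginalHamiltonian.

(* The parameter [qs] is [q^*]; [Phi eps qs] is the canonical transformation and
   [g s eps qs] collects the terms [f_l^(r,s)]. *)

Section NormalForm.
Variables (R : realType) (d n2 : nat) (r : nat).
Variables (omega : R) (Omega : 'I_n2 -> R).
Variables (f0 : tfseries R d n2) (f : nat -> R -> tfseries R d n2).
Variables (rho sigma rad : R).
Variables (g0 : tfseries R d n2) (g : nat -> R -> 'cV[R]_d -> tfseries R d n2).
Variables (Phi : R -> 'cV[R]_d -> phase R d n2 -> phase R d n2).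
Variables (rho' sigma' rad' : R).

Definition Hr_of (eps : R) (qs : 'cV[R]_d) : phase R d n2 -> R[i] :=
  ham omega Omega g0 (fun s => g s eps qs).

Definition Zr_of (eps : R) (qs : 'cV[R]_d) : phase R d n2 -> R[i] :=
  ham_trunc r omega Omega g0 (fun s => g s eps qs).

(* An analytic canonical transformation of the real phase space, extended to a
   complex neighbourhood of the torus [phat = 0, xi = eta = 0]. *)
Record canonical_transformation (dom dom' : set (phase R d n2))
    (F : phase R d n2 -> phase R d n2) : Prop := {
  ct_maps : forall z, dom' z -> dom (F z);
  ct_holomorphic : forall z, dom' z -> holomorphic_at F z;
  ct_injective : forall z w, dom' z -> dom' w -> F z = F w -> z = w;
  ct_symplectic : forall z, dom' z ->
    (jacobian_mx F z)^T *m Jmx R d n2 *m jacobian_mx F z = Jmx R d n2;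
  ct_real : forall z, dom' z -> real_point z -> real_point (F z);
  ct_torus : forall z k, dom' z -> F (z + angle_shift R n2 k) = F z + angle_shift R n2 k
}.

Let dom' := polydomain (n2 := n2) (d := d) rho' sigma' rad'.
Let e_q1 : phase R d n2 := delta_mx (idx_qhat n2 (first_idx d)) 0.
Let e_phat (j : 'I_(1 + d)) : phase R d n2 := delta_mx (idx_phat n2 j) 0.

(* Imposed on the terms of order [eps^s] for [1 <= s <= r], where the normal form
   has no term in [P_1]. *)
Record normalized (qs : 'cV[R]_d) (h : tfseries R d n2) : Prop := {
  nz_f0 : invariant_along dom' (tfeval (tfpart 0 h)) e_q1;
  nz_f1 : forall x, tfdeg x = 1%N -> h x = 0;
  nz_f2 : invariant_along dom' (tfeval (tfpart 2 h)) e_q1;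
  nz_f2_at : forall z, dom' z ->
    (forall j, qhat z (other_idx j) = (qs j 0)%:C) ->
    (forall j, xi z j = 0) -> (forall j, eta z j = 0) ->
    tfeval (tfpart 2 h) z = 0;
  nz_f3 : forall j, invariant_along dom' (tfeval (tfpart 3 h)) (e_phat j);
  nz_f4 : invariant_along dom'
    (fun z => tfeval (tfpart 4 h) (col_mx (usubmx z) 0)) e_q1
}.

Record normal_form : Prop := {
  nf_radii : [/\ 0 < rho', 0 < sigma' & 0 < rad'];
  nf_transformation : \forall eps \near (0 : R), forall qs,
    canonical_transformation (polydomain rho sigma rad) dom' (Phi eps qs);
  nf_composition : \forall eps \near (0 : R), forall qs z, dom' z ->
    Hr_of eps qs z = H0_of omega Omega f0 f eps (Phi eps qs z);
  nf_torus : \forall eps \near (0 : R), forall s qs (k : 'I_d -> int),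
    g s eps (qs + \col_j (2 * pi * (k j)%:~R)) = g s eps qs;
  nf_order_zero : split_order_zero dom' g0;
  (* [f_l^(r,s)] is of order [eps^s], in the sense of [oh_bound]: uniformly in [q^*],
     with constants independent of [eps]. *)
  nf_order : exists E mu : R, [/\ 0 < E, 0 < mu,
    forall l, (tfnorm rho' sigma' rad' (tfpart l g0) <= (E * 2 ^- l)%:E)%E &
    \forall eps \near (0 : R), forall qs l s, (0 < s)%N ->
      (tfnorm rho' sigma' rad' (tfpart l (g s eps qs))
         <= (E * 2 ^- l * (mu * `|eps|) ^+ s)%:E)%E];
  nf_normalized : \forall eps \near (0 : R), forall qs s, (1 <= s <= r)%N ->
    normalized qs (g s eps qs)
}.

End NormalForm.

Section Continuation.
Variables (R : realType) (d n2 : nat) (r : nat).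
Variables (omega : R) (Omega : 'I_n2 -> R).
Variables (g0 : tfseries R d n2) (g : nat -> R -> 'cV[R]_d -> tfseries R d n2).
Variables (rho' sigma' rad' : R).
Variables (qstar : R -> 'cV[R]_d) (q10 : R).

Definition period : R := 2 * pi / omega.

Definition xstar (eps : R) : reduced R d n2 := reduced_of_q n2 (qstar eps).

Definition stationary_qstar : Prop :=
  \forall eps \near (0 : R), forall j : 'I_d,
    \sum_(1 <= s < r.+1)
      partial (idx_qhat n2 (other_idx j)) (tfeval (tfpart 0 (g s eps (qstar eps))))
              (insert_q1 q10 (xstar eps)) = 0.

Let Hr (eps : R) := Hr_of omega Omega g0 g eps (qstar eps).
Let Zr (eps : R) := Zr_of r omega Omega g0 g eps (qstar eps).
Let zstar (eps : R) := insert_q1 q10 (xstar eps).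

(* By the normal form these matrices do not change along
   [(omega t + q_1(0), x^* )]; they are evaluated at [t = 0]. *)
Definition Lmx (eps : R) := Dham_field (Zr eps) (zstar eps).
Definition L11 (eps : R) := L11_of (Zr eps) (zstar eps).
Definition L22 (eps : R) := L22_of (Zr eps) (zstar eps).

Definition N11 (eps : R) : 'M[R[i]]_(((1 + d) + (1 + d)).-1) :=
  flat (expmx ((period%:C) *: L11 eps) - 1%:M).

(* [orb eps x] is the orbit of [H^(r)] with initial datum [(q_1(0), x)], for [x]
   in a neighbourhood of [x^*] in the real reduced space. *)
Variable orb : R -> reduced R d n2 -> R -> phase R d n2.

Definition orbits_near_xstar : Prop :=
  exists2 delta : R, 0 < delta &
    \forall eps \near (0 : R), forall x, real_reduced x ->
      l2norm (x - xstar eps) < delta ->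
      is_orbit (Hr eps) (polydomain rho' sigma' rad') period (orb eps x) /\
      orb eps x 0 = insert_q1 q10 x.

Definition Upsilon (eps : R) (x : reduced R d n2) :
    'cV[R[i]]_(((1 + d) + d) + (n2 + n2)) :=
  displacement omega period (orb eps x).

Definition continuation_hypotheses (c1 alpha : R) : Prop :=
  [/\ 0 < alpha, 2 * alpha < r.+1%:R,
      \forall eps \near (0 : R),
        l2norm (Upsilon eps (xstar eps)) <= c1 * `|eps| ^+ r.+1 &
      exists2 c : R, 0 < c & \forall eps \near (0 : R)^',
        N11 eps \in unitmx /\
        forall lambda, lambda \in spectrum (N11 eps) ->
          (c * `|eps| `^ alpha)%:C <= `|lambda|].

Definition is_continuation (c0 alpha : R) (xpo : R -> reduced R d n2) : Prop :=
  \forall eps \near (0 : R),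
    let near_xstar x := real_reduced x /\
      l2norm (x - xstar eps) <= c0 * `|eps| `^ (r.+1%:R - alpha) in
    [/\ near_xstar (xpo eps), Upsilon eps (xpo eps) = 0 &
        forall x, near_xstar x -> Upsilon eps x = 0 -> x = xpo eps].

End Continuation.

(* Main.v *)
(* Along the approximate orbit the Hessian of [Z^(r)] is constant, so [exp (L T)] is its
   monodromy matrix. Uniform bounds on the Taylor-Fourier series of [H^(r)] give
   [H^(r) - Z^(r) = O(eps^(r+1))] in C^2 on a complex tube around the torus. By Gronwall the
   true periodic orbit stays [O(eps^(r+1-alpha))]-close to the approximate one over a period,
   and comparing the two variational equations yields the first claim.

   As [eps -> 0] the matrices [Phi (T)], [exp (L11 T)] and [exp (L22 T)] converge to those of
   the unperturbed problem, whose spectrum consists of 1, with multiplicity [2 n_1], and of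
   the [exp (+- i Omega_j T)]. The nonresonance conditions separate the latter from 1 and,
   since all [Omega_j] are positive, the two signs from each other; continuity of the roots
   then splits the spectrum. The velocity of the periodic orbit is an eigenvector for 1 (the
   action [p_1] returns by conservation of energy), and 1 has even multiplicity because the
   monodromy matrix is symplectic. The eigenvalues away from 1 lie on the unit circle by
   Krein's argument: the monodromy preserves a Hermitian form, for which an eigenvector of an
   eigenvalue off the circle is isotropic, whereas an eigenvector of an eigenvalue away from 1
   is concentrated either on [xi] or on [eta], where the form is definite. *)

Set Warnings "-all".
Require Import Defs.
From HB Require Import structures.
From mathcomp Require Import all_boot all_order all_algebra.
From mathcomp Require Import complex.
From mathcomp Require Import all_classical all_reals all_analysis.
From mathcomp Require Import zify ring lra.
Set Implicit Arguments.
Unset Strict Implicit.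
Unset Printing Implicit Defensive.
Import Order.TTheory GRing.Theory Num.Theory.
Import numFieldNormedType.Exports.
Local Open Scope classical_set_scope.
Local Open Scope ring_scope.
Local Open Scope complex_scope.

(** Nothing is known of how [qstar eps] depends on [eps]: it solves an equation for each [eps]
    separately. Every bound must therefore be uniform in [q^*], and every limit independent of it.
    Uniformity comes from jets, that is, explicit bounds on a function, its first two derivatives
    and its Taylor remainders over a tube invariant under real translations of the angles. Jets pass
    to products and absolutely convergent series with explicit constants, so that Taylor-Fourier
    series are differentiated term by term without Cauchy estimates. Independence of [q^*] holds
    because the terms of order 0 ignore the angles: on the torus their Hessian is the one at the
    origin.

    The spectra of the monodromy and of the exponentials are not compared with each other but with
    those of one fixed unperturbed matrix. The multiplier 1 is degenerate there, with Jordan blocks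
    created by the twist, so eigenvalues need not inherit the order in [eps] of the matrix estimate;
    closeness only asks for a vanishing distance, which continuity of roots provides. *)

Local Notation normc := Normc.normc.

(** * Limits and series of complex numbers *)

Section Modulus.
Variable R : realType.
Implicit Types (x y z : R[i]).

Lemma normcE0 x : `|x| = (normc x)%:C.
Proof. by rewrite normc_def; case: x. Qed.

Lemma normc_ge0 x : 0 <= normc x.
Proof. by case: x => a b; rewrite /= sqrtr_ge0. Qed.

Lemma normc0 : normc (0 : R[i]) = 0.
Proof. exact: Normc.normc0. Qed.

Lemma normc1 : normc (1 : R[i]) = 1.
Proof. exact: Normc.normc1. Qed.

Lemma normc_eq0 x : (normc x == 0) = (x == 0).
Proof. by apply/eqP/eqP => [/Normc.eq0_normc //|->]; rewrite normc0. Qed.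

Lemma normcM x y : normc (x * y) = normc x * normc y.
Proof. exact: Normc.normcM. Qed.

Lemma normcD x y : normc (x + y) <= normc x + normc y.
Proof. exact: le_normcD. Qed.

Lemma normcN x : normc (- x) = normc x.
Proof. exact: normcN. Qed.

Lemma normcB x y : normc (x - y) <= normc x + normc y.
Proof. by rewrite -(normcN y) normcD. Qed.

Lemma normc_distC x y : normc (x - y) = normc (y - x).
Proof. by rewrite -normcN opprB. Qed.

Lemma normc_tri z x y : normc (x - y) <= normc (x - z) + normc (z - y).
Proof. by apply: le_trans (normcD _ _); rewrite addrA subrK. Qed.

Lemma normcR (a : R) : normc a%:C = `|a|.
Proof. by rewrite /= expr0n addr0 sqrtr_sqr. Qed.

Lemma normci : normc ('i : R[i]) = 1.
Proof. by rewrite /= expr0n add0r expr1n sqrtr1. Qed.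

Lemma normcX x n : normc (x ^+ n) = normc x ^+ n.
Proof. by elim: n => [|n IH]; rewrite ?expr0 ?normc1// !exprS normcM IH. Qed.

Lemma normcV x : normc x^-1 = (normc x)^-1.
Proof. exact: Normc.normcV. Qed.

Lemma normc_conj x : normc x^* = normc x.
Proof. by case: x => a b; rewrite /= sqrrN. Qed.

Lemma normc_sum (I : Type) (s : seq I) (P : pred I) (F : I -> R[i]) :
  normc (\sum_(i <- s | P i) F i) <= \sum_(i <- s | P i) normc (F i).
Proof.
elim/big_rec2: _ => [|i u v _ h]; first by rewrite normc0.
by apply: le_trans (normcD _ _) _; rewrite lerD2l.
Qed.

Lemma normc_sqr x : normc x ^+ 2 = complex.Re x ^+ 2 + complex.Im x ^+ 2.
Proof. by case: x => a b /=; rewrite sqr_sqrtr// addr_ge0// sqr_ge0. Qed.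

Lemma normc_Re x : `|complex.Re x| <= normc x.
Proof.
rewrite -(@ler_pXn2r _ 2)// ?nnegrE ?normc_ge0//.
by rewrite normc_sqr -normrX ger0_norm ?sqr_ge0// lerDl sqr_ge0.
Qed.

Lemma normc_Im x : `|complex.Im x| <= normc x.
Proof.
rewrite -(@ler_pXn2r _ 2)// ?nnegrE ?normc_ge0//.
by rewrite normc_sqr -normrX ger0_norm ?sqr_ge0// lerDr sqr_ge0.
Qed.

Lemma normc_ReIm x : normc x <= `|complex.Re x| + `|complex.Im x|.
Proof.
rewrite -(@ler_pXn2r _ 2)// ?nnegrE ?normc_ge0// ?addr_ge0//.
rewrite normc_sqr sqrrD !real_normK ?num_real// -addrA lerD2l lerDr.
by rewrite mulrn_wge0// mulr_ge0.
Qed.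

Lemma sqr_normc_conj x : (normc x ^+ 2)%:C = x * x^*.
Proof. by rewrite rmorphXn /= -normcE0 sqr_normc. Qed.

End Modulus.

Section ComplexConvergence.
Variable R : realType.

(** Convergence with real tolerances. In the topology of [R[i]] radii are complex numbers that
    happen to be real; the translation is confined to [climnE] and [partialE]. *)
Definition ccvg (T : Type) (F : set_system T) (f : T -> R[i]) (l : R[i]) : Prop :=
  forall e : R, 0 < e -> \forall t \near F, normc (f t - l) < e.

Section Filtered.
Context (T : Type) (F : set_system T) {FF : Filter F}.
Implicit Types (f g : T -> R[i]) (l m : R[i]).

Lemma ccvg_cst l : ccvg F (fun=> l) l.
Proof. by move=> e e0; apply: nearW => t; rewrite subrr normc0. Qed.

Lemma ccvg_ext f g l : (\forall t \near F, f t = g t) -> ccvg F f l -> ccvg F g l.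
Proof. by move=> fg fl e e0; apply: filterS2 fg (fl e e0) => t ->. Qed.

Lemma ccvgD f g l m : ccvg F f l -> ccvg F g m -> ccvg F (fun t => f t + g t) (l + m).
Proof.
move=> fl gm e e0; near=> t.
rewrite opprD addrACA (splitr e); apply: le_lt_trans (normcD _ _) _.
by apply: ltrD; near: t; [apply: fl|apply: gm]; rewrite divr_gt0.
Unshelve. all: end_near. Qed.

Lemma ccvgMl f l c : ccvg F f l -> ccvg F (fun t => c * f t) (c * l).
Proof.
have c0 : 0 < normc c + 1 by rewrite ltr_wpDl ?normc_ge0.
move=> fl e e0; near=> t; rewrite -mulrBr normcM.
apply: le_lt_trans (_ : _ <= (normc c + 1) * normc (f t - l)) _.
  by rewrite ler_wpM2r ?normc_ge0// lerDl.
rewrite mulrC -ltr_pdivlMr//; near: t; apply: fl; exact: divr_gt0.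
Unshelve. all: end_near. Qed.

Lemma ccvgN f l : ccvg F f l -> ccvg F (fun t => - f t) (- l).
Proof. by move=> fl e /fl; apply: filterS => t; rewrite -opprD normcN. Qed.

Lemma ccvgB f g l m : ccvg F f l -> ccvg F g m -> ccvg F (fun t => f t - g t) (l - m).
Proof. by move=> fl /ccvgN; exact: ccvgD. Qed.

Lemma ccvg_bounded f l : ccvg F f l -> \forall t \near F, normc (f t) < normc l + 1.
Proof.
move=> /(_ 1 ltr01); apply: filterS => t ft.
by rewrite -(subrK l (f t)) addrC; apply: le_lt_trans (normcD _ _) _; rewrite ltrD2l.
Qed.

Lemma ccvgM f g l m : ccvg F f l -> ccvg F g m -> ccvg F (fun t => f t * g t) (l * m).
Proof.
move=> fl gm; apply: ccvg_ext (_ : ccvg F (fun t => (f t - l) * g t + l * g t) _).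
  by apply: nearW => t; rewrite -mulrDl subrK.
rewrite -[X in ccvg _ _ X]add0r; apply: ccvgD; last exact: ccvgMl.
move=> e e0; have m0 : 0 < normc m + 1 by rewrite ltr_wpDl ?normc_ge0.
near=> t; rewrite subr0 normcM -(divfK (lt0r_neq0 m0) e).
apply: ltr_pM; rewrite ?normc_ge0//; near: t; last exact: ccvg_bounded.
by apply: fl; rewrite divr_gt0.
Unshelve. all: end_near. Qed.

Lemma ccvg_sum (I : Type) (s : seq I) (P : pred I) (f : I -> T -> R[i]) (l : I -> R[i]) :
  (forall i, P i -> ccvg F (f i) (l i)) ->
  ccvg F (fun t => \sum_(i <- s | P i) f i t) (\sum_(i <- s | P i) l i).
Proof.
move=> fl; elim: s => [|i s IH].
  by rewrite big_nil; apply: ccvg_ext (ccvg_cst 0); apply: nearW => t; rewrite big_nil.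
rewrite big_cons; have [Pi|Pi] := boolP (P i).
  apply: ccvg_ext (ccvgD (fl _ Pi) IH); apply: nearW => t.
  by rewrite big_cons Pi.
by apply: ccvg_ext IH; apply: nearW => t; rewrite big_cons (negbTE Pi).
Qed.

Lemma ccvg_prod (I : Type) (s : seq I) (P : pred I) (f : I -> T -> R[i]) (l : I -> R[i]) :
  (forall i, P i -> ccvg F (f i) (l i)) ->
  ccvg F (fun t => \prod_(i <- s | P i) f i t) (\prod_(i <- s | P i) l i).
Proof.
move=> fl; elim: s => [|i s IH].
  by rewrite big_nil; apply: ccvg_ext (ccvg_cst 1); apply: nearW => t; rewrite big_nil.
rewrite big_cons; have [Pi|Pi] := boolP (P i).
  apply: ccvg_ext (ccvgM (fl _ Pi) IH); apply: nearW => t.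
  by rewrite big_cons Pi.
by apply: ccvg_ext IH; apply: nearW => t; rewrite big_cons (negbTE Pi).
Qed.

Lemma ccvg_det (m : nat) (A : T -> 'M[R[i]]_m) (A0 : 'M[R[i]]_m) :
  (forall i j, ccvg F (fun t => A t i j) (A0 i j)) ->
  ccvg F (fun t => \det (A t)) (\det A0).
Proof.
by move=> AA0; rewrite /determinant; apply: ccvg_sum => s _; apply: ccvgMl; apply: ccvg_prod.
Qed.

End Filtered.

Section Proper.
Context (T : Type) (F : set_system T) {FF : ProperFilter F}.
Implicit Types (f g : T -> R[i]) (l m : R[i]).

Lemma ccvg_le f l (B : R) : (\forall t \near F, normc (f t) <= B) ->
  ccvg F f l -> normc l <= B.
Proof.
move=> fB fl; rewrite leNgt; apply/negP => Bl.
have e0 : 0 < normc l - B by rewrite subr_gt0.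
have [t] := filter_ex (filterI fB (fl _ e0)).
case=> fB' fl'; have := normcD (f t) (l - f t); rewrite addrC subrK leNgt => /negP; apply.
by rewrite -ltrBrDl normc_distC; apply: lt_le_trans fl' _; rewrite lerD2l lerN2.
Qed.

Lemma ccvg_uniq f l m : ccvg F f l -> ccvg F f m -> l = m.
Proof.
move=> fl fm; apply/eqP; rewrite -subr_eq0 -normc_eq0 eq_le normc_ge0 andbT.
apply: (ccvg_le _ (ccvgB fl fm)); apply: nearW => t.
by rewrite subrr normc0.
Qed.

End Proper.

Lemma climnE (u : nat -> R[i]) l : ccvg \oo u l -> climn u = l.
Proof.
move=> ul; rewrite /climn; apply: (@cvg_lim R[i]^o); first exact: norm_hausdorff.
apply/cvgrPdist_lt => e e0.
have := e0; case: e e0 => a b e0; rewrite ltcE /= => /andP[/eqP b0 a0].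
move: (ul _ a0); apply: filterS => n un.
by rewrite (normcE0 (l - u n)) ltcE /= b0 eqxx/= normc_distC.
Qed.

End ComplexConvergence.

Section ComplexSeries.
Variable R : realType.
Implicit Types (a b : nat -> R[i]) (u : nat -> R).

Definition csum a : R[i] := climn (fun N => \sum_(n < N) a n).

Definition csummable a : Prop := exists B : R, forall N, \sum_(n < N) normc (a n) <= B.

Lemma csummable_le a u (B : R) : (forall n, normc (a n) <= u n) ->
  (forall N, \sum_(n < N) u n <= B) -> csummable a.
Proof. by move=> au uB; exists B => N; apply: le_trans (uB N); apply: ler_sum. Qed.

Lemma bounded_series_cvg u (B : R) : (forall n, 0 <= u n) ->
  (forall N, \sum_(n < N) u n <= B) -> cvgn (series u).
Proof.
move=> u0 uB; apply: nondecreasing_is_cvgn; first exact: nondecreasing_series.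
by exists B => _ [N _ <-]; rewrite /series /= big_mkord.
Qed.

Lemma csummable_cvg a : csummable a -> ccvg \oo (fun N => \sum_(n < N) a n) (csum a).
Proof.
move=> [B aB].
(* [p] will be the real and then the imaginary part; each is an absolutely convergent real
   series. *)
have cv (p : R[i] -> R) : {morph p : x y / x + y} -> p 0 = 0 ->
    (forall x, `|p x| <= normc x) ->
    exists l : R, (fun N => p (\sum_(n < N) a n)) @ \oo --> l.
  move=> pD p0 pn; have cn : cvgn [normed series (p \o a)].
    apply: (@bounded_series_cvg _ B) => [n|N]; first exact: normr_ge0.
    by apply: le_trans (aB N); apply: ler_sum => i _; exact: pn.
  exists (limn (series (p \o a))); have := normed_cvg cn.
  rewrite (_ : series _ = (fun N => p (\sum_(n < N) a n)))//; apply/funext => N.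
  by rewrite /series /= big_mkord (big_morph p pD p0).
have [lr hr] : exists l : R, (fun N => complex.Re (\sum_(n < N) a n)) @ \oo --> l.
  by apply: cv => // [[? ?] [? ?]|] //; exact: normc_Re.
have [li hi] : exists l : R, (fun N => complex.Im (\sum_(n < N) a n)) @ \oo --> l.
  by apply: cv => // [[? ?] [? ?]|] //; exact: normc_Im.
suff cvl : ccvg \oo (fun N => \sum_(n < N) a n) (lr +i* li).
  by rewrite /csum (climnE cvl).
move=> e e0; have e20 : 0 < e / 2 by rewrite divr_gt0.
move/cvgrPdist_lt : hr => /(_ _ e20) hr; move/cvgrPdist_lt : hi => /(_ _ e20) hi.
apply: filterS2 hr hi => N.
case: (\sum_(n < N) a n) => x y /= hx hy.
rewrite (splitr e); apply: le_lt_trans (normc_ReIm ((x - lr) +i* (y - li))) _.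
by apply: ltrD; rewrite /= distrC.
Qed.

Lemma csum_unique a l : ccvg \oo (fun N => \sum_(n < N) a n) l -> csum a = l.
Proof. exact: climnE. Qed.

Lemma csum_le a (B : R) : (forall N, \sum_(n < N) normc (a n) <= B) -> normc (csum a) <= B.
Proof.
move=> aB; have := @csummable_cvg a (ex_intro _ _ aB).
by apply: ccvg_le; apply: nearW => N; apply: le_trans (aB N); apply: normc_sum.
Qed.

Lemma csumD a b : csummable a -> csummable b -> csum (fun n => a n + b n) = csum a + csum b.
Proof.
move=> sa sb; apply: csum_unique; apply: ccvg_ext (ccvgD (csummable_cvg sa) (csummable_cvg sb)).
by apply: nearW => N; rewrite big_split.
Qed.

Lemma csumZ a c : csummable a -> csum (fun n => c * a n) = c * csum a.
Proof.
move=> sa; apply: csum_unique; apply: ccvg_ext (ccvgMl c (csummable_cvg sa)).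
by apply: nearW => N; rewrite mulr_sumr.
Qed.

Lemma csummableD a b : csummable a -> csummable b -> csummable (fun n => a n + b n).
Proof.
move=> [A aA] [B bB]; exists (A + B) => N; apply: le_trans (lerD (aA N) (bB N)).
by rewrite -big_split; apply: ler_sum => i _; exact: normcD.
Qed.

Lemma csummableZ a c : csummable a -> csummable (fun n => c * a n).
Proof.
move=> [A aA]; exists (normc c * A) => N.
apply: le_trans (ler_wpM2l (normc_ge0 c) (aA N)).
by rewrite mulr_sumr; apply: ler_sum => i _; rewrite normcM.
Qed.

Lemma csum0 : csum (fun=> 0) = 0.
Proof.
by apply: csum_unique => e e0; apply: nearW => N; rewrite big1// subrr normc0.
Qed.

Lemma csummable0 : csummable (fun=> 0).
Proof. by exists 0 => N; rewrite big1// => i _; rewrite normc0. Qed.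

Lemma csum_sum (I : Type) (s : seq I) (f : I -> nat -> R[i]) :
  (forall i, csummable (f i)) ->
  csum (fun n => \sum_(i <- s) f i n) = \sum_(i <- s) csum (f i) /\
  csummable (fun n => \sum_(i <- s) f i n).
Proof.
move=> sf; elim: s => [|i s [IH1 IH2]].
  rewrite big_nil; under eq_fun do rewrite big_nil.
  by split; [exact: csum0 | exact: csummable0].
rewrite big_cons -IH1; under eq_fun do rewrite big_cons.
by split; [exact: csumD | exact: csummableD].
Qed.

End ComplexSeries.

Section PartialDerivative.
Variables (R : realType) (m : nat).
Implicit Types (F : 'cV[R[i]]_m -> R[i]) (z w : 'cV[R[i]]_m).

(** A quadratic remainder pins the derivative down: the difference quotient is within [C * normc h]
    of [c]. The increment [h] is complex, so this is a holomorphic derivative. *)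
Lemma partialE (j : 'I_m) F z (c : R[i]) (C r : R) : 0 < r ->
  (forall h : R[i], normc h < r ->
    normc (F (z + h *: delta_mx j 0) - F z - h * c) <= C * normc h ^+ 2) ->
  partial j F z = c.
Proof.
move=> r0 H; rewrite /partial; apply: (@cvg_lim R[i]^o); first exact: norm_hausdorff.
apply/cvgrPdist_lt => e e0.
have := e0; case: e e0 => a b e0; rewrite ltcE /= => /andP[/eqP b0 a0].
have C0 : 0 < `|C| + 1 by rewrite ltr_wpDl.
set d := Num.min r (a / (`|C| + 1)).
have d0 : 0 < d by rewrite lt_min r0 divr_gt0.
rewrite near_withinE; exists d%:C; first by rewrite /= ltcR.
move=> h /=; rewrite sub0r normrN normcE0 ltcR lt_min => /andP[hr hd] h0.
have nh0 : 0 < normc h by rewrite lt_neqAle normc_ge0 eq_sym normc_eq0 h0.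
rewrite normcE0 ltcE /= b0 eqxx /=.
have -> : c - h^-1 * (F (h *: delta_mx j 0 + z) - F z) =
    - (h^-1 * (F (z + h *: delta_mx j 0) - F z - h * c)).
  have K (u c' x y : R[i]) : u != 0 -> c' - u^-1 * (x - y) = - (u^-1 * (x - y - u * c')).
    by move=> u0; field.
  by rewrite [h *: _ + z]addrC; exact: K.
rewrite normcN normcM normcV mulrC ltr_pdivrMr//.
apply: le_lt_trans (H h hr) _; rewrite expr2 mulrA ltr_pM2r//.
apply: le_lt_trans (_ : _ <= (`|C| + 1) * normc h) _.
  by rewrite ler_wpM2r ?normc_ge0// (le_trans (ler_norm _))// lerDl.
by rewrite mulrC -ltr_pdivlMr.
Qed.

End PartialDerivative.

(** * Quantitative Taylor expansions *)

Section L1norm.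
Variables (R : realType) (m : nat).
Implicit Types (w : 'cV[R[i]]_m).

Definition l1norm w : R := \sum_i normc (w i 0).

Lemma l1norm_ge0 w : 0 <= l1norm w.
Proof. by apply: sumr_ge0 => i _; exact: normc_ge0. Qed.

Lemma normc_l1norm w i : normc (w i 0) <= l1norm w.
Proof.
rewrite /l1norm (bigD1 i)//= lerDl; apply: sumr_ge0 => j _; exact: normc_ge0.
Qed.

Lemma l1norm_delta (h : R[i]) (j : 'I_m) : l1norm (h *: delta_mx j 0) = normc h.
Proof.
rewrite /l1norm (bigD1 j)//= !mxE !eqxx mulr1 big1 ?addr0// => i ij.
by rewrite !mxE (negbTE ij) mulr0 normc0.
Qed.

Lemma sum_delta (h : R[i]) (j : 'I_m) (g : 'I_m -> R[i]) :
  \sum_i (h *: (delta_mx j 0 : 'cV_m)) i 0 * g i = h * g j.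
Proof.
rewrite (bigD1 j)//= !mxE !eqxx mulr1 big1 ?addr0// => i ij.
by rewrite !mxE (negbTE ij) mulr0 mul0r.
Qed.

Lemma normc_dot w (g : 'I_m -> R[i]) (c : R) : (forall i, normc (g i) <= c) ->
  normc (\sum_i w i 0 * g i) <= c * l1norm w.
Proof.
move=> gc; apply: le_trans (normc_sum _ _ _) _.
rewrite /l1norm mulr_sumr; apply: ler_sum => i _.
by rewrite normcM mulrC ler_wpM2r ?normc_ge0.
Qed.

End L1norm.

Section Jets.
Variables (R : realType) (m : nat) (kap : R).
Hypothesis kap0 : 0 < kap.
Variable U : set 'cV[R[i]]_m.
Hypothesis Uopen : forall z, U z -> exists2 r : R, 0 < r & forall w, l1norm w < r -> U (z + w).
Implicit Types (F f : 'cV[R[i]]_m -> R[i]) (z w : 'cV[R[i]]_m).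
Implicit Types (G g : 'I_m -> 'cV[R[i]]_m -> R[i]).
Implicit Types (H : 'I_m -> 'I_m -> 'cV[R[i]]_m -> R[i]) (a b N : R).

(* Bounds on the Taylor expansion of order one or two of [f], uniform on [U] and scaled so
   that the constant of a product or of a series is controlled by those of its terms; the
   derivatives are parameters until [jet1_partial] identifies them. *)
Definition near_in z w := [/\ U z, U (z + w) & l1norm w <= kap].

Definition lip f a := [/\ 0 <= a, forall z, U z -> normc (f z) <= a &
  forall z w, near_in z w -> normc (f (z + w) - f z) <= a * (l1norm w / kap)].

Definition rem2 f g a := forall z w, near_in z w ->
  normc (f (z + w) - f z - \sum_j w j 0 * g j z) <= a * (l1norm w / kap) ^+ 2.

Definition jet1 f g a :=
  [/\ lip f a, forall j z, U z -> normc (g j z) <= a / kap & rem2 f g a].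

Definition jet2 F G H N := [/\ jet1 F G N, forall j, jet1 (G j) (H^~ j) (N / kap),
  forall i j, lip (H i j) (N / kap ^+ 2) & forall i j z, U z -> H i j z = H j i z].

Let x0 w : 0 <= l1norm w / kap.
Proof. by rewrite divr_ge0 ?l1norm_ge0 ?ltW. Qed.
Let x20 w : 0 <= (l1norm w / kap) ^+ 2.
Proof. exact: sqr_ge0. Qed.

Lemma lip_le f a b : a <= b -> lip f a -> lip f b.
Proof.
move=> ab [a0 fa da]; split; first exact: le_trans ab.
  by move=> z /fa /le_trans; apply.
by move=> z w /da /le_trans; apply; rewrite ler_wpM2r.
Qed.

Lemma jet1_le f g a b : a <= b -> jet1 f g a -> jet1 f g b.
Proof.
move=> ab [fa ga ra]; split; first exact: lip_le fa.
  by move=> j z /(ga j) /le_trans; apply; rewrite ler_wpM2r// invr_ge0 ltW.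
by move=> z w /ra /le_trans; apply; rewrite ler_wpM2r.
Qed.

Lemma jet2_le F G H a b : a <= b -> jet2 F G H a -> jet2 F G H b.
Proof.
move=> ab [h1 h2 h3 h4]; split=> //; first exact: jet1_le h1.
  by move=> j; apply: jet1_le (h2 j); rewrite ler_wpM2r// invr_ge0 ltW.
by move=> i j; apply: lip_le (h3 i j); rewrite ler_wpM2r// invr_ge0 ltW// exprn_gt0.
Qed.

Lemma lip_ext f f' a : (forall z, U z -> f z = f' z) -> lip f a -> lip f' a.
Proof.
move=> ff' [a0 fa da]; split=> // [z Uz|z w zw]; first by rewrite -ff'// fa.
by case: (zw) => Uz Uzw _; rewrite -!ff'// da.
Qed.

Lemma jet1_ext f g f' g' a : (forall z, U z -> f z = f' z) ->
  (forall j z, U z -> g j z = g' j z) -> jet1 f g a -> jet1 f' g' a.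
Proof.
move=> ff' gg' [fa ga ra]; split; first exact: lip_ext fa.
  by move=> j z Uz; rewrite -gg'// ga.
move=> z w zw; case: (zw) => Uz Uzw _; rewrite -!ff'//.
under eq_bigr do rewrite -gg'//.
exact: ra.
Qed.

Lemma jet2_ext F G H F' G' H' N : (forall z, U z -> F z = F' z) ->
  (forall j z, U z -> G j z = G' j z) -> (forall i j z, U z -> H i j z = H' i j z) ->
  jet2 F G H N -> jet2 F' G' H' N.
Proof.
move=> FF' GG' HH' [h1 h2 h3 h4]; split; first exact: jet1_ext h1.
- by move=> j; apply: jet1_ext (h2 j) => // i z; [exact: GG'|exact: HH'].
- by move=> i j; apply: lip_ext (h3 i j); exact: HH'.
- by move=> i j z Uz; rewrite -!HH'// h4.
Qed.

Lemma lipM f f' a b : lip f a -> lip f' b -> lip (fun z => f z * f' z) (2 * (a * b)).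
Proof.
move=> [a0 fa da] [b0 fb db]; have ab0 := mulr_ge0 a0 b0; split.
- by rewrite mulr_ge0.
- move=> z Uz; rewrite normcM; apply: (@le_trans _ _ (a * b)); last by lra.
  by rewrite ler_pM ?normc_ge0 ?fa ?fb.
- move=> z w zw; case: (zw) => Uz Uzw _.
  have -> : f (z + w) * f' (z + w) - f z * f' z =
      f (z + w) * (f' (z + w) - f' z) + (f (z + w) - f z) * f' z by ring.
  apply: le_trans (normcD _ _) _; rewrite !normcM.
  have h1 : normc (f (z + w)) * normc (f' (z + w) - f' z) <= a * (b * (l1norm w / kap)).
    by rewrite ler_pM ?normc_ge0 ?fa ?db.
  have h2 : normc (f (z + w) - f z) * normc (f' z) <= a * (l1norm w / kap) * b.
    by rewrite ler_pM ?normc_ge0 ?fb ?da.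
  by apply: le_trans (lerD h1 h2) _; rewrite le_eqVlt; apply/orP; left; apply/eqP; ring.
Qed.

Lemma lipD f f' a b : lip f a -> lip f' b -> lip (fun z => f z + f' z) (a + b).
Proof.
move=> [a0 fa da] [b0 fb db]; split; first exact: addr_ge0.
  by move=> z Uz; apply: le_trans (normcD _ _) _; rewrite lerD ?fa ?fb.
move=> z w zw; have -> : f (z + w) + f' (z + w) - (f z + f' z) =
  (f (z + w) - f z) + (f' (z + w) - f' z) by ring.
by apply: le_trans (normcD _ _) _; rewrite mulrDl lerD ?da ?db.
Qed.

Lemma jet1D f g f' g' a b : jet1 f g a -> jet1 f' g' b ->
  jet1 (fun z => f z + f' z) (fun j z => g j z + g' j z) (a + b).
Proof.
move=> [fa ga ra] [fb gb rb]; split; first exact: lipD.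
  by move=> j z Uz; apply: le_trans (normcD _ _) _; rewrite mulrDl lerD ?ga ?gb.
move=> z w zw; rewrite [X in normc X](_ : _ =
    (f (z + w) - f z - \sum_j w j 0 * g j z) +
    (f' (z + w) - f' z - \sum_j w j 0 * g' j z)).
  by apply: le_trans (normcD _ _) _; rewrite mulrDl lerD ?ra ?rb.
by under eq_bigr do rewrite mulrDr; rewrite big_split/=; ring.
Qed.

(** The remainder of a product splits into three terms, each at most
    [a * b * (l1norm w / kap) ^+ 2]: hence the factor 3. *)
Lemma jet1M f g f' g' a b : jet1 f g a -> jet1 f' g' b ->
  jet1 (fun z => f z * f' z) (fun j z => f z * g' j z + f' z * g j z) (3 * (a * b)).
Proof.
move=> [fa ga ra] [fb gb rb]; have [a0 fa' da] := fa; have [b0 fb' db] := fb.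
have ab0 := mulr_ge0 a0 b0; split.
- by apply: lip_le (lipM fa fb); rewrite ler_wpM2r// ler_nat.
- move=> j z Uz; apply: le_trans (normcD _ _) _; rewrite !normcM.
  have h1 : normc (f z) * normc (g' j z) <= a * (b / kap).
    by rewrite ler_pM ?normc_ge0 ?fa' ?gb.
  have h2 : normc (f' z) * normc (g j z) <= b * (a / kap).
    by rewrite ler_pM ?normc_ge0 ?fb' ?ga.
  apply: le_trans (lerD h1 h2) _.
  have -> : 3 * (a * b) / kap = a * (b / kap) + b * (a / kap) + a * b / kap by ring.
  by rewrite lerDl divr_ge0// ltW.
- move=> z w zw; case: (zw) => Uz Uzw _.
  set S := \sum_j w j 0 * g j z; set S' := \sum_j w j 0 * g' j z.
  rewrite [X in normc X](_ : _ = f (z + w) * (f' (z + w) - f' z - S') +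
     (f (z + w) - f z - S) * f' z + (f (z + w) - f z) * S'); last first.
    rewrite (_ : \sum_j _ = f z * S' + f' z * S); first by ring.
    by rewrite /S /S' !mulr_sumr -big_split/=; apply: eq_bigr => j _; ring.
  have h1 : normc (f (z + w) * (f' (z + w) - f' z - S')) <= a * (b * (l1norm w / kap) ^+ 2).
    by rewrite normcM ler_pM ?normc_ge0 ?fa' ?rb.
  have h2 : normc ((f (z + w) - f z - S) * f' z) <= a * (l1norm w / kap) ^+ 2 * b.
    by rewrite normcM ler_pM ?normc_ge0 ?fb' ?ra.
  have h3 : normc ((f (z + w) - f z) * S') <= a * (l1norm w / kap) * (b / kap * l1norm w).
    by rewrite normcM ler_pM ?normc_ge0 ?da// normc_dot// => i; rewrite gb.
  apply: le_trans (normcD _ _) _; apply: le_trans (lerD (normcD _ _) (lexx _)) _.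
  apply: le_trans (lerD (lerD h1 h2) h3) _.
  by rewrite le_eqVlt; apply/orP; left; apply/eqP; ring.
Qed.

Lemma jet2D F G H F' G' H' a b : jet2 F G H a -> jet2 F' G' H' b ->
  jet2 (fun z => F z + F' z) (fun j z => G j z + G' j z)
    (fun i j z => H i j z + H' i j z) (a + b).
Proof.
move=> [h1 h2 h3 h4] [k1 k2 k3 k4]; split; first exact: jet1D.
- by move=> j; rewrite mulrDl; exact: jet1D.
- by move=> i j; rewrite mulrDl; exact: lipD.
- by move=> i j z Uz; rewrite h4// k4.
Qed.

(** The Hessian of a product has four terms, each costing the factor 2 of [lipM]: hence 8, which
    also covers the 3 of the function and the 3 + 3 of the gradient. *)
Lemma jet2M F G H F' G' H' a b : jet2 F G H a -> jet2 F' G' H' b ->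
  jet2 (fun z => F z * F' z) (fun j z => F z * G' j z + F' z * G j z)
    (fun i j z => (F z * H' i j z + G' j z * G i z) + (F' z * H i j z + G j z * G' i z))
    (8 * (a * b)).
Proof.
move=> [h1 h2 h3 h4] [k1 k2 k3 k4].
have [[a0 _ _] _ _] := h1; have [[b0 _ _] _ _] := k1.
have ab0 := mulr_ge0 a0 b0; have ik0 : 0 <= kap^-1 by rewrite invr_ge0 ltW.
split.
- by apply: jet1_le (jet1M h1 k1); rewrite ler_wpM2r// ler_nat.
- move=> j; apply: jet1_le (jet1D (jet1M h1 (k2 j)) (jet1M k1 (h2 j))).
  have -> : 8 * (a * b) / kap = 3 * (a * (b / kap)) + 3 * (b * (a / kap)) + 2 * (a * b / kap).
    by ring.
  by rewrite lerDl !mulr_ge0.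
- move=> i j; have [lF _ _] := h1; have [lF' _ _] := k1.
  have [lGi _ _] := h2 i; have [lGj _ _] := h2 j.
  have [lGi' _ _] := k2 i; have [lGj' _ _] := k2 j.
  apply: lip_le (lipD (lipD (lipM lF (k3 i j)) (lipM lGj' lGi))
    (lipD (lipM lF' (h3 i j)) (lipM lGj lGi'))).
  by rewrite le_eqVlt; apply/orP; left; apply/eqP; field; exact: lt0r_neq0.
- by move=> i j z Uz; rewrite h4// k4//; ring.
Qed.

Lemma lip_cst (c : R[i]) a : normc c <= a -> lip (fun=> c) a.
Proof.
move=> ca; have a0 := le_trans (normc_ge0 c) ca; split=> // z w _.
by rewrite subrr normc0 mulr_ge0.
Qed.

Lemma jet1_cst (c : R[i]) a : normc c <= a -> jet1 (fun=> c) (fun _ _ => 0) a.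
Proof.
move=> ca; have a0 := le_trans (normc_ge0 c) ca; split; first exact: lip_cst.
  by move=> j z _; rewrite normc0 divr_ge0// ltW.
move=> z w _; rewrite big1 => [|i _]; last by rewrite mulr0.
by rewrite !subrr normc0 mulr_ge0.
Qed.

Lemma jet2_cst (c : R[i]) a : normc c <= a -> jet2 (fun=> c) (fun _ _ => 0) (fun _ _ _ => 0) a.
Proof.
move=> ca; have a0 := le_trans (normc_ge0 c) ca; split=> //; first exact: jet1_cst.
  by move=> j; apply: jet1_cst; rewrite normc0 divr_ge0// ltW.
by move=> i j; apply: lip_cst; rewrite normc0 divr_ge0// exprn_ge0// ltW.
Qed.

Lemma jet2_coord (k : 'I_m) : (forall z, U z -> normc (z k 0) <= kap) ->
  jet2 (fun z => z k 0) (fun j _ => (j == k)%:R) (fun _ _ _ => 0) kap.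
Proof.
move=> Uk; have kk : kap / kap = 1 by rewrite divff// lt0r_neq0.
split=> //.
- split; [split; [exact: ltW|exact: Uk|]| |].
  + move=> z w _; rewrite mxE addrAC subrr add0r mulrC divfK ?lt0r_neq0//.
    exact: normc_l1norm.
  + by move=> j z _; rewrite kk; case: (j == k); rewrite ?normc1 ?normc0.
  + move=> z w _; rewrite (bigD1 k)//= eqxx mulr1 big1 => [|i /negbTE ->]; last by rewrite mulr0.
    have -> : (z + w) k 0 - z k 0 - (w k 0 + 0) = 0 by rewrite mxE; ring.
    by rewrite normc0 mulr_ge0// ltW.
- move=> j; rewrite kk; apply: jet1_cst.
  by case: (j == k); rewrite ?normc1 ?normc0.
- by move=> i j; apply: lip_cst; rewrite normc0 divr_ge0// ?exprn_ge0// ltW.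
Qed.

Lemma lip_csum (f : nat -> 'cV[R[i]]_m -> R[i]) (u : nat -> R) B :
  (forall n, lip (f n) (u n)) -> (forall M, \sum_(n < M) u n <= B) ->
  lip (fun z => csum (f^~ z)) B.
Proof.
move=> fu uB; have B0 : 0 <= B by have := uB 0%N; rewrite big_ord0.
have fb z n : U z -> normc (f n z) <= u n by case: (fu n) => _ + _; exact.
split=> // [z Uz|z w zw].
  by apply: csum_le => M; apply: le_trans (uB M); apply: ler_sum => n _; exact: fb.
case: (zw) => Uz Uzw _.
have s1 : csummable (f^~ (z + w)) by apply: (csummable_le _ uB) => n; exact: fb.
have s2 : csummable (f^~ z) by apply: (csummable_le _ uB) => n; exact: fb.
have -> : csum (f^~ (z + w)) - csum (f^~ z) = csum (fun n => f n (z + w) + -1 * f n z).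
  by rewrite csumD ?csumZ ?mulN1r//; exact: csummableZ.
apply: csum_le => M; apply: le_trans (ler_wpM2r (x0 w) (uB M)).
rewrite mulr_suml; apply: ler_sum => n _; rewrite mulN1r.
by case: (fu n) => _ _; exact.
Qed.

Lemma jet1_csum (f : nat -> 'cV[R[i]]_m -> R[i])
    (g : nat -> 'I_m -> 'cV[R[i]]_m -> R[i]) (u : nat -> R) B :
  (forall n, jet1 (f n) (g n) (u n)) -> (forall M, \sum_(n < M) u n <= B) ->
  jet1 (fun z => csum (f^~ z)) (fun j z => csum (fun n => g n j z)) B.
Proof.
move=> fu uB; have ik0 : 0 <= kap^-1 by rewrite invr_ge0 ltW.
have fl n : lip (f n) (u n) by case: (fu n).
have fb z n : U z -> normc (f n z) <= u n by case: (fl n) => _ + _; exact.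
have gb j z n : U z -> normc (g n j z) <= u n / kap by case: (fu n) => _ + _; exact.
have uB' M : \sum_(n < M) u n / kap <= B / kap by rewrite -mulr_suml ler_wpM2r.
split; first exact: lip_csum fl uB.
  move=> j z Uz; apply: csum_le => M; apply: le_trans (uB' M).
  by apply: ler_sum => n _; exact: gb.
move=> z w zw; case: (zw) => Uz Uzw _.
have s1 : csummable (f^~ (z + w)) by apply: (csummable_le _ uB) => n; exact: fb.
have s2 : csummable (f^~ z) by apply: (csummable_le _ uB) => n; exact: fb.
have s3 j : csummable (fun n => g n j z) by apply: (csummable_le _ uB') => n; exact: gb.
have [e3 s4] := csum_sum (index_enum 'I_m) (fun j => csummableZ (w j 0) (s3 j)).
rewrite [X in normc X](_ : _ = csum (fun n =>
   f n (z + w) + (-1 * f n z + -1 * \sum_j w j 0 * g n j z))); last first.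
  rewrite csumD ?csumD ?csumZ//; first last.
  - by apply: csummableD; exact: csummableZ.
  - exact: csummableZ.
  - exact: csummableZ.
  rewrite e3 !mulN1r addrA; congr (_ - _); apply: eq_bigr => j _.
  by rewrite csumZ.
apply: csum_le => M; apply: le_trans (ler_wpM2r (x20 w) (uB M)).
rewrite mulr_suml; apply: ler_sum => n _; rewrite !mulN1r addrA.
by case: (fu n) => _ _; exact.
Qed.

(** Term-by-term differentiation reduces to adding up the Taylor remainders of the terms;
    [jet1_partial] then recognizes the coefficient series as the derivatives of the sum. *)
Lemma jet2_csum (F : nat -> 'cV[R[i]]_m -> R[i])
    (G : nat -> 'I_m -> 'cV[R[i]]_m -> R[i])
    (H : nat -> 'I_m -> 'I_m -> 'cV[R[i]]_m -> R[i]) (u : nat -> R) B :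
  (forall n, jet2 (F n) (G n) (H n) (u n)) -> (forall M, \sum_(n < M) u n <= B) ->
  jet2 (fun z => csum (F^~ z)) (fun j z => csum (fun n => G n j z))
    (fun i j z => csum (fun n => H n i j z)) B.
Proof.
move=> Fu uB; have ik0 : 0 <= kap^-1 by rewrite invr_ge0 ltW.
split.
- by apply: (jet1_csum _ uB) => n; case: (Fu n).
- move=> j; apply: (@jet1_csum _ (fun n i => H n i j) (fun n => u n / kap)) => [n|M].
    by case: (Fu n) => _ + _ _; exact.
  by rewrite -mulr_suml ler_wpM2r.
- move=> i j; apply: (@lip_csum _ (fun n => u n / kap ^+ 2)) => [n|M].
    by case: (Fu n) => _ _ + _; exact.
  by rewrite -mulr_suml ler_wpM2r// invr_ge0 exprn_ge0// ltW.
- move=> i j z Uz; congr csum; apply/funext => n.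
  by case: (Fu n) => _ _ _; exact.
Qed.

Lemma near_in_delta z (j : 'I_m) : U z -> exists2 r : R, 0 < r &
  forall h : R[i], normc h < r -> near_in z (h *: delta_mx j 0).
Proof.
move=> Uz; have [r r0 Ur] := Uopen Uz.
exists (Num.min r kap); first by rewrite lt_min r0.
move=> h; rewrite lt_min => /andP[hr hk].
by split; rewrite ?l1norm_delta ?(ltW hk)//; apply: Ur; rewrite l1norm_delta.
Qed.

Lemma jet1_partial f g a (j : 'I_m) z : jet1 f g a -> U z -> partial j f z = g j z.
Proof.
move=> [_ _ ra] Uz; have [r r0 hr] := near_in_delta j Uz.
apply: (@partialE _ _ _ _ _ _ (a / kap ^+ 2) r) => // h /hr zh.
have := ra _ _ zh; rewrite sum_delta l1norm_delta => /le_trans; apply.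
by rewrite exprMn exprVn mulrA mulrAC.
Qed.

Lemma jet2_hessian F G H N z (i j : 'I_m) : jet2 F G H N -> U z ->
  hessian F z i j = H i j z.
Proof.
move=> [h1 h2 _ _] Uz; rewrite mxE; have [r r0 hr] := near_in_delta i Uz.
have [_ _ ra] := h2 j.
apply: (@partialE _ _ _ _ _ _ (N / kap / kap ^+ 2) r) => // h /hr zh.
have [_ Uzh _] := zh.
rewrite (jet1_partial j h1 Uz) (jet1_partial j h1 Uzh).
have := ra _ _ zh; rewrite sum_delta l1norm_delta => /le_trans; apply.
by rewrite exprMn exprVn mulrA mulrAC.
Qed.

Definition jet F N := jet2 F (fun j => partial j F) (fun i j z => hessian F z i j) N.

Lemma jet2_jet F G H N : jet2 F G H N -> jet F N.
Proof.
move=> FN; apply: jet2_ext (FN) => //.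
  by move=> j z Uz; case: FN => h1 _ _ _; rewrite (jet1_partial j h1 Uz).
by move=> i j z Uz; rewrite (jet2_hessian i j FN Uz).
Qed.

Lemma jet2_partial F G H N j z : jet2 F G H N -> U z -> partial j F z = G j z.
Proof. by case=> h1 _ _ _; exact: jet1_partial h1. Qed.

Lemma jetM F F' a b : jet F a -> jet F' b -> jet (fun z => F z * F' z) (8 * (a * b)).
Proof. by move=> Fa Fb; exact: jet2_jet (jet2M Fa Fb). Qed.

Lemma jet_le F a b : a <= b -> jet F a -> jet F b.
Proof. exact: jet2_le. Qed.

Lemma jet_ext F F' a : (forall z, U z -> F z = F' z) -> jet F a -> jet F' a.
Proof.
by move=> FF' Fa; apply: jet2_jet; apply: jet2_ext Fa => //.
Qed.

Lemma jet_cst c : jet (fun=> c) (normc c).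
Proof. exact: jet2_jet (jet2_cst (lexx _)). Qed.

Lemma jetZ c F a : jet F a -> jet (fun z => c * F z) (8 * (normc c * a)).
Proof. exact: jetM (jet_cst c). Qed.

Lemma jet_csum (F : nat -> 'cV[R[i]]_m -> R[i]) (u : nat -> R) B :
  (forall n, jet (F n) (u n)) -> (forall M, \sum_(n < M) u n <= B) ->
  [/\ jet (fun z => csum (F^~ z)) B,
    forall j z, U z -> partial j (fun z => csum (F^~ z)) z = csum (fun n => partial j (F n) z) &
    forall i j z, U z -> hessian (fun z => csum (F^~ z)) z i j = csum (fun n => hessian (F n) z i j)].
Proof.
move=> Fu uB; have J := jet2_csum Fu uB; split; first exact: jet2_jet J.
  by move=> j z; exact: jet2_partial J.
by move=> i j z; exact: jet2_hessian J.
Qed.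

End Jets.

(** * Bounds for the complex exponential and jets of Fourier modes *)

Section ComplexExponential.
Variable R : realType.
Implicit Types (u v : R[i]) (a b x : R).

Lemma ler_norm_sin x : `|sin x| <= `|x|.
Proof.
wlog x0 : x / 0 <= x.
  move=> H; have [/H //|x0] := leP 0 x.
  by have := H (- x); rewrite sinN !normrN; apply; rewrite oppr_ge0 ltW.
have [c _] := @MVT_segment R sin cos 0 x x0 (fun y _ => is_derive_sin y)
  (continuous_subspaceT (@continuous_sin R)).
rewrite sin0 !subr0 => ->.
by rewrite normrM ler_piMl// cos_max.
Qed.

Lemma ler_norm_cosB1 x : `|cos x - 1| <= `|x| ^+ 2.
Proof.
wlog x0 : x / 0 <= x.
  move=> H; have [/H //|x0] := leP 0 x.
  by have := H (- x); rewrite cosN !normrN; apply; rewrite oppr_ge0 ltW.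
have [c] := @MVT_segment R cos (fun y => - sin y) 0 x x0 (fun y _ => is_derive_cos y)
  (continuous_subspaceT (@continuous_cos R)).
rewrite in_itv /= => /andP[c0 cx].
rewrite cos0 subr0 => ->.
rewrite normrM normrN expr2 ler_wpM2r//; apply: le_trans (ler_norm_sin c) _.
by rewrite !ger0_norm.
Qed.

Lemma ler_norm_cosB1' x : `|cos x - 1| <= `|x|.
Proof.
wlog x0 : x / 0 <= x.
  move=> H; have [/H //|x0] := leP 0 x.
  by have := H (- x); rewrite cosN !normrN; apply; rewrite oppr_ge0 ltW.
have [c _] := @MVT_segment R cos (fun y => - sin y) 0 x x0 (fun y _ => is_derive_cos y)
  (continuous_subspaceT (@continuous_cos R)).
rewrite cos0 subr0 => ->.
by rewrite normrM normrN ler_piMl// sin_max.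
Qed.

Lemma ler_norm_sinB x : `|sin x - x| <= `|x| ^+ 2.
Proof.
wlog x0 : x / 0 <= x.
  move=> H; have [/H //|x0] := leP 0 x.
  have := H (- x); rewrite sinN -opprD !normrN; apply.
  by rewrite oppr_ge0 ltW.
have [c] := @MVT_segment R sin cos 0 x x0 (fun y _ => is_derive_sin y)
  (continuous_subspaceT (@continuous_sin R)).
rewrite in_itv /= => /andP[c0 cx]; rewrite sin0 !subr0 => ->.
rewrite -[X in _ - X]mul1r -mulrBl normrM expr2 ler_wpM2r//.
by apply: le_trans (ler_norm_cosB1' c) _; rewrite !ger0_norm.
Qed.

Lemma ler_norm_expRB1 x : `|expR x - 1| <= `|x| * expR `|x|.
Proof.
have h (y : R) : expR y - 1 <= y * expR y.
  have := expR_ge1Dx (- y); rewrite expRN => h.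
  have := ler_wpM2r (expR_ge0 y) h; rewrite mulVf ?gt_eqF ?expR_gt0// => h'; lra.
have [x0|x0] := leP 0 x.
  by rewrite !ger0_norm// subr_ge0 -expR0 ler_expR.
rewrite ler0_norm; last by rewrite subr_le0 -expR0 ler_expR ltW.
rewrite opprB; apply: le_trans (_ : - x <= _).
  by have := expR_ge1Dx x; lra.
rewrite ltr0_norm// ler_peMr// ?oppr_ge0 ?ltW//.
by rewrite -expR0 ltr_expR oppr_gt0.
Qed.

Lemma ler_norm_expRB1B x : `|expR x - 1 - x| <= `|x| ^+ 2 * expR `|x|.
Proof.
rewrite ger0_norm; last by have := expR_ge1Dx x; lra.
apply: le_trans (_ : x * (expR x - 1) <= _).
  have := expR_ge1Dx (- x); rewrite expRN => h.
  have := ler_wpM2r (expR_ge0 x) h; rewrite mulVf ?gt_eqF ?expR_gt0// => h'; lra.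
apply: le_trans (ler_norm _) _; rewrite normrM expr2 -mulrA.
by rewrite ler_wpM2l// ler_norm_expRB1.
Qed.

Lemma complexDE a b (c d : R) : (a +i* b) + (c +i* d) = (a + c) +i* (b + d).
Proof. by []. Qed.

Lemma complexBE a b (c d : R) : (a +i* b) - (c +i* d) = (a - c) +i* (b - d).
Proof. by []. Qed.

Lemma complexME a b (c d : R) : (a +i* b) * (c +i* d) = (a * c - b * d) +i* (a * d + b * c).
Proof. by []. Qed.

Lemma cexpE a b : cexp (a +i* b) = (expR a * cos b) +i* (expR a * sin b).
Proof. by rewrite /cexp /=; congr (_ +i* _); rewrite !mul0r ?subr0 ?addr0. Qed.

Lemma cexpD u v : cexp (u + v) = cexp u * cexp v.
Proof.
case: u v => [a b] [c d]; rewrite complexDE !cexpE complexME.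
by rewrite expRD cosD sinD; congr (_ +i* _); ring.
Qed.

Lemma cexp0 : cexp (0 : R[i]) = 1.
Proof. by rewrite cexpE expR0 cos0 sin0 !mul1r. Qed.

Lemma normc_cexp u : normc (cexp u) = expR (complex.Re u).
Proof.
case: u => a b; rewrite cexpE /= !exprMn -mulrDr cos2Dsin2 mulr1 sqrtr_sqr.
by rewrite ger0_norm// expR_ge0.
Qed.

Let normc_ReIm_le u N : `|complex.Re u| + `|complex.Im u| <= N -> normc u <= N.
Proof. exact: le_trans (normc_ReIm u). Qed.

Lemma cexpB1 u : normc (cexp u - 1) <= 3 * (normc u * expR (normc u)).
Proof.
move: (normc_Re u) (normc_Im u) (normc_ge0 u); move: (normc u) => N.
case: u => a b rn im N0; rewrite /= in rn im.
have eN (x : R) : `|x| <= N -> expR `|x| <= expR N by rewrite ler_expR.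
rewrite cexpE complexBE subr0; apply: normc_ReIm_le => /=.
have Ea : expR a <= expR N by apply: le_trans (eN _ rn); rewrite ler_expR ler_norm.
have h1 : `|expR a * cos b - 1| <= expR N * N + N * expR N.
  have -> : expR a * cos b - 1 = expR a * (cos b - 1) + (expR a - 1) by ring.
  apply: le_trans (ler_normD _ _) _; apply: lerD.
    rewrite normrM [`|expR a|]ger0_norm ?expR_ge0// ler_pM ?expR_ge0//.
    by apply: le_trans (ler_norm_cosB1' b) _.
  by apply: le_trans (ler_norm_expRB1 a) _; rewrite ler_pM ?expR_ge0 ?eN.
have h2 : `|expR a * sin b| <= expR N * N.
  rewrite normrM [`|expR a|]ger0_norm ?expR_ge0// ler_pM ?expR_ge0//.
  by apply: le_trans (ler_norm_sin b) _.
by apply: le_trans (lerD h1 h2) _; rewrite le_eqVlt; apply/orP; left; apply/eqP; ring.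
Qed.

Lemma cexpB1B u : normc (cexp u - 1 - u) <= 4 * (normc u ^+ 2 * expR (normc u)).
Proof.
move: (normc_Re u) (normc_Im u) (normc_ge0 u); move: (normc u) => N.
case: u => a b rn im N0; rewrite /= in rn im.
have eN (x : R) : `|x| <= N -> expR `|x| <= expR N by rewrite ler_expR.
rewrite cexpE !complexBE subr0; apply: normc_ReIm_le => /=.
have Ea : expR a <= expR N by apply: le_trans (eN _ rn); rewrite ler_expR ler_norm.
have sq (x : R) : `|x| <= N -> `|x| ^+ 2 <= N ^+ 2.
  by move=> xN; rewrite ler_pXn2r// nnegrE.
have E0 := expR_ge0 N.
have h1 : `|expR a * cos b - 1 - a| <= expR N * N ^+ 2 + N ^+ 2 * expR N.
  have -> : expR a * cos b - 1 - a = expR a * (cos b - 1) + (expR a - 1 - a) by ring.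
  apply: le_trans (ler_normD _ _) _; apply: lerD.
    rewrite normrM [`|expR a|]ger0_norm ?expR_ge0// ler_pM ?expR_ge0//.
    by apply: le_trans (ler_norm_cosB1 b) _; exact: sq.
  by apply: le_trans (ler_norm_expRB1B a) _; rewrite ler_pM ?expR_ge0 ?eN ?exprn_ge0 ?sq.
have h2 : `|expR a * sin b - b| <= expR N * N ^+ 2 + N * (N * expR N).
  have -> : expR a * sin b - b = expR a * (sin b - b) + b * (expR a - 1) by ring.
  apply: le_trans (ler_normD _ _) _; apply: lerD.
    rewrite normrM [`|expR a|]ger0_norm ?expR_ge0// ler_pM ?expR_ge0//.
    by apply: le_trans (ler_norm_sinB b) _; exact: sq.
  rewrite normrM ler_pM//; apply: le_trans (ler_norm_expRB1 a) _.
  by rewrite ler_pM ?expR_ge0 ?eN.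
by apply: le_trans (lerD h1 h2) _; rewrite le_eqVlt; apply/orP; left; apply/eqP; ring.
Qed.

Lemma cexp_2pi (k : int) : cexp ('i * (2 * pi * k%:~R)%:C) = 1 :> R[i].
Proof.
have -> : 'i * (2 * pi * k%:~R)%:C = 0 +i* (2 * pi * k%:~R) :> R[i].
  by rewrite complexME; congr (_ +i* _); ring.
have P n : cos (2 * pi * n%:R) = 1 :> R /\ sin (2 * pi * n%:R) = 0 :> R.
  elim: n => [|n [IHc IHs]]; first by rewrite mulr0 cos0 sin0.
  have -> : 2 * pi * n.+1%:R = 2 * pi * n%:R + pi *+ 2 :> R by rewrite -natr1; ring.
  by rewrite cosD2pi sinD2pi.
rewrite cexpE expR0 !mul1r; case: (intP k) => [|n|n].
- by rewrite mulr0 cos0 sin0.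
- by have [-> ->] := P n.+1.
- by rewrite mulrNz mulrN cosN sinN; have [-> ->] := P n.+1; rewrite oppr0.
Qed.

End ComplexExponential.

Section CexpJet.
Variables (R : realType) (m : nat) (kap : R).
Hypothesis kap0 : 0 < kap.
Variable U : set 'cV[R[i]]_m.
Variables (l : 'cV[R[i]]_m -> R[i]) (c : 'I_m -> R[i]) (A s : R).
Hypothesis ladd : forall z w, l (z + w) = l z + \sum_i w i 0 * c i.
Hypothesis cA : forall i, normc (c i) <= A.
Hypothesis A0 : 0 <= A.
Hypothesis ls : forall z, U z -> complex.Re (l z) <= s.

Let y := A * kap.
Let C := 4 * expR (s + 5 * y).
Let F z := cexp (l z).

Let y0 : 0 <= y. Proof. by rewrite mulr_ge0// ltW. Qed.
Let ye : y <= expR y. Proof. by have := expR_ge1Dx y; lra. Qed.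
Let e1 : 1 <= expR y. Proof. by rewrite -expR0 ler_expR. Qed.
Let F_le z : U z -> normc (F z) <= expR s.
Proof. by move=> /ls; rewrite normc_cexp ler_expR. Qed.

Let lw_le w : l1norm w <= kap -> normc (\sum_i w i 0 * c i) <= y * (l1norm w / kap) /\
  normc (\sum_i w i 0 * c i) <= y.
Proof.
move=> wk; have h := normc_dot w cA.
split; apply: le_trans h _.
  by rewrite /y -mulrA [_ * (_ / _)]mulrC divfK ?lt0r_neq0.
by rewrite ler_wpM2l.
Qed.

(** The free factor [t] lets one estimate serve [F] itself ([t = 1]), its gradient ([t = c j]) and
    its Hessian ([t = c j * c i]). *)
Let jet1_cexp (t : R[i]) (T D : R) : normc t <= T ->
  4 * T * (expR s * expR y ^+ 3) <= D ->
  jet1 kap U (fun z => t * F z) (fun i z => t * c i * F z) D.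
Proof.
move=> tT hD; have T0 : 0 <= T := le_trans (normc_ge0 t) tT.
have Ey := expR_ge0 y; have TE : 0 <= T * expR s by rewrite mulr_ge0// expR_ge0.
have hD' (u : R) : u <= 4 * expR y ^+ 3 -> T * expR s * u <= D.
  move=> u4; apply: le_trans hD; rewrite [leRHS](_ : _ = T * expR s * (4 * expR y ^+ 3)).
    by rewrite ler_wpM2l.
  by ring.
have tF z : U z -> normc (t * F z) <= T * expR s.
  by move=> Uz; rewrite normcM ler_pM ?normc_ge0 ?F_le.
have e3 : 1 <= expR y ^+ 3 by rewrite exprn_ege1.
have y3 : y <= expR y ^+ 3.
  by apply: le_trans ye _; rewrite exprS ler_peMr// exprn_ege1.
have D0 : 0 <= D.
  by have := hD' 0; rewrite mulr0; apply; rewrite mulr_ge0// exprn_ge0.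
split.
- split=> // [z Uz|z w [Uz Uzw wk]].
    by apply: le_trans (tF z Uz) _; rewrite -[X in X <= _]mulr1; apply: hD'; lra.
  have [h1 h2] := lw_le wk; set v := \sum_i w i 0 * c i in h1 h2.
  have -> : t * F (z + w) - t * F z = t * F z * (cexp v - 1).
    by rewrite /F ladd cexpD -/v; ring.
  rewrite normcM; set x := l1norm w / kap in h1 *.
  have x0 : 0 <= x by rewrite divr_ge0 ?l1norm_ge0// ltW.
  have h3 : normc (cexp v - 1) <= 3 * (y * x * expR y).
    apply: le_trans (cexpB1 v) _; rewrite ler_wpM2l//.
    by rewrite ler_pM ?normc_ge0 ?expR_ge0// ler_expR.
  apply: le_trans (ler_pM (normc_ge0 _) (normc_ge0 _) (tF z Uz) h3) _.
  have -> : T * expR s * (3 * (y * x * expR y)) = T * expR s * (3 * (y * expR y)) * x by ring.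
  rewrite ler_wpM2r//; apply: hD'.
  apply: le_trans (_ : _ <= 3 * (expR y * expR y)) _.
    by rewrite ler_wpM2l// ler_wpM2r.
  rewrite (exprSr _ 2) -expr2; have : 1 <= expR y ^+ 2 by rewrite exprn_ege1.
  by have := e1; nra.
- move=> j z Uz; rewrite mulrAC normcM ler_pdivlMr//.
  apply: le_trans (_ : _ <= T * expR s * A * kap) _.
    by rewrite (ler_wpM2r (ltW kap0))// ler_pM ?normc_ge0 ?tF.
  by rewrite -mulrA; apply: hD'; rewrite -/y; lra.
- move=> z w [Uz Uzw wk]; have [h1 h2] := lw_le wk.
  have -> : \sum_j w j 0 * (t * c j * F z) = t * F z * \sum_j w j 0 * c j.
    by rewrite mulr_sumr; apply: eq_bigr => j _; ring.
  set v := \sum_i w i 0 * c i in h1 h2 *.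
  have -> : t * F (z + w) - t * F z - t * F z * v = t * F z * (cexp v - 1 - v).
    by rewrite /F ladd cexpD -/v; ring.
  rewrite normcM; set x := l1norm w / kap in h1 *.
  have x0 : 0 <= x by rewrite divr_ge0 ?l1norm_ge0// ltW.
  have h3 : normc (cexp v - 1 - v) <= 4 * ((y * x) ^+ 2 * expR y).
    apply: le_trans (cexpB1B v) _; rewrite ler_wpM2l//.
    rewrite ler_pM ?exprn_ge0 ?normc_ge0 ?expR_ge0 ?ler_expR//.
    by rewrite ler_pXn2r// nnegrE; [exact: normc_ge0|exact: mulr_ge0].
  apply: le_trans (ler_pM (normc_ge0 _) (normc_ge0 _) (tF z Uz) h3) _.
  have -> : T * expR s * (4 * ((y * x) ^+ 2 * expR y)) =
    T * expR s * (4 * (y ^+ 2 * expR y)) * x ^+ 2 by ring.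
  rewrite ler_wpM2r ?sqr_ge0//; apply: hD'; rewrite ler_wpM2l//.
  by rewrite (exprSr _ 2) ler_wpM2r// ler_pXn2r// nnegrE.
Qed.

(** Here [y] bounds the variation of the exponent over an increment of size [kap]. The remainders
    cost [expR y ^+ 3]; the one or two factors [y] brought by a derivative are absorbed in
    [expR y ^+ 2]. This is the origin of [s + 5 * y]. *)
Lemma jet2_cexp : jet2 kap U F (fun j z => c j * F z) (fun i j z => c j * c i * F z) C.
Proof.
have Cs : C = 4 * (expR s * expR y ^+ 3) * expR y ^+ 2.
  rewrite /C expRD expRM_natl; ring.
have E0 : 0 <= 4 * (expR s * expR y ^+ 3) by rewrite !mulr_ge0 ?exprn_ge0 ?expR_ge0.
have e2 : 1 <= expR y ^+ 2 by rewrite exprn_ege1.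
have y2 : y ^+ 2 <= expR y ^+ 2 by rewrite ler_pXn2r// nnegrE// expR_ge0.
have yy : y <= expR y ^+ 2 by apply: le_trans ye _; rewrite expr2 ler_peMr// expR_ge0.
split.
- have := @jet1_cexp 1 1 C; rewrite normc1 => /(_ (lexx _)).
  rewrite mulr1 Cs ler_peMr// => /(_ isT); apply: jet1_ext => [z|j z] _; by rewrite mul1r.
- move=> j; apply: (jet1_cexp (cA j)); rewrite ler_pdivlMr// Cs.
  have -> : 4 * A * (expR s * expR y ^+ 3) * kap = 4 * (expR s * expR y ^+ 3) * y.
    by rewrite /y; ring.
  by rewrite ler_wpM2l.
- move=> i j; suff [] : jet1 kap U (fun z => c j * c i * F z)
     (fun k z => c j * c i * c k * F z) (C / kap ^+ 2) by [].
  apply: (@jet1_cexp _ (A ^+ 2)); first by rewrite normcM expr2 ler_pM ?normc_ge0.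
  rewrite ler_pdivlMr ?exprn_gt0// Cs.
  have -> : 4 * A ^+ 2 * (expR s * expR y ^+ 3) * kap ^+ 2 = 4 * (expR s * expR y ^+ 3) * y ^+ 2.
    by rewrite /y; ring.
  by rewrite ler_wpM2l.
- by move=> i j z _; ring.
Qed.

End CexpJet.

(** * Taylor-Fourier series *)

Section Tube.
Variables (R : realType) (d n2 : nat).
Local Notation dim := (((1 + d) + (1 + d)) + (n2 + n2))%N.
Implicit Types (z w : phase R d n2) (x : tfindex d n2).

Definition amplitude (i : 'I_dim) z : R :=
  if (i < 1 + d)%N then `|complex.Im (z i 0)| else normc (z i 0).

(** Only the imaginary parts of the angles are restricted: the tube is invariant under real
    translations of the angles and contains the lift of a whole orbit, however far [q_1] travels. *)
Definition tube (kap : R) : set (phase R d n2) := [set z | forall i, amplitude i z < kap].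

Lemma amplitudeD i z w : amplitude i (z + w) <= amplitude i z + normc (w i 0).
Proof.
rewrite /amplitude mxE; case: ifP => _; last exact: normcD.
apply: le_trans (_ : _ <= `|complex.Im (z i 0)| + `|complex.Im (w i 0)|) _.
  by case: (z i 0) (w i 0) => a b [a' b']; exact: ler_normD.
by rewrite lerD2l normc_Im.
Qed.

Lemma tube_open kap z : 0 < kap -> tube kap z ->
  exists2 r : R, 0 < r & forall w, l1norm w < r -> tube kap (z + w).
Proof.
move=> k0 tz.
set b := \big[Num.max/(kap - 1)]_i amplitude i z.
have bk : b < kap by apply: bigmax_lt => //; rewrite ltrBlDr ltrDl.
exists (kap - b); first by rewrite subr_gt0.
move=> w wr i; apply: le_lt_trans (amplitudeD i z w) _.
apply: le_lt_trans (_ : _ <= b + l1norm w) _; last by rewrite -ltrBrDl.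
by apply: lerD; [exact: le_bigmax | exact: normc_l1norm].
Qed.

Lemma amplitude_qhat (j : 'I_(1 + d)) z : amplitude (idx_qhat n2 j) z = `|complex.Im (qhat z j)|.
Proof. by rewrite /amplitude /= ltn_ord. Qed.

Lemma amplitude_phat (j : 'I_(1 + d)) z : amplitude (idx_phat n2 j) z = normc (phat z j).
Proof. by rewrite /amplitude /= ltnNge leq_addr. Qed.

Lemma amplitude_xi (j : 'I_n2) z : amplitude (idx_xi d j) z = normc (xi z j).
Proof. by rewrite /amplitude /= ltnNge -addnA leq_addr. Qed.

Lemma amplitude_eta (j : 'I_n2) z : amplitude (idx_eta d j) z = normc (Defs.eta z j).
Proof. by rewrite /amplitude /= ltnNge -!addnA leq_addr. Qed.

Lemma tube_polydomain kap rho sigma rad z : kap <= rho -> kap <= sigma -> kap <= rad ->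
  tube kap z -> polydomain rho sigma rad z.
Proof.
move=> kr ks kR tz; split => j.
- by rewrite -amplitude_qhat; apply: lt_le_trans (tz _) ks.
- by rewrite -amplitude_phat; apply: lt_le_trans (tz _) kr.
- by rewrite -amplitude_xi; apply: lt_le_trans (tz _) kR.
- by rewrite -amplitude_eta; apply: lt_le_trans (tz _) kR.
Qed.

Variables (kap rho sigma rad : R).
Hypothesis kap0 : 0 < kap.
Hypotheses (krho : 8 * kap <= rho) (ksigma : 8 * kap <= sigma) (krad : 8 * kap <= rad).

Local Notation jet := (jet kap (tube kap)).
Let Uo z := @tube_open kap z kap0.

(** By [jetM] a coordinate of size at most [kap] multiplies the constant by [8 * kap]. The condition
    [8 * kap <= r] turns this into a factor [r], so that a monomial of any degree costs no more than
    its weight in [tfnorm], up to a fixed factor. *)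
Lemma jet_pow (F : phase R d n2 -> R[i]) N (k : 'I_dim) n (r : R) : 8 * kap <= r ->
  (1 + d <= k)%N -> jet F N -> jet (fun z => F z * z k 0 ^+ n) (N * r ^+ n).
Proof.
move=> kr dk; elim: n N F => [|n IH] N F FN.
  by rewrite mulr1; apply: jet_ext FN => // z _; rewrite mulr1.
have r0 : 0 <= r by apply: le_trans kr; rewrite mulr_ge0// ltW.
have := jetM kap0 Uo FN (jet2_jet kap0 Uo (@jet2_coord _ _ _ kap0 (tube kap) k _)).
case=> [z /(_ k)|]; first by rewrite /amplitude ltnNge dk => /ltW.
have N0 : 0 <= N by case: FN => [[[]]].
move=> h1 h2 h3 h4; have {}h := And4 h1 h2 h3 h4.
have /IH : jet (fun z => F z * z k 0) (N * r).
  by apply: jet_le h => //; rewrite mulrCA ler_wpM2l.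
by rewrite -mulrA -exprS; apply: jet_ext => // z _; rewrite exprS mulrA.
Qed.

Lemma jet_prod (I : Type) (s : seq I) (F : phase R d n2 -> R[i]) N (k : I -> 'I_dim)
    (n : I -> nat) (r : R) : 8 * kap <= r -> (forall i, (1 + d <= k i)%N) -> jet F N ->
  jet (fun z => F z * \prod_(i <- s) z (k i) 0 ^+ n i) (N * r ^+ (\sum_(i <- s) n i)).
Proof.
move=> kr dk; elim: s N F => [|i s IH] N F FN.
  by rewrite big_nil mulr1; apply: jet_ext FN => // z _; rewrite big_nil mulr1.
have := IH _ _ (jet_pow (n i) kr (dk i) FN).
rewrite big_cons exprD mulrA; apply: jet_ext => // z _.
by rewrite big_cons mulrA.
Qed.

Definition tfphase (k : {ffun 'I_(1 + d) -> int}) z : R[i] :=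
  'i * \sum_j (k j)%:~R * qhat z j.

Lemma jet_tfphase (k : {ffun 'I_(1 + d) -> int}) :
  jet (fun z => cexp (tfphase k z)) (4 * expR ((\sum_j absz (k j))%N%:R * sigma)).
Proof.
pose c (i : 'I_dim) : R[i] := \sum_j (i == idx_qhat n2 j)%:R * ('i * (k j)%:~R).
pose K : R := (\sum_j absz (k j))%N%:R.
have nk j : normc ((k j)%:~R : R[i]) = (absz (k j))%:R.
  rewrite -[X in normc X](rmorph_int (real_complex R)) normcR -intr_norm.
  by rewrite pmulrn.
have K0 : 0 <= K := ler0n _ _.
have cK i : normc (c i) <= K.
  apply: le_trans (normc_sum _ _ _) _; rewrite /K natr_sum; apply: ler_sum => j _.
  rewrite !normcM normci mul1r nk.
  by case: eqP => _; rewrite ?normc1 ?normc0 ?mul1r ?mul0r.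
have cadd z w : tfphase k (z + w) = tfphase k z + \sum_i w i 0 * c i.
  have -> : \sum_i w i 0 * c i = tfphase k w.
    rewrite /tfphase mulr_sumr /c; under eq_bigr do rewrite mulr_sumr.
    rewrite exchange_big/=; apply: eq_bigr => j _.
    rewrite (bigD1 (idx_qhat n2 j))//= eqxx mul1r big1 => [|i /negbTE ->].
      by rewrite addr0 /qhat; ring.
    by rewrite mul0r mulr0.
  rewrite /tfphase -mulrDr -big_split; congr (_ * _); apply: eq_bigr => j _.
  by rewrite /qhat mxE /=; ring.
have cs z : tube kap z -> complex.Re (tfphase k z) <= K * kap.
  move=> tz; have -> : complex.Re (tfphase k z) = - complex.Im (\sum_j (k j)%:~R * qhat z j).
    by rewrite /tfphase mulrC ReiNIm.
  have ImD : {morph (@complex.Im R) : a b / a + b >-> a + b} by move=> [a b] [c' d'].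
  rewrite (big_morph _ ImD (erefl _)) -sumrN /K natr_sum mulr_suml; apply: ler_sum => j _.
  rewrite -[X in X * _](rmorph_int (real_complex R)).
  have -> : complex.Im ((k j)%:~R%:C * qhat z j) = (k j)%:~R * complex.Im (qhat z j).
    by case: (qhat z j) => a b /=; rewrite mul0r addr0.
  apply: le_trans (ler_norm _) _; rewrite normrN normrM -intr_norm pmulrn.
  by rewrite ler_wpM2l// ltW// -amplitude_qhat.
have := jet2_jet kap0 Uo (jet2_cexp kap0 cadd cK K0 cs).
apply: jet_le => //; rewrite ler_wpM2l// ler_expR.
(* Both [s] and [y] of [jet2_cexp] equal [K * kap], and [6 * kap] lies below [sigma]. *)
have -> : K * kap + 5 * (K * kap) = K * (6 * kap) by ring.
by rewrite /K ler_wpM2l//; have := ksigma; have := kap0; lra.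
Qed.

Lemma jet_tfmonomial x : jet (tfmonomial x) (4 * tfweight rho sigma rad x).
Proof.
case: x => [[[i m1] m2] k].
have h1 := jet_prod (index_enum _) (k := @idx_phat d n2) i krho _ (jet_tfphase k).
have h2 := jet_prod (index_enum _) (k := @idx_xi d n2) m1 krad _ (h1 _).
have h3 := jet_prod (index_enum _) (k := @idx_eta d n2) m2 krad _ (h2 _ _).
have {h3}h3 := h3 _ _ _.
have E : 4 * tfweight rho sigma rad (i, m1, m2, k) =
  4 * expR ((\sum_j absz (k j))%N%:R * sigma) * rho ^+ (\sum_j i j)%N
    * rad ^+ (\sum_j m1 j)%N * rad ^+ (\sum_j m2 j)%N.
  by rewrite /tfweight exprD; ring.
rewrite E; apply: jet_ext (h3 _ _ _) => //.
- by move=> z _; rewrite /tfmonomial /= /phat /xi /Defs.eta /tfphase; ring.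
- by move=> j; rewrite /= -!addnA leq_addr.
- by move=> j; rewrite /= -addnA leq_addr.
- by move=> j; rewrite /= leq_addr.
Qed.

End Tube.

Section PickleSum.
Variables (R : realType) (T : countType).

(** A partial sum along the enumeration is a finite subsum of the unordered sum: [pickle_inv] is
    injective where it is defined, so no index is counted twice. *)
Lemma pickle_sum_le (a : T -> R) (B : R) : (forall x, 0 <= a x) ->
  (\esum_(x in [set: T]) (a x)%:E <= B%:E)%E ->
  forall M, \sum_(n < M) (if pickle_inv n is Some x then a x else 0) <= B.
Proof.
move=> a0 aB M; set s := pmap (@pickle_inv T) (iota 0 M).
have us : uniq s.
  by apply: (pmap_uniq (@pickle_invK T)); exact: iota_uniq.
have -> : \sum_(n < M) (if pickle_inv n is Some x then a x else 0) = \sum_(x <- s) a x.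
  rewrite -(big_mkord xpredT (fun n => if pickle_inv n is Some x then a x else 0)).
  rewrite /index_iota subn0 /s; elim: (iota 0 M) => [|n l IH]; first by rewrite !big_nil.
  rewrite big_cons IH /=; case: (pickle_inv n) => [x|] /=; last by rewrite add0r.
  by rewrite big_cons.
rewrite -lee_fin; apply: le_trans aB; apply: esum_ge; exists [set` s].
  by split=> //; exact: finite_seq.
by rewrite -fsbig_seq//= sumEFin.
Qed.

End PickleSum.

Section JetUniqueness.
Variables (R : realType) (m : nat) (kap : R).
Hypothesis kap0 : 0 < kap.
Variable U : set 'cV[R[i]]_m.
Hypothesis Uopen : forall z, U z -> exists2 r : R, 0 < r & forall w, l1norm w < r -> U (z + w).
Implicit Types (F f : 'cV[R[i]]_m -> R[i]) (z w : 'cV[R[i]]_m).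
Implicit Types (G g : 'I_m -> 'cV[R[i]]_m -> R[i]).
Implicit Types (H : 'I_m -> 'I_m -> 'cV[R[i]]_m -> R[i]) (a b N : R).

Lemma jet1_uniq f g a f' g' b j z : jet1 kap U f g a -> jet1 kap U f' g' b ->
  (forall z, U z -> f z = f' z) -> U z -> g j z = g' j z.
Proof.
move=> fa fb ff' Uz; have fa' := jet1_ext ff' (fun _ _ _ => erefl) fa.
by rewrite -(jet1_partial kap0 Uopen j fb Uz) -(jet1_partial kap0 Uopen j fa' Uz).
Qed.

(** On an open set the derivatives are determined by the function. Two jets computed in different
    ways for the same function thus give identities between derivatives, which is how scalings and
    translations are exploited below. *)
Lemma jet2_uniq F G H N F' G' H' N' : jet2 kap U F G H N -> jet2 kap U F' G' H' N' ->
  (forall z, U z -> F z = F' z) ->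
  (forall j z, U z -> G j z = G' j z) /\ (forall i j z, U z -> H i j z = H' i j z).
Proof.
move=> [h1 h2 _ _] [k1 k2 _ _] FF'.
have GG j z : U z -> G j z = G' j z by exact: jet1_uniq h1 k1 FF'.
by split=> // i j z; apply: (jet1_uniq i (h2 j) (k2 j)) => w; exact: GG.
Qed.

Section Diagonal.
Variable c : 'I_m -> R[i].
Hypothesis c1 : forall i, normc (c i) <= 1.

Definition diag_scale z : 'cV[R[i]]_m := \col_i (c i * z i 0).
Hypothesis Udiag : forall z, U z -> U (diag_scale z).

Lemma diag_scaleD z w : diag_scale (z + w) = diag_scale z + diag_scale w.
Proof. by apply/colP => i; rewrite !mxE mulrDr. Qed.

Lemma l1norm_diag_scale w : l1norm (diag_scale w) <= l1norm w.
Proof.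
apply: ler_sum => i _; rewrite mxE normcM.
by rewrite ler_piMl ?normc_ge0.
Qed.

Let near_diag z w : near_in kap U z w -> near_in kap U (diag_scale z) (diag_scale w).
Proof.
case=> Uz Uzw wk; split; first exact: Udiag.
  by rewrite -diag_scaleD; exact: Udiag.
exact: le_trans (l1norm_diag_scale w) wk.
Qed.

Let leqw w : l1norm (diag_scale w) / kap <= l1norm w / kap.
Proof. by rewrite ler_pM2r ?invr_gt0// l1norm_diag_scale. Qed.

Lemma lip_diag f a t : normc t <= 1 -> lip kap U f a -> lip kap U (fun z => t * f (diag_scale z)) a.
Proof.
move=> t1 [a0 fa da]; split=> // [z Uz|z w zw].
  by rewrite normcM; apply: le_trans (fa _ (Udiag Uz)); rewrite ler_piMl ?normc_ge0.
rewrite -mulrBr diag_scaleD normcM.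
apply: le_trans (_ : _ <= a * (l1norm (diag_scale w) / kap)) _; last by rewrite ler_wpM2l// leqw.
by apply: le_trans (da _ _ (near_diag zw)); rewrite ler_piMl ?normc_ge0.
Qed.

Lemma jet1_diag f g a t : normc t <= 1 -> jet1 kap U f g a ->
  jet1 kap U (fun z => t * f (diag_scale z)) (fun j z => t * c j * g j (diag_scale z)) a.
Proof.
move=> t1 [fa ga ra]; have [a0 _ _] := fa; split; first exact: lip_diag.
  move=> j z Uz; rewrite normcM; apply: le_trans (ga j _ (Udiag Uz)).
  by rewrite ler_piMl ?normc_ge0// normcM mulr_ile1 ?normc_ge0.
move=> z w zw; rewrite [X in normc X](_ : _ = t * (f (diag_scale z + diag_scale w)
    - f (diag_scale z) - \sum_j diag_scale w j 0 * g j (diag_scale z))).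
  rewrite normcM; apply: le_trans (_ : _ <= a * (l1norm (diag_scale w) / kap) ^+ 2) _.
    by apply: le_trans (ra _ _ (near_diag zw)); rewrite ler_piMl ?normc_ge0.
  by rewrite ler_wpM2l// ler_pXn2r ?leqw// nnegrE divr_ge0 ?l1norm_ge0 ?(ltW kap0).
rewrite diag_scaleD !mulrBr mulr_sumr; congr (_ - _); apply: eq_bigr => j _.
by rewrite mxE; ring.
Qed.

Lemma jet2_diag F G H N : jet2 kap U F G H N ->
  jet2 kap U (fun z => F (diag_scale z)) (fun j z => c j * G j (diag_scale z))
    (fun i j z => c j * c i * H i j (diag_scale z)) N.
Proof.
move=> [h1 h2 h3 h4]; split.
- have := @jet1_diag _ _ _ 1 _ h1; rewrite normc1 => /(_ (lexx _)).
  by apply: jet1_ext => [z|j z] _; rewrite mul1r.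
- by move=> j; exact: (jet1_diag (c1 j) (h2 j)).
- by move=> i j; apply: lip_diag => //; rewrite normcM mulr_ile1 ?normc_ge0.
- by move=> i j z Uz; rewrite h4; [ring|exact: Udiag].
Qed.

End Diagonal.

Lemma jet2_shift F G H N v : (forall z, U z -> U (z + v)) -> jet2 kap U F G H N ->
  jet2 kap U (fun z => F (z + v)) (fun j z => G j (z + v)) (fun i j z => H i j (z + v)) N.
Proof.
move=> Uv.
have nv z w : near_in kap U z w -> near_in kap U (z + v) w.
  by case=> Uz Uzw wk; split=> //; [exact: Uv|rewrite addrAC; exact: Uv].
have L f a : lip kap U f a -> lip kap U (fun z => f (z + v)) a.
  case=> a0 fa da; split=> // [z Uz|z w zw]; first by apply: fa; exact: Uv.
  by rewrite addrAC; apply: da; exact: nv.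
have J f g a : jet1 kap U f g a -> jet1 kap U (fun z => f (z + v)) (fun j z => g j (z + v)) a.
  case=> fa ga ra; split; [exact: L|by move=> j z Uz; apply: ga; exact: Uv|].
  by move=> z w zw; rewrite (addrAC z w v); apply: ra; exact: nv.
case=> h1 h2 h3 h4; split.
- exact: J h1.
- by move=> j; exact: (J _ _ _ (h2 j)).
- by move=> i j; exact: (L _ _ (h3 i j)).
- by move=> i j z Uz; apply: h4; exact: Uv.
Qed.

Lemma jet2Z F G H N t : jet2 kap U F G H N -> jet2 kap U (fun z => t * F z)
  (fun j z => t * G j z) (fun i j z => t * H i j z) (8 * (normc t * N)).
Proof.
move=> FN; have := jet2M kap0 (jet2_cst kap0 U (lexx (normc t))) FN.
apply: jet2_ext => // [j z|i j z] _; first by rewrite mulr0 addr0.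
by rewrite !(mulr0, mul0r, addr0).
Qed.

(* Homogeneity: if [F] is multiplied by [t] when the coordinate [i] is multiplied by
   [c i], then at a fixed point only the derivatives with matching weight survive. *)
Lemma jet_homogeneous F N (c : 'I_m -> R[i]) (t : R[i]) z : jet kap U F N ->
  (forall i, normc (c i) <= 1) -> (forall w, U w -> U (diag_scale c w)) ->
  (forall w, U w -> F (diag_scale c w) = t * F w) -> U z -> diag_scale c z = z ->
  (forall j, c j != t -> partial j F z = 0) /\
  (forall i j, c j * c i != t -> hessian F z i j = 0).
Proof.
move=> FN c1 Uc Fc Uz cz.
have [e1 e2] := jet2_uniq (jet2_diag c1 Uc FN) (jet2Z t FN) Fc.
have solve (u x : R[i]) : u != t -> u * x = t * x -> x = 0.
  move=> ut /eqP; rewrite -subr_eq0 -mulrBl mulf_eq0 subr_eq0 (negbTE ut) /=.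
  by move/eqP.
split=> [j cj|i j cij]; first by apply: solve cj _; have := e1 j z Uz; rewrite cz.
by apply: solve cij _; have := e2 i j z Uz; rewrite cz.
Qed.

Lemma jet_translation F N v : jet kap U F N -> (forall z, U z -> U (z + v)) ->
  (forall z, U z -> F (z + v) = F z) ->
  (forall j z, U z -> partial j F (z + v) = partial j F z) /\
  (forall i j z, U z -> hessian F (z + v) i j = hessian F z i j).
Proof. by move=> FN Uv Fv; exact: (jet2_uniq (jet2_shift Uv FN) FN Fv). Qed.

Lemma jet_constant_direction F N (k : 'I_m) : jet kap U F N ->
  (forall z (a : R[i]), U z -> U (z + a *: delta_mx k 0) -> F (z + a *: delta_mx k 0) = F z) ->
  (forall z, U z -> partial k F z = 0) /\
  (forall i z, U z -> hessian F z i k = 0 /\ hessian F z k i = 0).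
Proof.
move=> FN Fk; have P z : U z -> partial k F z = 0.
  move=> Uz; have [r r0 Ur] := Uopen Uz; apply: (@partialE _ _ _ _ _ _ 0 r) => // h hr.
  rewrite Fk//; last by apply: Ur; rewrite l1norm_delta.
  by rewrite subrr mulr0 subr0 normc0 mul0r.
split=> // i z Uz; have [_ h2 _ h4] := FN.
suff h : hessian F z i k = 0 by split=> //; rewrite -h4.
have := jet1_uniq i (h2 k) (@jet1_cst _ _ kap kap0 U 0 0 _) P Uz.
by apply; rewrite normc0.
Qed.

End JetUniqueness.

Section TfEval.
Variables (R : realType) (d n2 : nat).
Local Notation dim := (((1 + d) + (1 + d)) + (n2 + n2))%N.
Implicit Types (z w : phase R d n2) (x : tfindex d n2) (g : tfseries R d n2).

Definition tfterm g (n : nat) z : R[i] :=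
  if pickle_inv n is Some x then g x * tfmonomial x z else 0.

Lemma tfevalE g z : tfeval g z = csum (fun n => tfterm g n z).
Proof. by []. Qed.

Lemma tfterm_part l g n z : tfterm (tfpart l g) n z =
  if @pickle_inv (tfindex d n2) n is Some x then (if tfdeg x == l then tfterm g n z else 0) else 0.
Proof. by rewrite /tfterm; case: pickle_inv => // x; rewrite /tfpart; case: eqP; rewrite ?mul0r. Qed.

Variables (rho sigma rad : R).
Hypotheses (rho0 : 0 <= rho) (rad0 : 0 <= rad).

Definition tfbounded g (B : R) : Prop := forall M, \sum_(n < M)
  (if pickle_inv n is Some x then normc (g x) * tfweight rho sigma rad x else 0) <= B.

Lemma tfweight_ge0 x : 0 <= tfweight rho sigma rad x.
Proof. by case: x => [[[i m1] m2] k]; rewrite !mulr_ge0 ?exprn_ge0 ?expR_ge0. Qed.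

Lemma tfnorm_bounded g B : (tfnorm rho sigma rad g <= B%:E)%E -> tfbounded g B.
Proof.
by apply: pickle_sum_le => x; rewrite mulr_ge0 ?normc_ge0 ?tfweight_ge0.
Qed.

Lemma tfbounded_part l g B : tfbounded g B -> tfbounded (tfpart l g) B.
Proof.
move=> gB M; apply: le_trans (gB M); apply: ler_sum => n _.
case: pickle_inv => // x; rewrite /tfpart; case: eqP => //.
by rewrite normc0 mul0r mulr_ge0 ?normc_ge0 ?tfweight_ge0.
Qed.

Lemma geometric_half_le (E : R) L : 0 <= E -> \sum_(l < L) E * 2 ^- l <= 2 * E.
Proof.
move=> E0; suff : \sum_(l < L) E * 2 ^- l = 2 * E - 2 * E * 2 ^- L.
  by move=> ->; rewrite gerBl mulr_ge0 ?invr_ge0 ?exprn_ge0 ?mulr_ge0.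
elim: L => [|L IH]; first by rewrite big_ord0 expr0 invr1 mulr1 subrr.
by rewrite big_ord_recr/= IH exprS invfM; field; rewrite expf_neq0// pnatr_eq0.
Qed.

(** The hypotheses bound each homogeneous part separately. A partial sum meets finitely many
    degrees, and the bounds [E * 2 ^- l] of the parts add up to at most [2 * E]. *)
Lemma tfbounded_parts g E : 0 <= E ->
  (forall l, (tfnorm rho sigma rad (tfpart l g) <= (E * 2 ^- l)%:E)%E) -> tfbounded g (2 * E).
Proof.
move=> E0 gE M.
pose deg n := if @pickle_inv (tfindex d n2) n is Some x then tfdeg x else 0%N.
pose L := (\max_(n < M) deg n).+1.
pose a l n := if pickle_inv n is Some x
  then normc (tfpart l g x) * tfweight rho sigma rad x else 0.
rewrite (_ : \sum_(n < M) _ = \sum_(l < L) \sum_(n < M) a l n); last first.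
  rewrite exchange_big /=; apply: eq_bigr => n _.
  have dL : (deg n < L)%N by rewrite ltnS; exact: (leq_bigmax n).
  rewrite (bigD1 (Ordinal dL))//= big1 ?addr0 => [|l].
    rewrite /a /deg; case: pickle_inv => // x.
    by rewrite /tfpart eqxx.
  rewrite -val_eqE /= /a /deg; case: pickle_inv => // x.
  by rewrite /tfpart eq_sym => /negbTE ->; rewrite normc0 mul0r.
apply: le_trans (geometric_half_le L E0); apply: ler_sum => l _.
exact: (tfnorm_bounded (gE l)).
Qed.

Variable kap : R.
Hypothesis kap0 : 0 < kap.
Hypotheses (krho : 8 * kap <= rho) (ksigma : 8 * kap <= sigma) (krad : 8 * kap <= rad).

Local Notation U := (tube kap).
Local Notation jet := (jet kap U).
Let Uo z := @tube_open R d n2 kap z kap0.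

(** The 32 is the 4 of a monomial times the 8 of the product with its coefficient. *)
Lemma jet_tfterm g n : jet (tfterm g n) (32 *
  (if pickle_inv n is Some x then normc (g x) * tfweight rho sigma rad x else 0)).
Proof.
rewrite /tfterm; case: pickle_inv => [x|].
  have := jetZ kap0 Uo (g x) (jet_tfmonomial kap0 krho ksigma krad x).
  by apply: jet_le => //; rewrite le_eqVlt; apply/orP; left; apply/eqP; ring.
by have := jet_cst kap0 Uo 0; rewrite normc0 mulr0.
Qed.

Lemma jet_tfeval g B : tfbounded g B ->
  [/\ jet (tfeval g) (32 * B),
    forall j z, U z -> partial j (tfeval g) z = csum (fun n => partial j (tfterm g n) z) &
    forall i j z, U z -> hessian (tfeval g) z i j = csum (fun n => hessian (tfterm g n) z i j)].
Proof.
move=> gB; apply: (jet_csum kap0 Uo (jet_tfterm g)) => M.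
by rewrite -mulr_sumr ler_wpM2l//; exact: gB.
Qed.

(* The weight of a coordinate in the grading of the classes [P_l]. *)
Definition wdeg (i : 'I_dim) : nat :=
  if (i < 1 + d)%N then 0 else if (i < (1 + d) + (1 + d))%N then 2 else 1.

(** The scaling [(q, p, xi, eta) -> (q, p/4, xi/2, eta/2)] multiplies a monomial of degree [l] by
    [2^-l]. Being a contraction it preserves the tube, and as the powers of 1/2 are distinct,
    weights can be read off from it. *)
Let c (i : 'I_dim) : R[i] := 2^-1 ^+ wdeg i.

Lemma wdeg_qhat j : wdeg (idx_qhat n2 j) = 0%N.
Proof. by rewrite /wdeg /= ltn_ord. Qed.

Lemma wdeg_phat j : wdeg (idx_phat n2 j) = 2%N.
Proof. by rewrite /wdeg /= ltnNge leq_addr /= ltn_add2l ltn_ord. Qed.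

Lemma wdeg_xi j : wdeg (idx_xi d j) = 1%N.
Proof. by rewrite /wdeg /= ltnNge -addnA leq_addr /= addnA ltnNge leq_addr. Qed.

Lemma wdeg_eta j : wdeg (idx_eta d j) = 1%N.
Proof.
rewrite /wdeg [X in if X then _ else _](_ : _ = false); last first.
  by apply/negbTE; rewrite -leqNgt /= -!addnA leq_addr.
rewrite (_ : (idx_eta d j < _)%N = false)//.
by apply/negbTE; rewrite -leqNgt /= leq_addr.
Qed.

Lemma tfmonomial_scale x z : tfmonomial x (diag_scale c z) = 2^-1 ^+ tfdeg x * tfmonomial x z.
Proof.
case: x => [[[i m1] m2] k]; rewrite /tfmonomial /tfdeg.
have P (n : nat) (f : 'I_n -> 'I_dim) (e : 'I_n -> nat) (u : nat) :
    (forall j, wdeg (f j) = u) ->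
    \prod_j diag_scale c z (f j) 0 ^+ e j =
    2^-1 ^+ (u * \sum_j e j) * \prod_j z (f j) 0 ^+ e j.
  move=> fu; rewrite big_distrr /= expr_sum -big_split; apply: eq_bigr => j _.
  by rewrite mxE exprMn /c fu -exprM.
have P3 : \prod_j phat (diag_scale c z) j ^+ i j = _ := P _ (@idx_phat d n2) i 2%N wdeg_phat.
have P2 : \prod_j xi (diag_scale c z) j ^+ m1 j = _ := P _ (@idx_xi d n2) m1 1%N wdeg_xi.
have P1 : \prod_j Defs.eta (diag_scale c z) j ^+ m2 j = _ := P _ (@idx_eta d n2) m2 1%N wdeg_eta.
rewrite P1 P2 P3 !mul1n.
have -> : \sum_j (k j)%:~R * qhat (diag_scale c z) j = \sum_j (k j)%:~R * qhat z j.
  by apply: eq_bigr => j _; rewrite /qhat mxE /c wdeg_qhat expr0 mul1r.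
by rewrite !exprD /phat /xi /Defs.eta; ring.
Qed.

Let c1 i : normc (c i) <= 1.
Proof.
rewrite /c normcX exprn_ile1 ?normc_ge0// normcV.
rewrite -(rmorph_nat (real_complex R)) normcR ger0_norm//.
by rewrite invf_le1// ler1n.
Qed.

Let U_scale w : U w -> U (diag_scale c w).
Proof.
move=> Uw i; apply: le_lt_trans (Uw i); rewrite /amplitude mxE.
case: ifP => iq; last by rewrite normcM ler_piMl// normc_ge0.
by rewrite /c /wdeg iq expr0 mul1r.
Qed.

Let cE i l : (c i == 2^-1 ^+ l) = (wdeg i == l).
Proof.
apply/eqP/eqP => [|<-//]; apply: ieexprIn; first by rewrite invr_gt0.
by rewrite invr_eq1 pnatr_eq1.
Qed.

Lemma tfterm_derivative0 g n x z : pickle_inv n = Some x -> U z ->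
  (forall i, wdeg i != 0%N -> z i 0 = 0) ->
  (forall j, wdeg j != tfdeg x -> partial j (tfterm g n) z = 0) /\
  (forall i j, (wdeg i + wdeg j)%N != tfdeg x -> hessian (tfterm g n) z i j = 0).
Proof.
move=> nx Uz z0.
have cz : diag_scale c z = z.
  apply/colP => i; rewrite mxE; have [i0|i0] := eqVneq (wdeg i) 0%N.
    by rewrite /c i0 mul1r.
  by rewrite z0 ?mulr0.
have [|h1 h2] := jet_homogeneous kap0 Uo (t := 2^-1 ^+ tfdeg x) (jet_tfterm g n) c1 U_scale _ Uz cz.
  by move=> w _; rewrite /tfterm nx tfmonomial_scale mulrCA.
split=> [j jx|i j ijx]; first by apply: h1; rewrite cE.
apply: h2; rewrite /c -exprD; apply: contra ijx => /eqP h; rewrite addnC.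
apply/eqP; move: h; apply: ieexprIn; first by rewrite invr_gt0.
by rewrite invr_eq1 pnatr_eq1.
Qed.

Let derivatives_zero z : (forall j, partial j (fun=> 0 : R[i]) z = 0) /\
  (forall i j, hessian (fun=> 0 : R[i]) z i j = 0).
Proof.
have P j (w : phase R d n2) : partial j (fun=> 0 : R[i]) w = 0.
  by apply: (@partialE _ _ _ _ _ _ 0 1) => // h _; rewrite mulr0 !subr0 normc0 mul0r.
split=> // i j; rewrite mxE (_ : partial j (fun=> 0) = fun=> 0)//.
by apply/funext => w; exact: P.
Qed.

(* Evaluating at [phat = xi = eta = 0] leaves only the part of matching degree. *)
Lemma tfeval_part_derivatives g B z : tfbounded g B -> U z ->
  (forall i, wdeg i != 0%N -> z i 0 = 0) ->
  (forall j, partial j (tfeval g) z = partial j (tfeval (tfpart (wdeg j) g)) z) /\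
  (forall i j, hessian (tfeval g) z i j = hessian (tfeval (tfpart (wdeg i + wdeg j) g)) z i j).
Proof.
move=> gB Uz z0; have [_ p1 p2] := jet_tfeval gB.
have term l n : tfterm (tfpart l g) n = (if @pickle_inv (tfindex d n2) n is Some x then
    (if tfdeg x == l then tfterm g n else fun=> 0) else fun=> 0).
  by apply/funext => w; rewrite tfterm_part; case: pickle_inv => // x; case: eqP.
have none n : @pickle_inv (tfindex d n2) n = None -> tfterm g n = fun=> 0.
  by move=> nx; apply/funext => w; rewrite /tfterm nx.
have pick (f : (phase R d n2 -> R[i]) -> R[i]) (b : bool) F0 F1 :
  (~~ b -> f F0 = f F1) -> f F0 = f (if b then F0 else F1) by case: b => // /(_ isT).
have [d1 d2] := derivatives_zero z.
split=> [j|i j].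
  have [_ q1 _] := jet_tfeval (tfbounded_part (wdeg j) gB).
  apply: (etrans (p1 j z Uz)); apply: (etrans _ (esym (q1 j z Uz))).
  apply: (f_equal (@csum R)); apply/funext => n.
  apply: (etrans _ (esym (congr1 (fun F => partial j F z) (term _ n)))).
  case nx : pickle_inv => [x|]; last exact: (congr1 (fun F => partial j F z) (none _ nx)).
  apply: (pick (fun F => partial j F z)) => nd.
  have [+ _] := tfterm_derivative0 g nx Uz z0 => /(_ j) h.
  by apply: (etrans (h _)); rewrite ?d1// eq_sym.
have [_ _ q2] := jet_tfeval (tfbounded_part (wdeg i + wdeg j) gB).
apply: (etrans (p2 i j z Uz)); apply: (etrans _ (esym (q2 i j z Uz))).
apply: (f_equal (@csum R)); apply/funext => n.
apply: (etrans _ (esym (congr1 (fun F => hessian F z i j) (term _ n)))).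
case nx : pickle_inv => [x|]; last exact: (congr1 (fun F => hessian F z i j) (none _ nx)).
apply: (pick (fun F => hessian F z i j)) => nd.
have [_] := tfterm_derivative0 g nx Uz z0 => /(_ i j) h.
by apply: (etrans (h _)); rewrite ?d2// eq_sym.
Qed.

Lemma tfeval_angle_shift g z k : tfeval g (z + angle_shift R n2 k) = tfeval g z.
Proof.
rewrite !tfevalE; congr csum; apply/funext => n; rewrite /tfterm.
case: pickle_inv => // -[[[i m1] m2] k']; congr (_ * _).
have other (l : 'I_dim) : (1 + d <= l)%N -> (z + angle_shift R n2 k) l 0 = z l 0.
  move=> dl; rewrite mxE; suff -> : angle_shift R n2 k l 0 = 0 by rewrite addr0.
  rewrite /angle_shift mxE; case: splitP => [l' ll'|l' _]; last by rewrite mxE.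
  rewrite mxE; case: splitP => [l'' ll''|l'' _]; last by rewrite mxE.
  by move: dl; rewrite ll' ll'' leqNgt ltn_ord.
have angle j : qhat (z + angle_shift R n2 k) j = qhat z j + (2 * pi * (k j)%:~R)%:C.
  by rewrite /qhat mxE; congr (_ + _); rewrite /angle_shift !col_mxEu mxE.
rewrite /tfmonomial; congr (_ * _ * _ * _).
- by apply: eq_bigr => j _; rewrite /phat other //= leq_addr.
- by apply: eq_bigr => j _; rewrite /xi other //= -addnA leq_addr.
- by apply: eq_bigr => j _; rewrite /Defs.eta other //= -!addnA leq_addr.
under eq_bigr do rewrite angle mulrDr.
rewrite big_split /= mulrDr cexpD; set a := 'i * \sum_j (k' j)%:~R * (2 * pi * (k j)%:~R)%:C.
suff -> : a = 'i * (2 * pi * (\sum_j k' j * k j)%:~R)%:C by rewrite cexp_2pi mulr1.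
rewrite /a (big_morph (fun m : int => m%:~R : R) (fun a b => intrD _ a b) (mulr0z 1)).
rewrite [2 * pi * _]mulr_sumr (raddf_sum (real_complex R)); congr (_ * _); apply: eq_bigr => j _.
rewrite -[X in X * _](rmorph_int (real_complex R)) -rmorphM /= intrM.
by congr (_%:C); ring.
Qed.

End TfEval.

Section Indices.
Variables (R : realType) (d n2 : nat).
Local Notation dim := (((1 + d) + (1 + d)) + (n2 + n2))%N.

Variant idx_spec : 'I_dim -> Type :=
  | IdxQhat j : idx_spec (idx_qhat n2 j)
  | IdxPhat j : idx_spec (idx_phat n2 j)
  | IdxXi j : idx_spec (idx_xi d j)
  | IdxEta j : idx_spec (idx_eta d j).

Lemma idxP i : idx_spec i.
Proof.
case: (split_ordP i) => [i' ->|i' ->]; case: (split_ordP i') => [j ->|j ->].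
- exact: IdxQhat.
- exact: IdxPhat.
- exact: IdxXi.
- exact: IdxEta.
Qed.

End Indices.

Section JetSum.
Variables (R : realType) (m : nat) (kap : R).
Hypothesis kap0 : 0 < kap.
Variable U : set 'cV[R[i]]_m.

Lemma jet2_sum (I : Type) (s : seq I) (F : I -> 'cV[R[i]]_m -> R[i])
    (G : I -> 'I_m -> 'cV[R[i]]_m -> R[i]) (H : I -> 'I_m -> 'I_m -> 'cV[R[i]]_m -> R[i])
    (N : I -> R) : (forall k, jet2 kap U (F k) (G k) (H k) (N k)) ->
  jet2 kap U (fun z => \sum_(k <- s) F k z) (fun j z => \sum_(k <- s) G k j z)
    (fun i j z => \sum_(k <- s) H k i j z) (\sum_(k <- s) N k).
Proof.
move=> FN; elim: s => [|k s IH].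
  have := jet2_cst kap0 U (lexx (normc (0 : R[i]))); rewrite normc0 big_nil.
  by apply: jet2_ext => *; rewrite big_nil.
rewrite big_cons; apply: jet2_ext (jet2D (FN k) IH) => *; by rewrite big_cons.
Qed.

End JetSum.

(** * The quadratic part, real translations of the angles and points of the torus *)

Section LinearPart.
Variables (R : realType) (d n2 : nat) (kap omega : R) (Omega : 'I_n2 -> R).
Local Notation dim := (((1 + d) + (1 + d)) + (n2 + n2))%N.
Implicit Types (z w : phase R d n2).
Hypothesis kap0 : 0 < kap.
Local Notation U := (@tube R d n2 kap).
Let Uo z := @tube_open R d n2 kap z kap0.

Definition linear_gradient (j : 'I_dim) z : R[i] :=
  omega%:C * (j == idx_phat n2 (first_idx d))%:R +
  \sum_k 'i * (Omega k)%:C *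
    (xi z k * (j == idx_eta d k)%:R + Defs.eta z k * (j == idx_xi d k)%:R).

Definition linear_hessian (i j : 'I_dim) : R[i] :=
  \sum_k 'i * (Omega k)%:C * ((j == idx_eta d k)%:R * (i == idx_xi d k)%:R +
    (j == idx_xi d k)%:R * (i == idx_eta d k)%:R).

Definition linear_bound : R :=
  8 * (normc (omega%:C : R[i]) * kap) +
  \sum_k 8 * (normc ('i * (Omega k)%:C : R[i]) * (8 * (kap * kap))).

Lemma jet2_ham_linear : jet2 kap U (ham_linear omega Omega) linear_gradient
  (fun i j _ => linear_hessian i j) linear_bound.
Proof.
have co (k : 'I_dim) : (1 + d <= k)%N -> forall z, U z -> normc (z k 0) <= kap.
  by move=> dk z /(_ k); rewrite /amplitude ltnNge dk => /ltW.
have cp := co (idx_phat n2 (first_idx d)); have cx k := co (idx_xi d k).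
have ce k := co (idx_eta d k).
have {}cp : forall z, U z -> normc (z (idx_phat n2 (first_idx d)) 0) <= kap.
  by apply: cp; rewrite /= leq_addr.
have {}cx k : forall z, U z -> normc (z (idx_xi d k) 0) <= kap.
  by apply: cx; rewrite /= -addnA leq_addr.
have {}ce k : forall z, U z -> normc (z (idx_eta d k) 0) <= kap.
  by apply: ce; rewrite /= -!addnA leq_addr.
have J1 := jet2Z kap0 omega%:C (jet2_coord kap0 cp).
have J2 k := jet2Z kap0 ('i * (Omega k)%:C) (jet2M kap0
  (jet2_coord kap0 (cx k)) (jet2_coord kap0 (ce k))).
have := jet2D J1 (jet2_sum kap0 (index_enum 'I_n2) J2).
apply: jet2_ext => [z|j z|i j z] _.
- rewrite /ham_linear; congr (_ + _); apply: eq_bigr => k _.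
  by rewrite /xi /Defs.eta mulrA.
- by [].
- rewrite mulr0 add0r; apply: eq_bigr => k _; by rewrite !mulr0 !add0r.
Qed.

End LinearPart.

Section Shifts.
Variables (R : realType) (d n2 : nat) (kap : R).
Local Notation dim := (((1 + d) + (1 + d)) + (n2 + n2))%N.
Implicit Types (z w : phase R d n2).
Hypothesis kap0 : 0 < kap.
Local Notation U := (@tube R d n2 kap).
Let Uo z := @tube_open R d n2 kap z kap0.

(** Serves both for translation vectors and for the points of the torus, which are real translates
    of the origin. *)
Definition real_angles (v : phase R d n2) : Prop := forall i,
  complex.Im (v i 0) = 0 /\ (wdeg i != 0%N -> v i 0 = 0).

Lemma wdeg_eq0 (i : 'I_dim) : (wdeg i == 0%N) = (i < 1 + d)%N.
Proof. by rewrite /wdeg; case: ifP => // _; case: ifP. Qed.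

Lemma tube_real_angles v z : real_angles v -> U z -> U (z + v).
Proof.
move=> vr Uz i; have := Uz i; rewrite /amplitude mxE; have [vi v0] := vr i.
case: ifP => iq; last by rewrite v0 ?addr0// wdeg_eq0 iq.
by case: (z i 0) (v i 0) vi => a b [a' b'] /= ->; rewrite addr0.
Qed.

Lemma real_angles_delta (a : R) j : real_angles (a%:C *: delta_mx (idx_qhat n2 j) 0).
Proof.
move=> i; rewrite !mxE; have [->|ij] := eqVneq i (idx_qhat n2 j).
  by rewrite !eqxx mulr1 wdeg_qhat.
by rewrite andFb mulr0; split.
Qed.

Lemma insert_q1_first (a : R) (x : reduced R d n2) :
  insert_q1 a x (idx_qhat n2 (first_idx d)) 0 = a%:C.
Proof. by rewrite /insert_q1 /idx_qhat !col_mxEu mxE eqxx mulr1n. Qed.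

Lemma insert_q1_other (a b : R) (x : reduced R d n2) i :
  i != idx_qhat n2 (first_idx d) -> insert_q1 a x i 0 = insert_q1 b x i 0.
Proof.
rewrite /insert_q1; case: (idxP i) => j.
- case: (split_ordP j) => [k ->|k ->]; last by rewrite !col_mxEu !col_mxEd.
  by rewrite (ord1 k) eqxx.
- by rewrite !col_mxEu !col_mxEd.
- by rewrite !col_mxEd.
- by rewrite !col_mxEd.
Qed.

Lemma insert_q1_shift (a b : R) (x : reduced R d n2) :
  insert_q1 b x = insert_q1 a x + (b - a)%:C *: delta_mx (idx_qhat n2 (first_idx d)) 0.
Proof.
apply/colP => i; rewrite [RHS]mxE [X in _ + X]mxE [delta_mx _ _ _ _]mxE eqxx andbT.
have [->|h] := eqVneq i (idx_qhat n2 (first_idx d)).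
  by rewrite !insert_q1_first mulr1 rmorphB addrCA subrr addr0.
by rewrite mulr0 addr0; exact: insert_q1_other.
Qed.

Variable qs : 'cV[R]_d.

Definition torus_point (a : R) : phase R d n2 := insert_q1 a (reduced_of_q n2 qs).

Lemma torus_point_shift a b :
  torus_point b = torus_point a + (b - a)%:C *: delta_mx (idx_qhat n2 (first_idx d)) 0.
Proof. exact: insert_q1_shift. Qed.

Lemma torus_point_real_angles a : real_angles (torus_point a).
Proof.
move=> i; case: (idxP i) => j.
- rewrite wdeg_qhat; split=> //.
  rewrite /torus_point /insert_q1 !col_mxEu; case: (split_ordP j) => [k ->|k ->].
    by rewrite (ord1 k) col_mxEu mxE eqxx mulr1n.
  by rewrite col_mxEd /reduced_of_q !col_mxKu mxE.
- by rewrite /torus_point /insert_q1 /reduced_of_q !col_mxEu !col_mxEd !col_mxKu !col_mxKd mxE.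
- by rewrite /torus_point /insert_q1 /reduced_of_q !col_mxEd !col_mxKd mxE.
- by rewrite /torus_point /insert_q1 /reduced_of_q !col_mxEd !col_mxKd mxE.
Qed.

Lemma torus_point_q a j : qhat (torus_point a) (other_idx j) = (qs j 0)%:C.
Proof.
rewrite /qhat /torus_point /insert_q1 /idx_qhat /other_idx !col_mxEu col_mxEd.
by rewrite /reduced_of_q !col_mxKu mxE.
Qed.

Lemma tube0 : U 0.
Proof. by move=> i; rewrite /amplitude mxE; case: ifP => _; rewrite ?normc0 ?normr0. Qed.

Lemma tube_torus_point a : U (torus_point a).
Proof. by rewrite -[torus_point a]add0r; apply: tube_real_angles tube0; exact: torus_point_real_angles. Qed.

End Shifts.

(** * Derivatives of the normal form on the torus *)

Lemma hessianE (R : realType) (m : nat) (F : 'cV[R[i]]_m -> R[i]) z i j :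
  hessian F z i j = partial i (partial j F) z.
Proof. by rewrite mxE. Qed.

Lemma tfpart_eq0 (R : realType) (d n2 l : nat) (h : tfseries R d n2) : (forall x, tfdeg x = l -> h x = 0) -> tfeval (tfpart l h) = fun=> 0.
Proof.
move=> hl; apply/funext => z; rewrite tfevalE -[RHS](csum0 R); apply: (f_equal (@csum R)).
apply/funext => n; rewrite /tfterm; case: pickle_inv => // x; rewrite /tfpart.
by case: eqP => [/hl ->|_]; rewrite mul0r.
Qed.

Lemma diag_scaleE (R : realType) (m : nat) (c : 'I_m -> R[i]) z i :
  diag_scale c z i 0 = c i * z i 0.
Proof. by rewrite mxE. Qed.

#[local] Opaque tfeval tfpart partial csum climn hessian torus_point diag_scale.

Section NormalFormTerms.
Variables (R : realType) (d n2 : nat) (rho sigma rad kap : R).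
Local Notation dim := (((1 + d) + (1 + d)) + (n2 + n2))%N.
Hypotheses (rho0 : 0 <= rho) (rad0 : 0 <= rad) (kap0 : 0 < kap).
Hypotheses (krho : 8 * kap <= rho) (ksigma : 8 * kap <= sigma) (krad : 8 * kap <= rad).
Implicit Types (z w : phase R d n2) (h : tfseries R d n2).
Local Notation U := (@tube R d n2 kap).
Let Uo z := @tube_open R d n2 kap z kap0.
Let p1 := first_idx d.
Local Notation e_q1 := (delta_mx (idx_qhat n2 (first_idx d)) 0 : phase R d n2).

Let dom : set (phase R d n2) := polydomain rho sigma rad.

Lemma tube_dom z : U z -> dom z.
Proof.
have k0 := kap0.
by apply: tube_polydomain; [have := krho|have := ksigma|have := krad]; lra.
Qed.

Lemma invariant_real_shift F (j : 'I_(1 + d)) (a : R) :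
  invariant_along dom F (delta_mx (idx_qhat n2 j) 0) ->
  forall z, U z -> F (z + a%:C *: delta_mx (idx_qhat n2 j) 0) = F z.
Proof.
move=> iF z Uz; apply: iF; apply: tube_dom => //.
by apply: tube_real_angles => //; exact: real_angles_delta.
Qed.

Lemma invariant_derivatives F N (j : 'I_(1 + d)) (a : R) : jet kap U F N ->
  invariant_along dom F (delta_mx (idx_qhat n2 j) 0) ->
  (forall i z, U z -> partial i F (z + a%:C *: delta_mx (idx_qhat n2 j) 0) = partial i F z) /\
  (forall i k z, U z ->
     hessian F (z + a%:C *: delta_mx (idx_qhat n2 j) 0) i k = hessian F z i k).
Proof.
move=> FN iF; apply: (jet_translation kap0 Uo FN) => z Uz.
  by apply: tube_real_angles => //; exact: real_angles_delta.
exact: invariant_real_shift.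
Qed.

Lemma invariant_partial0 F N (v : 'I_dim) : jet kap U F N ->
  invariant_along dom F (delta_mx v 0) ->
  (forall z, U z -> partial v F z = 0) /\
  (forall i z, U z -> hessian F z i v = 0 /\ hessian F z v i = 0).
Proof.
move=> FN iF; apply: (jet_constant_direction kap0 Uo FN) => z a Uz Uza.
by apply: iF; exact: tube_dom.
Qed.

Variables (qs : 'cV[R]_d).
Local Notation ctr := (torus_point n2 qs).

Variables (h : tfseries R d n2) (B : R).
Hypotheses (hB : tfbounded rho sigma rad h B) (hn : normalized rho sigma rad qs h).

Let jpart l : jet kap U (tfeval (tfpart l h)) (32 * B).
Proof.
by have [] := jet_tfeval kap0 krho ksigma krad (tfbounded_part rho0 rad0 l hB).
Qed.

Let parts a := tfeval_part_derivatives rho0 rad0 kap0 krho ksigma krad hB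
  (tube_torus_point kap0 qs a) (fun i => (@torus_point_real_angles R d n2 qs a i).2).

Let inv1 : invariant_along dom (tfeval (tfpart 1 h)) e_q1.
Proof. by rewrite (tfpart_eq0 (nz_f1 hn)). Qed.

Let cut (i : 'I_dim) : R[i] := if wdeg i == 1%N then 0 else 1.

Let cut_le i : normc (cut i) <= 1.
Proof. by rewrite /cut; case: ifP => _; rewrite ?normc0 ?normc1. Qed.

Let cutE z : diag_scale cut z = col_mx (usubmx z) 0.
Proof.
apply/colP => i; rewrite diag_scaleE /cut; case: (idxP i) => j.
- by rewrite wdeg_qhat mul1r col_mxEu mxE.
- by rewrite wdeg_phat mul1r col_mxEu mxE.
- by rewrite wdeg_xi mul0r col_mxEd mxE.
- by rewrite wdeg_eta mul0r col_mxEd mxE.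
Qed.

Let tube_cut z : U z -> U (diag_scale cut z).
Proof.
move=> Uz i; apply: le_lt_trans (Uz i); rewrite /amplitude diag_scaleE -wdeg_eq0 /cut.
case: eqP => [->|_]; first by rewrite mul1r.
by case: ifP => _; rewrite ?mul1r// mul0r normc0 normc_ge0.
Qed.

Let cut_torus_point a : diag_scale cut (ctr a) = ctr a.
Proof.
apply/colP => i; rewrite diag_scaleE /cut; case: eqP => [i1|_]; last by rewrite mul1r.
by rewrite (torus_point_real_angles _ _ _).2 ?mulr0// i1.
Qed.

(** The normal form controls [f_4] only on [xi = eta = 0]. Composing it with the projection [cut]
    yields a function invariant along [q_1] that has the same second derivatives in [phat] at the
    points of the torus, which [cut] fixes. *)
Let f4_hessian a b k l : hessian (tfeval (tfpart 4 h)) (ctr b) (idx_phat n2 k) (idx_phat n2 l) =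
  hessian (tfeval (tfpart 4 h)) (ctr a) (idx_phat n2 k) (idx_phat n2 l).
Proof.
have J := jet2_diag kap0 cut_le tube_cut (jpart 4).
have inv : invariant_along dom (fun z => tfeval (tfpart 4 h) (diag_scale cut z)) e_q1.
  by move=> z t dz dzt; rewrite !cutE; exact: (nz_f4 hn).
have [_ H] := invariant_derivatives (b - a) (jet2_jet kap0 Uo J) inv.
have E t : hessian (fun z => tfeval (tfpart 4 h) (diag_scale cut z)) (ctr t)
    (idx_phat n2 k) (idx_phat n2 l) =
  hessian (tfeval (tfpart 4 h)) (ctr t) (idx_phat n2 k) (idx_phat n2 l).
  apply: (etrans (jet2_hessian kap0 Uo _ _ J (tube_torus_point kap0 qs t))).
  have cp u : cut (idx_phat n2 u) = 1 by rewrite /cut wdeg_phat.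
  rewrite !cp !mul1r; exact: (congr1 (fun y => hessian (tfeval (tfpart 4 h)) y _ _) (cut_torus_point t)).
apply: (etrans (esym (E b))); apply: (etrans _ (E a)).
apply: (etrans _ (H _ _ _ (tube_torus_point kap0 qs a))).
exact: (congr1 (fun y => hessian (fun z => tfeval (tfpart 4 h) (diag_scale cut z)) y _ _)
  (torus_point_shift _ _ a b)).
Qed.

(** On the torus a second derivative sees only the degree equal to the sum of the two weights.
    Degrees 0 and 2 do not depend on [q_1] and degree 1 is absent; degree 3 arises with one action,
    of which [f_3] is independent; degree 4 arises only with two actions, where [f4_hessian]
    applies. *)
Lemma normalized_hessian a b i j : hessian (tfeval h) (ctr b) i j = hessian (tfeval h) (ctr a) i j.
Proof.
have [_ Pb] := parts b; have [_ Pa] := parts a.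
apply: (etrans (Pb i j)); apply: (etrans _ (esym (Pa i j))).
have shift l : invariant_along dom (tfeval (tfpart l h)) e_q1 ->
    hessian (tfeval (tfpart l h)) (ctr b) i j = hessian (tfeval (tfpart l h)) (ctr a) i j.
  move=> inv; have [_ H] := invariant_derivatives (b - a) (jpart l) inv.
  apply: (etrans _ (H _ _ _ (tube_torus_point kap0 qs a))).
  exact: (congr1 (fun y => hessian (tfeval (tfpart l h)) y i j) (torus_point_shift _ _ a b)).
have L3 k l : hessian (tfeval (tfpart 3 h)) (ctr b) (idx_phat n2 k) l =
     hessian (tfeval (tfpart 3 h)) (ctr a) (idx_phat n2 k) l /\
     hessian (tfeval (tfpart 3 h)) (ctr b) l (idx_phat n2 k) =
     hessian (tfeval (tfpart 3 h)) (ctr a) l (idx_phat n2 k).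
  have [_ H] := @invariant_partial0 _ _ (idx_phat n2 k) (jpart 3) (nz_f3 hn (j := k)).
  have [Hb Hb'] := H l _ (tube_torus_point kap0 qs b).
  have [Ha Ha'] := H l _ (tube_torus_point kap0 qs a).
  by split; [exact: (etrans Hb' (esym Ha')) | exact: (etrans Hb (esym Ha))].
have s0 := shift 0%N (nz_f0 hn); have s1 := shift 1%N inv1; have s2 := shift 2%N (nz_f2 hn).
case: (idxP i) (idxP j) s0 s1 s2 => i' [] j' s0 s1 s2; rewrite ?wdeg_qhat ?wdeg_phat ?wdeg_xi ?wdeg_eta.
- exact: s0.
- exact: s2.
- exact: s1.
- exact: s1.
- exact: s2.
- exact: f4_hessian.
- by have [] := L3 i' (idx_xi d j').
- by have [] := L3 i' (idx_eta d j').
- exact: s1.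
- by have [] := L3 j' (idx_xi d i').
- exact: s2.
- exact: s2.
- exact: s1.
- by have [] := L3 j' (idx_eta d i').
- exact: s2.
- exact: s2.
Qed.

(** Each direction has its own reason: [f_0] is independent of [q_1]; [f_2] vanishes over [q = q^*],
    [xi = eta = 0] whatever [phat], hence so do its derivatives in the actions; there is no degree 1
    to be differentiated in [xi] or [eta]. *)
Lemma normalized_gradient a i :
  (forall j, i != idx_qhat n2 (other_idx j)) -> partial i (tfeval h) (ctr a) = 0.
Proof.
have [Pa _] := parts a; move=> hi; apply: (etrans (Pa i)); move: hi.
have Ua : U (ctr a) := tube_torus_point kap0 qs a.
have [r r0 Ur] := Uo Ua; case: (idxP i) => j hj.
- case: (split_ordP j) hj => [k ->|k ->] hj; last by have := hj k; rewrite eqxx.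
  rewrite wdeg_qhat; have [H _] := invariant_partial0 (jpart 0) (nz_f0 hn).
  by have := H _ Ua; rewrite (ord1 k).
- rewrite wdeg_phat; apply: (@partialE _ _ _ _ _ _ 0 r) => // t tr.
  have Z s : normc s < r -> tfeval (tfpart 2 h) (ctr a + s *: delta_mx (idx_phat n2 j) 0) = 0.
    move=> sr; apply: (nz_f2_at hn).
    + by apply: tube_dom; apply: Ur; rewrite l1norm_delta.
    + move=> k; rewrite -(torus_point_q n2 qs a) /qhat !mxE [_ == idx_phat _ _](_ : _ = false) ?mulr0 ?addr0//.
      by apply/eqP => /(congr1 (@wdeg d n2)); rewrite wdeg_qhat wdeg_phat.
    + move=> k; rewrite /xi mxE (torus_point_real_angles qs a _).2 ?wdeg_xi// add0r !mxE.
      rewrite [_ == idx_phat _ _](_ : _ = false) ?mulr0//.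
      by apply/eqP => /(congr1 (@wdeg d n2)); rewrite wdeg_xi wdeg_phat.
    + move=> k; rewrite /Defs.eta mxE (torus_point_real_angles qs a _).2 ?wdeg_eta// add0r !mxE.
      rewrite [_ == idx_phat _ _](_ : _ = false) ?mulr0//.
      by apply/eqP => /(congr1 (@wdeg d n2)); rewrite wdeg_eta wdeg_phat.
  have := Z 0; rewrite normc0 scale0r addr0 => /(_ r0) ->.
  by rewrite Z// subrr mulr0 subrr normc0 mul0r.
- rewrite wdeg_xi (tfpart_eq0 (nz_f1 hn)).
  by apply: (@partialE _ _ _ _ _ _ 0 1) => // t _; rewrite subrr mulr0 subrr normc0 mul0r.
- rewrite wdeg_eta (tfpart_eq0 (nz_f1 hn)).
  by apply: (@partialE _ _ _ _ _ _ 0 1) => // t _; rewrite subrr mulr0 subrr normc0 mul0r.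
Qed.

Lemma normalized_gradient_q a b j : partial (idx_qhat n2 j) (tfeval h) (ctr b) =
  partial (idx_qhat n2 j) (tfeval (tfpart 0 h)) (ctr a).
Proof.
have [Pb _] := parts b; apply: (etrans (Pb _)); rewrite wdeg_qhat.
have [H _] := invariant_derivatives (b - a) (jpart 0) (nz_f0 hn).
apply: (etrans _ (H _ _ (tube_torus_point kap0 qs a))).
exact: (congr1 (fun y => partial _ (tfeval (tfpart 0 h)) y) (torus_point_shift _ _ a b)).
Qed.

End NormalFormTerms.

Section OrderZero.
Variables (R : realType) (d n2 : nat) (rho sigma rad kap : R).
Local Notation dim := (((1 + d) + (1 + d)) + (n2 + n2))%N.
Hypotheses (rho0 : 0 <= rho) (rad0 : 0 <= rad) (kap0 : 0 < kap).
Hypotheses (krho : 8 * kap <= rho) (ksigma : 8 * kap <= sigma) (krad : 8 * kap <= rad).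
Implicit Types (z w : phase R d n2).
Local Notation U := (@tube R d n2 kap).
Let Uo z := @tube_open R d n2 kap z kap0.
Variables (g : tfseries R d n2) (B : R).
Hypotheses (gB : tfbounded rho sigma rad g B).
Hypothesis gsplit : split_order_zero (polydomain rho sigma rad) g.

Let jg : jet kap U (tfeval g) (32 * B).
Proof. by have [] := jet_tfeval kap0 krho ksigma krad gB. Qed.

Let dom z : U z -> polydomain rho sigma rad z.
Proof. exact: tube_dom. Qed.

Let same_eval z w : U z -> U w -> phat z =1 phat w -> xi z =1 xi w -> Defs.eta z =1 Defs.eta w ->
  tfeval g z = tfeval g w.
Proof.
move=> Uz Uw hp hx he; have [_ [h0 [g0 E]]] := gsplit.
by rewrite !E; [rewrite (funext hp) (funext hx) (funext he)|exact: dom..].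
Qed.

Lemma order_zero_shift v z : real_angles v -> U z ->
  (forall i, partial i (tfeval g) (z + v) = partial i (tfeval g) z) /\
  (forall i j, hessian (tfeval g) (z + v) i j = hessian (tfeval g) z i j).
Proof.
move=> va Uz; have [|w Uw|e1 e2] := jet_translation kap0 Uo (v := v) jg.
- by move=> w; exact: tube_real_angles.
- apply: same_eval => //; first exact: tube_real_angles.
  + by move=> j; rewrite /phat mxE (va _).2 ?addr0// wdeg_phat.
  + by move=> j; rewrite /xi mxE (va _).2 ?addr0// wdeg_xi.
  + by move=> j; rewrite /Defs.eta mxE (va _).2 ?addr0// wdeg_eta.
- by split=> *; [exact: e1|exact: e2].
Qed.

Lemma order_zero_q j : (forall z, U z -> partial (idx_qhat n2 j) (tfeval g) z = 0) /\
  (forall i z, U z -> hessian (tfeval g) z i (idx_qhat n2 j) = 0 /\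
     hessian (tfeval g) z (idx_qhat n2 j) i = 0).
Proof.
apply: (jet_constant_direction kap0 Uo jg) => z a Uz Uza.
have off (l : 'I_dim) : wdeg l != 0%N -> (z + a *: delta_mx (idx_qhat n2 j) 0) l 0 = z l 0.
  move=> lq; rewrite !mxE [_ == idx_qhat _ _](_ : _ = false) ?mulr0 ?addr0//.
  by apply/eqP => h; move: lq; rewrite h wdeg_qhat.
apply: same_eval => // k; rewrite /phat /xi /Defs.eta off//.
- by rewrite wdeg_phat.
- by rewrite wdeg_xi.
- by rewrite wdeg_eta.
Qed.

Let deg_le2 l : (l <= 2)%N -> tfeval (tfpart l g) = fun=> 0.
Proof. by move=> l2; apply: tfpart_eq0 => x xl; have [H _] := gsplit; apply: H; rewrite xl. Qed.

Let parts z (Uz : U z) := tfeval_part_derivatives rho0 rad0 kap0 krho ksigma krad gB Uz.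

Let partial_cst0 (i : 'I_dim) z : partial i (fun=> 0) z = 0 :> R[i].
Proof.
by apply: (@partialE _ _ _ _ _ _ 0 1) => // t _; rewrite subrr mulr0 subrr normc0 mul0r.
Qed.

Lemma order_zero_gradient v i : real_angles v -> partial i (tfeval g) v = 0.
Proof.
move=> va; have Uv : U v by rewrite -[v]add0r; apply: tube_real_angles va (tube0 kap0).
have [-> _] := parts Uv (fun i => (va i).2).
by rewrite deg_le2 ?partial_cst0//; case: (idxP i) => j;
  rewrite ?wdeg_qhat ?wdeg_phat ?wdeg_xi ?wdeg_eta.
Qed.

Lemma order_zero_hessian_xieta i j : wdeg i = 1%N -> wdeg j = 1%N -> hessian (tfeval g) 0 i j = 0.
Proof.
move=> i1 j1; have [|_ ->] := parts (tube0 kap0); first by move=> k _; rewrite mxE.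
rewrite i1 j1 deg_le2// hessianE (_ : partial j _ = fun=> 0) ?partial_cst0//.
by apply/funext => z; exact: partial_cst0.
Qed.

(** The functions [h0] and [g0] of the splitting are arbitrary and cannot be differentiated. But the
    increment of their sum along an action is the same at 0 and at a point [w] displaced in [xi] or
    [eta], so the derivative in the action is constant in that direction. *)
Lemma order_zero_hessian_mixed i j : wdeg i = 1%N -> wdeg j = 2%N ->
  hessian (tfeval g) 0 i j = 0 /\ hessian (tfeval g) 0 j i = 0.
Proof.
move=> i1 j2; have U0 : U 0 := tube0 kap0; suff h : hessian (tfeval g) 0 i j = 0.
  by split=> //; have [_ _ _ sym] := jg; rewrite sym.
have [h1 _ _ _] := jg; have [_ _ rem] := h1.
have [r r0 Ur] := Uo U0; rewrite hessianE; apply: (@partialE _ _ _ _ _ _ 0 r) => // s sr.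
set w := s *: delta_mx i 0; have Uw : U (0 + w) by apply: Ur; rewrite l1norm_delta.
suff -> : partial j (tfeval g) (0 + w) = partial j (tfeval g) 0.
  by rewrite subrr mulr0 subrr normc0 mul0r.
have [r' r'0 Ur'] := Uo Uw.
have [r'' r''0 Ur''] := near_in_delta kap0 Uo j U0.
(* The derivative at [w] is computed from the Taylor remainder at 0, which the equality of
   increments transfers. *)
apply: (@partialE _ _ _ _ _ _ (32 * B / kap ^+ 2) (Num.min r' r'')); first by rewrite lt_min r'0.
move=> t; rewrite lt_min => /andP[tr' tr''].
have near0 := Ur'' _ tr''; have [_ Ut _] := near0.
have Uwt : U (0 + w + t *: delta_mx j 0) by apply: Ur'; rewrite l1norm_delta.
suff -> : tfeval g (0 + w + t *: delta_mx j 0) - tfeval g (0 + w) =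
    tfeval g (0 + t *: delta_mx j 0) - tfeval g 0.
  have := rem _ _ near0; rewrite sum_delta l1norm_delta => /le_trans; apply.
  by rewrite exprMn exprVn mulrA mulrAC.
have [_ [h0 [g0 E]]] := gsplit; rewrite !E; try exact: dom.
have wi (l : 'I_dim) : wdeg l != 1%N -> w l 0 = 0.
  rewrite !mxE; have [->|] := eqVneq l i; first by rewrite i1.
  by rewrite mulr0.
have tj (l : 'I_dim) : wdeg l != 2%N -> (t *: delta_mx j 0 : phase R d n2) l 0 = 0.
  rewrite !mxE; have [->|] := eqVneq l j; first by rewrite j2.
  by rewrite mulr0.
have -> : phat (0 + w + t *: delta_mx j 0) = phat (0 + t *: delta_mx j 0).
  apply/funext => k; rewrite /phat mxE [(0 + w) _ _]mxE [in RHS]mxE wi ?addr0//.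
  by rewrite wdeg_phat.
have -> : phat (0 + w) = phat (0 : phase R d n2).
  by apply/funext => k; rewrite /phat mxE wi ?addr0// wdeg_phat.
have -> : xi (0 + w + t *: delta_mx j 0) = xi (0 + w).
  by apply/funext => k; rewrite /xi mxE tj ?addr0// wdeg_xi.
have -> : Defs.eta (0 + w + t *: delta_mx j 0) = Defs.eta (0 + w).
  by apply/funext => k; rewrite /Defs.eta mxE tj ?addr0// wdeg_eta.
have -> : xi (0 + t *: delta_mx j 0) = xi (0 : phase R d n2).
  by apply/funext => k; rewrite /xi mxE tj ?addr0// wdeg_xi.
have -> : Defs.eta (0 + t *: delta_mx j 0) = Defs.eta (0 : phase R d n2).
  by apply/funext => k; rewrite /Defs.eta mxE tj ?addr0// wdeg_eta.
by ring.
Qed.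

End OrderZero.

Lemma leq_addS_pred (N r M : nat) : (N + r.+1 <= M)%N ->
  exists2 M', M = M'.+1 & (r <= M')%N && (N <= M' - r)%N.
Proof. by case: M => [|M] h; [lia | exists M => //; lia]. Qed.

Section Hamiltonians.
Variables (R : realType) (d n2 : nat) (rho sigma rad kap : R).
Local Notation dim := (((1 + d) + (1 + d)) + (n2 + n2))%N.
Hypotheses (rho0 : 0 <= rho) (rad0 : 0 <= rad) (kap0 : 0 < kap).
Hypotheses (krho : 8 * kap <= rho) (ksigma : 8 * kap <= sigma) (krad : 8 * kap <= rad).
Implicit Types (z w : phase R d n2).
Local Notation U := (@tube R d n2 kap).
Let Uo z := @tube_open R d n2 kap z kap0.
Variables (r : nat) (omega : R) (Omega : 'I_n2 -> R) (g0 : tfseries R d n2).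
Variables (f : nat -> tfseries R d n2) (qs : 'cV[R]_d) (q10 E x : R).
Hypotheses (E0 : 0 <= E) (x0 : 0 <= x) (x2 : x <= 2^-1).
Hypothesis g0B : tfbounded rho sigma rad g0 (2 * E).
Hypothesis fB : forall s, (0 < s)%N -> tfbounded rho sigma rad (f s) (2 * E * x ^+ s).
Local Notation tp := (torus_point n2 qs).

Let H := ham omega Omega g0 f.
Let Z := ham_trunc r omega Omega g0 f.
Let fz (k : nat) : phase R d n2 -> R[i] := tfeval (f k.+1).
Let nb (k : nat) : R := 64 * E * x ^+ k.+1.

Definition ham_bound : R := linear_bound kap omega Omega + 256 * E.

Let jfz k : jet kap U (fz k) (nb k).
Proof.
have [J _ _] := jet_tfeval kap0 krho ksigma krad (fB (ltn0Sn k)).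
by apply: jet_le J => //; rewrite /nb le_eqVlt; apply/orP; left; apply/eqP; ring.
Qed.

Let jg0 : jet kap U (tfeval g0) (64 * E).
Proof.
have [J _ _] := jet_tfeval kap0 krho ksigma krad g0B.
by apply: jet_le J => //; rewrite le_eqVlt; apply/orP; left; apply/eqP; ring.
Qed.

Let nb_ge0 k : 0 <= nb k. Proof. by rewrite !mulr_ge0 ?exprn_ge0. Qed.

(** The number [x] will be [mu * |eps|]; being at most 1/2 it makes a geometric series dominate the
    tail, whose size is that of its first term. *)
Let nb_tail s M : \sum_(k < M) nb (k + s) <= 128 * E * x ^+ s.+1.
Proof.
have E' : 0 <= 64 * E * x ^+ s.+1 by rewrite !mulr_ge0 ?exprn_ge0.
have -> : 128 * E * x ^+ s.+1 = 2 * (64 * E * x ^+ s.+1) by ring.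
apply: le_trans (geometric_half_le M E'); apply: ler_sum => k _.
rewrite /nb -addnS addnC exprD mulrA ler_wpM2l// -exprVn.
by rewrite lerXn2r// nnegrE.
Qed.

Lemma ham_truncE z : Z z = ham_linear omega Omega z + tfeval g0 z + \sum_(0 <= k < r) fz k z.
Proof. by rewrite /Z /ham_trunc big_add1. Qed.

Let jets_trunc : jet2 kap U Z
  (fun j z => linear_gradient omega Omega j z + partial j (tfeval g0) z
     + \sum_(0 <= k < r) partial j (fz k) z)
  (fun i j z => linear_hessian Omega i j + hessian (tfeval g0) z i j
     + \sum_(0 <= k < r) hessian (fz k) z i j)
  (linear_bound kap omega Omega + 64 * E + \sum_(0 <= k < r) nb k).
Proof.
have := jet2D (jet2D (jet2_ham_linear d omega Omega kap0) jg0)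
  (jet2_sum kap0 (index_iota 0 r) jfz).
by apply: jet2_ext => // z _; rewrite ham_truncE.
Qed.

Lemma jet_trunc : jet kap U Z ham_bound.
Proof.
apply: jet_le (jet2_jet kap0 Uo jets_trunc) => //.
have := nb_tail 0 r; under eq_bigr do rewrite addn0.
rewrite big_mkord /ham_bound expr1 => h.
have : 128 * E * x <= 128 * E * 2^-1 by rewrite ler_wpM2l// mulr_ge0.
have := E0; lra.
Qed.

Let tail z := csum (fun k => fz (k + r) z).

Lemma ham_tail z : U z -> H z = Z z + tail z.
Proof.
move=> Uz; rewrite ham_truncE /H /ham -[RHS]addrA; congr (_ + _).
have sm : csummable (fun k => fz (k + r) z).
  apply: (@csummable_le _ _ (fun k => nb (k + r)) _ _ (nb_tail r)) => k.
  by have [[[_ + _] _ _] _ _ _] := jfz (k + r); exact.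
apply: climnE => e e0; have [N _ hN] := csummable_cvg sm e0.
(* The sum in [ham] runs over [1 <= s < M]: the shift of the index and the [r] terms of the
   truncation account for [r.+1]. *)
exists (N + r.+1)%N => // M /= NM.
have [M' -> /andP[rM NM']] := leq_addS_pred NM.
rewrite big_add1 /= (@big_cat_nat _ _ _ r)//= opprD addrACA subrr add0r.
rewrite -{1}[r]add0n big_addn big_mkord.
exact: hN.
Qed.

Lemma jet_tail : jet kap U tail (128 * E * x ^+ r.+1).
Proof.
by have [J _ _] := jet_csum kap0 Uo (fun k => jfz (k + r)) (nb_tail r).
Qed.

Let jets_ham : jet2 kap U H
  (fun j z => partial j Z z + partial j tail z)
  (fun i j z => hessian Z z i j + hessian tail z i j)
  (ham_bound + 128 * E * x ^+ r.+1).
Proof.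
by apply: jet2_ext (jet2D jet_trunc jet_tail) => // z Uz; rewrite ham_tail.
Qed.

Lemma jet_ham : jet kap U H (ham_bound + 128 * E).
Proof.
apply: jet_le (jet2_jet kap0 Uo jets_ham) => //; rewrite lerD2l.
rewrite ler_piMr ?mulr_ge0// exprn_ile1//.
by apply: le_trans x2 _; rewrite invf_le1// ler1n.
Qed.

Let addl_sub (a b c : R[i]) : a = b + c -> a - b = c.
Proof. by move=> ->; rewrite addrC addKr. Qed.

Lemma ham_trunc_gradient_close z j : U z ->
  normc (partial j H z - partial j Z z) <= 128 * E / kap * x ^+ r.+1.
Proof.
move=> Uz; have [_ _ _ _] := jets_ham.
rewrite (addl_sub (jet2_partial kap0 Uo j jets_ham Uz)).
have [[_ + _] _ _ _] := jet_tail => /(_ j z Uz) /le_trans; apply.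
by rewrite mulrAC.
Qed.

Lemma ham_trunc_hessian_close z i j : U z ->
  normc (hessian H z i j - hessian Z z i j) <= 128 * E / kap ^+ 2 * x ^+ r.+1.
Proof.
move=> Uz.
rewrite (addl_sub (jet2_hessian kap0 Uo i j jets_ham Uz)).
have [_ _ + _] := jet_tail => /(_ i j) [_ + _] => /(_ z Uz) /le_trans; apply.
by rewrite mulrAC.
Qed.

Lemma ham_angle_shift z k : H (z + angle_shift R n2 k) = H z.
Proof.
apply: (f_equal2 +%R); first apply: (f_equal2 +%R); last 2 first.
- exact: tfeval_angle_shift.
- apply: (f_equal (@climn R)); apply/funext => N; apply: eq_bigr => s _.
  exact: tfeval_angle_shift.
  have other (l : 'I_dim) : wdeg l != 0%N -> (z + angle_shift R n2 k) l 0 = z l 0.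
    rewrite mxE; case: (idxP l) => j; rewrite ?wdeg_qhat// => _.
    + by rewrite /angle_shift !col_mxEu !col_mxEd mxE addr0.
    + by rewrite /angle_shift !col_mxEd mxE addr0.
    + by rewrite /angle_shift !col_mxEd mxE addr0.
  rewrite /ham_linear /phat /xi /Defs.eta other ?wdeg_phat//; congr (_ + _).
  by apply: eq_bigr => j _; rewrite !other ?wdeg_xi ?wdeg_eta.
Qed.

Hypothesis g0split : split_order_zero (polydomain rho sigma rad) g0.

Definition hessian0 (i j : 'I_dim) : R[i] :=
  linear_hessian Omega i j + hessian (tfeval g0) 0 i j.

Let oz a i j : hessian (tfeval g0) (tp a) i j = hessian (tfeval g0) 0 i j.
Proof.
have [_ sh] := order_zero_shift kap0 krho ksigma krad g0B g0split
  (@torus_point_real_angles R d n2 qs a) (tube0 kap0).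
exact: (etrans (congr1 (fun y => hessian (tfeval g0) y i j) (esym (add0r (tp a)))) (sh i j)).
Qed.

Let addKs (a b b' c : R[i]) : b = b' -> a + b + c - (a + b') = c.
Proof. by move=> ->; rewrite addrC addKr. Qed.

(** The limit [hessian0] does not involve [qs], since the terms of order 0 are invariant under
    translation of the angles and may be evaluated at the origin. The Hessian on the torus thus
    converges even if [q^*] does not. *)
Lemma ham_trunc_hessian0 a i j :
  normc (hessian Z (tp a) i j - hessian0 i j) <= 128 * E / kap ^+ 2 * x.
Proof.
have Ua : U (tp a) := tube_torus_point kap0 qs a.
rewrite (jet2_hessian kap0 Uo i j jets_trunc Ua).
rewrite /hessian0 (addKs _ _ (oz a i j)).
apply: le_trans (normc_sum _ _ _) _; rewrite big_mkord.
have := nb_tail 0 r; under eq_bigr do rewrite addn0.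
rewrite expr1 => h; apply: le_trans (_ : _ <= \sum_(k < r) nb k / kap ^+ 2) _.
  apply: ler_sum => k _; have [_ _ + _] := jfz k => /(_ i j) [_ + _]; exact.
by rewrite -mulr_suml mulrAC ler_wpM2r// invr_ge0 exprn_ge0// ltW.
Qed.

Hypothesis fN : forall s, (1 <= s <= r)%N -> normalized rho sigma rad qs (f s).

Lemma ham_trunc_hessian_cst a b i j : hessian Z (tp b) i j = hessian Z (tp a) i j.
Proof.
have Ua : U (tp a) := tube_torus_point kap0 qs a.
have Ub : U (tp b) := tube_torus_point kap0 qs b.
apply: (etrans (jet2_hessian kap0 Uo i j jets_trunc Ub)).
apply: (etrans _ (esym (jet2_hessian kap0 Uo i j jets_trunc Ua))).
apply: (f_equal2 +%R (f_equal2 +%R (erefl _) (etrans (oz b i j) (esym (oz a i j))))).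
apply: eq_big_nat => k /andP[_ kr].
exact: (normalized_hessian rho0 rad0 kap0 krho ksigma krad (fB (ltn0Sn k)) (fN (s := k.+1) kr)).
Qed.

Hypothesis stationary : forall j : 'I_d, \sum_(1 <= s < r.+1)
  partial (idx_qhat n2 (other_idx j)) (tfeval (tfpart 0 (f s))) (tp q10) = 0.

(** The straight line [torus_point (q10 + omega t)] is therefore an orbit of [Z]. The derivatives in
    [q] cancel only in the sum over [s], by the choice of [q^*]; all the other components of the
    perturbing terms vanish one by one. Independence of [q_1] carries the stationarity condition
    from [q10] to any [a]. *)
Lemma ham_trunc_gradient a i :
  partial i Z (tp a) = omega%:C * (i == idx_phat n2 (first_idx d))%:R.
Proof.
have Ua : U (tp a) := tube_torus_point kap0 qs a.
apply: (etrans (jet2_partial kap0 Uo i jets_trunc Ua)).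
have -> : linear_gradient omega Omega i (tp a) = omega%:C * (i == idx_phat n2 (first_idx d))%:R.
  rewrite /linear_gradient big1 ?addr0// => k _.
  rewrite /xi /Defs.eta (torus_point_real_angles qs a _).2 ?wdeg_xi//.
  by rewrite (torus_point_real_angles qs a _).2 ?wdeg_eta// !mul0r addr0 mulr0.
have gz : partial i (tfeval g0) (tp a) = 0.
  apply: (order_zero_gradient rho0 rad0 kap0 krho ksigma krad g0B g0split).
  exact: torus_point_real_angles.
rewrite gz addr0 -[RHS]addr0; congr (_ + _).
have fgrad k : (k < r)%N -> (forall j, i != idx_qhat n2 (other_idx j)) -> partial i (fz k) (tp a) = 0.
  move=> kr ij.
  exact: (normalized_gradient rho0 rad0 kap0 krho ksigma krad (fB (ltn0Sn k)) (fN (s := k.+1) kr)).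
case: (pselect (exists j, i = idx_qhat n2 (other_idx j))) => [[j ij]|ni]; last first.
  rewrite big_nat; apply: big1 => k /andP[_ kr]; apply: (fgrad k kr) => j.
  by apply/eqP => ij; apply: ni; exists j.
apply: (etrans _ (stationary j)); rewrite big_add1; apply: eq_big_nat => k /andP[_ kr].
rewrite ij.
exact: (normalized_gradient_q rho0 rad0 kap0 krho ksigma krad (fB (ltn0Sn k)) (fN (s := k.+1) kr)).
Qed.

End Hamiltonians.

#[local] Transparent tfeval tfpart partial csum climn hessian torus_point diag_scale.

(** * Differential inequalities and linear equations *)

Section RealDerivative.
Variable R : realType.
Implicit Types (f : R -> R) (t d : R).

Lemma is_derive_eps f t d : is_derive t 1 f d <->
  (forall e, 0 < e -> exists2 del, 0 < del & forall h, `|h| < del ->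
     `|f (t + h) - f t - h * d| <= e * `|h|).
Proof.
split=> [fd e e0|H].
  have fc : (fun h : R => h^-1 *: (f (h *: 1 + t) - f t)) @ 0^' --> d.
    by rewrite -(@derive_val _ _ _ _ _ _ _ fd); exact: (@ex_derive _ _ _ _ _ _ _ fd).
  move/cvgrPdist_le : fc => /(_ e e0); rewrite near_withinE => -[del /= del0 Hd].
  exists del => // h hd; have [->|h0] := eqVneq h 0.
    by rewrite addr0 subrr mul0r subrr normr0 mulr0.
  have := Hd h; rewrite /= sub0r normrN => /(_ hd h0).
  rewrite /GRing.scale /= mulr1 [h + t]addrC => Hh.
  have -> : f (t + h) - f t - h * d = - h * (d - h^-1 * (f (t + h) - f t)) by field.
  by rewrite normrM normrN mulrC ler_wpM2r.
have fc : (fun h : R => h^-1 *: (f (h *: 1 + t) - f t)) @ 0^' --> d.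
  apply/cvgrPdist_le => e e0; rewrite near_withinE; have [del del0 Hd] := H e e0.
  exists del => // h /=; rewrite sub0r normrN => hd h0.
  rewrite /GRing.scale /= mulr1 [h + t]addrC.
  have hp : 0 < `|h| by rewrite normr_gt0.
  rewrite -(ler_pM2r hp) -normrM.
  have -> : (d - h^-1 * (f (t + h) - f t)) * h = - (f (t + h) - f t - h * d) by field.
  by rewrite normrN; exact: Hd.
by apply: DeriveDef; [apply/cvg_ex; exists d | apply: cvg_lim].
Qed.

Lemma is_derive_continuous_eps f t d : is_derive t 1 f d ->
  forall e, 0 < e -> exists2 del, 0 < del & forall h, `|h| < del -> `|f (t + h) - f t| < e.
Proof.
move=> /is_derive_eps /(_ 1 ltr01) [del del0 H] e e0.
have d0 : 0 < `|d| + 1 by rewrite ltr_wpDl.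
exists (Num.min del (e / (`|d| + 1))); first by rewrite lt_min del0 divr_gt0.
move=> h; rewrite lt_min => /andP[/H h1 h2].
apply: le_lt_trans (_ : _ <= (`|d| + 1) * `|h|) _; last by rewrite mulrC -ltr_pdivlMr.
have -> : f (t + h) - f t = (f (t + h) - f t - h * d) + h * d by ring.
apply: le_trans (ler_normD _ _) _; rewrite mulrDl addrC lerD//.
by rewrite normrM mulrC.
Qed.

(** At the infimum of the times where [w] is nonnegative, [w] vanishes after having been negative,
    so its derivative cannot be negative there. *)
Lemma barrier (w dw : R -> R) (T : R) :
  (forall t, 0 <= t <= T -> is_derive t 1 w (dw t)) -> w 0 < 0 ->
  (forall t, 0 <= t <= T -> w t = 0 -> dw t < 0) ->
  forall t, 0 <= t <= T -> w t < 0.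
Proof.
move=> wd w0 wz t1 t1T; rewrite ltNge; apply/negP => wt1.
pose S := [set t | 0 <= t <= t1 /\ 0 <= w t].
have /andP[t10 t1T'] := t1T.
have S1 : S t1 by rewrite /S /= t10 lexx.
have lbS : has_inf S by split; [exists t1 | exists 0 => t [/andP[]]].
pose t0 := inf S.
have t01 : t0 <= t1 by apply: ge_inf => //; case: lbS.
have t00 : 0 <= t0 by apply: lb_le_inf; [exists t1|move=> t [/andP[]]].
have t0T : 0 <= t0 <= T by rewrite t00 (le_trans t01).
have before t : 0 <= t -> t < t0 -> w t < 0.
  move=> t0' tt0; rewrite ltNge; apply/negP => wt.
  have : t0 <= t by apply: ge_inf; [case: lbS|split=> //; rewrite t0' (le_trans (ltW tt0))].
  by rewrite leNgt tt0.
have wt0_ge : 0 <= w t0.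
  rewrite leNgt; apply/negP => wneg.
  have nw : 0 < - w t0 by rewrite oppr_gt0.
  have [del del0 H] := is_derive_continuous_eps (wd _ t0T) nw.
  have [s [s0 ws] sd] := @inf_adherent _ S del del0 lbS.
  have ts : t0 <= s by apply: ge_inf => //; case: lbS.
  have := H (s - t0); rewrite [t0 + _]addrC subrK ger0_norm ?subr_ge0// => H'.
  have : w s < 0.
    have sd' : s - t0 < del by rewrite ltrBlDl.
    have := H' sd'; rewrite ltr_norml => /andP[]; lra.
  by rewrite ltNge ws.
have t0pos : 0 < t0.
  by rewrite lt_neqAle t00 andbT; apply/eqP => t0e; have := wt0_ge; rewrite -t0e leNgt w0.
have wt0_le : w t0 <= 0.
  rewrite leNgt; apply/negP => wpos.
  have [del del0 H] := is_derive_continuous_eps (wd _ t0T) wpos.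
  pose h := - Num.min (del / 2) (t0 / 2).
  have m0 : 0 < Num.min (del / 2) (t0 / 2) by rewrite lt_min !divr_gt0.
  have m1 : Num.min (del / 2) (t0 / 2) <= del / 2 by rewrite ge_min lexx.
  have m2 : Num.min (del / 2) (t0 / 2) <= t0 / 2 by rewrite ge_min lexx orbT.
  have := H h; rewrite normrN gtr0_norm// => Hh.
  have : `|w (t0 + h) - w t0| < w t0 by apply: Hh; lra.
  have : w (t0 + h) < 0 by apply: before; rewrite /h; lra.
  move=> h1; rewrite ltr_norml => /andP[]; lra.
have wt0 : w t0 = 0 by apply/eqP; rewrite eq_le wt0_le.
have dneg := wz _ t0T wt0.
have e0 : 0 < - dw t0 / 2 by rewrite divr_gt0// oppr_gt0.
have /is_derive_eps /(_ _ e0) [del del0 H] := wd _ t0T.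
pose h := - Num.min (del / 2) (t0 / 2).
have m0 : 0 < Num.min (del / 2) (t0 / 2) by rewrite lt_min !divr_gt0.
have m1 : Num.min (del / 2) (t0 / 2) <= del / 2 by rewrite ge_min lexx.
have m2 : Num.min (del / 2) (t0 / 2) <= t0 / 2 by rewrite ge_min lexx orbT.
have := H h; rewrite normrN gtr0_norm// wt0 subr0 => Hh.
have : `|w (t0 + h) - h * dw t0| <= - dw t0 / 2 * Num.min (del / 2) (t0 / 2).
  by apply: Hh; lra.
have : w (t0 + h) < 0 by apply: before; rewrite /h; lra.
rewrite /h; move: (Num.min _ _) m0 (w _) => m m0 y y0.
rewrite ler_norml => /andP[]; nra.
Qed.

(* The differential inequality is only available while [u] is below [kappa]; the final
   bound being below [kappa], a barrier argument makes it self-sustaining. *)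
Lemma gronwall_bootstrap (T k a b kappa : R) (u du : R -> R) :
  0 <= k -> 0 <= a -> 0 <= b -> (forall t, 0 <= t <= T -> is_derive t 1 u (du t)) ->
  u 0 <= a -> (forall t, 0 <= t <= T -> u t < kappa -> du t <= k * u t + b) ->
  (a + b) * expR ((k + 1) * T) < kappa ->
  forall t, 0 <= t <= T -> u t <= (a + b) * expR ((k + 1) * t).
Proof.
move=> k0 a0 b0 ud ua udb small t tT.
have E0 (x : R) : 0 < expR x := expR_gt0 x.
set ET := expR ((k + 1) * T) in small.
have ET0 : 0 < ET := E0 _.
(* The slack [eta] makes the comparison with [(a + b + eta) * expR ((k + 1) * s)] strict at the
   initial time; where the two curves meet one has [b < u], so that the rate [k + 1] absorbs the
   source [b]. *)
suff H eta : 0 < eta -> eta * ET < kappa - (a + b) * ET ->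
    u t <= (a + b) * expR ((k + 1) * t) + eta * expR ((k + 1) * t).
  have gap : 0 < kappa - (a + b) * ET by rewrite subr_gt0.
  apply/ler_addgt0Pr => e e0.
  pose eta := Num.min (e / expR ((k + 1) * t)) ((kappa - (a + b) * ET) / ET / 2).
  have eta0 : 0 < eta by rewrite lt_min !divr_gt0.
  apply: le_trans (H eta eta0 _) _.
    apply: le_lt_trans (_ : _ <= (kappa - (a + b) * ET) / ET / 2 * ET) _.
      by rewrite (ler_wpM2r (ltW ET0))// ge_min lexx orbT.
    rewrite mulrAC divfK ?gt_eqF//; lra.
  rewrite lerD2l -ler_pdivlMr// ge_min lexx//.
move=> eta0 etas.
pose w s := u s - (a + b + eta) * expR ((k + 1) * s).
pose dw s := du s - (a + b + eta) * ((k + 1) * expR ((k + 1) * s)).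
suff : w t < 0 by rewrite /w; nra.
apply: (@barrier w dw T) => // [s sT||s sT ws].
- have dE : is_derive s 1 (fun x : R => expR ((k + 1) * x)) ((k + 1) * expR ((k + 1) * s)).
    have lin : is_derive s 1 (fun x : R => (k + 1) * x) (k + 1).
      apply/is_derive_eps => e e0; exists 1 => // h _.
      rewrite [X in `|X|](_ : _ = 0) ?normr0 ?mulr_ge0 ?(ltW e0)//; ring.
    have := @is_derive1_comp _ expR (fun x : R => (k + 1) * x) s (expR ((k + 1) * s)) (k + 1).
    by rewrite [_ * (k + 1)]mulrC => /(_ (is_derive_expR _) lin).
  by rewrite /w /dw; apply: is_deriveB; first exact: ud.
- by rewrite /w mulr0 expR0 mulr1; lra.
- have /andP[s0 sT'] := sT.
  have us : u s = (a + b + eta) * expR ((k + 1) * s) by move: ws; rewrite /w => /eqP; rewrite subr_eq0 => /eqP.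
  have Es : expR ((k + 1) * s) <= ET by rewrite ler_expR ler_wpM2l// addr_ge0.
  have E1 : 1 <= expR ((k + 1) * s) by rewrite -expR0 ler_expR mulr_ge0// addr_ge0.
  have usk : u s < kappa.
    rewrite us; apply: le_lt_trans (_ : _ <= (a + b + eta) * ET) _; last by nra.
    by rewrite ler_wpM2l// !addr_ge0// ltW.
  have := udb _ sT usk; rewrite /dw.
  have -> : (a + b + eta) * ((k + 1) * expR ((k + 1) * s)) = (k + 1) * u s by rewrite us; ring.
  have : b < u s.
    apply: lt_le_trans (_ : a + b + eta <= _); first by lra.
    by rewrite us ler_peMr// !addr_ge0// ltW.
  by nra.
Qed.

End RealDerivative.

Section ComplexDerivative.
Variable R : realType.
Implicit Types (f g : R -> R[i]) (t : R) (v w : R[i]).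

Lemma has_time_derivative_eps f t w : has_time_derivative f t w <->
  (forall e, 0 < e -> exists2 del, 0 < del & forall h : R, `|h| < del ->
     normc (f (t + h) - f t - h%:C * w) <= e * `|h|).
Proof.
have ReE (x y u : R[i]) (h : R) : complex.Re (x - y - h%:C * u) =
    complex.Re x - complex.Re y - h * complex.Re u.
  by case: x y u => [a b] [c d] [p q] /=; rewrite mul0r subr0.
have ImE (x y u : R[i]) (h : R) : complex.Im (x - y - h%:C * u) =
    complex.Im x - complex.Im y - h * complex.Im u.
  by case: x y u => [a b] [c d] [p q] /=; rewrite mul0r addr0.
split=> [[/is_derive_eps hr /is_derive_eps hi] e e0|H].
  have e20 : 0 < e / 2 by rewrite divr_gt0.
  have [d1 d10 h1] := hr _ e20; have [d2 d20 h2] := hi _ e20.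
  exists (Num.min d1 d2); first by rewrite lt_min d10.
  move=> h; rewrite lt_min => /andP[/h1 {}h1 /h2 {}h2].
  apply: le_trans (normc_ReIm _) _; rewrite ReE ImE.
  by apply: le_trans (lerD h1 h2) _; rewrite -mulrDl -splitr.
split; apply/is_derive_eps => e e0; have [del del0 h] := H e e0; exists del => // x /h.
  by rewrite -ReE; apply: le_trans; exact: normc_Re.
by rewrite -ImE; apply: le_trans; exact: normc_Im.
Qed.

Lemma has_time_derivative_cst t w : has_time_derivative (fun=> w) t 0.
Proof.
apply/has_time_derivative_eps => e e0; exists 1 => // h _.
by rewrite mulr0 subrr subr0 normc0 mulr_ge0// ltW.
Qed.

Lemma has_time_derivativeD f g t v w : has_time_derivative f t v ->
  has_time_derivative g t w -> has_time_derivative (fun s => f s + g s) t (v + w).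
Proof.
move=> /has_time_derivative_eps fv /has_time_derivative_eps gw.
apply/has_time_derivative_eps => e e0; have e20 : 0 < e / 2 by rewrite divr_gt0.
have [d1 d10 h1] := fv _ e20; have [d2 d20 h2] := gw _ e20.
exists (Num.min d1 d2); first by rewrite lt_min d10.
move=> h; rewrite lt_min => /andP[/h1 {}h1 /h2 {}h2].
have -> : f (t + h) + g (t + h) - (f t + g t) - h%:C * (v + w) =
  (f (t + h) - f t - h%:C * v) + (g (t + h) - g t - h%:C * w) by ring.
apply: le_trans (normcD _ _) _.
by apply: le_trans (lerD h1 h2) _; rewrite -mulrDl -splitr.
Qed.

Lemma has_time_derivative_continuous f t v : has_time_derivative f t v ->
  exists2 C, 0 < C & exists2 del, 0 < del &
  forall h : R, `|h| < del -> normc (f (t + h) - f t) <= C * `|h|.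
Proof.
move=> /has_time_derivative_eps /(_ 1 ltr01) [del del0 h].
exists (1 + normc v); first by rewrite ltr_pwDl ?normc_ge0.
exists del => // x /h hx.
have -> : f (t + x) - f t = (f (t + x) - f t - x%:C * v) + x%:C * v by ring.
apply: le_trans (normcD _ _) _; rewrite mulrDl lerD//.
by rewrite normcM normcR mulrC.
Qed.

Lemma has_time_derivativeM f g t v w : has_time_derivative f t v ->
  has_time_derivative g t w -> has_time_derivative (fun s => f s * g s) t (f t * w + g t * v).
Proof.
move=> fv gw; have [C C0 [d3 d30 hC]] := has_time_derivative_continuous fv.
move: fv gw => /has_time_derivative_eps fv /has_time_derivative_eps gw.
apply/has_time_derivative_eps => e e0.
set A := normc (f t) + C; have A0 : 0 < A by rewrite ltr_wpDl ?normc_ge0.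
set B := normc (g t) + 1; have B0 : 0 < B by rewrite ltr_wpDl ?normc_ge0.
set W := normc w + 1; have W0 : 0 < W by rewrite ltr_wpDl ?normc_ge0.
have [d1 d10 h1] := fv (e / 3 / B) ltac:(by rewrite !divr_gt0).
have [d2 d20 h2] := gw (e / 3 / A) ltac:(by rewrite !divr_gt0).
exists (Num.min (Num.min d1 d2) (Num.min d3 (Num.min 1 (e / 3 / (C * W))))).
  by rewrite !lt_min d10 d20 d30 ltr01 !divr_gt0 ?mulr_gt0.
move=> h; rewrite !lt_min => /andP[/andP[/h1 {}h1 /h2 {}h2] /andP[/hC {}hC /andP[h11 he]]].
have -> : f (t + h) * g (t + h) - f t * g t - h%:C * (f t * w + g t * v) =
  f (t + h) * (g (t + h) - g t - h%:C * w) + (f (t + h) - f t - h%:C * v) * g t +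
  h%:C * ((f (t + h) - f t) * w) by ring.
have x0 : 0 <= `|h| := normr_ge0 h.
have fth : normc (f (t + h)) <= A.
  have -> : f (t + h) = f t + (f (t + h) - f t) by ring.
  apply: le_trans (normcD _ _) _; rewrite lerD2l; apply: le_trans hC _.
  by rewrite ler_piMr ?(ltW C0)// ltW.
have b1 : normc (f (t + h) * (g (t + h) - g t - h%:C * w)) <= e / 3 * `|h|.
  rewrite normcM; apply: le_trans (ler_pM (normc_ge0 _) (normc_ge0 _) fth h2) _.
  by rewrite mulrA mulrCA divff ?mulr1// gt_eqF.
have b2 : normc ((f (t + h) - f t - h%:C * v) * g t) <= e / 3 * `|h|.
  rewrite normcM; apply: le_trans (ler_pM (normc_ge0 _) (normc_ge0 _) h1 (_ : _ <= B)) _.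
    by rewrite lerDl.
  by rewrite mulrAC divfK// gt_eqF.
have b3 : normc (h%:C * ((f (t + h) - f t) * w)) <= e / 3 * `|h|.
  rewrite !normcM normcR mulrC ler_wpM2r//.
  apply: le_trans (ler_pM (normc_ge0 _) (normc_ge0 _) hC (_ : _ <= W)) _.
    by rewrite lerDl.
  have : C * W * `|h| <= C * W * (e / 3 / (C * W)).
    by rewrite ler_wpM2l ?(ltW he)// mulr_ge0// ltW.
  by rewrite [C * W * (_ / _)]mulrC divfK ?gt_eqF ?mulr_gt0// mulrAC.
apply: le_trans (normcD _ _) _; apply: le_trans (lerD (normcD _ _) (lexx _)) _.
apply: le_trans (lerD (lerD b1 b2) b3) _.
by rewrite le_eqVlt; apply/orP; left; apply/eqP; field.
Qed.

Lemma has_time_derivativeZ f t v c : has_time_derivative f t v ->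
  has_time_derivative (fun s => c * f s) t (c * v).
Proof.
move=> fv; have := has_time_derivativeM (has_time_derivative_cst t c) fv.
by rewrite mulr0 addr0.
Qed.

Lemma has_time_derivativeB f g t v w : has_time_derivative f t v ->
  has_time_derivative g t w -> has_time_derivative (fun s => f s - g s) t (v - w).
Proof.
move=> fv /(has_time_derivativeZ (-1)) gw; have := has_time_derivativeD fv gw.
by rewrite mulN1r; under eq_fun do rewrite mulN1r.
Qed.

Lemma has_time_derivative_sum (I : Type) (s : seq I) (f : I -> R -> R[i]) t (v : I -> R[i]) :
  (forall i, has_time_derivative (f i) t (v i)) ->
  has_time_derivative (fun x => \sum_(i <- s) f i x) t (\sum_(i <- s) v i).
Proof.
move=> fv; elim: s => [|i s IH].
  by rewrite big_nil; under eq_fun do rewrite big_nil; exact: has_time_derivative_cst.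
by rewrite big_cons; under eq_fun do rewrite big_cons; exact: has_time_derivativeD.
Qed.

Lemma has_time_derivative_conj f t v : has_time_derivative f t v ->
  has_time_derivative (fun s => (f s)^*) t v^*.
Proof.
move=> /has_time_derivative_eps fv; apply/has_time_derivative_eps => e e0.
have [del del0 h] := fv e e0; exists del => // x /h.
rewrite -normc_conj !rmorphB rmorphM /=.
by rewrite oppr0.
Qed.

Lemma has_time_derivative_id t : has_time_derivative (fun s : R => s%:C) t 1.
Proof.
apply/has_time_derivative_eps => e e0; exists 1 => // h _.
have -> : (t + h)%:C - t%:C - h%:C * 1 = 0 by rewrite rmorphD; ring.
by rewrite normc0 mulr_ge0// ltW.
Qed.

(** The square of the norm is differentiable even where the vector vanishes, so it can be fed to
    [gronwall_bootstrap]. *)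
Definition sqnorm (I : finType) (v : I -> R[i]) : R := \sum_i normc (v i) ^+ 2.

Lemma sqnorm_ge0 (I : finType) (v : I -> R[i]) : 0 <= sqnorm v.
Proof. by apply: sumr_ge0 => i _; exact: sqr_ge0. Qed.

Lemma normc_sqnorm (I : finType) (v : I -> R[i]) i : normc (v i) ^+ 2 <= sqnorm v.
Proof. by rewrite /sqnorm (bigD1 i)//= lerDl; apply: sumr_ge0 => j _; exact: sqr_ge0. Qed.

(** The difference of the two sides is half the sum of [(x i - x j) ^+ 2] over all pairs. *)
Lemma sqr_sum_le (I : finType) (x : I -> R) : (\sum_i x i) ^+ 2 <= #|I|%:R * \sum_i x i ^+ 2.
Proof.
have h : 0 <= \sum_i \sum_j (x i - x j) ^+ 2.
  by apply: sumr_ge0 => i _; apply: sumr_ge0 => j _; exact: sqr_ge0.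
suff e : \sum_i \sum_j (x i - x j) ^+ 2 = 2 * (#|I|%:R * \sum_i x i ^+ 2) - 2 * (\sum_i x i) ^+ 2.
  by move: h; rewrite e; lra.
have e i : \sum_j (x i - x j) ^+ 2 =
    #|I|%:R * x i ^+ 2 + (\sum_j x j ^+ 2 - 2 * \sum_j x j * x i).
  rewrite (eq_bigr (fun j => x i ^+ 2 + (x j ^+ 2 - 2 * (x j * x i)))) => [|j _]; last by ring.
  by rewrite big_split/= sumr_const mulr_natl big_split/= sumrN -mulr_sumr.
rewrite (eq_bigr _ (fun i _ => e i)) big_split/= -mulr_sumr sumrB sumr_const.
rewrite -mulr_sumr -[X in _ + (X - _)]mulr_natl.
have -> : \sum_i \sum_j x j * x i = (\sum_i x i) ^+ 2.
  by rewrite expr2 mulr_sumr; apply: eq_bigr => i _; rewrite mulr_suml.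
by ring.
Qed.

Lemma sqnorm_derivative (I : finType) (v v' : R -> I -> R[i]) t :
  (forall i, has_time_derivative (v^~ i) t (v' t i)) ->
  is_derive t 1 (fun s => sqnorm (v s)) (\sum_i 2 *
    (complex.Re (v t i) * complex.Re (v' t i) + complex.Im (v t i) * complex.Im (v' t i))).
Proof.
move=> vd; rewrite /sqnorm; elim: (index_enum I) => [|i s IH].
  by rewrite big_nil; under eq_fun do rewrite big_nil; exact: is_derive_cst.
rewrite big_cons; under eq_fun do rewrite big_cons normc_sqr.
have [dr di] := vd i; apply: is_deriveD => //.
refine (is_derive_eq (is_deriveD (is_deriveX 2 dr) (is_deriveX 2 di)) _).
by rewrite /GRing.scale /= !expr1; ring.
Qed.

(** The derivative of [|v|^2] is at most [|v|^2 + |v'|^2]: this adds 1 to the rate, and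
    [gronwall_bootstrap] adds another. *)
Lemma gronwall_sqnorm (I : finType) (T k a b kappa : R) (v v' : R -> I -> R[i]) :
  0 <= k -> 0 <= a -> 0 <= b ->
  (forall t, 0 <= t <= T -> forall i, has_time_derivative (v^~ i) t (v' t i)) ->
  sqnorm (v 0) <= a ->
  (forall t, 0 <= t <= T -> sqnorm (v t) < kappa -> sqnorm (v' t) <= k * sqnorm (v t) + b) ->
  (a + b) * expR ((k + 2) * T) < kappa ->
  forall t, 0 <= t <= T -> sqnorm (v t) <= (a + b) * expR ((k + 2) * t).
Proof.
move=> k0 a0 b0 vd va vb small.
have e : k + 2 = (k + 1) + 1 by ring.
rewrite e in small *.
apply: (@gronwall_bootstrap R T (k + 1) a b kappa (fun s => sqnorm (v s)) _ _ a0 b0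
  (fun t tT => sqnorm_derivative (vd t tT)) va).
- by rewrite addr_ge0.
- move=> t tT uk; apply: le_trans (_ : _ <= sqnorm (v t) + sqnorm (v' t)) _.
    rewrite /sqnorm -big_split; apply: ler_sum => i _ /=; rewrite !normc_sqr.
    have := sqr_ge0 (complex.Re (v t i) - complex.Re (v' t i)).
    have := sqr_ge0 (complex.Im (v t i) - complex.Im (v' t i)).
    by nra.
  by have := vb t tT uk; lra.
- exact: small.
Qed.

Lemma gronwall_linear (I : finType) (T k a b : R) (v v' : R -> I -> R[i]) :
  0 <= k -> 0 <= a -> 0 <= b ->
  (forall t, 0 <= t <= T -> forall i, has_time_derivative (v^~ i) t (v' t i)) ->
  sqnorm (v 0) <= a ->
  (forall t, 0 <= t <= T -> sqnorm (v' t) <= k * sqnorm (v t) + b) ->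
  forall t, 0 <= t <= T -> sqnorm (v t) <= (a + b) * expR ((k + 2) * t).
Proof.
move=> k0 a0 b0 vd va vb.
apply: (gronwall_sqnorm (kappa := (a + b) * expR ((k + 2) * T) + 1) k0 a0 b0 vd va).
  by move=> t tT _; exact: vb.
by rewrite ltrDl.
Qed.

End ComplexDerivative.

Section LinearODE.
Variables (R : realType) (m : nat).
Implicit Types (A B M N : R -> 'M[R[i]]_m).

Definition solves_linear (T : R) A M := forall t, 0 <= t <= T -> forall i j,
  has_time_derivative (fun s => M s i j) t ((A t *m M t) i j).

Let entries (M : 'M[R[i]]_m) (p : 'I_m * 'I_m) : R[i] := M p.1 p.2.

Lemma sqnorm_mulmx (A M : 'M[R[i]]_m) (K : R) : 0 <= K -> (forall i j, normc (A i j) <= K) ->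
  sqnorm (entries (A *m M)) <= (m%:R ^+ 2 * K ^+ 2) * sqnorm (entries M).
Proof.
move=> K0 AK; rewrite /sqnorm.
rewrite -(pair_bigA _ (fun i j => normc (entries (A *m M) (i, j)) ^+ 2)) /=.
rewrite -(pair_bigA _ (fun i j => normc (entries M (i, j)) ^+ 2)) /=.
apply: le_trans (_ : _ <= \sum_(i < m) \sum_(j < m)
    K ^+ 2 * (m%:R * \sum_(l < m) normc (M l j) ^+ 2)) _.
  apply: ler_sum => i _; apply: ler_sum => j _; rewrite /entries /= mxE.
  apply: le_trans (_ : _ <= (K * \sum_l normc (M l j)) ^+ 2) _.
    rewrite ler_pXn2r ?nnegrE ?normc_ge0 ?mulr_ge0 ?sumr_ge0 //; last by move=> *; exact: normc_ge0.
    apply: le_trans (normc_sum _ _ _) _; rewrite mulr_sumr; apply: ler_sum => l _.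
    by rewrite normcM ler_wpM2r ?normc_ge0.
  rewrite exprMn ler_wpM2l ?sqr_ge0//.
  by have := sqr_sum_le (fun l => normc (M l j)); rewrite card_ord.
rewrite sumr_const card_ord -mulr_natl -mulr_sumr -mulr_sumr exchange_big /= le_eqVlt.
by apply/orP; left; apply/eqP; rewrite /entries /=; ring.
Qed.

Definition growth (K : R) : R := m%:R ^+ 2 * K ^+ 2.

Lemma linear_bounded T K A M : 0 <= K -> solves_linear T A M ->
  (forall t, 0 <= t <= T -> forall i j, normc (A t i j) <= K) ->
  forall t, 0 <= t <= T -> sqnorm (entries (M t)) <= sqnorm (entries (M 0)) * expR ((growth K + 2) * t).
Proof.
move=> K0 MA AK t tT; rewrite -[X in X * expR _]addr0.
apply: (gronwall_linear (v := fun s => entries (M s)) (v' := fun s => entries (A s *m M s))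
   (T := T)) => //.
- by rewrite /growth mulr_ge0 ?exprn_ge0.
- exact: sqnorm_ge0.
- by move=> s sT [i j]; exact: MA.
- by move=> s sT; rewrite addr0; apply: sqnorm_mulmx => //; exact: AK.
Qed.

(** The difference [M - N] solves the equation of [M] with source [(A - B) N], where [N] is bounded
    by [linear_bounded]. The estimate is on squared norms; the square root restores a bound linear
    in [e]. *)
Lemma linear_compare T K e A B M N : 0 <= T -> 0 <= K -> 0 <= e ->
  solves_linear T A M -> solves_linear T B N -> M 0 = N 0 ->
  (forall t, 0 <= t <= T -> forall i j, normc (A t i j) <= K) ->
  (forall t, 0 <= t <= T -> forall i j, normc (B t i j) <= K) ->
  (forall t, 0 <= t <= T -> forall i j, normc (A t i j - B t i j) <= e) ->
  forall i j, normc (M T i j - N T i j) <= e * Num.sqrt (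
     2 * (m%:R ^+ 2) * (sqnorm (entries (N 0)) * expR ((growth K + 2) * T)) *
     expR ((2 * growth K + 2) * T)).
Proof.
move=> T0 K0 e0 MA NB MN AK BK ABe i j.
have G0 : 0 <= growth K by rewrite /growth mulr_ge0 ?exprn_ge0.
set C := sqnorm (entries (N 0)) * expR ((growth K + 2) * T).
have C0 : 0 <= C by rewrite mulr_ge0 ?sqnorm_ge0 ?expR_ge0.
have TT : 0 <= T <= T by rewrite T0 lexx.
have NC t : 0 <= t <= T -> sqnorm (entries (N t)) <= C.
  move=> /[dup] tT /andP[t0 tT']; apply: le_trans (linear_bounded K0 NB BK tT) _.
  rewrite ler_wpM2l ?sqnorm_ge0// ler_expR ler_wpM2l// addr_ge0//.
have b0 : 0 <= 2 * (m%:R ^+ 2 * e ^+ 2 * C) by rewrite mulr_ge0// mulr_ge0// mulr_ge0 ?exprn_ge0.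
have H : sqnorm (entries (M T - N T)) <=
    (0 + 2 * (m%:R ^+ 2 * e ^+ 2 * C)) * expR ((2 * growth K + 2) * T).
  apply: (gronwall_linear (v := fun s => entries (M s - N s))
    (v' := fun s => entries (A s *m M s - B s *m N s)) (T := T)) => //.
  - by rewrite mulr_ge0.
  - move=> t tT [k l]; rewrite /entries /= [X in has_time_derivative _ _ X]mxE [(- (_ *m _)) _ _]mxE.
    have -> : (fun s => (M s - N s) k l) = fun s => M s k l - N s k l.
      by apply/funext => s; rewrite !mxE.
    by apply: has_time_derivativeB; [exact: MA|exact: NB].
  - by rewrite MN subrr /sqnorm big1// => p _; rewrite /entries mxE normc0 expr0n.
  - move=> t tT; have -> : A t *m M t - B t *m N t = A t *m (M t - N t) + (A t - B t) *m N t.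
      by rewrite mulmxBr mulmxBl addrA subrK.
    have h1 := sqnorm_mulmx (M t - N t) K0 (AK t tT).
    have h2 : sqnorm (entries ((A t - B t) *m N t)) <= m%:R ^+ 2 * e ^+ 2 * C.
      apply: le_trans (sqnorm_mulmx (N t) e0 _) _.
        by move=> k l; rewrite !mxE; exact: ABe.
      by rewrite ler_wpM2l ?NC// mulr_ge0 ?exprn_ge0.
    apply: le_trans (_ : _ <= 2 * sqnorm (entries (A t *m (M t - N t))) +
        2 * sqnorm (entries ((A t - B t) *m N t))) _; last first.
      by rewrite /growth -mulrA; lra.
    rewrite /sqnorm !mulr_sumr -big_split; apply: ler_sum => p _ /=.
    rewrite {1}/entries mxE -!/(entries _ p); have := normcD (entries (A t *m (M t - N t)) p)
      (entries ((A t - B t) *m N t) p).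
    move: (normc _) (normc_ge0 (entries (A t *m (M t - N t)) p + entries ((A t - B t) *m N t) p)).
    move: (normc _) (normc_ge0 (entries (A t *m (M t - N t)) p)).
    move: (normc _) (normc_ge0 (entries ((A t - B t) *m N t) p)) => x x0 y y0 z z0 zxy.
    have : z ^+ 2 <= (y + x) ^+ 2 by rewrite ler_pXn2r// nnegrE// addr_ge0.
    by have := sqr_ge0 (x - y); nra.
have := le_trans (normc_sqnorm (entries (M T - N T)) (i, j)) H.
rewrite /entries /= !mxE => H'.
rewrite -(@ler_pXn2r _ 2)// ?nnegrE ?normc_ge0 ?mulr_ge0 ?sqrtr_ge0//.
apply: le_trans H' _; rewrite exprMn sqr_sqrtr ?mulr_ge0 ?expR_ge0 ?sqnorm_ge0//.
by rewrite add0r le_eqVlt; apply/orP; left; apply/eqP; ring.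
Qed.

End LinearODE.

Lemma ccvg_ReIm (R : realType) (T : Type) (F : set_system T) {FF : Filter F} (u : T -> R[i]) (a b : R) :
  (fun t => complex.Re (u t)) @ F --> a -> (fun t => complex.Im (u t)) @ F --> b ->
  ccvg F u (a +i* b).
Proof.
move=> /cvgrPdist_lt ha /cvgrPdist_lt hb e e0; have e20 : 0 < e / 2 by rewrite divr_gt0.
apply: filterS2 (ha _ e20) (hb _ e20) => t.
case: (u t) => x y /= hx hy.
rewrite (splitr e); apply: le_lt_trans (normc_ReIm ((x - a) +i* (y - b))) _.
by apply: ltrD; rewrite /= distrC.
Qed.

(** * The matrix exponential as a fundamental solution *)

Section MatrixExponential.
Variables (R : realType) (m : nat) (L : 'M[R[i]]_m).

Let K : R := \sum_i \sum_j normc (L i j).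
Let D : R := m%:R * K.

Let LK i j : normc (L i j) <= K.
Proof.
rewrite /K (bigD1 i)//= (bigD1 j)//= -addrA lerDl addr_ge0// sumr_ge0// => *.
  exact: normc_ge0.
by apply: sumr_ge0 => *; exact: normc_ge0.
Qed.

Let K0 : 0 <= K.
Proof. by apply: sumr_ge0 => i _; apply: sumr_ge0 => j _; exact: normc_ge0. Qed.

Let D0 : 0 <= D. Proof. by rewrite mulr_ge0. Qed.

Let powD k i j : normc ((L ^+ k) i j) <= D ^+ k.
Proof.
elim: k i j => [|k IH] i j.
  by rewrite !expr0 mxE; case: (i == j); rewrite ?mulr1n ?mulr0n ?normc1 ?normc0.
rewrite !exprS [X in normc X]mxE; apply: le_trans (normc_sum _ _ _) _.
apply: le_trans (_ : _ <= \sum_(l < m) K * D ^+ k) _.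
  by apply: ler_sum => l _; rewrite normcM ler_pM ?normc_ge0.
by rewrite sumr_const card_ord /D mulr_natl mulrnAl.
Qed.

(** Taylor coefficients, in time, of the entries of the [s]-th derivative of the exponential. Their
    real and imaginary parts, selected by [p], are differentiated as real power series, and one
    derivative turns [s] into [s.+1]. *)
Let coef (s k : nat) i j : R[i] := (k`!%:R^-1)%:C * (L ^+ (k + s)) i j.

Let c (p : R[i] -> R) s i j : nat -> R := fun k => p (coef s k i j).

Section Part.
Variable p : R[i] -> R.
Hypothesis pM : forall (a : R) z, p (a%:C * z) = a * p z.
Hypothesis pn : forall z, `|p z| <= normc z.

Let cvg_part s i j x : cvgn (pseries (c p s i j) x).
Proof.
apply: normed_cvg.
apply: (@bounded_series_cvg _ _ (D ^+ s * expR (D * `|x|))) => [n|N]; first exact: normr_ge0.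
apply: le_trans (_ : _ <= \sum_(k < N) D ^+ s * exp_coeff (D * `|x|) k) _.
  apply: ler_sum => k _; rewrite /= normrM normrX /c /coef pM normrM.
  rewrite ger0_norm ?invr_ge0// /exp_coeff /= [(D * `|x|) ^+ k]exprMn.
  have := le_trans (pn ((L ^+ (k + s)) i j)) (powD (k + s) i j); rewrite [D ^+ (k + s)]exprD => h.
  have -> : D ^+ s * (D ^+ k * `|x| ^+ k / k`!%:R) = k`!%:R^-1 * (D ^+ k * D ^+ s) * `|x| ^+ k by ring.
  by rewrite ler_wpM2r ?exprn_ge0// ler_wpM2l// invr_ge0.
rewrite -mulr_sumr ler_wpM2l ?exprn_ge0//.
have := @nondecreasing_cvgn_le R (series (exp_coeff (D * `|x|))) _ (is_cvg_series_exp_coeff _) N.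
rewrite /series /= big_mkord; apply; apply: nondecreasing_series => k _ _.
by apply: exp_coeff_ge0; rewrite mulr_ge0.
Qed.

Let diffs_part s i j : pseries_diffs (c p s i j) = c p s.+1 i j.
Proof.
apply/funext => k; rewrite /pseries_diffs /c /coef !pM addSnnS mulrA; congr (_ * _).
by rewrite factS natrM invfM mulVKf// pnatr_eq0.
Qed.

Lemma expmx_part_derivative s i j (x : R) :
  is_derive x 1 (fun y => limn (pseries (c p s i j) y)) (limn (pseries (c p s.+1 i j) x)).
Proof.
have := @pseries_snd_diffs R (c p s i j) (`|x| + 1) x; rewrite !diffs_part; apply; try exact: cvg_part.
by rewrite [`|_ + 1|]ger0_norm ?addr_ge0// ltrDl.
Qed.

Hypothesis pD : {morph p : y z / y + z}.
Hypothesis p0 : p 0 = 0.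

Lemma expmx_part_cvg s i j (x : R) : (fun N => p (\sum_(k < N) (x ^+ k)%:C * coef s k i j)) @ \oo -->
  limn (pseries (c p s i j) x).
Proof.
rewrite (_ : (fun N => _) = pseries (c p s i j) x); first exact: cvg_part.
apply/funext => N; rewrite (big_morph p pD p0) /pseries /series /= big_mkord.
by apply: eq_bigr => k _; rewrite pM mulrC.
Qed.

End Part.

Let ReM (a : R) (z : R[i]) : complex.Re (a%:C * z) = a * complex.Re z.
Proof. by case: z => u v /=; rewrite mul0r subr0. Qed.
Let ImM (a : R) (z : R[i]) : complex.Im (a%:C * z) = a * complex.Im z.
Proof. by case: z => u v /=; rewrite mul0r addr0. Qed.
Let ReD : {morph (@complex.Re R) : y z / y + z}. Proof. by move=> [? ?] [? ?]. Qed.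
Let ImD : {morph (@complex.Im R) : y z / y + z}. Proof. by move=> [? ?] [? ?]. Qed.

Let S s i j (x : R) : R[i] :=
  limn (pseries (c (@complex.Re R) s i j) x) +i* limn (pseries (c (@complex.Im R) s i j) x).

Let S_cvg s i j x : ccvg \oo (fun N => \sum_(k < N) (x ^+ k)%:C * coef s k i j) (S s i j x).
Proof.
apply: ccvg_ReIm; first exact: (expmx_part_cvg ReM (@normc_Re R) ReD (erefl _)).
exact: (expmx_part_cvg ImM (@normc_Im R) ImD (erefl _)).
Qed.

Let powZ (x : R) k : (x%:C *: L) ^+ k = (x ^+ k)%:C *: L ^+ k.
Proof.
elim: k => [|k IH]; first by rewrite !expr0 scale1r.
rewrite [LHS]exprS IH; change ((x%:C *: L) *m ((x ^+ k)%:C *: L ^+ k) = (x ^+ k.+1)%:C *: L ^+ k.+1).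
by rewrite -scalemxAl -scalemxAr scalerA (exprS x) rmorphM (exprS L).
Qed.

Let expmxS (x : R) i j : expmx (x%:C *: L) i j = S 0 i j x.
Proof.
rewrite mxE; apply: climnE; apply: ccvg_ext (S_cvg 0 i j x); apply: nearW => N.
rewrite summxE; apply: eq_bigr => k _; rewrite powZ !mxE /coef addn0 mulrCA.
by congr (_ * (_ * _)); rewrite fmorphV rmorph_nat.
Qed.

Lemma expmx_derivative (x : R) i j :
  has_time_derivative (fun t => expmx (t%:C *: L) i j) x ((L *m expmx (x%:C *: L)) i j).
Proof.
suff -> : (L *m expmx (x%:C *: L)) i j = S 1 i j x.
  rewrite (_ : (fun t => _) = S 0 i j); last by apply/funext => t; exact: expmxS.
  by split; [exact: (expmx_part_derivative ReM (@normc_Re R)) |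
    exact: (expmx_part_derivative ImM (@normc_Im R))].
apply: (ccvg_uniq _ (S_cvg 1 i j x)).
have -> : (L *m expmx (x%:C *: L)) i j = \sum_l L i l * S 0 l j x.
  by rewrite mxE; apply: eq_bigr => l _; rewrite expmxS.
apply: (ccvg_ext _ (ccvg_sum (index_enum 'I_m) (P := xpredT)
  (fun l _ => ccvgMl (L i l) (S_cvg 0 l j x)))).
apply: nearW => N; under eq_bigr do rewrite mulr_sumr.
rewrite exchange_big /=; apply: eq_bigr => k _; rewrite /coef addn1 exprS [in RHS]mxE.
by rewrite !mulr_sumr; apply: eq_bigr => l _; rewrite addn0; ring.
Qed.

Lemma expmx0 : expmx (0%:C *: L) = 1%:M.
Proof.
apply/matrixP => i j; rewrite mxE; apply: climnE => e e0.
exists 1%N => // -[//|N] _ /=; rewrite scale0r summxE big_ord_recl /= big1 ?addr0.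
  by rewrite expr0 invr1 scale1r subrr normc0.
by move=> k _; rewrite exprS mul0r scaler0 mxE.
Qed.

End MatrixExponential.

(** * Continuity of spectra *)

Section Matching.
Variable R : realType.
Implicit Types (s t u : seq R[i]) (e : R).

Let close e (x y : R[i]) := `|x - y| <= e%:C.

Lemma closeE e x y : close e x y = (normc (x - y) <= e).
Proof. by rewrite /close normcE0 lecR. Qed.

Lemma all2_cat (T U : Type) (r : T -> U -> bool) (s1 s2 : seq T) (u1 u2 : seq U) :
  size s1 = size u1 -> all2 r (s1 ++ s2) (u1 ++ u2) = all2 r s1 u1 && all2 r s2 u2.
Proof. by elim: s1 u1 => [|x s1 IH] [|y u1] //= [/IH ->]; rewrite andbA. Qed.

Lemma all2_catl (T U : Type) (r : T -> U -> bool) (s1 s2 : seq T) (u : seq U) :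
  all2 r (s1 ++ s2) u -> exists u1 u2 : seq U, [/\ u = u1 ++ u2, all2 r s1 u1 & all2 r s2 u2].
Proof.
elim: s1 u => [|x s1 IH] [|y u] //= h; [by exists [::], [::]|by exists [::], (y :: u)|].
have /andP[xy /IH[u1 [u2 [-> h1 h2]]]] := h.
by exists (y :: u1), u2; split; rewrite //= xy.
Qed.

Lemma all2_perml (T U : eqType) (r : T -> U -> bool) (s s' : seq T) (u : seq U) : perm_eq s s' ->
  all2 r s u -> exists2 u', perm_eq u' u & all2 r s' u'.
Proof.
move=> ss' su; have : exists2 u', perm_eq u' u & all2 r s u' by exists u.
refine (@catCA_perm_ind T (fun x => exists2 u' : seq U, perm_eq u' u & all2 r x u') _ s s' ss').
move=> s1 s2 s3 [u' pu] /all2_catl[u1 [v [E h1 /all2_catl[u2 [u3 [E' h2 h3]]]]]].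
exists (u2 ++ u1 ++ u3); first by rewrite perm_catCA -E' -E.
have z1 : size s1 = size u1 by move: h1; rewrite all2E => /andP[/eqP].
have z2 : size s2 = size u2 by move: h2; rewrite all2E => /andP[/eqP].
by rewrite !all2_cat// h1 h2.
Qed.

Lemma all2_swap (T U : Type) (r : T -> U -> bool) (s : seq T) (u : seq U) :
  all2 r s u = all2 (fun x y => r y x) u s.
Proof. by elim: s u => [|x s IH] [|y u] //=; rewrite IH. Qed.

Lemma matched_perm e s s' t t' : perm_eq s s' -> perm_eq t t' ->
  matched_within e s t -> matched_within e s' t'.
Proof.
move=> ss' tt' [u ut su]; have [v vu sv] := all2_perml ss' su.
by exists v => //; apply: perm_trans vu _; apply: perm_trans ut _.
Qed.

Lemma matched_cons e x y s t : normc (x - y) <= e -> matched_within e s t ->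
  matched_within e (x :: s) (y :: t).
Proof.
move=> xy [u ut su]; exists (y :: u); first by rewrite perm_cons.
by rewrite /= -/(close e x y) closeE xy.
Qed.

Lemma matched_trans_sym e s t u : matched_within e s u -> matched_within e t u ->
  matched_within (e + e) s t.
Proof.
move=> [u1 u1u su1] [u2 u2u tu2]; rewrite all2_swap in tu2.
have u21 : perm_eq u2 u1 by rewrite (perm_trans u2u)// perm_sym.
have [t' t't u1t'] := all2_perml u21 tu2.
exists t' => //; elim: s u1 t' su1 u1t' {u1u u21 t't} => [|x s IH] [|y u1] [|z t'] //=.
rewrite -!/(close _ _ _) !closeE => /andP[xy su1] /andP[zy u1t'].
rewrite (IH u1)// andbT; apply: le_trans (normc_tri y x z) _.
by rewrite lerD// normc_distC.
Qed.

(** When [P] is constant on the balls of radius [e] around each of the two groups of targets, no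
    pair of the matching can cross from one group to the other. *)
Lemma matched_filter e s t1 t2 (P : pred R[i]) : matched_within e s (t1 ++ t2) ->
  {in t1, forall y x, normc (x - y) <= e -> P x} ->
  {in t2, forall y x, normc (x - y) <= e -> ~~ P x} ->
  matched_within e [seq x <- s | P x] t1 /\ matched_within e [seq x <- s | ~~ P x] t2.
Proof.
move=> [t' pt st]; rewrite all2_swap in st.
have [s' ps ts'] := all2_perml pt st.
have [s1 [s2 [E h1 h2]]] := all2_catl ts' => P1 P2.
have a1 : all P s1.
  elim: t1 (s1) h1 P1 {E pt st ts'} => [|y t1 IH] [|x v] //=.
  rewrite -/(close e x y) closeE => /andP[xy h1] P1.
  by rewrite (P1 y)//= ?mem_head// IH// => z zt; apply: P1; rewrite inE zt orbT.
have a2 : all (fun x => ~~ P x) s2.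
  elim: t2 (s2) h2 P2 {E pt st ts'} => [|y t2 IH] [|x v] //=.
  rewrite -/(close e x y) closeE => /andP[xy h2] P2.
  by rewrite (P2 y)//= ?mem_head// IH// => z zt; apply: P2; rewrite inE zt orbT.
have no (Q : pred R[i]) v : all (predC Q) v -> [seq x <- v | Q x] = [::].
  by move=> h; apply/eqP; rewrite -size_eq0 size_filter eqn0Ngt -has_count -all_predC.
have f1 : [seq x <- s1 ++ s2 | P x] = s1.
  by rewrite filter_cat (all_filterP a1) (no P)// cats0.
have f2 : [seq x <- s1 ++ s2 | ~~ P x] = s2.
  rewrite filter_cat (all_filterP a2) (no (fun x => ~~ P x))//.
  by apply: sub_all a1 => x /= ->.
rewrite E in ps.
have fm (Q : pred R[i]) (v y : seq R[i]) : [seq x <- s1 ++ s2 | Q x] = v -> all2 (fun a b => close e b a) y v ->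
    matched_within e [seq x <- s | Q x] y.
  move=> fv h; apply: (matched_perm (s := v) (t := y)) => //.
    by rewrite -fv perm_filter.
  by exists y => //; rewrite all2_swap.
by split; [exact: fm f1 h1|exact: fm f2 h2].
Qed.

End Matching.

Section RootContinuity.
Variables (R : realType) (T : Type) (F : set_system T).
Context {FF : Filter F}.
Local Notation C := R[i].

Definition pcvg (P : T -> {poly C}) (p : {poly C}) : Prop :=
  forall k, ccvg F (fun t => (P t)`_k) p`_k.

Lemma pcvgM P Q p q : pcvg P p -> pcvg Q q -> pcvg (fun t => P t * Q t) (p * q).
Proof.
move=> Pp Qq k; rewrite coefM; apply: ccvg_ext (_ : ccvg F (fun t => \sum_(i < k.+1) (P t)`_i * (Q t)`_(k - i)) _).
  by apply: nearW => t; rewrite coefM.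
by apply: ccvg_sum => i _; apply: ccvgM.
Qed.

Lemma pcvg_cst p : pcvg (fun=> p) p.
Proof. by move=> k; exact: ccvg_cst. Qed.

Lemma pcvg_sum (I : Type) (s : seq I) (P : I -> T -> {poly C}) p :
  (forall i, pcvg (P i) (p i)) -> pcvg (fun t => \sum_(i <- s) P i t) (\sum_(i <- s) p i).
Proof.
move=> Pp k; rewrite coef_sum; apply: ccvg_ext (ccvg_sum s (fun i (_ : true) => Pp i k)).
by apply: nearW => t; rewrite coef_sum.
Qed.

Lemma pcvg_prod (I : Type) (s : seq I) (P : I -> T -> {poly C}) p :
  (forall i, pcvg (P i) (p i)) -> pcvg (fun t => \prod_(i <- s) P i t) (\prod_(i <- s) p i).
Proof.
move=> Pp; elim: s => [|i s IH].
  by rewrite big_nil; under eq_fun do rewrite big_nil; exact: pcvg_cst.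
by rewrite big_cons; under eq_fun do rewrite big_cons; exact: pcvgM.
Qed.

Lemma pcvg_char_poly (m : nat) (A : T -> 'M[C]_m) (A0 : 'M[C]_m) :
  (forall i j, ccvg F (fun t => A t i j) (A0 i j)) ->
  pcvg (fun t => char_poly (A t)) (char_poly A0).
Proof.
move=> AA0; rewrite /char_poly /determinant; apply: pcvg_sum => s.
apply: pcvgM; first exact: pcvg_cst.
apply: pcvg_prod => i k; move: (perm.fun_of_perm.body s i) => j.
have E (B : 'M[C]_m) : (char_poly_mx B i j)`_k =
    ('X *+ (i == j) : {poly C})`_k - (if k == 0%N then B i j else 0).
  by rewrite !mxE coefB coefC.
rewrite E; apply: (ccvg_ext (f := fun t => ('X *+ (i == j) : {poly C})`_k -
    (if k == 0%N then A t i j else 0))); first by apply: nearW => t; rewrite E.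
by apply: ccvgB; [exact: ccvg_cst|case: eqP => _; [exact: AA0|exact: ccvg_cst]].
Qed.

Lemma prod_small_factor (s : seq R) x : all (fun y => 0 <= y) (x :: s) ->
  exists2 y, y \in x :: s & y ^+ (size s).+1 <= \prod_(z <- x :: s) z.
Proof.
elim: s x => [|y s IH] x /= /andP[x0 s0].
  by exists x; rewrite ?mem_head// expr1 big_seq1.
have [z zs hz] := IH y s0; have z0 : 0 <= z.
  by have /allP := (s0 : all (fun u => 0 <= u) (y :: s)); apply.
rewrite big_cons; have [xz|zx] := leP x z.
  exists x; first exact: mem_head.
  rewrite exprS ler_wpM2l//; apply: le_trans hz.
  by rewrite lerXn2r// nnegrE.
exists z; first by rewrite inE zs orbT.
by rewrite exprS ler_pM ?exprn_ge0 ?(ltW zx).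
Qed.

(* A small value of a monic polynomial at [a] forces one of its roots to be near [a]. *)
Lemma small_root_distance (s : seq C) a : s != [::] ->
  exists2 b, b \in s & normc (a - b) ^+ size s <= normc (\prod_(z <- s) ('X - z%:P)).[a].
Proof.
case: s => // x s _.
have nn : all (fun y => 0 <= y) (map (fun b => normc (a - b)) (x :: s)).
  by apply/allP => _ /mapP[b _ ->]; exact: normc_ge0.
have [y ys hb] := prod_small_factor nn.
have /mapP[b bs yb] : y \in map (fun b => normc (a - b)) (x :: s) := ys.
exists b => //; rewrite yb in hb; move: hb; rewrite /= size_map; move/le_trans; apply.
rewrite horner_prod (big_morph (@Normc.normc R) (@normcM R) (@normc1 R)).
rewrite -[_ :: map _ _]/(map (fun b => normc (a - b)) (x :: s)) big_map.
by rewrite le_eqVlt; apply/orP; left; apply/eqP; apply: eq_bigr => z _; rewrite hornerXsubC.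
Qed.

(* By deflation: the root closest to [a] converges to [a], hence the quotients by the
   corresponding linear factors converge as well. *)
Lemma root_continuity (s : seq C) (S : T -> seq C) : (forall t, size (S t) = size s) ->
  pcvg (fun t => \prod_(b <- S t) ('X - b%:P)) (\prod_(a <- s) ('X - a%:P)) ->
  forall e, 0 < e -> \forall t \near F, matched_within e (S t) s.
Proof.
elim: s S => [|a s IH] S sz cv e e0.
  apply: nearW => t; have := sz t; case: (S t) => // _.
  by exists [::].
have ne t : S t != [::] by rewrite -size_eq0 sz.
have [b hb] : {b : T -> C & forall t, b t \in S t /\
    normc (a - b t) ^+ (size s).+1 <= normc (\prod_(z <- S t) ('X - z%:P)).[a]}.
  apply: (@choice T C (fun t b => b \in S t /\ normc (a - b) ^+ (size s).+1 <=
    normc (\prod_(z <- S t) ('X - z%:P)).[a])) => t.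
  by have [b bs hb] := small_root_distance a (ne t); exists b; move: hb; rewrite sz.
pose S' t := rem (b t) (S t).
have pS t : perm_eq (S t) (b t :: S' t) by apply: perm_to_rem; case: (hb t).
have PS t : \prod_(z <- S t) ('X - z%:P) = ('X - (b t)%:P) * \prod_(z <- S' t) ('X - z%:P).
  by rewrite (perm_big _ (pS t)) big_cons.
have szS' t : size (S' t) = size s.
  by have /perm_size := pS t; rewrite sz /= => -[].
have hor t : (\prod_(z <- S t) ('X - z%:P)).[a] =
    \sum_(i < (size s).+2) (\prod_(z <- S t) ('X - z%:P))`_i * a ^+ i.
  by apply: horner_coef_wide; rewrite size_prod_XsubC sz.
have P0 : ccvg F (fun t => (\prod_(z <- S t) ('X - z%:P)).[a]) 0.
  have -> : 0 = \sum_(i < (size s).+2) (\prod_(z <- a :: s) ('X - z%:P))`_i * a ^+ i.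
    rewrite -horner_coef_wide ?size_prod_XsubC//; apply/esym/eqP.
    by rewrite -/(root _ _) root_prod_XsubC mem_head.
  apply: ccvg_ext (_ : ccvg F (fun t => \sum_(i < (size s).+2)
    (\prod_(z <- S t) ('X - z%:P))`_i * a ^+ i) _).
    by apply: nearW => t; rewrite hor.
  by apply: ccvg_sum => i _; apply: ccvgM; [exact: cv|exact: ccvg_cst].
have bcv : ccvg F b a.
  move=> d d0; have := P0 (d ^+ (size s).+1) (exprn_gt0 _ d0).
  apply: filterS => t; rewrite subr0 => h; have [_ h'] := hb t.
  rewrite normc_distC ltNge; apply/negP => dn; have := le_lt_trans h' h.
  by rewrite ltNge lerXn2r// nnegrE ?normc_ge0// ltW.
have cv' : pcvg (fun t => \prod_(z <- S' t) ('X - z%:P)) (\prod_(z <- s) ('X - z%:P)).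
  have XQ (c : C) (Q : {poly C}) l : Q`_l = (('X - c%:P) * Q)`_l.+1 + c * Q`_l.+1.
    by rewrite mulrBl coefB coefXM coefCM /= subrK.
  (* The coefficients of the quotient are recovered from the top down by
     [Q_l = P_(l+1) + a Q_(l+1)], starting above the degree, where they vanish. *)
  suff H n k : (size s < k + n)%N ->
      ccvg F (fun t => (\prod_(z <- S' t) ('X - z%:P))`_k) (\prod_(z <- s) ('X - z%:P))`_k.
    by move=> k; apply: (H (size s).+1); rewrite addnS ltnS leq_addl.
  elim: n k => [|n IHn] k kn.
    rewrite addn0 in kn; rewrite nth_default ?size_prod_XsubC//.
    apply: (ccvg_ext (f := fun=> 0)); last exact: ccvg_cst.
    by apply: nearW => t; rewrite nth_default// size_prod_XsubC szS'.
  rewrite (XQ a); apply: (ccvg_ext (f := fun t =>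
    (\prod_(z <- S t) ('X - z%:P))`_k.+1 + b t * (\prod_(z <- S' t) ('X - z%:P))`_k.+1)).
    by apply: nearW => t; rewrite [RHS](XQ (b t)) PS.
  apply: ccvgD; first by have := cv k.+1; rewrite big_cons.
  by apply: ccvgM => //; apply: IHn; rewrite addSnnS.
apply: filterS2 (IH S' szS' cv' e e0) (bcv e e0) => t h1 h2.
apply: (matched_perm _ (perm_refl _) (matched_cons (x := b t) (y := a) (ltW h2) h1)).
by rewrite perm_sym.
Qed.

Lemma spectrum_prod (m : nat) (A : 'M[C]_m) : char_poly A = \prod_(z <- spectrum A) ('X - z%:P).
Proof.
rewrite /spectrum; case: closed_field_poly_normal => s /= e.
by rewrite {1}e (monicP (char_poly_monic A)) scale1r.
Qed.

Lemma size_spectrum (m : nat) (A : 'M[C]_m) : size (spectrum A) = m.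
Proof.
by have := size_char_poly A; rewrite spectrum_prod size_prod_XsubC => -[].
Qed.

Lemma spectrum_continuity (m : nat) (A : T -> 'M[C]_m) (A0 : 'M[C]_m) (s : seq C) :
  (forall i j, ccvg F (fun t => A t i j) (A0 i j)) ->
  char_poly A0 = \prod_(a <- s) ('X - a%:P) ->
  forall e, 0 < e -> \forall t \near F, matched_within e (spectrum (A t)) s.
Proof.
move=> AA0 As; apply: root_continuity.
  move=> t; rewrite size_spectrum; have := size_char_poly A0.
  by rewrite As size_prod_XsubC => -[].
rewrite -As; have := pcvg_char_poly AA0.
by under eq_fun do rewrite spectrum_prod.
Qed.

End RootContinuity.

(** * The multiplicity of the eigenvalue 1 of a symplectic matrix *)

Section UnitMultiplicity.
Variable R : realType.
Local Notation C := R[i].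

Lemma poly_eq0_infinite (p : {poly C}) : (forall x : C, x != 0 -> x != 1 -> p.[x] = 0) -> p = 0.
Proof.
move=> p0; apply/eqP/negPn/negP => pn0.
have := @max_poly_roots _ p [seq n%:R | n <- iota 2 (size p)] pn0.
rewrite size_map size_iota ltnn => H; suff : false by []; apply: H.
  apply/allP => x /mapP[n]; rewrite mem_iota => /andP[n2 _] ->.
  apply/rootP; apply: p0; first by rewrite pnatr_eq0; lia.
  by rewrite -(subr_eq0 _ 1) -(natrB _ (ltnW n2)) pnatr_eq0; lia.
by rewrite map_inj_uniq ?iota_uniq// => a b /eqP; rewrite eqr_nat => /eqP.
Qed.

Lemma horner_char_poly (m : nat) (M : 'M[C]_m) (x : C) : (char_poly M).[x] = \det (x%:M - M).
Proof.
rewrite -/(horner_eval x _) -det_map_mx; congr (\det _); apply/matrixP => i j.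
by rewrite mxE /= /horner_eval !mxE hornerD hornerN hornerC hornerMn hornerX.
Qed.

Lemma spectrum_eigenvector (m : nat) (M : 'M[C]_m) (l : C) :
  reflect (exists2 v : 'cV[C]_m, v != 0 & M *m v = l *: v) (l \in spectrum M).
Proof.
rewrite -root_prod_XsubC -spectrum_prod /root horner_char_poly -det_tr.
apply: (iffP det0P) => -[v v0 hv].
  exists v^T; first by rewrite -trmx0 (inj_eq trmx_inj).
  apply/eqP; rewrite eq_sym -subr_eq0 -mul_scalar_mx -mulmxBl; apply/eqP.
  by apply: trmx_inj; rewrite trmx_mul trmxK hv trmx0.
exists v^T; first by rewrite -trmx0 (inj_eq trmx_inj).
by rewrite -trmx_mul mulmxBl mul_scalar_mx hv subrr trmx0.
Qed.

(** Symplecticity gives [M^T J (x - M) = (x M^T - 1) J]. The determinants of [J] cancel, that of [M]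
    is 1, and in even dimension the sign of [x M^T - 1] can be reversed. *)
Lemma symplectic_char_poly (m : nat) (M J : 'M[C]_m) : M^T *m J *m M = J -> \det J != 0 ->
  \det M = 1 -> ~~ odd m -> forall x, (char_poly M).[x] = \det (1%:M - x *: M).
Proof.
move=> MJM J0 M1 m2 x; rewrite horner_char_poly.
have e : M^T *m J *m (x%:M - M) = (x *: M^T - 1%:M) *m J.
  by rewrite mulmxBr MJM mul_mx_scalar mulmxBl mul1mx scalemxAl.
have := congr1 determinant e; rewrite !det_mulmx det_tr M1 mul1r mulrC => /(mulIf J0) ->.
rewrite -opprB -scaleN1r detZ -signr_odd (negbTE m2) expr0 mul1r -det_tr.
by rewrite linearB /= linearZ /= trmxK trmx1.
Qed.

(* The characteristic polynomial is palindromic, so its part coprime to [X - 1] agrees with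
   its own reversal up to the sign [(-1)^k], [k] the multiplicity of the root 1. *)
Lemma symplectic_unit_multiplicity (m : nat) (M J : 'M[C]_m) : M^T *m J *m M = J ->
  \det J != 0 -> \det M = 1 -> ~~ odd m -> ~~ odd (count_mem (1 : C) (spectrum M)).
Proof.
move=> MJM J0 M1 m2; set S := spectrum M.
have reci x : x != 0 -> (char_poly M).[x] = \prod_(b <- S) (1 - x * b).
  move=> x0; rewrite (symplectic_char_poly MJM)//.
  have -> : 1%:M - x *: M = x *: ((x^-1)%:M - M).
    by rewrite scalerBr scale_scalar_mx divff.
  rewrite detZ -horner_char_poly spectrum_prod horner_prod -{1}(size_spectrum M) -/S.
  elim: S => [|b s IH]; first by rewrite !big_nil mulr1.
  by rewrite !big_cons /= exprS mulrACA IH hornerXsubC mulrBr divff.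
set k := count_mem 1 S; pose S' := [seq b <- S | b != 1].
have pS : perm_eq S (nseq k 1 ++ S').
  have /all_pred1P e1 : all (pred1 1) [seq b <- S | b == 1] by exact: filter_all.
  by rewrite /k -size_filter -e1 perm_sym; exact: permEl (perm_filterC (pred1 1) S).
pose g : {poly C} := \prod_(b <- S') ('X - b%:P).
have g0 : g.[1] != 0.
  by rewrite -/(root _ _) root_prod_XsubC mem_filter eqxx.
have eg : g = (-1) ^+ k *: \prod_(b <- S') (1 - b *: 'X).
  apply/eqP; rewrite -subr_eq0; apply/eqP; apply: poly_eq0_infinite => x x0 x1.
  have := reci x x0; rewrite spectrum_prod -/S (perm_big _ pS) (perm_big _ pS) /= !big_cat /=.
  have x1' : (x - 1) ^+ k != 0 by rewrite expf_neq0// subr_eq0.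
  have e1 : \prod_(b <- nseq k (1 : C)) ('X - b%:P) = ('X - 1%:P) ^+ k.
    by rewrite big_nseq; elim: (k) => //= l ->; rewrite exprS.
  have e2 : \prod_(b <- nseq k (1 : C)) (1 - x * b) = (-1) ^+ k * (x - 1) ^+ k.
    by rewrite big_nseq -exprMn mulN1r opprB mulr1; elim: (k) => //= l ->; rewrite exprS.
  rewrite e1 e2 hornerM horner_exp hornerXsubC mulrAC -/g [RHS]mulrC => /(mulfI x1').
  rewrite hornerD hornerN hornerZ => ->; rewrite horner_prod.
  apply/eqP; rewrite subr_eq0; apply/eqP; congr (_ * _); apply: eq_bigr => b _.
  by rewrite !hornerE mulrC.
have g1 : (\prod_(b <- S') (1 - b *: 'X)).[1] = g.[1].
  rewrite /g !horner_prod; apply: eq_bigr => b _.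
  by rewrite !hornerE.
(* At 1 the polynomial [g] and its reversal take the same nonzero value, so the sign relating them
   is 1. *)
have := congr1 (fun p : {poly C} => p.[1]) eg; rewrite hornerZ g1.
rewrite -signr_odd; case: (odd k) => //; rewrite expr1 mulN1r => /eqP.
rewrite -addr_eq0 -mulr2n mulrn_eq0 /= => /eqP g2; by rewrite g2 eqxx in g0.
Qed.

End UnitMultiplicity.

(** * Hamiltonian flows and their linearization *)

Section Flow.
Variables (R : realType) (m : nat) (kap N : R) (U : set 'cV[R[i]]_m).
Hypothesis kap0 : 0 < kap.
Hypothesis Uopen : forall z, U z -> exists2 r : R, 0 < r & forall w, l1norm w < r -> U (z + w).
Implicit Types (z w v : 'cV[R[i]]_m).

Lemma l1norm_sqnorm v : l1norm v ^+ 2 <= m%:R * sqnorm (fun i => v i 0).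
Proof. by have := sqr_sum_le (fun i => normc (v i 0)); rewrite card_ord. Qed.

Lemma sqnorm_l1norm v : sqnorm (fun i => v i 0) <= l1norm v ^+ 2.
Proof.
rewrite /sqnorm expr2 {1}/l1norm mulr_suml; apply: ler_sum => i _.
by rewrite expr2 ler_wpM2l ?normc_ge0// normc_l1norm.
Qed.

Lemma chain_rule F g a (z z' : R -> 'cV[R[i]]_m) t : jet1 kap U F g a -> U (z t) ->
  (forall i, has_time_derivative (fun s => z s i 0) t (z' t i 0)) ->
  has_time_derivative (fun s => F (z s)) t (\sum_j z' t j 0 * g j (z t)).
Proof.
move=> [[a0 _ _] _ Fr] Uz zd.
have [r r0 Ur] := Uopen Uz.
have [C C0 [d1 d10 zC]] : exists2 C, 0 < C & exists2 del, 0 < del & forall h : R, `|h| < del ->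
    l1norm (z (t + h) - z t) <= C * `|h|.
  rewrite /l1norm; elim: (index_enum _) => [|i s [C C0 [d d0 IH]]].
    by exists 1 => //; exists 1 => // h _; rewrite big_nil mul1r.
  have [C' C'0 [d' d'0 h']] := has_time_derivative_continuous (zd i).
  exists (C' + C); first exact: addr_gt0.
  exists (Num.min d d'); first by rewrite lt_min d0.
  move=> h; rewrite lt_min => /andP[hd hd']; rewrite big_cons mulrDl lerD ?IH//.
  by rewrite !mxE h'.
have lin : has_time_derivative (fun s => \sum_j (z s j 0 - z t j 0) * g j (z t)) t
    (\sum_j z' t j 0 * g j (z t)).
  apply: has_time_derivative_sum => j.
  have := has_time_derivativeZ (g j (z t)) (has_time_derivativeB (zd j)
    (has_time_derivative_cst t (z t j 0))).
  by rewrite subr0 mulrC; under eq_fun do rewrite mulrC.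
move: lin => /has_time_derivative_eps lin; apply/has_time_derivative_eps => e e0.
have [d2 d20 h2] := lin (e / 2) ltac:(by rewrite divr_gt0).
have D0 : 0 < a + 1 by rewrite ltr_wpDl.
(* Below [d1] the curve is Lipschitz with constant [C], below [d2] its linear part is accurate to
   [e / 2]; [r / C] and [kap / C] keep the increment in [U] and within the range of the jet, and the
   last term makes the quadratic remainder at most [e / 2 * |h|]. *)
pose del := Num.min (Num.min d1 d2) (Num.min (r / C) (Num.min (kap / C)
  (e / 2 / ((a + 1) * (C / kap) ^+ 2)))).
have del0 : 0 < del by rewrite !lt_min d10 d20 !divr_gt0// mulr_gt0// exprn_gt0// divr_gt0.
exists del => // h; rewrite !lt_min => /andP[/andP[hd1 hd2] /andP[hr /andP[hk he]]].
have hC := zC h hd1; pose w := z (t + h) - z t.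
have zw : z (t + h) = z t + w by rewrite /w [RHS]addrC subrK.
have Cr x : `|h| < x / C -> C * `|h| < x by rewrite ltr_pdivlMr// mulrC.
have nw : near_in kap U (z t) w.
  by split=> //; [apply: Ur; exact: le_lt_trans hC (Cr _ hr)|exact: ltW (le_lt_trans hC (Cr _ hk))].
have H1 := Fr _ _ nw; have H2 := h2 h hd2.
have s0 : \sum_j (z t j 0 - z t j 0) * g j (z t) = 0 by apply: big1 => j _; rewrite subrr mul0r.
have sw : \sum_j (z (t + h) j 0 - z t j 0) * g j (z t) = \sum_j w j 0 * g j (z t).
  by apply: eq_bigr => j _; rewrite /w !mxE.
rewrite s0 subr0 sw in H2; rewrite zw.
rewrite [X in normc X](_ : _ = (F (z t + w) - F (z t) - \sum_j w j 0 * g j (z t)) +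
  (\sum_j w j 0 * g j (z t) - h%:C * \sum_j z' t j 0 * g j (z t))); last by ring.
apply: le_trans (normcD _ _) _; rewrite [e]splitr mulrDl; apply: lerD => //.
apply: le_trans H1 _; apply: le_trans (_ : _ <= (a + 1) * ((C / kap) * `|h|) ^+ 2) _.
  apply: ler_pM; rewrite ?sqr_ge0//; first by rewrite lerDl.
  have Ck0 : 0 <= C / kap by rewrite divr_ge0 ?ltW.
  rewrite ler_pXn2r ?nnegrE ?(mulr_ge0 Ck0) ?divr_ge0 ?l1norm_ge0 ?(ltW kap0)//.
  by rewrite mulrAC ler_wpM2r ?invr_ge0 ?(ltW kap0).
move: he; rewrite ltr_pdivlMr; last by rewrite mulr_gt0// exprn_gt0// divr_gt0.
move=> he; rewrite exprMn [X in _ * (_ * X)]expr2 2!mulrA; apply: ler_wpM2r => //.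
by rewrite mulrC; exact: ltW.
Qed.

Lemma has_time_derivative0_cst (f : R -> R[i]) (T : R) : 0 <= T ->
  (forall t, 0 <= t <= T -> has_time_derivative f t 0) -> f T = f 0.
Proof.
move=> T0 f0; have TT : 0 <= T <= T by rewrite T0 lexx.
apply/eqP; rewrite -subr_eq0 -normr_eq0 normcE0.
suff : normc (f T - f 0) ^+ 2 <= 0.
  by rewrite le_eqVlt ltNge sqr_ge0 orbF sqrf_eq0 => /eqP ->.
apply: le_trans (normc_sqnorm (fun _ : 'I_1 => f T - f 0) ord0) _.
apply: le_trans (_ : _ <= (0 + 0) * expR ((0 + 2) * T)) _; last by rewrite addr0 mul0r.
apply: (@gronwall_linear R 'I_1 T 0 0 0 (fun t _ => f t - f 0) (fun _ _ => 0)) => //.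
- by move=> t tT _; have := has_time_derivativeB (f0 t tT) (has_time_derivative_cst t (f 0));
    rewrite subr0.
- by rewrite /sqnorm big_ord1 subrr normc0 expr0n.
- by move=> t _; rewrite /sqnorm big_ord1 normc0 expr0n mul0r addr0.
Qed.

Lemma sum_ord_le (x : 'I_m -> R) c : (forall i, x i <= c) -> \sum_i x i <= m%:R * c.
Proof.
move=> xc; apply: le_trans (ler_sum _ (fun i _ => xc i)) _.
by rewrite sumr_const card_ord mulr_natl.
Qed.

Lemma has_time_derivative_mulmx (n1 n2 n3 : nat) (A A' : R -> 'M[R[i]]_(n1, n2))
    (B B' : R -> 'M[R[i]]_(n2, n3)) t :
  (forall i j, has_time_derivative (fun s => A s i j) t (A' t i j)) ->
  (forall i j, has_time_derivative (fun s => B s i j) t (B' t i j)) ->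
  forall i j, has_time_derivative (fun s => (A s *m B s) i j) t ((A' t *m B t + A t *m B' t) i j).
Proof.
move=> AA BB i j; rewrite [X in has_time_derivative _ _ X]mxE [(_ *m _) i j]mxE.
rewrite [(A t *m _) i j]mxE -big_split /=.
under eq_fun do rewrite mxE; apply: has_time_derivative_sum => k.
by have := has_time_derivativeM (AA i k) (BB k j); rewrite addrC [X in _ + X]mulrC mulrC mulrC [X in X + _]mulrC.
Qed.

Lemma linear_unique (n : nat) (T K : R) (A : R -> 'M[R[i]]_m) (M N' : R -> 'M[R[i]]_(m, n)) :
  0 <= T -> 0 <= K -> (forall t, 0 <= t <= T -> forall i j, normc (A t i j) <= K) ->
  (forall t, 0 <= t <= T -> forall i j, has_time_derivative (fun s => M s i j) t ((A t *m M t) i j)) ->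
  (forall t, 0 <= t <= T -> forall i j, has_time_derivative (fun s => N' s i j) t ((A t *m N' t) i j)) ->
  M 0 = N' 0 -> M T = N' T.
Proof.
move=> T0 K0 AK MA NA MN; have TT : 0 <= T <= T by rewrite T0 lexx.
apply/matrixP => i j; apply/eqP; rewrite -subr_eq0 -normr_eq0 normcE0.
pose v t i := M t i j - N' t i j.
have vA t : 0 <= t <= T -> forall i, has_time_derivative (v^~ i) t (\sum_l A t i l * v t l).
  move=> tT k; have := has_time_derivativeB (MA t tT k j) (NA t tT k j).
  by rewrite !mxE -sumrB; under eq_bigr do rewrite -mulrBr.
suff : normc (v T i) ^+ 2 <= 0.
  by rewrite le_eqVlt ltNge sqr_ge0 orbF sqrf_eq0 => /eqP ->.
apply: le_trans (normc_sqnorm (v T) i) _.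
apply: le_trans (_ : _ <= (0 + 0) * expR ((m%:R * (K ^+ 2 * m%:R) + 2) * T)) _.
  apply: (gronwall_linear _ (lexx _) (lexx _) vA) => //.
  - by rewrite !mulr_ge0// exprn_ge0.
  - by rewrite /sqnorm big1// => k _; rewrite /v MN subrr normc0 expr0n.
  - move=> t tT; rewrite addr0 {1}/sqnorm -mulrA; apply: sum_ord_le => k.
    apply: le_trans (_ : _ <= (K * \sum_l normc (v t l)) ^+ 2) _.
      rewrite ler_pXn2r ?nnegrE ?normc_ge0 ?mulr_ge0 ?sumr_ge0 //; last by move=> *; exact: normc_ge0.
      apply: le_trans (normc_sum _ _ _) _; rewrite mulr_sumr; apply: ler_sum => l _.
      by rewrite normcM ler_wpM2r ?normc_ge0// AK.
    rewrite exprMn -mulrA ler_wpM2l ?sqr_ge0//.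
    by have := sqr_sum_le (fun l => normc (v t l)); rewrite card_ord.
by rewrite addr0 mul0r.
Qed.

Variables (H : 'cV[R[i]]_m -> R[i]) (J : 'M[R[i]]_m).
Hypothesis jH : jet kap U H N.
Hypothesis J1 : forall i j, normc (J i j) <= 1.

Lemma jet_ge0 : 0 <= N.
Proof. by case: jH => -[[]]. Qed.

Lemma field_bound (g : 'cV[R[i]]_m) e : (forall j, normc (g j 0) <= e) ->
  forall i, normc ((J *m g) i 0) <= m%:R * e.
Proof.
move=> ge i; rewrite mxE; apply: le_trans (normc_sum _ _ _) _.
apply: sum_ord_le => j; rewrite -[e]mul1r.
by rewrite normcM ler_pM ?normc_ge0.
Qed.

Lemma jacobian_bound (h : 'M[R[i]]_m) e : (forall i j, normc (h i j) <= e) ->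
  forall i j, normc ((J *m h) i j) <= m%:R * e.
Proof.
move=> ge i j; rewrite mxE; apply: le_trans (normc_sum _ _ _) _.
apply: sum_ord_le => k; rewrite -[e]mul1r.
by rewrite normcM ler_pM ?normc_ge0.
Qed.

(* The squared Gronwall constant of the deviation [v = z - y], for
   [|v'| <= m (N kap^-2 |v| + e)]. *)
Definition deviation_rate : R := 2 * m%:R ^+ 3 * (N / kap / kap) ^+ 2 * m%:R.
Definition deviation_const (T : R) : R :=
  Num.sqrt (m.+1%:R * (1 + 2 * m%:R ^+ 3) * expR ((deviation_rate + 2) * T)).

Lemma orbit_close (T e : R) (y z : R -> 'cV[R[i]]_m) (g : R -> 'cV[R[i]]_m) :
  0 <= T -> 0 <= e ->
  (forall t w, 0 <= t <= T -> l1norm w < kap -> U (y t + w)) ->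
  (forall t, 0 <= t <= T -> forall i, has_time_derivative (fun s => y s i 0) t ((J *m g t) i 0)) ->
  (forall t, 0 <= t <= T -> forall j, normc (partial j H (y t) - g t j 0) <= e) ->
  (forall t, 0 <= t <= T -> forall i,
    has_time_derivative (fun s => z s i 0) t ((J *m gradient H (z t)) i 0)) ->
  l1norm (z 0 - y 0) <= e -> e * deviation_const T < kap ->
  forall t, 0 <= t <= T -> l1norm (z t - y t) <= e * deviation_const T.
Proof.
move=> T0 e0 yU yd ge zd v0 small t tT; have TT : 0 <= T <= T by rewrite T0 lexx.
have N0 := jet_ge0; set k := deviation_rate.
have k0 : 0 <= k.
  by rewrite /k /deviation_rate mulr_ge0// mulr_ge0 ?sqr_ge0// mulr_ge0 ?exprn_ge0.
pose v s i := (z s - y s) i 0.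
have vd s : 0 <= s <= T -> forall i,
    has_time_derivative (v^~ i) s ((J *m (gradient H (z s) - g s)) i 0).
  move=> sT i; have := has_time_derivativeB (zd s sT i) (yd s sT i).
  have -> : (J *m (gradient H (z s) - g s)) i 0 = (J *m gradient H (z s)) i 0 - (J *m g s) i 0.
    by rewrite mulmxBr mxE [(- (J *m g s)) i 0]mxE.
  suff -> : v^~ i = fun x => z x i 0 - y x i 0 by [].
  by apply/funext => x; rewrite /v mxE [(- y x) i 0]mxE.
have b0 : 0 <= 2 * m%:R ^+ 3 * e ^+ 2 by rewrite !mulr_ge0 ?exprn_ge0.
have sqC : (e * deviation_const T) ^+ 2 =
    m.+1%:R * ((e ^+ 2 + 2 * m%:R ^+ 3 * e ^+ 2) * expR ((k + 2) * T)).
  rewrite exprMn sqr_sqrtr; first by rewrite /k; ring.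
  by rewrite mulr_ge0 ?expR_ge0// mulr_ge0// addr_ge0// mulr_ge0 ?exprn_ge0.
have H0 : forall t, 0 <= t <= T -> sqnorm (v t) <=
    (e ^+ 2 + 2 * m%:R ^+ 3 * e ^+ 2) * expR ((k + 2) * t).
  (* As [l1norm ^+ 2 <= m * sqnorm], this threshold keeps the deviation below [kap], where the jet
     of [H] may be used; [m.+1] in place of [m] avoids dividing by 0. *)
  apply: (gronwall_sqnorm (kappa := kap ^+ 2 / m.+1%:R) k0 (sqr_ge0 e) b0 vd).
  - apply: le_trans (sqnorm_l1norm _) _.
    by rewrite ler_pXn2r ?nnegrE ?l1norm_ge0.
  - move=> s sT sk; have lk : l1norm (z s - y s) < kap.
      rewrite -(@ltr_pXn2r _ 2)// ?nnegrE ?l1norm_ge0 ?(ltW kap0)//.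
      apply: le_lt_trans (l1norm_sqnorm _) _.
      apply: le_lt_trans (_ : _ <= m.+1%:R * sqnorm (v s)) _.
        by rewrite ler_wpM2r ?sqnorm_ge0// ler_nat.
      by rewrite mulrC -ltr_pdivlMr.
    have Uy : U (y s) by rewrite -[y s]addr0; apply: yU => //; rewrite /l1norm big1// => i _; rewrite mxE normc0.
    have nw : near_in kap U (y s) (z s - y s) by split=> //; [exact: yU|exact: ltW].
    have gj j : normc ((gradient H (z s) - g s) j 0) <= N / kap / kap * l1norm (z s - y s) + e.
      have [_ /(_ j) [[_ _ /(_ _ _ nw) h] _ _] _ _] := jH; move: h.
      have -> : y s + (z s - y s) = z s by rewrite addrC subrK.
      rewrite mulrA mulrAC => h.
      have -> : (gradient H (z s) - g s) j 0 =
        (partial j H (z s) - partial j H (y s)) + (partial j H (y s) - g s j 0).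
        by rewrite 2!mxE [(- g s) j 0]mxE addrA subrK.
      by apply: le_trans (normcD _ _) _; rewrite lerD// ge.
    have fb := field_bound gj; set X := l1norm _ in gj fb.
    have X0 : 0 <= X := l1norm_ge0 _; set c := N / kap / kap in gj fb *.
    have c0 : 0 <= c by rewrite /c divr_ge0// ?divr_ge0// ltW.
    apply: le_trans (_ : _ <= m%:R * (m%:R * (c * X + e)) ^+ 2) _.
      rewrite /sqnorm; apply: sum_ord_le => i; rewrite ler_pXn2r ?nnegrE ?normc_ge0//.
      by rewrite mulr_ge0// addr_ge0// mulr_ge0.
    have hX := l1norm_sqnorm (z s - y s); rewrite -/X -/(v s) in hX.
    have h2 : (c * X + e) ^+ 2 <= 2 * (c ^+ 2 * X ^+ 2) + 2 * e ^+ 2.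
      by have := sqr_ge0 (c * X - e); nra.
    have h3 : c ^+ 2 * X ^+ 2 <= c ^+ 2 * (m%:R * sqnorm (v s)) by rewrite ler_wpM2l ?sqr_ge0.
    apply: le_trans (_ : _ <= m%:R ^+ 3 * (2 * (c ^+ 2 * (m%:R * sqnorm (v s))) + 2 * e ^+ 2)) _.
      have -> : m%:R * (m%:R * (c * X + e)) ^+ 2 = m%:R ^+ 3 * (c * X + e) ^+ 2 by ring.
      rewrite ler_wpM2l ?exprn_ge0//.
      by apply: le_trans h2 _; rewrite lerD2r ler_wpM2l.
    by rewrite /k /deviation_rate -/c le_eqVlt; apply/orP; left; apply/eqP; ring.
  - rewrite ltr_pdivlMr// mulrC -sqC ltr_pXn2r ?nnegrE ?(ltW kap0)//.
    by rewrite mulr_ge0// sqrtr_ge0.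
rewrite -(@ler_pXn2r _ 2)// ?nnegrE ?l1norm_ge0 ?mulr_ge0 ?sqrtr_ge0//.
apply: le_trans (l1norm_sqnorm _) _; rewrite sqC; apply: ler_pM; rewrite ?sqnorm_ge0 ?ler_nat//.
have := H0 t tT; rewrite -/(v t) => /le_trans; apply; rewrite ler_wpM2l ?addr_ge0 ?sqr_ge0//.
by rewrite ler_expR ler_wpM2l ?addr_ge0//; case/andP: tT.
Qed.

Lemma hessian_bound z i j : U z -> normc (hessian H z i j) <= N / kap ^+ 2.
Proof. by move=> Uz; have [_ _ /(_ i j) [_ h _] _] := jH; exact: h. Qed.

Lemma hessian_sym z : U z -> (hessian H z)^T = hessian H z.
Proof. by move=> Uz; have [_ _ _ h] := jH; apply/matrixP => i j; rewrite mxE h. Qed.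

Lemma hessian_lip z w i j : U z -> U w -> l1norm (w - z) <= kap ->
  normc (hessian H w i j - hessian H z i j) <= N / kap ^+ 2 * (l1norm (w - z) / kap).
Proof.
move=> Uz Uw wz; have [_ _ /(_ i j) [_ _ h] _] := jH.
have e : z + (w - z) = w by rewrite addrC subrK.
by have := h z (w - z); rewrite e; apply; split; rewrite // e.
Qed.

Lemma partial_lip z w j : U z -> U w -> l1norm (w - z) <= kap ->
  normc (partial j H w - partial j H z) <= N / kap * (l1norm (w - z) / kap).
Proof.
move=> Uz Uw wz; have [_ /(_ j) [[_ _ h] _ _] _ _] := jH.
have e : z + (w - z) = w by rewrite addrC subrK.
by have := h z (w - z); rewrite e; apply; split; rewrite // e.
Qed.

Hypotheses (JT : J^T = - J) (JJ : J *m J = - 1%:M).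
Variables (T : R) (z : R -> 'cV[R[i]]_m).
Hypothesis T0 : 0 <= T.
Hypothesis zU : forall t, 0 <= t <= T -> U (z t).
Hypothesis zd : forall t, 0 <= t <= T -> forall i,
  has_time_derivative (fun s => z s i 0) t ((J *m gradient H (z t)) i 0).

Lemma energy_conserved : H (z T) = H (z 0).
Proof.
apply: (has_time_derivative0_cst (f := fun t => H (z t)) T0) => t tT.
have [h1 _ _ _] := jH; have := chain_rule (z' := fun s => J *m gradient H (z s)) h1 (zU tT) (zd tT).
set d := \sum_j _; suff -> : d = 0 by [].
pose g := gradient H (z t); have dE : d = ((J *m g)^T *m g) 0 0.
  by rewrite mxE; apply: eq_bigr => j _; apply: f_equal2; rewrite [RHS]mxE.
have : d = - d.
  rewrite {1}dE trmx_mul JT mulmxN mulNmx mxE dE; congr (- _).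
  by rewrite -[in RHS](trmxK ((J *m g)^T *m g)) [in RHS]mxE trmx_mul trmxK mulmxA.
by move/eqP; rewrite -addr_eq0 -mulr2n mulrn_eq0 => /eqP.
Qed.

Variable M : R -> 'M[R[i]]_m.
Hypothesis M0 : M 0 = 1%:M.
Hypothesis Md : forall t, 0 <= t <= T -> forall i j,
  has_time_derivative (fun s => M s i j) t (((J *m hessian H (z t)) *m M t) i j).

Let TT : 0 <= T <= T. Proof. by rewrite T0 lexx. Qed.

(** With a symmetric Hessian, [A = J hess] satisfies [A^T J + J A = 0], so [M^T J M] has zero
    derivative and keeps its initial value [J]. *)
Lemma fundamental_symplectic : (M T)^T *m J *m M T = J.
Proof.
pose A t := J *m hessian H (z t).
have AJ t : 0 <= t <= T -> (A t)^T *m J + J *m A t = 0.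
  move=> tT; rewrite /A trmx_mul JT hessian_sym; last exact: zU.
  rewrite mulmxN mulNmx -mulmxA JJ.
  by rewrite mulmxA JJ mulmxN mulmx1 opprK mulNmx mul1mx subrr.
apply/matrixP => i j.
have := @has_time_derivative0_cst (fun t => ((M t)^T *m J *m M t) i j) T T0.
rewrite M0 trmx1 mul1mx mulmx1; apply=> t tT.
have MT : forall k l, has_time_derivative (fun s => (M s)^T k l) t ((A t *m M t)^T k l).
  by move=> k l; rewrite mxE; under eq_fun do rewrite mxE; exact: Md.
have J0 : forall k l, has_time_derivative (fun s => J k l) t ((0 : 'M[R[i]]_m) k l).
  by move=> k l; rewrite mxE; exact: has_time_derivative_cst.
have MJ := has_time_derivative_mulmx (A := fun s => (M s)^T) (A' := fun s => (A s *m M s)^T)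
  (B := fun=> J) (B' := fun=> 0) MT J0.
have := has_time_derivative_mulmx (A := fun s => (M s)^T *m J)
  (A' := fun s => (A s *m M s)^T *m J + (M s)^T *m 0)
  (B := M) (B' := fun s => A s *m M s) MJ (Md tT) i j.
have -> : ((A t *m M t)^T *m J + (M t)^T *m 0) *m M t + (M t)^T *m J *m (A t *m M t) =
    (M t)^T *m (((A t)^T *m J + J *m A t) *m M t).
  by rewrite mulmx0 addr0 trmx_mul mulmxDl mulmxDr !mulmxA.
by rewrite AJ// mul0mx mulmx0 mxE.
Qed.

(** By the chain rule the velocity along the orbit solves the variational equation, so [M]
    transports its initial value. *)
Lemma fundamental_field : M T *m (J *m gradient H (z 0)) = J *m gradient H (z T).
Proof.
have N0 := jet_ge0.
apply: (@linear_unique 1 T (m%:R * (N / kap ^+ 2)) (fun t => J *m hessian H (z t))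
  (fun t => M t *m (J *m gradient H (z 0))) (fun t => J *m gradient H (z t)) T0) => //.
- by rewrite mulr_ge0// divr_ge0// exprn_ge0// ltW.
- by move=> t tT; apply: jacobian_bound => i j; apply: hessian_bound; exact: zU.
- move=> t tT i j; rewrite mulmxA.
  have C0 : forall k l, has_time_derivative (fun s : R => (J *m gradient H (z 0)) k l) t
      ((0 : 'cV[R[i]]_m) k l).
    by move=> k l; rewrite [X in has_time_derivative _ _ X]mxE; exact: has_time_derivative_cst.
  have := has_time_derivative_mulmx (A := M) (A' := fun s => J *m hessian H (z s) *m M s)
    (B := fun=> J *m gradient H (z 0)) (B' := fun=> 0) (Md tT) C0 i j.
  by rewrite mulmx0 addr0.
- move=> t tT i j; rewrite ord1 -mulmxA.
  have C0 : forall k l, has_time_derivative (fun s : R => J k l) t ((0 : 'M[R[i]]_m) k l).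
    by move=> k l; rewrite [X in has_time_derivative _ _ X]mxE; exact: has_time_derivative_cst.
  have Gd : forall k l, has_time_derivative (fun s => gradient H (z s) k l) t
      ((hessian H (z t) *m (J *m gradient H (z t))) k l).
    move=> k l; rewrite ord1 [X in has_time_derivative _ _ X]mxE.
    have [_ /(_ k) h2 _ sym] := jH; have := chain_rule (z' := fun s => J *m gradient H (z s)) h2 (zU tT) (zd tT).
    have -> : (fun s => partial k H (z s)) = fun s => gradient H (z s) k 0.
      by apply/funext => s; rewrite mxE.
    set a := \sum_j _; set b := \sum_j _; suff -> : a = b by [].
    by apply: eq_bigr => l' _; rewrite mulrC sym//; exact: zU.
  have := has_time_derivative_mulmx (A := fun=> J) (A' := fun=> 0)
    (B := fun s => gradient H (z s)) (B' := fun s => hessian H (z s) *m (J *m gradient H (z s)))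
    C0 Gd i 0.
  by rewrite mul0mx add0r.
- by rewrite M0 mul1mx.
Qed.

End Flow.

(** * Compatibility of the monodromy matrix with complex conjugation *)

Section RealStructure.
Variables (R : realType) (m : nat) (kap N : R) (U : set 'cV[R[i]]_m).
Hypothesis kap0 : 0 < kap.
Hypothesis Uopen : forall z, U z -> exists2 r : R, 0 < r & forall w, l1norm w < r -> U (z + w).
Variables (S J : 'M[R[i]]_m).
Local Notation cj := (map_mx (@conjc R)).
Hypotheses (ST : S^T = S) (SS : S *m cj S = 1%:M) (SJS : S *m J *m S = J) (Jr : cj J = J).

(* The real phase space is the fixed locus of the antilinear involution [v |-> S conj v]. *)
Definition fixed_by_conjugation (v : 'cV[R[i]]_m) : Prop := S *m cj v = v.
Local Notation real_vec := fixed_by_conjugation.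

(** The difference quotients of [F] at a real point, along a real direction and with real
    increments, are real; so is their limit. Applied twice it gives the reality of the Hessian on
    real vectors. *)
Lemma real_directional F g a z v : jet1 kap U F g a ->
  (forall z, U z -> real_vec z -> complex.Im (F z) = 0) ->
  U z -> real_vec z -> real_vec v -> complex.Im (\sum_j v j 0 * g j z) = 0.
Proof.
move=> jF Fr Uz zr vr; set I := complex.Im _.
suff H e : 0 < e -> `|I| <= e.
  apply/eqP; rewrite -normr_eq0; apply/eqP/le_anti; rewrite normr_ge0 andbT.
  by apply/ler_addgt0Pl => e e0; rewrite addr0 H.
move=> e0; have cd i : has_time_derivative (fun s => (z + s%:C *: v) i 0) 0 (v i 0).
  have -> : (fun s : R => (z + s%:C *: v) i 0) = fun s => z i 0 + v i 0 * s%:C.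
    by apply/funext => s; rewrite !mxE mulrC.
  have := has_time_derivativeD (has_time_derivative_cst 0 (z i 0))
    (has_time_derivativeZ (v i 0) (has_time_derivative_id (0 : R))).
  by rewrite add0r mulr1.
have z0 : z + (0 : R)%:C *: v = z by rewrite scale0r addr0.
have := chain_rule kap0 Uopen (z := fun s => z + s%:C *: v) (z' := fun=> v) (t := 0) jF.
rewrite z0 => /(_ Uz cd) /has_time_derivative_eps /(_ e e0) [del del0 hd].
have [r r0 Ur] := Uopen Uz.
have D0 : 0 < l1norm v + 1 by rewrite ltr_wpDl ?l1norm_ge0.
pose h := Num.min (del / 2) (r / (l1norm v + 1)).
have h0 : 0 < h by rewrite lt_min !divr_gt0.
have hdel : `|h| < del.
  by rewrite gtr0_norm// gt_min ltr_pdivrMr// ltr_pMr// ltrDl ltr01.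
have hr : real_vec (z + h%:C *: v).
  rewrite /real_vec map_mxD map_mxZ mulmxDr zr -scalemxAr vr; congr (_ + _ *: _).
  by apply/eqP; rewrite eq_complex /= oppr0 !eqxx.
have Uh : U (z + h%:C *: v).
  apply: Ur; apply: le_lt_trans (_ : _ <= h * l1norm v) _.
    rewrite /l1norm mulr_sumr; apply: ler_sum => i _.
    by rewrite mxE normcM normcR gtr0_norm.
  apply: lt_le_trans (_ : _ < h * (l1norm v + 1)) _; first by rewrite ltr_pM2l// ltrDl.
  by rewrite -ler_pdivlMr// ge_min lexx orbT.
have := hd h hdel; rewrite add0r z0 gtr0_norm// => H.
have := le_trans (normc_Im _) H.
have ImE (x y u : R[i]) : complex.Im x = 0 -> complex.Im y = 0 ->
    complex.Im (x - y - h%:C * u) = - (h * complex.Im u).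
  by case: x y u => [a1 b1] [c d] [p q] /= -> ->; rewrite mul0r addr0; ring.
by rewrite ImE ?Fr// normrN normrM gtr0_norm// mulrC ler_pM2r.
Qed.

Variable H : 'cV[R[i]]_m -> R[i].
Hypothesis jH : jet kap U H N.
Hypothesis Hr : forall z, U z -> real_vec z -> complex.Im (H z) = 0.

Let conj_i : conjc ('i : R[i]) = - 'i.
Proof. by apply/eqP; rewrite eq_complex /= oppr0 !eqxx. Qed.

Lemma cjK (n p : nat) (A : 'M[R[i]]_(n, p)) : cj (cj A) = A.
Proof. by apply/matrixP => i j; rewrite !mxE conjcK. Qed.

Lemma hessian_real_bilinear z u v : U z -> real_vec z -> real_vec u -> real_vec v ->
  complex.Im ((u^T *m hessian H z *m v) 0 0) = 0.
Proof.
move=> Uz zr ur vr; have [h1 h2 _ _] := jH.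
have jv : jet1 kap U (fun z => \sum_j v j 0 * partial j H z)
    (fun i z => \sum_j v j 0 * hessian H z i j) (\sum_j 3 * (normc (v j 0) * (N / kap))).
  elim: (index_enum _) => [|j s IH].
    have j0 : jet1 kap U (fun=> 0 : R[i]) (fun _ _ => 0) 0 by apply: jet1_cst; rewrite ?normc0.
    by rewrite big_nil; apply: jet1_ext j0 => [w _|j w _]; rewrite big_nil.
  have c1 : jet1 kap U (fun=> v j 0) (fun _ _ => 0) (normc (v j 0)) by apply: jet1_cst.
  have := jet1D (jet1M kap0 c1 (h2 j)) IH.
  rewrite [X in _ -> jet1 _ _ _ _ X]big_cons; apply: jet1_ext.
    by move=> w _; rewrite big_cons.
  by move=> i w _; rewrite big_cons mulr0 addr0.
have := real_directional jv _ Uz zr ur.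
have -> : (u^T *m hessian H z *m v) 0 0 = \sum_j u j 0 * \sum_k v k 0 * hessian H z j k.
  rewrite -mulmxA mxE; apply: eq_bigr => j _; rewrite mxE; congr (_ * _).
  by rewrite mxE; apply: eq_bigr => k _; rewrite mulrC.
by apply=> w Uw wr; apply: (real_directional h1 Hr).
Qed.

(** The Hessian form [B] is real on real vectors, and these span all vectors over the complex
    numbers. Expanding in real and imaginary parts gives [conj (B u v) = B (s u) (s v)], which is
    then read on the canonical basis. *)
Lemma hessian_conj z : U z -> real_vec z -> cj (hessian H z) = S *m hessian H z *m S.
Proof.
move=> Uz zr; set h := hessian H z.
pose B (u v : 'cV[R[i]]_m) := (u^T *m h *m v) 0 0.
have Br u v : real_vec u -> real_vec v -> complex.Im (B u v) = 0.
  exact: hessian_real_bilinear.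
have BD1 u u' v : B (u + u') v = B u v + B u' v by rewrite /B linearD /= !mulmxDl mxE.
have BD2 u v v' : B u (v + v') = B u v + B u v' by rewrite /B mulmxDr mxE.
have BZ1 c u v : B (c *: u) v = c * B u v by rewrite /B linearZ /= -!scalemxAl mxE.
have BZ2 c u v : B u (c *: v) = c * B u v by rewrite /B -scalemxAr mxE.
have BN1 u v : B (- u) v = - B u v by rewrite -scaleN1r BZ1 mulN1r.
have BN2 u v : B u (- v) = - B u v by rewrite -scaleN1r BZ2 mulN1r.
pose s (u : 'cV[R[i]]_m) := S *m cj u.
have sK u : s (s u) = u by rewrite /s map_mxM cjK mulmxA SS mul1mx.
have sD u v : s (u + v) = s u + s v by rewrite /s map_mxD mulmxDr.
have sZ c u : s (c *: u) = conjc c *: s u by rewrite /s map_mxZ scalemxAr.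
have dec u : exists r1 r2, [/\ real_vec r1, real_vec r2, u = r1 + 'i *: r2 & s u = r1 - 'i *: r2].
  (* Real and imaginary parts with respect to the involution [s]. *)
  exists (2^-1 *: (u + s u)), (2^-1 *: ('i *: (s u - u))).
  have i2 : ('i * 'i : R[i]) = -1 by rewrite -expr2 sqrCi.
  have h2 : conjc (2^-1 : R[i]) = 2^-1 by rewrite fmorphV rmorph_nat.
  have E : u + s u - (s u - u) = 2 *: u by move: (s u) => w; apply/colP => k; rewrite !mxE; ring.
  have E' : u + s u + (s u - u) = 2 *: s u by move: (s u) => w; apply/colP => k; rewrite !mxE; ring.
  have F : 'i *: (2^-1 *: ('i *: (s u - u))) = 2^-1 *: - (s u - u).
    by rewrite !scalerA mulrAC i2 mulN1r scaleNr scalerN.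
  split.
  - by rewrite /real_vec -/(s _) sZ sD sK; apply: f_equal2; [exact: h2|exact: addrC].
  - rewrite /real_vec -/(s _) sZ; apply: f_equal2; first exact: h2.
    have sN w : s (- w) = - s w by rewrite /s map_mxN mulmxN.
    by rewrite sZ sD sN sK conj_i scaleNr -scalerN opprB.
  - by rewrite F -scalerDr E scalerA mulVf ?scale1r// pnatr_eq0.
  - by rewrite F scalerN opprK -scalerDr E' scalerA mulVf ?scale1r// pnatr_eq0.
have Bc u v : conjc (B u v) = B (s u) (s v).
  have [r1 [r2 [h1 h2 -> ->]]] := dec u; have [r3 [r4 [h3 h4 -> ->]]] := dec v.
  have E1 : B (r1 + 'i *: r2) (r3 + 'i *: r4) = B r1 r3 + 'i * B r1 r4 + 'i * (B r2 r3 + 'i * B r2 r4).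
    by rewrite BD1 BZ1 !BD2 !BZ2.
  have E2 : B (r1 - 'i *: r2) (r3 - 'i *: r4) = B r1 r3 - 'i * B r1 r4 - 'i * (B r2 r3 - 'i * B r2 r4).
    rewrite BD1 BN1 BZ1 !BD2 !BN2 !BZ2.
    by move: (B r1 r3) (B r1 r4) (B r2 r3) (B r2 r4) => *; ring.
  rewrite E1 E2; move: (Br _ _ h1 h3) (Br _ _ h1 h4) (Br _ _ h2 h3) (Br _ _ h2 h4).
  case: (B r1 r3) (B r1 r4) (B r2 r3) (B r2 r4) => [a1 b1] [a2 b2] [a3 b3] [a4 b4] /= -> -> -> ->.
  by apply/eqP; rewrite eq_complex /=; apply/andP; split; apply/eqP; ring.
have entry (A : 'M[R[i]]_m) i j : ((delta_mx i 0 : 'cV_m)^T *m A *m (delta_mx j 0 : 'cV_m)) 0 0 = A i j.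
  by rewrite trmx_delta -rowE -colE !mxE.
apply/matrixP => i j; rewrite mxE -(entry h) -(entry (S *m h *m S)).
apply: etrans (Bc _ _) _.
by rewrite /B /s !map_delta_mx trmx_mul ST !mulmxA.
Qed.

Variables (T : R) (z : R -> 'cV[R[i]]_m) (M : R -> 'M[R[i]]_m).
Hypothesis T0 : 0 <= T.
Hypothesis zU : forall t, 0 <= t <= T -> U (z t) /\ real_vec (z t).
Hypothesis M0 : M 0 = 1%:M.
Hypothesis Md : forall t, 0 <= t <= T -> forall i j,
  has_time_derivative (fun s => M s i j) t (((J *m hessian H (z t)) *m M t) i j).
Hypothesis J1 : forall i j, normc (J i j) <= 1.

(** Both sides solve the variational equation with initial value [S]: by [hessian_conj] and
    [S J S = J], conjugating the generator and moving it past [S] gives it back. *)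
Lemma fundamental_real : M T *m S = S *m cj (M T).
Proof.
have N0 := jet_ge0 jH.
apply: (@linear_unique R m m T (m%:R * (N / kap ^+ 2)) (fun t => J *m hessian H (z t))
  (fun t => M t *m S) (fun t => S *m cj (M t)) T0).
- by rewrite mulr_ge0// divr_ge0// exprn_ge0// ltW.
- move=> t tT; apply: (jacobian_bound J1) => i j.
  by apply: (hessian_bound jH); case: (zU tT).
- move=> t tT i j; rewrite mulmxA.
  have C0 : forall k l, has_time_derivative (fun s : R => S k l) t ((0 : 'M[R[i]]_m) k l).
    by move=> k l; rewrite [X in has_time_derivative _ _ X]mxE; exact: has_time_derivative_cst.
  have := has_time_derivative_mulmx (A := M) (A' := fun s => J *m hessian H (z s) *m M s)
    (B := fun=> S) (B' := fun=> 0) (Md tT) C0 i j.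
  by rewrite mulmx0 addr0.
- move=> t tT i j; have [Uz zr] := zU tT.
  have C0 : forall k l, has_time_derivative (fun s : R => S k l) t ((0 : 'M[R[i]]_m) k l).
    by move=> k l; rewrite [X in has_time_derivative _ _ X]mxE; exact: has_time_derivative_cst.
  have Mc : forall k l, has_time_derivative (fun s => cj (M s) k l) t
      (cj (J *m hessian H (z t) *m M t) k l).
    move=> k l; rewrite [X in has_time_derivative _ _ X]mxE; under eq_fun do rewrite mxE.
    by apply: has_time_derivative_conj; exact: Md.
  have := has_time_derivative_mulmx (A := fun=> S) (A' := fun=> 0)
    (B := fun s => cj (M s)) (B' := fun s => cj (J *m hessian H (z s) *m M s)) C0 Mc i j.
  rewrite mul0mx add0r !map_mxM Jr hessian_conj//.
  by rewrite !mulmxA SJS.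
- by rewrite M0 map_mx1 mul1mx mulmx1.
Qed.

End RealStructure.

Section HermitianForm.
Variables (R : realType) (m : nat) (S J M : 'M[R[i]]_m).
Local Notation cj := (map_mx (@conjc R)).

(* [M] preserves the sesquilinear form [(S conj v)^T J v]. *)
Lemma isotropic_eigenvector (l : R[i]) (v : 'cV[R[i]]_m) : S^T = S ->
  M^T *m J *m M = J -> M *m S = S *m cj M ->
  M *m v = l *: v -> normc l != 1 -> (cj v)^T *m S *m J *m v = 0.
Proof.
move=> ST MJM MS Mv l1; set b := _ *m v.
have MS' : (cj M)^T *m S = S *m M^T.
  by rewrite -{1}ST -trmx_mul -MS trmx_mul ST.
have E : (cj (M *m v))^T *m S *m J *m (M *m v) = b.
  rewrite map_mxM trmx_mul -[(cj v)^T *m _ *m S]mulmxA MS' /b -[in RHS]MJM !mulmxA.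
  by [].
have : (normc l ^+ 2)%:C *: b = b.
  rewrite -[in RHS]E Mv -scalemxAr map_mxZ [(_ *: _)^T]linearZ /= -!scalemxAl scalerA.
  by rewrite sqr_normc_conj mulrC.
move/eqP; rewrite -[X in _ == X]scale1r -subr_eq0 -scalerBl scaler_eq0 => /orP[|/eqP//].
rewrite -[1]/(1%:C) -rmorphB /= => /eqP[] /eqP.
rewrite subr_eq0 sqrf_eq1 (negbTE l1) /= => /eqP e.
by have := normc_ge0 l; rewrite e oppr_ge0 ler10.
Qed.

End HermitianForm.

(** * The unperturbed monodromy matrix *)

Section SymplecticMatrix.
Variables (R : realType) (d n2 : nat).
Local Notation dim := (((1 + d) + (1 + d)) + (n2 + n2))%N.
Local Notation J := (Jmx R d n2).
Local Notation cj := (map_mx (@conjc R)).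

Lemma sympl_tr m : (sympl R m)^T = - sympl R m.
Proof. by rewrite /sympl tr_block_mx !trmx0 trmx1 linearN /= trmx1 opp_block_mx !oppr0 opprK. Qed.

Lemma sympl_sqr m : sympl R m *m sympl R m = - 1%:M.
Proof.
rewrite /sympl mulmx_block !(mul0mx, mulmx0, mul1mx, mulmx1, mulmxN, mulNmx) !add0r !addr0.
by rewrite [in RHS](scalar_mx_block _ _ 1) [RHS]opp_block_mx !oppr0.
Qed.

Lemma Jmx_tr : J^T = - J.
Proof. by rewrite /Jmx tr_block_mx !trmx0 !sympl_tr [RHS]opp_block_mx !oppr0. Qed.

Lemma Jmx_sqr : J *m J = - 1%:M.
Proof.
rewrite /Jmx mulmx_block !(mul0mx, mulmx0) !sympl_sqr !add0r !addr0.
by rewrite [in RHS](scalar_mx_block _ _ 1) [RHS]opp_block_mx !oppr0.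
Qed.

Lemma Jmx_det : \det J != 0.
Proof.
apply/negP => /eqP J0; have := congr1 determinant Jmx_sqr.
rewrite det_mulmx J0 mul0r -scaleN1r detZ det1 mulr1 => /esym/eqP.
by rewrite expf_eq0 oppr_eq0 oner_eq0 andbF.
Qed.

Lemma Jmx_bool i j : exists b c : bool, J i j = b%:R - c%:R.
Proof.
rewrite /Jmx /sympl; case: (split_ordP i) => k ->; case: (split_ordP j) => l ->;
  rewrite !(block_mxEul, block_mxEur, block_mxEdl, block_mxEdr);
  last (case: (split_ordP k) => {}k ->; case: (split_ordP l) => {}l ->;
    rewrite !(block_mxEul, block_mxEur, block_mxEdl, block_mxEdr));
  first (case: (split_ordP k) => {}k ->; case: (split_ordP l) => {}l ->;
    rewrite !(block_mxEul, block_mxEur, block_mxEdl, block_mxEdr));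
  rewrite !mxE; try by exists false, false; rewrite subrr.
all: solve [exists (k == l), false; by rewrite [false%:R]mulr0n subr0|exists false, (k == l); by rewrite [false%:R]mulr0n sub0r].
Qed.

Lemma Jmx_le1 i j : normc (J i j) <= 1.
Proof.
have [b [c ->]] := Jmx_bool i j.
by case: b c => -[]; rewrite ?subrr ?subr0 ?sub0r ?normcN ?normc0 ?normc1.
Qed.

Lemma Jmx_real : cj J = J.
Proof.
apply/matrixP => i j; rewrite mxE; have [b [c ->]] := Jmx_bool i j.
by rewrite rmorphB /= !rmorph_nat.
Qed.

Lemma dim_even : ~~ odd dim.
Proof. by rewrite !addnn oddD !odd_double. Qed.

(** Composed with conjugation, the map [xi -> - i conj eta], [eta -> - i conj xi]: its fixed vectors
    satisfy the reality condition of [real_point]. *)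
Definition conj_mx : 'M[R[i]]_dim :=
  block_mx 1%:M 0 0 (block_mx 0 (- 'i)%:M (- 'i)%:M 0).

Lemma conj_mx_tr : conj_mx^T = conj_mx.
Proof. by rewrite /conj_mx !tr_block_mx !trmx0 trmx1 !tr_scalar_mx. Qed.

Lemma conj_mxK : conj_mx *m cj conj_mx = 1%:M.
Proof.
rewrite /conj_mx !map_block_mx !map_mx0 map_mx1 !map_scalar_mx !mulmx_block.
rewrite !(mul0mx, mulmx0, mul1mx, mulmx1) !add0r !addr0 -!scalar_mxM.
have -> : - 'i * conjc (- 'i) = 1 :> R[i].
  by apply/eqP; rewrite eq_complex /=; apply/andP; split; apply/eqP; ring.
by rewrite -!scalar_mx_block.
Qed.

Lemma conj_mx_Jmx : conj_mx *m J *m conj_mx = J.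
Proof.
have c2 : - 'i * - 'i = - 1 :> R[i] by rewrite mulrNN -expr2 sqr_i.
have e m : block_mx 0 (- 'i)%:M (- 'i)%:M 0 *m sympl R m *m block_mx 0 (- 'i)%:M (- 'i)%:M 0 = sympl R m.
  move: (- 'i) c2 => c c2; rewrite /sympl [X in X *m _]mulmx_block !mul0mx !mulmx0 !mulmx1 mulmxN mulmx1.
  rewrite !add0r !addr0 mulmx_block !mul0mx !mulmx0 mulNmx -scalar_mxM c2 !add0r !addr0.
  by rewrite raddfN opprK.
rewrite /conj_mx /Jmx; move: (e n2).
move: (block_mx 0 _ _ 0) (sympl R n2) (sympl R (1 + d)) => q s s' qsq.
by rewrite !mulmx_block !(mul0mx, mulmx0, mul1mx, mulmx1, addr0, add0r) qsq.
Qed.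

Lemma conj_mxE (v : phase R d n2) : [/\
  forall j, (conj_mx *m cj v) (idx_qhat n2 j) 0 = conjc (v (idx_qhat n2 j) 0),
  forall j, (conj_mx *m cj v) (idx_phat n2 j) 0 = conjc (v (idx_phat n2 j) 0),
  forall j, (conj_mx *m cj v) (idx_xi d j) 0 = - 'i * conjc (v (idx_eta d j) 0) &
  forall j, (conj_mx *m cj v) (idx_eta d j) 0 = - 'i * conjc (v (idx_xi d j) 0)].
Proof.
have E : conj_mx *m cj v = col_mx (usubmx (cj v)) (col_mx ((- 'i) *: dsubmx (dsubmx (cj v)))
    ((- 'i) *: usubmx (dsubmx (cj v)))).
  rewrite -[in LHS](vsubmxK (cj v)) -[in LHS](vsubmxK (dsubmx (cj v))).
  by rewrite /conj_mx !mul_block_col !mul0mx mul1mx !mul_scalar_mx addr0 !add0r addr0.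
by rewrite E; split=> j; rewrite /idx_qhat /idx_phat /idx_xi /idx_eta
  ?(col_mxEu, col_mxEd) !mxE.
Qed.

Lemma real_pointP (v : phase R d n2) : real_point v <-> fixed_by_conjugation conj_mx v.
Proof.
have [hq hp hx he] := conj_mxE v; rewrite /fixed_by_conjugation.
have Im0 (x : R[i]) : complex.Im x = 0 <-> conjc x = x.
  case: x => a b /=; split=> [->|[/eqP]]; first by rewrite oppr0.
  by rewrite eq_sym -addr_eq0 -mulr2n mulrn_eq0 => /eqP.
split=> [[vq vp ve]|E]; last first.
  split=> j; last by rewrite /Defs.eta -[in LHS]E he mulNr.
    by apply/Im0; rewrite /qhat -[in RHS]E hq.
  by apply/Im0; rewrite /phat -[in RHS]E hp.
apply/colP => i; case: (idxP i) => j; rewrite ?hq ?hp ?hx ?he.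
- exact/Im0/vq.
- exact/Im0/vp.
- have := ve j; rewrite /Defs.eta /xi => ->; case: (v _ _) => a b.
  by apply/eqP; rewrite eq_complex /=; apply/andP; split; apply/eqP; ring.
- by have := ve j; rewrite /Defs.eta /xi => ->; rewrite mulNr.
Qed.

End SymplecticMatrix.

Lemma has_time_derivative_cexp (R : realType) (a t : R) :
  has_time_derivative (fun s => cexp ('i * (a * s)%:C)) t ('i * a%:C * cexp ('i * (a * t)%:C)).
Proof.
have E s : cexp ('i * (a * s)%:C) = cos (a * s) +i* sin (a * s).
  have -> : 'i * (a * s)%:C = 0 +i* (a * s) by rewrite complexME; congr (_ +i* _); ring.
  by rewrite cexpE expR0 !mul1r.
have da : is_derive t 1 (fun s : R => a * s) a.
  by refine (is_derive_eq (is_deriveZ a (is_derive_id t 1)) _); rewrite /GRing.scale /= mulr1.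
rewrite (_ : (fun s => _) = fun s => cos (a * s) +i* sin (a * s)); last by apply/funext.
rewrite E (_ : 'i * a%:C * _ = - (a * sin (a * t)) +i* (a * cos (a * t))); last first.
  by apply/eqP; rewrite eq_complex /=; apply/andP; split; apply/eqP; ring.
split=> /=.
  refine (is_derive_eq (is_derive1_comp (is_derive_cos _) da) _).
  by rewrite /GRing.scale /=; ring.
refine (is_derive_eq (is_derive1_comp (is_derive_sin _) da) _).
by rewrite /GRing.scale /=; ring.
Qed.

Lemma has_time_derivative_block (R : realType) (k1 k2 l1 l2 : nat) (t : R)
    (a a1 : R -> 'M[R[i]]_(k1, l1)) (b b1 : R -> 'M[R[i]]_(k1, l2))
    (c c1 : R -> 'M[R[i]]_(k2, l1)) (e e1 : R -> 'M[R[i]]_(k2, l2)) :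
  (forall i j, has_time_derivative (fun s => a s i j) t (a1 t i j)) ->
  (forall i j, has_time_derivative (fun s => b s i j) t (b1 t i j)) ->
  (forall i j, has_time_derivative (fun s => c s i j) t (c1 t i j)) ->
  (forall i j, has_time_derivative (fun s => e s i j) t (e1 t i j)) ->
  forall i j, has_time_derivative (fun s => block_mx (a s) (b s) (c s) (e s) i j) t
    (block_mx (a1 t) (b1 t) (c1 t) (e1 t) i j).
Proof.
move=> ha hb hc he i j; case: (split_ordP i) => k ->; case: (split_ordP j) => l ->.
- by rewrite block_mxEul; under eq_fun do rewrite block_mxEul; exact: ha.
- by rewrite block_mxEur; under eq_fun do rewrite block_mxEur; exact: hb.
- by rewrite block_mxEdl; under eq_fun do rewrite block_mxEdl; exact: hc.
- by rewrite block_mxEdr; under eq_fun do rewrite block_mxEdr; exact: he.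
Qed.

Lemma char_poly_ublock (F : comNzRingType) (m p : nat) (A : 'M[F]_m) B (D : 'M[F]_p) :
  char_poly (block_mx A B 0 D) = char_poly A * char_poly D.
Proof.
rewrite /char_poly /char_poly_mx map_block_mx/= !map_mx0.
by rewrite scalar_mx_block opp_block_mx add_block_mx subr0 det_ublock.
Qed.

Section Unperturbed.
Variables (R : realType) (d n2 : nat) (Omega : 'I_n2 -> R) (C : 'M[R[i]]_(1 + d)).
Local Notation dim := (((1 + d) + (1 + d)) + (n2 + n2))%N.
Implicit Types t : R.

Definition twist_flow t : 'M[R[i]]_((1 + d) + (1 + d)) := block_mx 1%:M (t%:C *: C) 0 1%:M.

Definition oscillator_flow t : 'M[R[i]]_(n2 + n2) :=
  block_mx (diag_mx (\row_j cexp ('i * (Omega j * t)%:C))) 0 0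
    (diag_mx (\row_j cexp ('i * ((- Omega j) * t)%:C))).

Definition unperturbed_flow t : 'M[R[i]]_dim :=
  block_mx (twist_flow t) 0 0 (oscillator_flow t).

Definition twist_generator : 'M[R[i]]_((1 + d) + (1 + d)) := block_mx 0 C 0 0.

Definition frequencies : 'M[R[i]]_n2 := diag_mx (\row_j ('i * (Omega j)%:C)).

Definition oscillator_generator : 'M[R[i]]_(n2 + n2) :=
  block_mx frequencies 0 0 (- frequencies).

Definition unperturbed_hessian : 'M[R[i]]_dim :=
  block_mx (block_mx 0 0 0 C) 0 0 (block_mx 0 frequencies frequencies 0).

Definition unperturbed_generator : 'M[R[i]]_dim :=
  block_mx twist_generator 0 0 oscillator_generator.

Lemma unperturbed_generatorE : Jmx R d n2 *m unperturbed_hessian = unperturbed_generator.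
Proof.
rewrite /Jmx /unperturbed_hessian mulmx_block !mul0mx !mulmx0 !addr0 add0r.
rewrite /sympl /unperturbed_generator /twist_generator /oscillator_generator; congr block_mx.
  by rewrite mulmx_block !mul0mx !mulmx0 mul1mx !addr0 !add0r.
by rewrite mulmx_block !mul0mx !mulmx0 mul1mx mulNmx mul1mx !addr0 !add0r.
Qed.

Lemma flows0 : [/\ twist_flow 0 = 1%:M, oscillator_flow 0 = 1%:M & unperturbed_flow 0 = 1%:M].
Proof.
have t0 : twist_flow 0 = 1%:M by rewrite /twist_flow scale0r -scalar_mx_block.
have c1 (a : R) : cexp ('i * (a * 0)%:C) = 1 by rewrite mulr0 mulr0 cexp0.
have o0 : oscillator_flow 0 = 1%:M.
  rewrite /oscillator_flow (scalar_mx_block _ _ 1); congr block_mx;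
  by apply/matrixP => i j; rewrite !mxE c1.
by split=> //; rewrite /unperturbed_flow t0 o0 -scalar_mx_block.
Qed.

Lemma twist_flow_derivative t i j : has_time_derivative (fun s => twist_flow s i j) t
  ((twist_generator *m twist_flow t) i j).
Proof.
rewrite /twist_generator /twist_flow mulmx_block !mul0mx !mulmx0 mulmx1 !addr0 !add0r.
have cst n1 n3 (A : 'M[R[i]]_(n1, n3)) k l :
    has_time_derivative (fun s : R => A k l) t ((0 : 'M[R[i]]_(n1, n3)) k l).
  by rewrite mxE; exact: has_time_derivative_cst.
apply: (has_time_derivative_block (a := fun=> 1%:M) (a1 := fun=> 0) (b := fun s => s%:C *: C)
  (b1 := fun=> C) (c := fun=> 0) (c1 := fun=> 0) (e := fun=> 1%:M) (e1 := fun=> 0)) => // k l.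
have := has_time_derivativeZ (C k l) (has_time_derivative_id t).
by rewrite mulr1; under eq_fun do rewrite mulrC; under [in X in _ -> X]eq_fun do rewrite mxE.
Qed.

Lemma oscillator_flow_derivative t i j : has_time_derivative (fun s => oscillator_flow s i j) t
  ((oscillator_generator *m oscillator_flow t) i j).
Proof.
rewrite /oscillator_generator /oscillator_flow mulmx_block !mul0mx !mulmx0 !addr0 !add0r.
have cst n1 n3 (A : 'M[R[i]]_(n1, n3)) k l :
    has_time_derivative (fun s : R => A k l) t ((0 : 'M[R[i]]_(n1, n3)) k l).
  by rewrite mxE; exact: has_time_derivative_cst.
have dg (f : 'I_n2 -> R) k l :
  has_time_derivative (fun s => diag_mx (\row_j cexp ('i * (f j * s)%:C)) k l) t
    ((diag_mx (\row_j ('i * (f j)%:C)) *m diag_mx (\row_j cexp ('i * (f j * t)%:C))) k l).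
  rewrite mul_diag_mx !mxE; under eq_fun do rewrite !mxE.
  case: eqVneq => _; last by rewrite mulr0; exact: has_time_derivative_cst.
  exact: has_time_derivative_cexp.
have fN : - frequencies = diag_mx (\row_j ('i * (- Omega j)%:C)).
  by rewrite /frequencies -raddfN; congr diag_mx; apply/rowP => k; rewrite !mxE rmorphN mulrN.
rewrite fN.
apply: (has_time_derivative_block (a := fun s => diag_mx (\row_j cexp ('i * (Omega j * s)%:C)))
  (a1 := fun s => frequencies *m diag_mx (\row_j cexp ('i * (Omega j * s)%:C)))
  (b := fun=> 0) (b1 := fun=> 0) (c := fun=> 0) (c1 := fun=> 0)
  (e := fun s => diag_mx (\row_j cexp ('i * (- Omega j * s)%:C)))
  (e1 := fun s => diag_mx (\row_j ('i * (- Omega j)%:C)) *m diag_mx (\row_j cexp ('i * (- Omega j * s)%:C)))) => //.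
Qed.

Lemma unperturbed_flow_derivative t i j : has_time_derivative (fun s => unperturbed_flow s i j) t
  ((unperturbed_generator *m unperturbed_flow t) i j).
Proof.
rewrite /unperturbed_generator /unperturbed_flow mulmx_block !mul0mx !mulmx0 !addr0 !add0r.
apply: (has_time_derivative_block (a := twist_flow) (a1 := fun s => twist_generator *m twist_flow s)
  (b := fun=> 0) (b1 := fun=> 0) (c := fun=> 0) (c1 := fun=> 0)
  (e := oscillator_flow) (e1 := fun s => oscillator_generator *m oscillator_flow s)).
- exact: twist_flow_derivative.
- by move=> k l; rewrite mxE; exact: has_time_derivative_cst.
- by move=> k l; rewrite mxE; exact: has_time_derivative_cst.
- exact: oscillator_flow_derivative.
Qed.

Definition multipliers t : seq R[i] := [seq cexp ('i * (Omega j * t)%:C) | j : 'I_n2] ++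
  [seq cexp ('i * (- Omega j * t)%:C) | j : 'I_n2].

Lemma char_poly_twist_flow t :
  char_poly (twist_flow t) = \prod_(a <- nseq ((1 + d) + (1 + d)) 1) ('X - a%:P).
Proof.
have c1 m : char_poly (1%:M : 'M[R[i]]_m) = \prod_(a <- nseq m 1) ('X - a%:P).
  rewrite char_poly_trig ?scalar_mx_is_trig// big_nseq.
  under eq_bigr do rewrite mxE eqxx.
  by rewrite big_const card_ord.
by rewrite char_poly_ublock !c1 (nseqD (1 + d) (1 + d)) [RHS]big_cat.
Qed.

Lemma char_poly_oscillator_flow t :
  char_poly (oscillator_flow t) = \prod_(a <- multipliers t) ('X - a%:P).
Proof.
rewrite char_poly_ublock big_cat !char_poly_trig ?diag_mx_is_trig// !big_image /=.
by congr (_ * _); apply: eq_bigr => j _; rewrite !mxE eqxx.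
Qed.

Lemma char_poly_unperturbed_flow t : char_poly (unperturbed_flow t) =
  \prod_(a <- nseq ((1 + d) + (1 + d)) 1 ++ multipliers t) ('X - a%:P).
Proof.
by rewrite char_poly_ublock char_poly_twist_flow char_poly_oscillator_flow [RHS]big_cat.
Qed.

End Unperturbed.

Section DiagonalBlocks.
Variables (R : realType) (d n2 : nat).
Local Notation dim := (((1 + d) + (1 + d)) + (n2 + n2))%N.
Implicit Types h : 'M[R[i]]_dim.

(** The block [L11_of] as a function of the Hessian alone, so that it can also be evaluated at the
    limit matrix [unperturbed_hessian]. *)
Definition hessian_L11 h : 'M[R[i]]_((1 + d) + (1 + d)) :=
  let hqp : 'M[R[i]]_((1 + d) + (1 + d)) := ulsubmx h in
  let hqq : 'M[R[i]]_(1 + d) := ulsubmx hqp in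
  let hqp' : 'M[R[i]]_(1 + d) := ursubmx hqp in
  let K : 'M[R[i]]_(1 + d) := col_mx 0 (dsubmx hqp') in
  block_mx K^T (drsubmx hqp) (- block_mx 0 0 0 (drsubmx hqq)) (- K).

Definition hessian_L22 h : 'M[R[i]]_(n2 + n2) :=
  let hxe : 'M[R[i]]_(n2 + n2) := drsubmx h in
  block_mx (ursubmx hxe)^T (drsubmx hxe) (- ulsubmx hxe) (- ursubmx hxe).

Lemma L11_ofE (H : phase R d n2 -> R[i]) z : L11_of H z = hessian_L11 (hessian H z).
Proof. by []. Qed.

Lemma L22_ofE (H : phase R d n2 -> R[i]) z : L22_of H z = hessian_L22 (hessian H z).
Proof. by []. Qed.

(** The blocks only select, sign or erase entries of the Hessian, so passing to them increases
    neither bounds nor distances between entries. *)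
Definition signed_entry (f : 'M[R[i]]_dim -> R[i]) : Prop :=
  (forall h, f h = 0) \/ exists k l, (forall h, f h = h k l) \/ (forall h, f h = - h k l).

Lemma signed_entry_close f h h0 e : signed_entry f -> 0 <= e ->
  (forall i j, normc (h i j - h0 i j) <= e) -> normc (f h - f h0) <= e.
Proof.
move=> [f0|[k [l [fE|fE]]]] e0 he; rewrite ?f0 ?fE ?subrr ?normc0//.
by rewrite opprK addrC -opprB normcN.
Qed.

Lemma hessian_L11_entry i j : signed_entry (fun h => hessian_L11 h i j).
Proof.
pose i' (k : 'I_(1 + d)) : 'I_dim := lshift (n2 + n2) (lshift (1 + d) k).
pose j' (k : 'I_(1 + d)) : 'I_dim := lshift (n2 + n2) (rshift (1 + d) k).
rewrite /hessian_L11; case: (split_ordP i) => k ->; case: (split_ordP j) => l ->.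
- case: (split_ordP l) => {}l ->; first by left=> h; rewrite block_mxEul mxE col_mxEu mxE.
  right; exists (i' (rshift 1 l)), (j' k); left=> h.
  by rewrite block_mxEul mxE col_mxEd !mxE.
- right; exists (j' k), (j' l); left=> h.
  by rewrite block_mxEur !mxE.
- case: (split_ordP k) => {}k ->.
    left=> h; rewrite block_mxEdl mxE; case: (split_ordP l) => {}l ->.
      by rewrite block_mxEul mxE oppr0.
    by rewrite block_mxEur mxE oppr0.
  case: (split_ordP l) => {}l ->; first by left=> h; rewrite block_mxEdl mxE block_mxEdl mxE oppr0.
  right; exists (i' (rshift 1 k)), (i' (rshift 1 l)); right=> h.
  by rewrite block_mxEdl mxE block_mxEdr !mxE.
- case: (split_ordP k) => {}k ->; first by left=> h; rewrite block_mxEdr mxE col_mxEu mxE oppr0.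
  right; exists (i' (rshift 1 k)), (j' l); right=> h.
  by rewrite block_mxEdr mxE col_mxEd !mxE.
Qed.

Lemma hessian_L22_entry i j : signed_entry (fun h => hessian_L22 h i j).
Proof.
rewrite /hessian_L22; case: (split_ordP i) => k ->; case: (split_ordP j) => l ->; right.
- by exists (idx_xi d l), (idx_eta d k); left=> h; rewrite block_mxEul !mxE.
- by exists (idx_eta d k), (idx_eta d l); left=> h; rewrite block_mxEur !mxE.
- by exists (idx_xi d k), (idx_xi d l); right=> h; rewrite block_mxEdl !mxE.
- by exists (idx_xi d k), (idx_eta d l); right=> h; rewrite block_mxEdr !mxE.
Qed.

Lemma hessian_L11_unperturbed Omega C :
  hessian_L11 (unperturbed_hessian Omega C) = twist_generator C.
Proof.
rewrite /hessian_L11 /unperturbed_hessian block_mxKul block_mxKur block_mxKdr block_mxKul.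
rewrite /twist_generator; congr block_mx; first by rewrite linear0 col_mx0 trmx0.
  have -> : drsubmx (0 : 'M[R[i]]_(1 + d)) = 0 by apply/matrixP => ? ?; rewrite !mxE.
  by rewrite block_mx0 oppr0.
by rewrite linear0 col_mx0 oppr0.
Qed.

Lemma hessian_L22_unperturbed Omega C :
  hessian_L22 (unperturbed_hessian Omega C) = oscillator_generator Omega.
Proof.
rewrite /hessian_L22 /unperturbed_hessian block_mxKdr block_mxKur block_mxKdr block_mxKul.
by rewrite tr_diag_mx oppr0.
Qed.

End DiagonalBlocks.

Section UnperturbedHessian.
Variables (R : realType) (d n2 : nat) (rho sigma rad kap : R).
Local Notation dim := (((1 + d) + (1 + d)) + (n2 + n2))%N.
Hypotheses (rho0 : 0 <= rho) (rad0 : 0 <= rad) (kap0 : 0 < kap).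
Hypotheses (krho : 8 * kap <= rho) (ksigma : 8 * kap <= sigma) (krad : 8 * kap <= rad).
Variables (Omega : 'I_n2 -> R) (g0 : tfseries R d n2) (E : R).
Hypothesis g0B : tfbounded rho sigma rad g0 (2 * E).
Hypothesis g0split : split_order_zero (polydomain rho sigma rad) g0.

Definition twist : 'M[R[i]]_(1 + d) :=
  \matrix_(i, j) hessian0 Omega g0 (idx_phat n2 i) (idx_phat n2 j).

Lemma linear_hessianE (i j : 'I_n2) : [/\
  linear_hessian (d := d) Omega (idx_xi d i) (idx_eta d j) = frequencies Omega i j,
  linear_hessian (d := d) Omega (idx_eta d i) (idx_xi d j) = frequencies Omega i j,
  linear_hessian (d := d) Omega (idx_xi d i) (idx_xi d j) = 0 &
  linear_hessian (d := d) Omega (idx_eta d i) (idx_eta d j) = 0].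
Proof.
rewrite /linear_hessian /idx_xi /idx_eta /frequencies !mxE.
have S0 (F : 'I_n2 -> R[i]) (b : bool) : (forall k, k != i -> F k = 0) ->
    F i = 'i * (Omega i)%:C *+ b -> \sum_k F k = 'i * (Omega i)%:C *+ b.
  by move=> F0 <-; rewrite (bigD1 i)//= big1 ?addr0.
by split; [apply: S0 => [k ki|]|apply: S0 => [k ki|]|apply: big1 => k _|apply: big1 => k _];
  rewrite !eq_shift ?eqxx 1?[i == k]eq_sym ?(negbTE ki) ?(mulr0, mul0r, addr0, add0r, mulr1)//
  [j == i]eq_sym mulr_natr.
Qed.

(** Angles are absent at order 0, the splitting removes the entries mixing actions with [xi, eta],
    and as [g0] starts at degree 3 the [xi, eta] block comes from the quadratic part alone. *)
Lemma hessian0E :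
  (\matrix_(i, j) hessian0 Omega g0 i j) = unperturbed_hessian Omega twist.
Proof.
have lin0 (i j : 'I_dim) : (wdeg i != 1%N) || (wdeg j != 1%N) -> linear_hessian Omega i j = 0.
  move=> ij; rewrite /linear_hessian big1// => k _.
  have ne (a b : 'I_dim) : wdeg a = 1%N -> wdeg b = 1%N -> (j == a)%:R * (i == b)%:R = 0 :> R[i].
    move=> a1 b1; have [ja|] := eqVneq j a; last by rewrite mul0r.
    have [ib|] := eqVneq i b; last by rewrite mulr0.
    by move: ij; rewrite ja ib a1 b1.
  by rewrite !ne ?wdeg_xi ?wdeg_eta// addr0 mulr0.
have U0 : tube kap (0 : phase R d n2) := tube0 kap0.
have hq i j := (order_zero_q kap0 krho ksigma krad g0B g0split j).2 i _ U0.
have hm := order_zero_hessian_mixed kap0 krho ksigma krad g0B g0split.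
have hx := order_zero_hessian_xieta rho0 rad0 kap0 krho ksigma krad g0B g0split.
have sum0 (a b : R[i]) : a = 0 -> b = 0 -> a + b = 0 by move=> -> ->; rewrite addr0.
have Zq i j : hessian0 Omega g0 i (idx_qhat n2 j) = 0 /\ hessian0 Omega g0 (idx_qhat n2 j) i = 0.
  have [h1 h2] := hq i j.
  by split; apply: sum0 => //; apply: lin0; rewrite wdeg_qhat ?orbT.
have Zm i j : wdeg i = 1%N -> hessian0 Omega g0 i (idx_phat n2 j) = 0 /\
    hessian0 Omega g0 (idx_phat n2 j) i = 0.
  move=> i1; have [h1 h2] := hm _ _ i1 (wdeg_phat n2 j).
  by split; apply: sum0 => //; apply: lin0; rewrite wdeg_phat ?orbT.
have Zx i j : wdeg i = 1%N -> wdeg j = 1%N -> hessian0 Omega g0 i j = linear_hessian Omega i j.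
  by move=> i1 j1; apply: etrans (f_equal2 +%R (erefl _) (hx _ _ i1 j1)) _; rewrite addr0.
have ent (a b c : R[i]) : a = b -> c = b -> a = c by move=> -> ->.
apply/matrixP => i j; rewrite mxE.
case: (idxP i) => k; case: (idxP j) => l;
  rewrite /unperturbed_hessian ?(block_mxEul, block_mxEur, block_mxEdl, block_mxEdr).
- by apply: ent (Zq _ _).1 _; rewrite mxE.
- by apply: ent (Zq _ _).2 _; rewrite mxE.
- by apply: ent (Zq _ _).2 _; rewrite mxE.
- by apply: ent (Zq _ _).2 _; rewrite mxE.
- by apply: ent (Zq _ _).1 _; rewrite mxE.
- by rewrite mxE.
- by apply: ent (Zm _ _ (wdeg_xi _ _)).2 _; rewrite mxE.
- by apply: ent (Zm _ _ (wdeg_eta _ _)).2 _; rewrite mxE.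
- by apply: ent (Zq _ _).1 _; rewrite mxE.
- by apply: ent (Zm _ _ (wdeg_xi _ _)).1 _; rewrite mxE.
- by apply: ent (Zx _ _ (wdeg_xi _ _) (wdeg_xi _ _)) _; have [_ _ -> _] := linear_hessianE k l; rewrite mxE.
- by apply: ent (Zx _ _ (wdeg_xi _ _) (wdeg_eta _ _)) _; have [-> _ _ _] := linear_hessianE k l.
- by apply: ent (Zq _ _).1 _; rewrite mxE.
- by apply: ent (Zm _ _ (wdeg_eta _ _)).1 _; rewrite mxE.
- by apply: ent (Zx _ _ (wdeg_eta _ _) (wdeg_xi _ _)) _; have [_ -> _ _] := linear_hessianE k l.
- by apply: ent (Zx _ _ (wdeg_eta _ _) (wdeg_eta _ _)) _; have [_ _ _ ->] := linear_hessianE k l; rewrite mxE.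
Qed.

End UnperturbedHessian.

(** * Orbits close to the torus *)

Section CompareIdentity.
Variables (R : realType) (m : nat).

Definition compare_const (K T : R) : R :=
  Num.sqrt (2 * m%:R ^+ 2 *
   (sqnorm (fun p : 'I_m * 'I_m => (1%:M : 'M[R[i]]_m) p.1 p.2) * expR ((growth m K + 2) * T)) *
   expR ((2 * growth m K + 2) * T)).

Lemma fundamental_compare (T K e : R) (A B M N : R -> 'M[R[i]]_m) : 0 <= T -> 0 <= K -> 0 <= e ->
  solves_linear T A M -> solves_linear T B N -> M 0 = 1%:M -> N 0 = 1%:M ->
  (forall t, 0 <= t <= T -> forall i j, normc (A t i j) <= K) ->
  (forall t, 0 <= t <= T -> forall i j, normc (B t i j) <= K) ->
  (forall t, 0 <= t <= T -> forall i j, normc (A t i j - B t i j) <= e) ->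
  forall i j, normc (M T i j - N T i j) <= e * compare_const K T.
Proof.
move=> T0 K0 e0 MA NB M1 N1 AK BK AB i j.
have := linear_compare T0 K0 e0 MA NB (etrans M1 (esym N1)) AK BK AB i j.
by rewrite N1.
Qed.

Lemma mx_subE (p q : nat) (A B : 'M[R[i]]_(p, q)) i j : (A - B) i j = A i j - B i j.
Proof. by rewrite !mxE. Qed.

Lemma expmx_solves T (L : 'M[R[i]]_m) : solves_linear T (fun=> L) (fun t => expmx (t%:C *: L)).
Proof. by move=> t _ i j; exact: expmx_derivative. Qed.

End CompareIdentity.

Lemma Jmx_phat (R : realType) (d n2 : nat) i (j : 'I_(1 + d)) :
  Jmx R d n2 i (idx_phat n2 j) = (i == idx_qhat n2 j)%:R.
Proof.
rewrite /Jmx /sympl; case: (idxP i) => k;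
  rewrite ?(block_mxEul, block_mxEur, block_mxEdl, block_mxEdr) mxE /idx_qhat /idx_phat
    /idx_xi /idx_eta ?eq_shift//.
Qed.

Lemma speed_num (R : realType) (kap omega b : R) (u1 u2 u3 : R[i]) c l :
  0 < kap -> 0 < omega -> normc (u1 - u2) <= c * (l / kap) -> normc (u2 - u3) <= b ->
  u3 = omega%:C -> l <= b -> 0 <= c -> omega - b * (c * kap^-1 + 1) <= normc u1.
Proof.
move=> kap0 omega0 h1 h2 e hl c0; have : omega <= normc u1 + (c * (l / kap) + b).
  have -> : omega = normc (u3 : R[i]) by rewrite e normcR gtr0_norm.
  have -> : u3 = u1 - ((u1 - u2) + (u2 - u3)) by ring.
  apply: le_trans (normcB _ _) _; rewrite lerD2l.
  by apply: le_trans (normcD _ _) _; exact: lerD.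
have : c * (l / kap) <= c * (b / kap) by rewrite ler_wpM2l// ler_wpM2r// invr_ge0 ltW.
have -> : c * (b / kap) = b * (c * kap^-1) by ring.
lra.
Qed.

Lemma gradientE (R : realType) (m : nat) (F : 'cV[R[i]]_m -> R[i]) z j :
  gradient F z j 0 = partial j F z.
Proof. by rewrite mxE. Qed.

#[local] Opaque tfeval tfpart partial csum climn hessian gradient torus_point Jmx expmx deviation_const compare_const.

Section NearlyIntegrable.
Variables (R : realType) (d n2 : nat) (kap omega N T : R).
Local Notation dim := (((1 + d) + (1 + d)) + (n2 + n2))%N.
Variables (H Z : phase R d n2 -> R[i]) (qs : 'cV[R]_d) (q10 b : R).
Hypotheses (kap0 : 0 < kap) (omega0 : 0 < omega) (T0 : 0 <= T) (b0 : 0 <= b).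
Local Notation U := (@tube R d n2 kap).
Local Notation J := (Jmx R d n2).
Local Notation tp := (torus_point n2 qs).
Let Uo z := @tube_open R d n2 kap z kap0.
Hypotheses (jH : jet kap U H N) (jZ : jet kap U Z N).
Hypothesis gradient_close : forall z j, U z -> normc (partial j H z - partial j Z z) <= b.
Hypothesis hessian_close : forall z i j, U z -> normc (hessian H z i j - hessian Z z i j) <= b.
Hypothesis gradient_torus : forall a i,
  partial i Z (tp a) = omega%:C * (i == idx_phat n2 (first_idx d))%:R.
Hypothesis hessian_torus : forall a i j, hessian Z (tp a) i j = hessian Z (tp q10) i j.

Variables (z : R -> phase R d n2) (M : R -> 'M[R[i]]_dim).
Hypothesis zd : forall t, 0 <= t <= T -> forall i,
  has_time_derivative (fun s => z s i 0) t ((J *m gradient H (z t)) i 0).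
Hypothesis z0 : l1norm (z 0 - tp q10) <= b.
Hypothesis M0 : M 0 = 1%:M.
Hypothesis Md : forall t, 0 <= t <= T -> forall i j,
  has_time_derivative (fun s => M s i j) t (((J *m hessian H (z t)) *m M t) i j).

Definition orbit_const : R := deviation_const dim kap N T.
Hypothesis small : b * orbit_const < kap.

Let N0 : 0 <= N := jet_ge0 jH.
Let D0 : 0 <= orbit_const. Proof. exact: sqrtr_ge0. Qed.
Let Nk0 : 0 <= N / kap ^+ 2. Proof. by rewrite divr_ge0// exprn_ge0// ltW. Qed.
Let K : R := dim%:R * (N / kap ^+ 2).
Let K0 : 0 <= K. Proof. by rewrite mulr_ge0// divr_ge0// exprn_ge0// ltW. Qed.
Let L : 'M[R[i]]_dim := J *m hessian Z (tp q10).

Let y0 (t : R) : tp (q10 + omega * t) =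
  tp q10 + (omega * t)%:C *: delta_mx (idx_qhat n2 (first_idx d)) 0.
Proof. by rewrite (torus_point_shift n2 qs q10) addrAC subrr add0r. Qed.

Lemma tube_near_torus a w : l1norm w < kap -> U (tp a + w).
Proof.
move=> wk; rewrite addrC; apply: tube_real_angles; first exact: torus_point_real_angles.
move=> i; apply: le_lt_trans wk; apply: le_trans (normc_l1norm w i); rewrite /amplitude.
by case: ifP => _ //; exact: normc_Im.
Qed.

(** One tolerance [b] bounds both the distance between the derivatives of [H] and [Z] and the
    initial deviation. It will be a multiple of [|eps|^(r+1-alpha)], the order of the initial
    deviation, which dominates that of the truncation. *)
Lemma orbit_near_torus t : 0 <= t <= T -> l1norm (z t - tp (q10 + omega * t)) <= b * orbit_const.
Proof.
move=> tT.
pose g (_ : R) : phase R d n2 := omega%:C *: delta_mx (idx_phat n2 (first_idx d)) 0.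
have gE i s : (J *m g s) i 0 = omega%:C * (i == idx_qhat n2 (first_idx d))%:R.
  by rewrite -scalemxAr -colE mxE [col _ _ _ _]mxE Jmx_phat.
have h1 s w : 0 <= s <= T -> l1norm w < kap -> U (tp (q10 + omega * s) + w).
  by move=> _; exact: tube_near_torus.
have h2 s : 0 <= s <= T -> forall i,
    has_time_derivative (fun u => tp (q10 + omega * u) i 0) s ((J *m g s) i 0).
  move=> _ i; rewrite gE.
  have := has_time_derivativeD (has_time_derivative_cst s (tp q10 i 0))
    (has_time_derivativeZ (omega%:C * (i == idx_qhat n2 (first_idx d))%:R) (has_time_derivative_id s)).
  rewrite add0r mulr1.
  suff -> : (fun u => tp (q10 + omega * u) i 0) = fun u : R => tp q10 i 0 +
    omega%:C * (i == idx_qhat n2 (first_idx d))%:R * u%:C by [].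
  apply/funext => u; rewrite y0 mxE; congr (_ + _); rewrite mxE [delta_mx _ _ _ _]mxE eqxx andbT.
  by rewrite rmorphM /= mulrAC.
have h3 s : 0 <= s <= T -> forall j, normc (partial j H (tp (q10 + omega * s)) - g s j 0) <= b.
  move=> _ j; have -> : g s j 0 = partial j Z (tp (q10 + omega * s)).
    by rewrite gradient_torus mxE [delta_mx _ _ _ _]mxE eqxx andbT.
  by apply: gradient_close; exact: tube_torus_point.
have h4 : l1norm (z 0 - tp (q10 + omega * 0)) <= b by rewrite mulr0 addr0.
exact: (orbit_close kap0 jH (@Jmx_le1 R d n2) T0 b0 h1 h2 h3 zd h4 small tT).
Qed.

Lemma orbit_in_tube t : 0 <= t <= T -> U (z t).
Proof.
move=> tT; have -> : z t = tp (q10 + omega * t) + (z t - tp (q10 + omega * t)).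
  by rewrite addrC subrK.
by apply: tube_near_torus; exact: le_lt_trans (orbit_near_torus tT) small.
Qed.

Let dist_num (u1 u2 u3 u4 : R[i]) c l D : normc (u1 - u2) <= c * (l / kap) ->
  normc (u2 - u3) <= b -> u3 = u4 -> l <= b * D -> 0 <= c ->
  normc (u1 - u4) <= b * (c * (D / kap) + 1).
Proof.
move=> h1 h2 <- hl c0; apply: le_trans (normc_tri u2 _ _) _; apply: le_trans (lerD h1 h2) _.
rewrite mulrDr mulr1 lerD2r [leRHS]mulrCA; apply: ler_wpM2l => //.
by rewrite mulrA ler_wpM2r ?invr_ge0 ?(ltW kap0).
Qed.

Definition hessian_const : R := N / kap ^+ 2 * (orbit_const / kap) + 1.

Lemma orbit_hessian t i j : 0 <= t <= T ->
  normc (hessian H (z t) i j - hessian Z (tp q10) i j) <= b * hessian_const.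
Proof.
move=> tT; have Ut := orbit_in_tube tT.
have Ua : U (tp (q10 + omega * t)) := tube_torus_point kap0 qs _.
have hz := orbit_near_torus tT; have hk := ltW (le_lt_trans hz small).
have h1 := hessian_lip jH i j Ua Ut hk.
have h2 := hessian_close i j Ua.
have h3 := hessian_torus (q10 + omega * t) i j.
exact: (dist_num h1 h2 h3 hz Nk0).
Qed.

Definition monodromy_const : R := dim%:R * hessian_const * compare_const dim K T.

Let LK i j : normc (L i j) <= K.
Proof.
apply: (jacobian_bound (@Jmx_le1 R d n2)) => k l.
by apply: (hessian_bound jZ); exact: tube_torus_point.
Qed.

Lemma monodromy_close i j : normc (M T i j - expmx (T%:C *: L) i j) <= b * monodromy_const.
Proof.
have hc0 : 0 <= hessian_const.
  by rewrite addr_ge0// mulr_ge0// divr_ge0// ?exprn_ge0// ltW.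
have h1 : solves_linear T (fun t => J *m hessian H (z t)) M := Md.
have h2 : forall t, 0 <= t <= T -> forall i j, normc ((J *m hessian H (z t)) i j) <= K.
  move=> t tT; apply: (jacobian_bound (@Jmx_le1 R d n2)) => k l.
  by apply: (hessian_bound jH); exact: orbit_in_tube.
have h3 : forall t, 0 <= t <= T -> forall i j, normc ((J *m hessian H (z t)) i j - L i j) <=
    dim%:R * (b * hessian_const).
  move=> t tT k l; have -> : (J *m hessian H (z t)) k l - L k l =
    (J *m (hessian H (z t) - hessian Z (tp q10))) k l by rewrite mulmxBr mx_subE.
  apply: (jacobian_bound (@Jmx_le1 R d n2)) => k' l'.
  by rewrite mx_subE; exact: orbit_hessian.
have e0 : 0 <= dim%:R * (b * hessian_const) by rewrite !mulr_ge0.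
have -> : b * monodromy_const = dim%:R * (b * hessian_const) * compare_const dim K T.
  by rewrite /monodromy_const -/K; ring.
exact: (fundamental_compare T0 K0 e0 h1 (expmx_solves (T := T) L) M0 (expmx0 L) h2 (fun _ _ => LK) h3).
Qed.

Lemma monodromy_symplectic : (M T)^T *m J *m M T = J.
Proof.
exact: (fundamental_symplectic jH (@Jmx_tr R d n2) (@Jmx_sqr R d n2) T0
  (fun t tT => orbit_in_tube tT) M0 Md).
Qed.

Lemma monodromy_real : (forall w, U w -> real_point w -> complex.Im (H w) = 0) ->
  (forall t, 0 <= t <= T -> real_point (z t)) ->
  M T *m conj_mx R d n2 = conj_mx R d n2 *m map_mx (@conjc R) (M T).
Proof.
move=> Hr zr; have Hr' w : U w -> fixed_by_conjugation (conj_mx R d n2) w -> complex.Im (H w) = 0.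
  by move=> Uw /real_pointP; exact: Hr.
have zU t : 0 <= t <= T -> U (z t) /\ fixed_by_conjugation (conj_mx R d n2) (z t).
  by move=> tT; split; [exact: orbit_in_tube|apply/real_pointP; exact: zr].
exact: (fundamental_real kap0 Uo (@conj_mx_tr R d n2) (@conj_mxK R d n2)
  (@conj_mx_Jmx R d n2) (@Jmx_real R d n2) jH Hr' T0 zU M0 Md (@Jmx_le1 R d n2)).
Qed.

Section Return.
Hypothesis H_shift : forall w k, H (w + angle_shift R n2 k) = H w.
Hypothesis hT : omega * T = 2 * pi.
Hypothesis returns : displacement omega T z = 0.

Let p1 := idx_phat n2 (first_idx d).
Let q1 := idx_qhat n2 (first_idx d).

Definition turn : phase R d n2 := angle_shift R n2 (fun j => (j == first_idx d)%:R).

Lemma turnE i : turn i 0 = (omega * T)%:C * (i == q1)%:R.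
Proof.
rewrite hT /turn /angle_shift /q1; case: (idxP i) => j;
  rewrite /idx_qhat /idx_phat /idx_xi /idx_eta ?col_mxEu ?col_mxEd ?eq_shift !mxE ?mulr0//.
by case: eqVneq => _; rewrite ?mulr1 ?mulr0.
Qed.

Lemma turn_real_angles : real_angles turn.
Proof.
move=> i; rewrite turnE; have [->|] := eqVneq i q1; last by rewrite mulr0.
by rewrite mulr1 /q1 wdeg_qhat.
Qed.

Lemma displacementE i : i != p1 -> z T i 0 = z 0 i 0 + turn i 0.
Proof.
move: returns; rewrite /displacement => /eqP; rewrite !col_mx_eq0 => /andP[/andP[/eqP hq /eqP hp] /eqP hx].
have E (k : 'I_dim) (a : R[i]) : (z T - z 0) k 0 = a -> z T k 0 = z 0 k 0 + a.
  by rewrite mx_subE => <-; rewrite addrC subrK.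
rewrite turnE /p1 /q1; case: (idxP i) => j ip; apply: E.
- have := congr1 (fun A : 'cV[R[i]]_(1 + d) => A j 0) hq; rewrite !mxE => /eqP.
  rewrite subr_eq0 => /eqP ->; rewrite /idx_qhat !eq_shift.
  case: (split_ordP j) => k ->; rewrite ?(col_mxEu, col_mxEd) !mxE.
    by rewrite !ord1 eqxx mulr1.
  by rewrite /first_idx eq_shift mulr0.
- case: (split_ordP j) ip => k ->; first by rewrite ord1 eqxx.
  move=> _; rewrite /idx_phat eq_shift mulr0.
  by have := congr1 (fun A : 'cV[R[i]]_d => A k 0) hp; rewrite !mxE.
- have := congr1 (fun A : 'cV[R[i]]_(n2 + n2) => A (lshift n2 j) 0) hx; rewrite !mxE.
  by rewrite /idx_xi eq_shift mulr0.
- have := congr1 (fun A : 'cV[R[i]]_(n2 + n2) => A (rshift n2 j) 0) hx; rewrite !mxE.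
  by rewrite /idx_eta eq_shift mulr0.
Qed.

(** The condition [b * return_const < omega] says that the lower bound of [speed_lower] on the
    [p_1]-derivative of [H] exceeds [N / kap ^+ 2] times [2 * b * orbit_const], the largest possible
    defect of [p_1] over a period. *)
Definition return_const : R := N / kap * kap^-1 + 1 + N / kap ^+ 2 * (2 * orbit_const).
Hypothesis small2 : b * (2 * orbit_const) <= kap.
Hypothesis small3 : b * return_const < omega.

Let TT : 0 <= T <= T. Proof. by rewrite T0 lexx. Qed.
Let T00 : 0 <= (0 : R) <= T. Proof. by rewrite T0 lexx. Qed.

Let g1 : R[i] := partial p1 H (z 0).

Lemma speed_lower : omega - b * (N / kap * kap^-1 + 1) <= normc g1.
Proof.
have U0 := orbit_in_tube T00; have Ut : U (tp q10) := tube_torus_point kap0 qs q10.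
have h0 := orbit_near_torus T00; rewrite mulr0 addr0 in h0.
have h1 := partial_lip jH p1 Ut U0 (ltW (le_lt_trans h0 small)).
have h2 := gradient_close p1 Ut.
have h3 := gradient_torus q10 p1; rewrite eqxx mulr1 in h3.
have k0 : 0 <= N / kap by rewrite divr_ge0 // ltW.
exact: (speed_num kap0 omega0 h1 h2 h3 z0 k0).
Qed.

(* By energy conservation: [H] does not change over a period, its [p_1]-derivative is close
   to [omega], and all variables but [p_1] return. *)
Lemma orbit_returns : z T = z 0 + turn.
Proof.
have U0 := orbit_in_tube T00; have UT := orbit_in_tube TT.
set del := z T p1 0 - z 0 p1 0; pose w : phase R d n2 := del *: delta_mx p1 0.
have tp1 : turn p1 0 = 0 by rewrite turnE /p1 /q1 /idx_phat /idx_qhat !eq_shift mulr0.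
have zT : z T = z 0 + w + turn.
  apply/colP => i; rewrite mxE [(z 0 + w) i 0]mxE [w i 0]mxE [delta_mx _ _ _ _]mxE eqxx andbT.
  have [->|ip] := eqVneq i p1; last by rewrite mulr0 addr0 displacementE.
  by rewrite tp1 mulr1 addr0 /del addrC subrK.
suff d0 : del = 0 by rewrite zT /w d0 scale0r addr0.
have Uw : U (z 0 + w).
  have -> : z 0 + w = z T + - turn by rewrite zT addrK.
  apply: tube_real_angles UT => i; have [ti t0] := turn_real_angles i.
  rewrite mxE; split=> [|/t0 ->]; last by rewrite oppr0.
  by move: ti; case: (turn i 0) => ? ? /= ->; rewrite oppr0.
have lw : l1norm w = normc del by exact: l1norm_delta.
have dk : normc del <= b * (2 * orbit_const).
  have e a : tp a p1 0 = 0.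
    by apply: (torus_point_real_angles qs a p1).2; rewrite /p1 wdeg_phat.
  have e1 : del = (z T - tp (q10 + omega * T)) p1 0 - (z 0 - tp (q10 + omega * 0)) p1 0.
    by rewrite !mx_subE !e !subr0.
  have h1 := le_trans (normc_l1norm _ p1) (orbit_near_torus TT).
  have h2 := le_trans (normc_l1norm _ p1) (orbit_near_torus T00).
  rewrite e1; apply: le_trans (normcB _ _) _; apply: le_trans (lerD h1 h2) _.
  by rewrite le_eqVlt; apply/orP; left; apply/eqP; ring.
have HT : H (z 0 + w) = H (z 0).
  rewrite -(energy_conserved kap0 Uo jH (@Jmx_tr R d n2) T0 (fun t tT => orbit_in_tube tT) zd) zT.
  by rewrite H_shift.
have [[_ _ Hrem] _ _ _] := jH.
have nw : near_in kap U (z 0) w by split; rewrite ?lw ?(le_trans dk).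
have := Hrem _ _ nw; rewrite HT subrr sub0r normcN sum_delta lw normcM -/g1 => hr.
(* With equal energies the Taylor remainder bounds [|g1| * |del|] by a multiple of [|del|^2];
   dividing by a nonzero [|del|] would make [g1] too small. *)
apply/eqP/negPn/negP => dn0; have dpos : 0 < normc del.
  by rewrite lt_def normc_ge0 andbT; apply: contra_neq dn0; exact: Normc.eq0_normc.
have : normc g1 <= N / kap ^+ 2 * normc del.
  rewrite -(ler_pM2l dpos); apply: le_trans hr _.
  by rewrite le_eqVlt; apply/orP; left; apply/eqP; rewrite exprMn exprVn; ring.
move/(le_trans speed_lower); apply/negP; rewrite -ltNge.
apply: le_lt_trans (ler_wpM2l Nk0 dk) _.
rewrite ltrBrDl; apply: le_lt_trans small3; rewrite /return_const.
by rewrite le_eqVlt; apply/orP; left; apply/eqP; ring.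
Qed.

Lemma one_in_spectrum : (1 : R[i]) \in spectrum (M T).
Proof.
have U0 := orbit_in_tube T00.
have gT : gradient H (z T) = gradient H (z 0).
  have [|v Uv|h _] := jet_translation kap0 Uo (v := turn) jH.
  - by move=> v Uv; apply: tube_real_angles Uv; exact: turn_real_angles.
  - exact: H_shift.
  - apply/colP => j; apply: etrans (gradientE _ _ _) (etrans _ (esym (gradientE _ _ _))).
    have e2 := h j _ U0; have e1 := congr1 (partial j H) orbit_returns.
    by apply: etrans e1 _; exact: e2.
apply/spectrum_eigenvector; exists (J *m gradient H (z 0)); last first.
  have := fundamental_field kap0 Uo jH (@Jmx_le1 R d n2) T0 (fun t tT => orbit_in_tube tT) zd M0 Md.
  by rewrite gT scale1r.
apply/eqP => X0.
have g0 : gradient H (z 0) = 0.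
  by rewrite -[LHS]mul1mx -[1%:M]opprK -(Jmx_sqr R d n2) mulNmx -mulmxA X0 mulmx0 oppr0.
have := speed_lower; have -> : g1 = 0 by rewrite /g1 -gradientE g0 mxE.
rewrite normc0 subr_le0; apply/negP; rewrite -ltNge; apply: le_lt_trans small3.
have c0 : 0 <= N / kap ^+ 2 * (2 * orbit_const) := mulr_ge0 Nk0 (mulr_ge0 (ler0n _ 2) D0).
have hc : N / kap * kap^-1 + 1 <= return_const by rewrite /return_const lerDl; exact: c0.
exact: (ler_wpM2l b0 hc).
Qed.

End Return.

Variables (h0 : 'M[R[i]]_dim) (y : R).
Hypothesis y_ge0 : 0 <= y.
Hypothesis hessian_h0 : forall i j, normc (hessian Z (tp q10) i j - h0 i j) <= y.
Hypothesis h0_bound : forall i j, normc (h0 i j) <= N / kap ^+ 2.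
Variables (Omega : 'I_n2 -> R) (C : 'M[R[i]]_(1 + d)).
Hypothesis h0E : h0 = unperturbed_hessian Omega C.

Lemma expmx_unperturbed i j : normc (expmx (T%:C *: L) i j - unperturbed_flow Omega C T i j) <=
  y * (dim%:R * compare_const dim K T).
Proof.
have [_ _ f0] := flows0 Omega C.
have h1 k l : normc (unperturbed_generator Omega C k l) <= K.
  by rewrite -unperturbed_generatorE -h0E; apply: (jacobian_bound (@Jmx_le1 R d n2)).
have h2 : solves_linear T (fun=> unperturbed_generator Omega C) (unperturbed_flow Omega C).
  by move=> t _ k l; exact: unperturbed_flow_derivative.
have h3 k l : normc (L k l - unperturbed_generator Omega C k l) <= dim%:R * y.
  rewrite -unperturbed_generatorE -h0E -mx_subE -mulmxBr.
  by apply: (jacobian_bound (@Jmx_le1 R d n2)) => k' l'; rewrite mx_subE.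
have e0 : 0 <= dim%:R * y by rewrite mulr_ge0.
have -> : y * (dim%:R * compare_const dim K T) = dim%:R * y * compare_const dim K T by ring.
exact: (fundamental_compare T0 K0 e0 (expmx_solves (T := T) L) h2 (expmx0 L) f0
  (fun _ _ => LK) (fun _ _ => h1) (fun _ _ => h3)).
Qed.

Let entry_bound f (h : 'M[R[i]]_dim) : @signed_entry R d n2 f -> (forall i j, normc (h i j) <= N / kap ^+ 2) ->
  normc (f h) <= N / kap ^+ 2.
Proof.
move=> fs hN; have f0 : f 0 = 0 :> R[i].
  by case: fs => [->//|[k [l [->|->]]]]; rewrite mxE ?oppr0.
rewrite -[f h]subr0 -f0; apply: signed_entry_close => // i j.
by rewrite mxE subr0.
Qed.

Let hZ i j : normc (hessian Z (tp q10) i j) <= N / kap ^+ 2.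
Proof. by apply: (hessian_bound jZ); exact: tube_torus_point. Qed.

Lemma expmx_twist i j : normc (expmx (T%:C *: L11_of Z (tp q10)) i j - twist_flow C T i j) <=
  y * compare_const ((1 + d) + (1 + d)) (N / kap ^+ 2) T.
Proof.
have [f0 _ _] := flows0 Omega C; rewrite L11_ofE.
have h1 k l : normc (hessian_L11 (hessian Z (tp q10)) k l) <= N / kap ^+ 2.
  exact: (entry_bound (@hessian_L11_entry R d n2 k l) hZ).
have h2 k l : normc (twist_generator C k l) <= N / kap ^+ 2.
  rewrite -(hessian_L11_unperturbed Omega) -h0E.
  exact: (entry_bound (@hessian_L11_entry R d n2 k l)).
have h3 : solves_linear T (fun=> twist_generator C) (twist_flow C).
  by move=> t _ k l; exact: twist_flow_derivative.
have h4 k l : normc (hessian_L11 (hessian Z (tp q10)) k l - twist_generator C k l) <= y.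
  rewrite -(hessian_L11_unperturbed Omega) -h0E.
  exact: (signed_entry_close (@hessian_L11_entry R d n2 k l)).
exact: (fundamental_compare T0 Nk0 y_ge0 (expmx_solves (T := T) _) h3 (expmx0 _) f0
  (fun _ _ => h1) (fun _ _ => h2) (fun _ _ => h4)).
Qed.

Lemma expmx_oscillator i j :
  normc (expmx (T%:C *: L22_of Z (tp q10)) i j - oscillator_flow Omega T i j) <=
  y * compare_const (n2 + n2) (N / kap ^+ 2) T.
Proof.
have [_ f0 _] := flows0 Omega C; rewrite L22_ofE.
have h1 k l : normc (hessian_L22 (hessian Z (tp q10)) k l) <= N / kap ^+ 2.
  exact: (entry_bound (@hessian_L22_entry R d n2 k l) hZ).
have h2 k l : normc (oscillator_generator Omega k l) <= N / kap ^+ 2.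
  rewrite -(hessian_L22_unperturbed Omega C) -h0E.
  exact: (entry_bound (@hessian_L22_entry R d n2 k l)).
have h3 : solves_linear T (fun=> oscillator_generator Omega) (oscillator_flow Omega).
  by move=> t _ k l; exact: oscillator_flow_derivative.
have h4 k l : normc (hessian_L22 (hessian Z (tp q10)) k l - oscillator_generator Omega k l) <= y.
  rewrite -(hessian_L22_unperturbed Omega C) -h0E.
  exact: (signed_entry_close (@hessian_L22_entry R d n2 k l)).
exact: (fundamental_compare T0 Nk0 y_ge0 (expmx_solves (T := T) _) h3 (expmx0 _) f0
  (fun _ _ => h1) (fun _ _ => h2) (fun _ _ => h4)).
Qed.

End NearlyIntegrable.

#[local] Transparent tfeval tfpart partial csum climn hessian gradient torus_point Jmx expmx
  deviation_const compare_const.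

(** * Eigenvalues on the unit circle *)

Section UnitCircle.
Variables (R : realType) (d n2 : nat).
Local Notation dim := (((1 + d) + (1 + d)) + (n2 + n2))%N.
Local Notation J := (Jmx R d n2).
Local Notation cj := (map_mx (@conjc R)).
Implicit Types v : phase R d n2.

(** The form preserved by the monodromy is therefore [i (|xi|^2 - |eta|^2)] plus a term coupling
    each angle with its action. *)
Lemma conj_Jmx_mulE v : [/\
  forall j, (conj_mx R d n2 *m J *m v) (idx_qhat n2 j) 0 = v (idx_phat n2 j) 0,
  forall j, (conj_mx R d n2 *m J *m v) (idx_phat n2 j) 0 = - v (idx_qhat n2 j) 0,
  forall j, (conj_mx R d n2 *m J *m v) (idx_xi d j) 0 = 'i * v (idx_xi d j) 0 &
  forall j, (conj_mx R d n2 *m J *m v) (idx_eta d j) 0 = - 'i * v (idx_eta d j) 0].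
Proof.
have E : conj_mx R d n2 *m J *m v =
    col_mx (col_mx (dsubmx (usubmx v)) (- usubmx (usubmx v)))
      (col_mx ('i *: usubmx (dsubmx v)) ((- 'i) *: dsubmx (dsubmx v))).
  have e : block_mx 0 (- 'i)%:M (- 'i)%:M 0 *m sympl R n2 = block_mx 'i%:M 0 0 (- 'i)%:M.
    rewrite /sympl mulmx_block !mul0mx !mulmx0 !mulmx1 mulmxN mulmx1 !add0r !addr0.
    by rewrite -raddfN opprK.
  have e' : sympl R (1 + d) *m usubmx v = col_mx (dsubmx (usubmx v)) (- usubmx (usubmx v)).
    rewrite -[in LHS](vsubmxK (usubmx v)) /sympl mul_block_col !mul0mx mul1mx mulNmx mul1mx.
    by rewrite add0r addr0.
  rewrite /conj_mx /Jmx; move: (sympl R n2) (sympl R (1 + d)) (block_mx 0 _ _ 0) e e' => s s' q e e'.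
  rewrite mulmx_block !(mul0mx, mulmx0, addr0, add0r, mul1mx) e -[in LHS](vsubmxK v).
  rewrite mul_block_col !mul0mx addr0 add0r e' -[in LHS](vsubmxK (dsubmx v)).
  by rewrite mul_block_col !mul0mx addr0 add0r !mul_scalar_mx.
by rewrite E; split=> j; rewrite /idx_qhat /idx_phat /idx_xi /idx_eta
  ?(col_mxEu, col_mxEd) !mxE.
Qed.

Lemma sum_phase (F : 'I_dim -> R[i]) : \sum_i F i =
  \sum_j (F (idx_qhat n2 j) + F (idx_phat n2 j)) + (\sum_j F (idx_xi d j) + \sum_j F (idx_eta d j)).
Proof.
rewrite big_split_ord /=; congr (_ + _); first by rewrite big_split_ord [RHS]big_split.
by rewrite big_split_ord.
Qed.

Lemma isotropic_balance v : (cj v)^T *m conj_mx R d n2 *m J *m v = 0 ->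
  `|\sum_j normc (v (idx_xi d j) 0) ^+ 2 - \sum_j normc (v (idx_eta d j) 0) ^+ 2| <=
  \sum_j 2 * (normc (v (idx_qhat n2 j) 0) * normc (v (idx_phat n2 j) 0)).
Proof.
have [hq hp hx he] := conj_Jmx_mulE v; set w := conj_mx R d n2 *m J *m v in hq hp hx he.
rewrite -!mulmxA mulmxA -/w => /(congr1 (fun A : 'M[R[i]]_1 => A 0 0)).
have -> : ((cj v)^T *m conj_mx R d n2 *m (J *m v)) 0 0 = \sum_i conjc (v i 0) * w i 0.
  by rewrite -mulmxA [conj_mx R d n2 *m (J *m v)]mulmxA -/w mxE; apply: eq_bigr => i _; rewrite !mxE.
rewrite [X in _ = X]mxE sum_phase.
set S1 := \sum_j _; set X := \sum_j normc (v (idx_xi d j) 0) ^+ 2.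
set Y := \sum_j normc (v (idx_eta d j) 0) ^+ 2.
have eX : \sum_j conjc (v (idx_xi d j) 0) * w (idx_xi d j) 0 = 'i * X%:C.
  rewrite rmorph_sum mulr_sumr; apply: eq_bigr => j _; rewrite hx mulrCA; congr (_ * _).
  by apply: esym; rewrite mulrC; exact: sqr_normc_conj.
have eY : \sum_j conjc (v (idx_eta d j) 0) * w (idx_eta d j) 0 = - 'i * Y%:C.
  rewrite rmorph_sum mulr_sumr; apply: eq_bigr => j _; rewrite he mulrCA; congr (_ * _).
  by apply: esym; rewrite mulrC; exact: sqr_normc_conj.
rewrite eX eY mulNr -mulrBr -rmorphB /= => /eqP; rewrite addrC addr_eq0 => /eqP e.
have -> : `|X - Y| = normc S1.
  by rewrite -[normc S1]normcN -e normcM normci mul1r normcR.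
apply: le_trans (normc_sum _ _ _) _; apply: ler_sum => j _; rewrite hq hp.
apply: le_trans (normcD _ _) _; rewrite !normcM normcN !normc_conj.
by move: (normc _) (normc _) => x y; lra.
Qed.

Variables (Omega : 'I_n2 -> R) (C : 'M[R[i]]_(1 + d)) (T : R).

Lemma unperturbed_flow_mulE v : [/\
  forall j, (unperturbed_flow Omega C T *m v) (idx_qhat n2 j) 0 =
    v (idx_qhat n2 j) 0 + \sum_k T%:C * C j k * v (idx_phat n2 k) 0,
  forall j, (unperturbed_flow Omega C T *m v) (idx_phat n2 j) 0 = v (idx_phat n2 j) 0,
  forall j, (unperturbed_flow Omega C T *m v) (idx_xi d j) 0 =
    cexp ('i * (Omega j * T)%:C) * v (idx_xi d j) 0 &
  forall j, (unperturbed_flow Omega C T *m v) (idx_eta d j) 0 =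
    cexp ('i * (- Omega j * T)%:C) * v (idx_eta d j) 0].
Proof.
have -> : unperturbed_flow Omega C T *m v = col_mx
    (col_mx (usubmx (usubmx v) + T%:C *: C *m dsubmx (usubmx v)) (dsubmx (usubmx v)))
    (col_mx (diag_mx (\row_j cexp ('i * (Omega j * T)%:C)) *m usubmx (dsubmx v))
      (diag_mx (\row_j cexp ('i * (- Omega j * T)%:C)) *m dsubmx (dsubmx v))).
  rewrite -[in LHS](vsubmxK v) -[in LHS](vsubmxK (usubmx v)) -[in LHS](vsubmxK (dsubmx v)).
  rewrite /unperturbed_flow mul_block_col !mul0mx addr0 add0r /twist_flow /oscillator_flow.
  by rewrite !mul_block_col !mul0mx !mul1mx !addr0 !add0r.
split=> j; rewrite /idx_qhat /idx_phat /idx_xi /idx_eta ?(col_mxEu, col_mxEd).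
- rewrite mxE; apply: (f_equal2 +%R); first by rewrite !mxE.
  by rewrite mxE; apply: eq_bigr => k _; rewrite !mxE.
- by rewrite !mxE.
- by rewrite mul_diag_mx !mxE.
- by rewrite mul_diag_mx !mxE.
Qed.

Definition twist_size : R := \sum_j \sum_k normc (T%:C * C j k).

(** For an eigenvector of l1 norm [s], the actions are bounded by [P = e s / del] and the angles by
    [Q], where the twist feeds [P] back. The factor [n2 + 2 (1 + d) + 1] comes from the balance
    between [xi] and [eta], and the dimension from summing the components. *)
Definition unit_const (del : R) : R :=
  dim%:R * (n2%:R + 2 * (1 + d)%:R + 1) * (del^-1 + (1 + twist_size * (1 + d)%:R / del) / del).

Let twist_le j k : normc (T%:C * C j k) <= twist_size.
Proof.
rewrite /twist_size (bigD1 j)//= (bigD1 k)//= -addrA lerDl addr_ge0//.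
  by apply: sumr_ge0 => ? _; exact: normc_ge0.
by apply: sumr_ge0 => ? _; apply: sumr_ge0 => ? _; exact: normc_ge0.
Qed.

(* An eigenvalue off the unit circle has an isotropic eigenvector [v]. If it is away from 1
   then the angle and action components of [v] are small, and as it is away from one of the
   two clusters [exp (+- i Omega T)] so is one of [xi], [eta]; the balance between [xi] and
   [eta] given by isotropy then makes [v] too small. *)
Lemma unit_circle (M : 'M[R[i]]_dim) (l : R[i]) (del e : R) : 0 < del -> 0 <= e ->
  (forall i j, normc (M i j - unperturbed_flow Omega C T i j) <= e) ->
  M^T *m J *m M = J -> M *m conj_mx R d n2 = conj_mx R d n2 *m cj M ->
  (forall j k, 2 * del <= normc (cexp ('i * (Omega j * T)%:C) - cexp ('i * (- Omega k * T)%:C))) ->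
  e * unit_const del < 1 -> l \in spectrum M -> del <= normc (l - 1) -> normc l = 1.
Proof.
move=> del0 e0 ME Msym Mreal gap small /spectrum_eigenvector[v v0 Mv] l1.
apply/eqP/negPn/negP => nl.
have bal := isotropic_balance (isotropic_eigenvector (@conj_mx_tr R d n2) Msym Mreal Mv nl).
set s := l1norm v; have s0 : 0 < s.
  rewrite lt_def l1norm_ge0 andbT; apply: contra_neq v0 => s0; apply/colP => i; rewrite mxE.
  apply: Normc.eq0_normc; apply/eqP; rewrite eq_le normc_ge0 andbT.
  by apply: le_trans (normc_l1norm v i) _; rewrite -/s s0.
(* An eigenvector of [M] is almost one of the unperturbed flow, whose action is explicit. *)
have ev i : normc ((unperturbed_flow Omega C T *m v) i 0 - l * v i 0) <= e * s.
  have -> : (unperturbed_flow Omega C T *m v) i 0 - l * v i 0 =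
      \sum_k v k 0 * (unperturbed_flow Omega C T i k - M i k).
    have -> : l * v i 0 = (M *m v) i 0 by rewrite Mv mxE.
    rewrite !mxE -sumrB; apply: eq_bigr => k _.
    by rewrite mulrBr [v k 0 * _]mulrC [v k 0 * _]mulrC.
  by apply: normc_dot => k; rewrite normc_distC.
have [Eq Ep Ex Ee] := unperturbed_flow_mulE v.
have es0 : 0 <= e * s by rewrite mulr_ge0// ltW.
set P := e * s / del; have P0 : 0 <= P by rewrite divr_ge0// ltW.
have away (c x : R[i]) : del <= normc (l - c) -> normc (c * x - l * x) <= e * s -> normc x <= P.
  move=> lc; rewrite -mulrBl normcM normc_distC => h.
  rewrite /P ler_pdivlMr// mulrC; apply: le_trans h.
  by rewrite ler_wpM2r// normc_ge0.
have hp j : normc (v (idx_phat n2 j) 0) <= P.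
  by apply: (away 1 _ l1); rewrite mul1r -[X in X - _]Ep.
have t0 : 0 <= twist_size.
  by apply: sumr_ge0 => ? _; apply: sumr_ge0 => ? _; exact: normc_ge0.
set Q := (e * s + twist_size * (1 + d)%:R * P) / del.
have Q0 : 0 <= Q.
  apply: divr_ge0; last exact: ltW.
  by apply: addr_ge0 => //; apply: mulr_ge0 => //; exact: mulr_ge0.
have hq j : normc (v (idx_qhat n2 j) 0) <= Q.
  rewrite /Q ler_pdivlMr// mulrC; apply: le_trans (_ : _ <= normc (l - 1) * normc (v (idx_qhat n2 j) 0)) _.
    by rewrite ler_wpM2r ?normc_ge0.
  have := ev (idx_qhat n2 j); rewrite Eq => h.
  rewrite -normcM (_ : _ * _ = \sum_k T%:C * C j k * v (idx_phat n2 k) 0 -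
    (v (idx_qhat n2 j) 0 + \sum_k T%:C * C j k * v (idx_phat n2 k) 0 - l * v (idx_qhat n2 j) 0)); last by ring.
  apply: le_trans (normcB _ _) _; rewrite addrC lerD//.
  apply: le_trans (normc_sum _ _ _) _; apply: le_trans (_ : _ <= \sum_(k < 1 + d) twist_size * P) _.
    by apply: ler_sum => k _; rewrite normcM ler_pM ?normc_ge0.
  by rewrite sumr_const card_ord -[X in X <= _]mulr_natl [X in X <= _]mulrCA mulrA.
pose X := P + Q; have PX : P <= X by rewrite lerDl.
have QX : Q <= X by rewrite lerDr.
have X0 : 0 <= X by rewrite addr_ge0.
pose k : R := n2%:R + 2 * (1 + d)%:R + 1.
have k1 : 1 <= k by rewrite lerDr addr_ge0// mulr_ge0.
have k0 : 0 <= k by apply: le_trans k1.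
have qp : \sum_j 2 * (normc (v (idx_qhat n2 j) 0) * normc (v (idx_phat n2 j) 0)) <= 2 * (1 + d)%:R * X ^+ 2.
  apply: le_trans (_ : _ <= \sum_(j < 1 + d) 2 * X ^+ 2) _.
    apply: ler_sum => j _; rewrite ler_wpM2l// expr2 ler_pM ?normc_ge0//.
      exact: le_trans (hq j) QX.
    exact: le_trans (hp j) PX.
  by rewrite sumr_const card_ord -[X in X <= _]mulr_natl [X in X <= _]mulrCA mulrA.
(* [f] stands for whichever of [xi], [eta] is small by distance from its cluster and [g] for the
   other one, which the balance then bounds. As [k >= 1], replacing [k] by its square avoids a
   square root. *)
have other (f g : 'I_n2 -> R) : (forall j, 0 <= f j) -> (forall j, 0 <= g j) ->
    (forall j, f j <= P) -> \sum_j g j ^+ 2 <= \sum_j f j ^+ 2 + 2 * (1 + d)%:R * X ^+ 2 ->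
    (forall j, f j <= k * X) /\ (forall j, g j <= k * X).
  move=> f0 g0 fP fg; split=> j.
    by apply: le_trans (fP j) _; apply: le_trans PX _; rewrite ler_peMl.
  rewrite -(@ler_pXn2r _ 2)// ?nnegrE ?mulr_ge0//.
  apply: le_trans (_ : _ <= \sum_j g j ^+ 2) _.
    by rewrite (bigD1 j)//= lerDl sumr_ge0// => ? _; exact: sqr_ge0.
  apply: le_trans fg _; apply: le_trans (_ : _ <= k * X ^+ 2) _.
    have : \sum_j f j ^+ 2 <= n2%:R * X ^+ 2.
      apply: le_trans (_ : _ <= \sum_(j < n2) X ^+ 2) _.
        apply: ler_sum => i _; rewrite ler_pXn2r ?nnegrE//.
        exact: le_trans (fP i) PX.
      by rewrite sumr_const card_ord mulr_natl.
    move=> h; rewrite -[leLHS]addr0.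
    have -> : k * X ^+ 2 = n2%:R * X ^+ 2 + 2 * (1 + d)%:R * X ^+ 2 + X ^+ 2 by rewrite /k; ring.
    exact: lerD (lerD h (lexx _)) (sqr_ge0 X).
  by rewrite exprMn ler_wpM2r ?sqr_ge0// expr2 ler_peMl.
have xe : (forall j, normc (v (idx_xi d j) 0) <= k * X) /\ (forall j, normc (v (idx_eta d j) 0) <= k * X).
  have n0 i : 0 <= normc (v i 0) by exact: normc_ge0.
  (* Either [l] is away from every [exp (i Omega T)], or it is close to one of them and the gap
     keeps it away from every [exp (- i Omega T)]. *)
  have [/forallP A|] := boolP [forall j, del <= normc (l - cexp ('i * (Omega j * T)%:C))].
    apply: other => //.
      by move=> j; apply: (away _ _ (A j)); rewrite -[X in X - _]Ex.
    by move: bal; rewrite ler_norml => /andP[h _]; move: qp; lra.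
  rewrite negb_forall => /existsP[j0]; rewrite -ltNge => lj0.
  suff [h1 h2] : (forall j, normc (v (idx_eta d j) 0) <= k * X) /\
    (forall j, normc (v (idx_xi d j) 0) <= k * X) by [].
  apply: other => //; last by move: bal; rewrite ler_norml => /andP[_ h]; move: qp; lra.
  move=> j; apply: (away (cexp ('i * (- Omega j * T)%:C))); last by rewrite -[X in X - _]Ee.
  rewrite leNgt; apply/negP => lj; have := gap j0 j; apply/negP; rewrite -ltNge.
  apply: le_lt_trans (normc_tri l _ _) _; rewrite mulr_natl mulr2n normc_distC.
  exact: ltrD.
have all_small i : normc (v i 0) <= k * X.
  case: (idxP i) => j.
  - by apply: le_trans (hq j) _; apply: le_trans QX _; rewrite ler_peMl.
  - by apply: le_trans (hp j) _; apply: le_trans PX _; rewrite ler_peMl.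
  - exact: xe.1.
  - exact: xe.2.
(* Summing the bounds on all components contradicts [e * unit_const del < 1]. *)
have : s <= e * unit_const del * s.
  apply: le_trans (sum_ord_le all_small) _; rewrite le_eqVlt; apply/orP; left; apply/eqP.
  by rewrite /X /Q /P /k /unit_const; field; rewrite gt_eqF.
by rewrite leNgt -subr_gt0 -[X in X - _]mul1r -mulrBl mulr_gt0 // subr_gt0.
Qed.

End UnitCircle.

(** * Gaps between the unperturbed multipliers *)

Section Resonances.
Variable R : realType.

Lemma cexp_i (a : R) : cexp ('i * a%:C) = cos a +i* sin a.
Proof.
have -> : 'i * a%:C = 0 +i* a by rewrite complexME; congr (_ +i* _); ring.
by rewrite cexpE expR0 !mul1r.
Qed.

Lemma cexp_eq1 (a : R) : cexp ('i * a%:C) = 1 -> exists k : int, a = 2 * pi * k%:~R.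
Proof.
move=> a1; have p0 : 0 < 2 * (pi : R) by rewrite mulr_gt0// pi_gt0.
(* After reduction to [0 <= b < 2 pi], the value [cos b = 1] forces [sin (b / 2) = 0] with [b / 2]
   in [[0, pi)], hence [b = 0]. *)
pose k := Num.floor (a / (2 * pi)); exists k; set b := a - 2 * pi * k%:~R.
have /andP[k1 k2] := floor_itv (a / (2 * pi)); rewrite -/k in k1 k2.
rewrite ler_pdivlMr// in k1; rewrite ltr_pdivrMr// intrD in k2.
have b0 : 0 <= b by rewrite subr_ge0 mulrC.
have b2 : b < 2 * pi by rewrite ltrBlDr [_ * k%:~R]mulrC; move: k2; rewrite mulrDl mul1r addrC.
have : cexp ('i * b%:C) = 1.
  rewrite -[LHS]mulr1 -(cexp_2pi R k) -cexpD -mulrDr -rmorphD /= /b subrK.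
  by rewrite a1 cexp_2pi.
rewrite cexp_i => /eqP; rewrite eq_complex /= => /andP[/eqP cb _].
have bb : b = (b / 2) *+ 2 by rewrite -mulr_natr divfK.
move: cb; rewrite bb cos_mulr2n => /eqP; rewrite subr_eq -(mulr2n 1) eqr_pMn2r// => /eqP c1.
have s0 : sin (b / 2) = 0.
  by apply/eqP; rewrite -sqrf_eq0 sin2cos2 c1 subrr.
apply/eqP; rewrite -subr_eq0 -/b eq_le b0 andbT leNgt; apply/negP => bp.
have := @sin_gt0_pi R (b / 2); rewrite s0 ltxx => H; suff : false by []; apply: H.
by rewrite divr_gt0//= ltr_pdivrMr// mulrC.
Qed.

Lemma finite_lower_bound (s : seq R) : all (fun a => 0 < a) s ->
  exists2 del, 0 < del & all (fun a => del <= a) s.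
Proof.
elim: s => [_|a s IH /= /andP[a0 /IH[del del0 sd]]]; first by exists 1.
exists (Num.min a del); first by rewrite lt_min a0.
rewrite ge_min lexx /=; apply: sub_all sd => x dx.
by rewrite ge_min dx orbT.
Qed.

Variables (n2 : nat) (omega : R) (Omega : 'I_n2 -> R).
Hypothesis omega0 : 0 < omega.
Hypothesis Omega0 : forall j, 0 < Omega j.
Hypothesis melnikov1 : forall (k1 : int) (j : 'I_n2),
  k1%:~R * omega + Omega j != 0 /\ k1%:~R * omega - Omega j != 0.
Hypothesis melnikov2 : forall (k1 : int) (j k : 'I_n2) (a b : bool), k1 != 0 ->
  k1%:~R * omega + (-1) ^+ a * Omega j + (-1) ^+ b * Omega k != 0.
Local Notation T := (period omega).

Let resonance (a : R) : cexp ('i * (a * T)%:C) = 1 -> exists k : int, a = k%:~R * omega.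
Proof.
move/cexp_eq1 => [k ek]; exists k; have p0 : 2 * (pi : R) != 0 by rewrite mulf_neq0// gt_eqF// pi_gt0.
have o0 : omega != 0 by rewrite gt_eqF.
apply: (mulIf p0); have -> : a * (2 * pi) = a * T * omega by rewrite /period; field.
by rewrite ek; ring.
Qed.

Lemma multiplier_neq1 x : x \in multipliers Omega T -> x != 1.
Proof.
rewrite mem_cat => /orP[] /mapP[j _ ->]; apply/eqP => /resonance[k e].
  by have [_] := melnikov1 k j; rewrite -e subrr eqxx.
by have [+ _] := melnikov1 k j; rewrite -e addNr eqxx.
Qed.

(** Equality would make [Omega j + Omega k] a multiple of [omega]. Positivity of the frequencies
    excludes the multiple 0, and the second nonresonance condition excludes all the others. *)
Lemma multipliers_definite j k :
  cexp ('i * (Omega j * T)%:C) != cexp ('i * (- Omega k * T)%:C).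
Proof.
apply/eqP => e; have [l el] : exists l : int, Omega j + Omega k = l%:~R * omega.
  apply: resonance; rewrite mulrDl rmorphD mulrDr cexpD e -cexpD -mulrDr -rmorphD -mulrDl addNr.
  by rewrite mul0r mulr0 cexp0.
have l0 : l != 0.
  by apply: contraTneq (addr_gt0 (Omega0 j) (Omega0 k)) => l0; rewrite el l0 mul0r ltxx.
have := melnikov2 j k true true l0; rewrite expr1 !mulN1r -el.
by rewrite addrAC addrK subrr eqxx.
Qed.

(** There are finitely many distances and all are positive. The factor 2 leaves room for a ball of
    radius [del] around each of the two points. *)
Lemma multiplier_gap : exists2 del, 0 < del &
  (forall x, x \in multipliers Omega T -> 2 * del <= normc (x - 1)) /\
  (forall j k, 2 * del <= normc (cexp ('i * (Omega j * T)%:C) - cexp ('i * (- Omega k * T)%:C))).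
Proof.
have pos (x y : R[i]) : x != y -> 0 < normc (x - y).
  move=> xy; rewrite lt_def normc_ge0 andbT; apply: contra_neq xy => h.
  by apply/eqP; rewrite -subr_eq0; apply/eqP; exact: Normc.eq0_normc h.
have [|d1 d10 h1] := @finite_lower_bound [seq normc (x - 1) | x <- multipliers Omega T].
  by apply/allP => _ /mapP[x xm ->]; apply: pos; exact: multiplier_neq1.
have [|d2 d20 h2] := @finite_lower_bound [seq normc (cexp ('i * (Omega p.1 * T)%:C) -
    cexp ('i * (- Omega p.2 * T)%:C)) | p : 'I_n2 * 'I_n2].
  by apply/allP => _ /mapP[x xm ->]; apply: pos; exact: multipliers_definite.
exists (Num.min d1 d2 / 2); first by rewrite divr_gt0// lt_min d10.
rewrite mulrC divfK//; split=> [x xm|j k]; rewrite ge_min.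
  by rewrite (allP h1)//; apply/mapP; exists x.
by rewrite (allP h2) ?orbT//; apply/mapP; exists (j, k); rewrite // mem_enum.
Qed.

End Resonances.

Lemma det_unperturbed_flow (R : realType) (d n2 : nat) (Omega : 'I_n2 -> R) (C : 'M[R[i]]_(1 + d)) t :
  \det (unperturbed_flow Omega C t) = 1.
Proof.
rewrite /unperturbed_flow det_ublock /twist_flow det_ublock !det1 !mul1r /oscillator_flow det_ublock.
rewrite !det_diag -big_split big1// => j _ /=; rewrite !mxE -cexpD -mulrDr -rmorphD -mulrDl subrr.
by rewrite mul0r mulr0 cexp0.
Qed.

Definition entrywise_cvg (R : realType) (m : nat) (A : R -> 'M[R[i]]_m) (A0 : 'M[R[i]]_m) : Prop :=
  forall e, 0 < e -> \forall eps \near (0 : R), forall i j, normc (A eps i j - A0 i j) < e.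

Lemma entrywise_ccvg (R : realType) (m : nat) (A : R -> 'M[R[i]]_m) A0 : entrywise_cvg A A0 ->
  forall i j, ccvg (nbhs (0 : R)) (fun eps => A eps i j) (A0 i j).
Proof. by move=> h i j e e0; apply: filterS (h e e0) => eps; exact. Qed.

Section SpectralSplitting.
Variables (R : realType) (d n2 : nat) (omega : R) (Omega : 'I_n2 -> R) (C : 'M[R[i]]_(1 + d)).
Local Notation dim := (((1 + d) + (1 + d)) + (n2 + n2))%N.
Hypothesis omega0 : 0 < omega.
Hypothesis Omega0 : forall j, 0 < Omega j.
Hypothesis melnikov1 : forall (k1 : int) (j : 'I_n2),
  k1%:~R * omega + Omega j != 0 /\ k1%:~R * omega - Omega j != 0.
Hypothesis melnikov2 : forall (k1 : int) (j k : 'I_n2) (a b : bool), k1 != 0 ->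
  k1%:~R * omega + (-1) ^+ a * Omega j + (-1) ^+ b * Omega k != 0.
Local Notation T := (period omega).
Variables (Mo : R -> 'M[R[i]]_dim) (A11 : R -> 'M[R[i]]_((1 + d) + (1 + d))).
Variable (A22 : R -> 'M[R[i]]_(n2 + n2)).
Hypothesis Mo_cvg : entrywise_cvg Mo (unperturbed_flow Omega C T).
Hypothesis A11_cvg : entrywise_cvg A11 (twist_flow C T).
Hypothesis A22_cvg : entrywise_cvg A22 (oscillator_flow Omega T).
Hypothesis Mo_near : \forall eps \near (0 : R),
  [/\ (Mo eps)^T *m Jmx R d n2 *m Mo eps = Jmx R d n2,
      Mo eps *m conj_mx R d n2 = conj_mx R d n2 *m map_mx (@conjc R) (Mo eps) &
      (1 : R[i]) \in spectrum (Mo eps)].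

(** Symplecticity leaves the values 1 and -1; continuity selects that of the unperturbed flow. *)
Lemma monodromy_det : \forall eps \near (0 : R), \det (Mo eps) = 1.
Proof.
have := ccvg_det (entrywise_ccvg Mo_cvg) ltr01; rewrite det_unperturbed_flow => /(_ (nbhs_filter _)).
apply: filterS2 Mo_near => eps [sym _ _] d1.
have : \det (Mo eps) ^+ 2 = 1.
  have := congr1 determinant sym; rewrite !det_mulmx det_tr mulrAC -expr2 => h.
  by apply: (mulIf (Jmx_det R d n2)); rewrite h mul1r.
move/eqP; rewrite sqrf_eq1 => /orP[/eqP//|/eqP e]; move: d1.
rewrite e -opprD normcN -[1 + 1]/(2%:R) -(rmorph_nat (@real_complex R)) normcR ger0_norm//.
by rewrite ltNge ler1n.
Qed.

Lemma spectral_splitting : exists S11 S22 : R -> seq R[i],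
  [/\ \forall eps \near (0 : R),
        [/\ perm_eq (spectrum (Mo eps)) (S11 eps ++ S22 eps),
            (2 <= count_mem (1 : R[i])%R (S11 eps))%N &
            forall lambda, lambda \in S22 eps -> `|lambda| = 1],
      close_to S11 (fun eps => spectrum (A11 eps)) &
      close_to S22 (fun eps => spectrum (A22 eps))].
Proof.
have [del del0 [gap1 gap2]] := multiplier_gap omega0 Omega0 melnikov1 melnikov2.
have num (u w e1 : R) : u <= e1 -> 2 * del <= u + w -> 0 < del -> e1 <= del / 2 -> del <= w by lra.
pose P (x : R[i]) := normc (x - 1) < del.
exists (fun eps => [seq x <- spectrum (Mo eps) | P x]), (fun eps => [seq x <- spectrum (Mo eps) | ~~ P x]).
(* A matching with the unperturbed spectrum within [del / 2] cannot cross the threshold [del] around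
   1, the oscillator multipliers being at distance at least [2 * del] from 1. *)
have split e : 0 < e -> \forall eps \near (0 : R),
    matched_within e [seq x <- spectrum (Mo eps) | P x] (nseq ((1 + d) + (1 + d)) 1) /\
    matched_within e [seq x <- spectrum (Mo eps) | ~~ P x] (multipliers Omega T).
  move=> e0; pose e' := Num.min e (del / 2).
  have e'0 : 0 < e' by rewrite lt_min e0 divr_gt0.
  have mono e1 e2 (s t : seq R[i]) : e1 <= e2 -> matched_within e1 s t -> matched_within e2 s t.
    move=> e12 [u ut su]; exists u => //; move: su; rewrite !all2E => /andP[-> /=].
    by apply: sub_all => -[x1 x2] /=; rewrite !normcE0 !lecR => /le_trans; apply.
  apply: filterS (spectrum_continuity (entrywise_ccvg Mo_cvg)
    (char_poly_unperturbed_flow Omega C T) e'0) => eps h.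
  have [|x xm y xy|h1 h2] := @matched_filter R e' (spectrum (Mo eps)) _ _ P h.
  - move=> x /nseqP[-> _] y xy; apply: le_lt_trans xy _.
    by rewrite gt_min; apply/orP; right; rewrite ltr_pdivrMr// ltr_pMr// ltr1n.
  - rewrite /P -leNgt; have := gap1 x xm => hx.
    have h' := le_trans hx (normc_tri y x 1); rewrite normc_distC in xy.
    have : e' <= del / 2 by rewrite ge_min lexx orbT.
    exact: num xy h' del0.
  by split; [apply: mono h1|apply: mono h2]; rewrite ge_min lexx.
split.
- have uc0 : 0 <= unit_const n2 C T del.
    have t0 : 0 <= twist_size C T.
      by apply: sumr_ge0 => ? _; apply: sumr_ge0 => ? _; exact: normc_ge0.
    rewrite /unit_const !mulr_ge0// ?addr_ge0// ?mulr_ge0// ?invr_ge0 ?(ltW del0)//.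
    by rewrite addr_ge0// !mulr_ge0// invr_ge0 ltW.
  pose e := (unit_const n2 C T del + 1)^-1; have e0 : 0 < e by rewrite invr_gt0 ltr_wpDl.
  have small : e * unit_const n2 C T del < 1.
    by rewrite mulrC ltr_pdivrMr ?ltr_wpDl// mul1r ltrDl.
  apply: filterS3 (Mo_cvg e0) Mo_near monodromy_det => eps close [sym rl one] det1; split.
  + by rewrite perm_sym; apply: permEl; exact: perm_filterC.
  + have c1 : count_mem 1 [seq x <- spectrum (Mo eps) | P x] = count_mem 1 (spectrum (Mo eps)).
      rewrite count_filter; apply: eq_count => x /=; case: eqVneq => //= ->.
      by rewrite /P subrr normc0.
    (* The multiplicity of 1 is positive and even, hence at least 2; the disc around 1 captures all
       of it. *)
    rewrite c1; have ev := symplectic_unit_multiplicity sym (Jmx_det R d n2) det1 (dim_even d n2).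
    have : (0 < count_mem 1%R (spectrum (Mo eps)))%N by rewrite -has_count has_pred1.
    by move: ev; case: (count_mem _ _) => [|[|]].
  + move=> l; rewrite mem_filter /P -leNgt => /andP[l1 ls].
    rewrite normcE0 (unit_circle del0 (ltW e0) _ sym rl gap2 small ls l1)// => i j.
    exact: ltW.
- move=> e e0; have e20 : 0 < e / 2 by rewrite divr_gt0.
  apply: filterS2 (split _ e20) (spectrum_continuity (entrywise_ccvg A11_cvg)
    (char_poly_twist_flow C T) e20) => eps [h1 _] h2.
  by rewrite [e]splitr; exact: matched_trans_sym h1 h2.
- move=> e e0; have e20 : 0 < e / 2 by rewrite divr_gt0.
  apply: filterS2 (split _ e20) (spectrum_continuity (entrywise_ccvg A22_cvg)
    (char_poly_oscillator_flow Omega T) e20) => eps [_ h1] h2.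
  by rewrite [e]splitr; exact: matched_trans_sym h1 h2.
Qed.

End SpectralSplitting.

(** * Estimates uniform in the small parameter *)

Lemma pow_small (R : realType) (p c eta : R) : 0 < p -> 0 <= c -> 0 < eta ->
  \forall eps \near (0 : R), c * `|eps| `^ p < eta.
Proof.
move=> p0 c0 eta0; have c1 : 0 < c + 1 by rewrite ltr_wpDl.
pose a := (eta / (c + 1)) `^ p^-1; have a0 : 0 < a by apply: powR_gt0; rewrite divr_gt0.
exists a => // eps /=; rewrite sub0r normrN => ea.
have h : `|eps| `^ p < eta / (c + 1).
  have := gt0_ltr_powR p0 _ _ ea; rewrite !nnegrE normr_ge0 (ltW a0) => /(_ erefl erefl).
  by rewrite /a -powRrM mulVf ?gt_eqF// powRr1// ltW// divr_gt0.
apply: le_lt_trans (_ : _ <= (c + 1) * `|eps| `^ p) _.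
  by rewrite ler_wpM2r ?powR_ge0// lerDl.
by rewrite mulrC -ltr_pdivlMr.
Qed.

Lemma norm_small (R : realType) (c eta : R) : 0 <= c -> 0 < eta ->
  \forall eps \near (0 : R), c * `|eps| < eta.
Proof.
move=> c0 eta0; apply: filterS (pow_small (p := 1) ltr01 c0 eta0) => eps.
by rewrite powRr1.
Qed.

Lemma expr_le_powR (R : realType) (n : nat) (p e : R) : 0 <= e -> e <= 1 -> (0 < n)%N ->
  p <= n%:R -> e ^+ n <= e `^ p.
Proof.
rewrite le_eqVlt => /orP[/eqP <- _ n0 _|e0 e1 n0 pn].
  by rewrite expr0n gtn_eqF// powR_ge0.
by rewrite -powR_mulrn ?(ltW e0)// ger_powR// e0.
Qed.

Section Norms.
Variable R : realType.

Lemma l2norm_ge0 m (v : 'cV[R[i]]_m) : 0 <= l2norm v.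
Proof. exact: sqrtr_ge0. Qed.

Lemma normc_l2norm m (v : 'cV[R[i]]_m) i : normc (v i 0) <= l2norm v.
Proof.
rewrite -(@ler_pXn2r _ 2)// ?nnegrE ?normc_ge0 ?l2norm_ge0// sqr_sqrtr.
  exact: (normc_sqnorm (fun i => v i 0)).
by apply: sumr_ge0 => j _; exact: sqr_ge0.
Qed.

Lemma l2norm_l1norm m (v : 'cV[R[i]]_m) : l2norm v <= l1norm v.
Proof.
rewrite -(@ler_pXn2r _ 2)// ?nnegrE ?l1norm_ge0 ?l2norm_ge0// sqr_sqrtr.
  exact: sqnorm_l1norm.
by apply: sumr_ge0 => j _; exact: sqr_ge0.
Qed.

Lemma opnorm_le m (A : 'M[R[i]]_m) e : (forall i j, normc (A i j) <= e) ->
  opnorm A <= m%:R * (m%:R * e).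
Proof.
move=> Ae; apply: ge_sup.
  exists (l2norm (A *m 0)); exists 0 => //=.
  rewrite /l2norm big1 ?sqrtr0// => i _.
  by rewrite mxE normc0 expr0n.
move=> _ [v /= v1 <-]; apply: le_trans (l2norm_l1norm _) _; apply: sum_ord_le => i.
rewrite mxE; apply: le_trans (normc_sum _ _ _) _; apply: sum_ord_le => j.
rewrite normcM -[e]mulr1; apply: ler_pM; rewrite ?normc_ge0//.
exact: le_trans (normc_l2norm v j) v1.
Qed.

Variables d n2 : nat.
Local Notation dim := (((1 + d) + (1 + d)) + (n2 + n2))%N.

Lemma l1norm_insert_q1 a (x y : reduced R d n2) :
  l1norm (insert_q1 a x - insert_q1 a y) <= dim%:R * l2norm (x - y).
Proof.
apply: sum_ord_le => i; rewrite mx_subE.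
suff [->|[k ->]] : insert_q1 a x i 0 - insert_q1 a y i 0 = 0 \/
    exists k, insert_q1 a x i 0 - insert_q1 a y i 0 = (x - y) k 0.
- by rewrite normc0 l2norm_ge0.
- exact: normc_l2norm.
rewrite /insert_q1; case: (split_ordP i) => {}i ->.
  rewrite !col_mxEu; case: (split_ordP i) => {}i ->.
    rewrite !col_mxEu; case: (split_ordP i) => {}i ->.
      by left; rewrite !col_mxEu subrr.
    right; exists (lshift (n2 + n2) (lshift (1 + d) i)).
    by rewrite !col_mxEd !mxE.
  right; exists (lshift (n2 + n2) (rshift d i)).
  by rewrite !col_mxEd !mxE.
right; exists (rshift (d + (1 + d)) i).
by rewrite !col_mxEd !mxE.
Qed.

End Norms.

Lemma Lmx_torus (R : realType) (d n2 r : nat) (omega : R) (Omega : 'I_n2 -> R)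
    (g0 : tfseries R d n2) g qstar q10 eps :
  Lmx r omega Omega g0 g qstar q10 eps = Jmx R d n2 *m
    hessian (ham_trunc r omega Omega g0 (fun s => g s eps (qstar eps)))
      (torus_point n2 (qstar eps) q10).
Proof. by []. Qed.

Lemma xstar_torus (R : realType) (d n2 : nat) (qstar : R -> 'cV[R]_d) (q10 eps : R) :
  insert_q1 q10 (xstar n2 qstar eps) = torus_point n2 (qstar eps) q10.
Proof. by []. Qed.

Lemma L11_torus (R : realType) (d n2 r : nat) (omega : R) (Omega : 'I_n2 -> R)
    (g0 : tfseries R d n2) g qstar q10 eps :
  L11 r omega Omega g0 g qstar q10 eps =
    L11_of (ham_trunc r omega Omega g0 (fun s => g s eps (qstar eps)))
      (torus_point n2 (qstar eps) q10).
Proof. by []. Qed.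

Lemma L22_torus (R : realType) (d n2 r : nat) (omega : R) (Omega : 'I_n2 -> R)
    (g0 : tfseries R d n2) g qstar q10 eps :
  L22 r omega Omega g0 g qstar q10 eps =
    L22_of (ham_trunc r omega Omega g0 (fun s => g s eps (qstar eps)))
      (torus_point n2 (qstar eps) q10).
Proof. by []. Qed.

#[local] Opaque tfeval tfpart partial csum climn hessian gradient torus_point Jmx expmx
  orbit_const monodromy_const return_const compare_const ham ham_trunc.

(** * The estimates at one value of the parameter *)

Section FixedParameter.
Variables (R : realType) (d n2 r : nat) (rho sigma rad kap : R).
Local Notation dim := (((1 + d) + (1 + d)) + (n2 + n2))%N.
Hypotheses (rho0 : 0 <= rho) (rad0 : 0 <= rad) (kap0 : 0 < kap).
Hypotheses (krho : 8 * kap <= rho) (ksigma : 8 * kap <= sigma) (krad : 8 * kap <= rad).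
Variables (omega : R) (Omega : 'I_n2 -> R) (g0 : tfseries R d n2) (f : nat -> tfseries R d n2).
Variables (qs : 'cV[R]_d) (q10 E x b : R).
Hypotheses (omega0 : 0 < omega) (E0 : 0 <= E) (x0 : 0 <= x) (x2 : x <= 2^-1) (b0 : 0 <= b).
Hypothesis g0B : tfbounded rho sigma rad g0 (2 * E).
Hypothesis fB : forall s, (0 < s)%N -> tfbounded rho sigma rad (f s) (2 * E * x ^+ s).
Hypothesis g0split : split_order_zero (polydomain rho sigma rad) g0.
Hypothesis fN : forall s, (1 <= s <= r)%N -> normalized rho sigma rad qs (f s).
Hypothesis stationary : forall j : 'I_d, \sum_(1 <= s < r.+1)
  partial (idx_qhat n2 (other_idx j)) (tfeval (tfpart 0 (f s))) (torus_point n2 qs q10) = 0.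
Hypothesis b1 : 128 * E / kap * x ^+ r.+1 <= b.
Hypothesis b2 : 128 * E / kap ^+ 2 * x ^+ r.+1 <= b.
Let T := period omega.
Let H := ham omega Omega g0 f.
Let Z := ham_trunc r omega Omega g0 f.
Let N := ham_bound kap omega Omega E + 128 * E.
Variables (z : R -> phase R d n2) (M : R -> 'M[R[i]]_dim).
Hypothesis orbit : is_orbit H (polydomain rho sigma rad) T z.
Hypothesis z0 : l1norm (z 0 - torus_point n2 qs q10) <= b.
Hypothesis fundamental : is_fundamental_matrix H T z M.
Hypothesis returns : displacement omega T z = 0.
Hypothesis small1 : b * orbit_const d n2 kap N T < kap.
Hypothesis small2 : b * (2 * orbit_const d n2 kap N T) <= kap.
Hypothesis small3 : b * return_const d n2 kap N T < omega.
Hypothesis H_real : forall w, polydomain rho sigma rad w -> real_point w -> complex.Im (H w) = 0.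

Let T0 : 0 <= T.
Proof. by rewrite divr_ge0 ?(ltW omega0)// mulr_ge0// pi_ge0. Qed.
Let jH : jet kap (@tube R d n2 kap) H N := jet_ham kap0 krho ksigma krad r omega Omega E0 x0 x2 g0B fB.
Let jZ : jet kap (@tube R d n2 kap) Z N.
Proof.
apply: (jet_le kap0 _ (jet_trunc kap0 krho ksigma krad r omega Omega E0 x0 x2 g0B fB)).
by rewrite /N lerDl mulr_ge0.
Qed.
Let gc (w : phase R d n2) j : tube kap w -> normc (partial j H w - partial j Z w) <= b.
Proof.
move=> Uw; apply: le_trans b1.
exact: (ham_trunc_gradient_close kap0 krho ksigma krad r omega Omega E0 x0 x2 g0B fB j Uw).
Qed.
Let hc (w : phase R d n2) i j : tube kap w -> normc (hessian H w i j - hessian Z w i j) <= b.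
Proof.
move=> Uw; apply: le_trans b2.
exact: (ham_trunc_hessian_close kap0 krho ksigma krad r omega Omega E0 x0 x2 g0B fB i j Uw).
Qed.
Let gt := ham_trunc_gradient rho0 rad0 kap0 krho ksigma krad omega Omega g0B fB g0split fN stationary.
Let ht a i j := ham_trunc_hessian_cst rho0 rad0 kap0 krho ksigma krad omega Omega g0B fB g0split fN q10 a i j.
Let zd t : 0 <= t <= T -> forall i,
  has_time_derivative (fun s => z s i 0) t ((Jmx R d n2 *m gradient H (z t)) i 0).
Proof. by move=> tT; have [_ _] := orbit tT. Qed.
Let M0 : M 0 = 1%:M. Proof. by have [] := fundamental. Qed.
Let Md t : 0 <= t <= T -> forall i j,
  has_time_derivative (fun s => M s i j) t (((Jmx R d n2 *m hessian H (z t)) *m M t) i j).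
Proof. by have [_] := fundamental; exact. Qed.

Lemma fixed_monodromy i j :
  normc (M T i j - expmx (T%:C *: (Jmx R d n2 *m hessian Z (torus_point n2 qs q10))) i j) <=
  b * monodromy_const d n2 kap N T.
Proof. exact: (monodromy_close kap0 T0 b0 jH jZ gc hc gt ht zd z0 M0 Md small1). Qed.

Lemma fixed_symplectic : (M T)^T *m Jmx R d n2 *m M T = Jmx R d n2.
Proof. exact: (monodromy_symplectic kap0 T0 b0 jH gc gt zd z0 M0 Md small1). Qed.

Lemma fixed_real : M T *m conj_mx R d n2 = conj_mx R d n2 *m map_mx (@conjc R) (M T).
Proof.
have Hr w : tube kap w -> real_point w -> complex.Im (H w) = 0.
  by move=> Uw; apply: H_real; exact: (tube_dom kap0 krho ksigma krad Uw).
have zr t : 0 <= t <= T -> real_point (z t) by move=> tT; have [] := orbit tT.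
exact: (monodromy_real kap0 T0 b0 jH gc gt zd z0 M0 Md small1 Hr zr).
Qed.

Lemma fixed_one : (1 : R[i]) \in spectrum (M T).
Proof.
have oT : omega * T = 2 * pi by rewrite /T /period mulrC divfK// gt_eqF.
exact: (one_in_spectrum kap0 omega0 T0 b0 jH gc gt zd z0 M0 Md small1
  (ham_angle_shift omega Omega g0 f) oT returns small2 small3).
Qed.

Let h0 := unperturbed_hessian Omega (twist Omega g0).
Definition limit_rate : R := 128 * E / kap ^+ 2 * x.

Let y0 : 0 <= limit_rate.
Proof.
have k2 : 0 <= kap ^+ 2 by rewrite exprn_ge0// ltW.
exact: (mulr_ge0 (divr_ge0 (mulr_ge0 (ler0n _ 128) E0) k2) x0).
Qed.

Let h0E i j : h0 i j = hessian0 Omega g0 i j.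
Proof. by rewrite /h0 -(hessian0E rho0 rad0 kap0 krho ksigma krad Omega g0B g0split) mxE. Qed.

Let hh0 i j : normc (hessian Z (torus_point n2 qs q10) i j - h0 i j) <= limit_rate.
Proof.
rewrite h0E.
exact: (ham_trunc_hessian0 kap0 krho ksigma krad r omega Omega qs E0 x0 x2 g0B fB g0split q10 i j).
Qed.

Let h0N i j : normc (h0 i j) <= N / kap ^+ 2.
Proof.
have jZ' := jet_trunc kap0 krho ksigma krad r omega Omega E0 x0 x2 g0B fB.
have h1 := hessian_bound jZ' i j (tube_torus_point kap0 qs q10 : tube kap (torus_point n2 qs q10)).
have h2 := hh0 i j; have k2 : 0 <= (kap ^+ 2)^-1 by rewrite invr_ge0 exprn_ge0// ltW.
have num (u w : R[i]) e1 e2 e3 : normc u <= e1 -> normc (u - w) <= e2 -> e1 + e2 <= e3 -> normc w <= e3.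
  move=> hu huw; apply: le_trans; have -> : w = u - (u - w) by ring.
  by apply: le_trans (normcB _ _) _; exact: lerD.
apply: (num _ _ _ _ _ h1 h2); rewrite /N [leRHS]mulrDl lerD2l /limit_rate.
rewrite -[X in _ <= X]mulr1; apply: ler_wpM2l; first by rewrite mulr_ge0// mulr_ge0.
by apply: le_trans x2 _; rewrite invf_le1// ler1n.
Qed.

Lemma fixed_limit i j :
  normc (expmx (T%:C *: (Jmx R d n2 *m hessian Z (torus_point n2 qs q10))) i j -
    unperturbed_flow Omega (twist Omega g0) T i j) <=
  limit_rate * (dim%:R * compare_const dim (dim%:R * (N / kap ^+ 2)) T).
Proof. exact: (expmx_unperturbed kap0 T0 jH jZ y0 hh0 h0N (erefl h0)). Qed.

Lemma fixed_limit11 i j :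
  normc (expmx (T%:C *: L11_of Z (torus_point n2 qs q10)) i j - twist_flow (twist Omega g0) T i j) <=
  limit_rate * compare_const ((1 + d) + (1 + d)) (N / kap ^+ 2) T.
Proof. exact: (expmx_twist kap0 T0 jH jZ y0 hh0 h0N (erefl h0)). Qed.

Lemma fixed_limit22 i j :
  normc (expmx (T%:C *: L22_of Z (torus_point n2 qs q10)) i j - oscillator_flow Omega T i j) <=
  limit_rate * compare_const (n2 + n2) (N / kap ^+ 2) T.
Proof. exact: (expmx_oscillator kap0 T0 jH jZ y0 hh0 h0N (erefl h0)). Qed.

End FixedParameter.

Theorem theorem2p2 (R : realType) (d n2 r : nat) (hr : (1 <= r)%N)
  (omega : R) (Omega : 'I_n2 -> R)
  (f0 : tfseries R d n2) (f : nat -> R -> tfseries R d n2) (rho sigma rad : R)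
  (horiginal : original_hamiltonian omega Omega f0 f rho sigma rad)
  (g0 : tfseries R d n2) (g : nat -> R -> 'cV[R]_d -> tfseries R d n2)
  (Phi : R -> 'cV[R]_d -> phase R d n2 -> phase R d n2) (rho' sigma' rad' : R)
  (hnormal : normal_form r omega Omega f0 f rho sigma rad g0 g Phi rho' sigma' rad')
  (qstar : R -> 'cV[R]_d) (q10 : R)
  (hqstar : stationary_qstar r g qstar q10)
  (orb : R -> reduced R d n2 -> R -> phase R d n2)
  (horb : orbits_near_xstar omega Omega g0 g rho' sigma' rad' qstar q10 orb)
  (c0 c1 alpha : R) (hc0 : 0 < c0) (hc1 : 0 < c1)
  (hcont : continuation_hypotheses r omega Omega g0 g qstar q10 orb c1 alpha)
  (xpo : R -> reduced R d n2)
  (hxpo : is_continuation r omega qstar orb c0 alpha xpo)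
  (hOmega : forall j, 0 < Omega j)
  (M : R -> R -> 'M[R[i]]_(((1 + d) + (1 + d)) + (n2 + n2)))
  (hM : \forall eps \near (0 : R),
     is_fundamental_matrix (Hr_of omega Omega g0 g eps (qstar eps)) (period omega)
       (orb eps (xpo eps)) (M eps)) :
  let T := period omega in
  let monodromy eps := M eps T in
  let expLT eps := expmx (T%:C *: Lmx r omega Omega g0 g qstar q10 eps) in
  let expL11T eps := expmx (T%:C *: L11 r omega Omega g0 g qstar q10 eps) in
  let expL22T eps := expmx (T%:C *: L22 r omega Omega g0 g qstar q10 eps) in
  (exists2 cA : R, 0 < cA &
     \forall eps \near (0 : R), exists A,
       monodromy eps = expLT eps + A /\
       opnorm A <= cA * `|eps| `^ (r.+1%:R - alpha)) /\
  exists Sigma11 Sigma22 : R -> seq R[i],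
    [/\ \forall eps \near (0 : R),
          [/\ perm_eq (spectrum (monodromy eps)) (Sigma11 eps ++ Sigma22 eps),
              (2 <= count_mem (1 : R[i])%R (Sigma11 eps))%N &
              forall lambda, lambda \in Sigma22 eps -> `|lambda| = 1],
        close_to Sigma11 (fun eps => spectrum (expL11T eps)) &
        close_to Sigma22 (fun eps => spectrum (expL22T eps))].
Proof.
move=> T monodromy expLT expL11T expL22T.
have omega0 := oh_omega horiginal.
have [rho'0 sigma'0 rad'0] := nf_radii hnormal.
have [E [mu [E0 mu0 g0n near_order]]] := nf_order hnormal.
have [alpha0 alpha2 _ _] := hcont.
pose be : R := r.+1%:R - alpha.
(* [2 * alpha < r.+1] with [alpha > 0] makes the exponent of all the estimates positive. *)
have be0 : 0 < be by rewrite subr_gt0; lra.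
have ber : be <= r.+1%:R by rewrite gerBl ltW.
(* The division by 8 provides the margin that jets of monomials require in each radius. *)
pose kap := Num.min (Num.min rho' sigma') rad' / 8.
have m0 : 0 < Num.min (Num.min rho' sigma') rad' by rewrite !lt_min rho'0 sigma'0.
have kap0 : 0 < kap by rewrite divr_gt0.
have kE : 8 * kap = Num.min (Num.min rho' sigma') rad' by rewrite /kap mulrC divfK.
have krho : 8 * kap <= rho' by rewrite kE !ge_min lexx.
have ksigma : 8 * kap <= sigma' by rewrite kE !ge_min lexx orbT.
have krad : 8 * kap <= rad' by rewrite kE !ge_min lexx orbT.
have g0B := tfbounded_parts (ltW rho'0) (ltW rad'0) (ltW E0) g0n.
have g0split := nf_order_zero hnormal.
pose N := ham_bound kap omega Omega E + 128 * E.
pose dim := (((1 + d) + (1 + d)) + (n2 + n2))%N.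
pose K1 := 128 * E / kap * mu ^+ r.+1; pose K2 := 128 * E / kap ^+ 2 * mu ^+ r.+1.
(* [K1] and [K2] measure the gradient and the Hessian of the truncated tail; [dim%:R * c0] measures
   the distance from the periodic orbit to the torus point at time 0. *)
pose CB := K1 + K2 + dim%:R * c0.
have K10 : 0 <= K1 by rewrite /K1 mulr_ge0 ?exprn_ge0 ?(ltW mu0)// divr_ge0 ?(ltW kap0)// mulr_ge0 ?(ltW E0).
have K20 : 0 <= K2 by rewrite /K2 mulr_ge0 ?exprn_ge0 ?(ltW mu0)// divr_ge0 ?exprn_ge0 ?(ltW kap0)// mulr_ge0 ?(ltW E0).
have dc0 : 0 <= dim%:R * c0 by rewrite mulr_ge0 ?(ltW hc0).
have CB0 : 0 <= CB by rewrite /CB !addr_ge0.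
have [delta delta0 near_orb] := horb.
pose D := orbit_const d n2 kap N T; pose RC := return_const d n2 kap N T.
pose MC := monodromy_const d n2 kap N T.
pose C := twist Omega g0.
pose rate (eps : R) := limit_rate kap E (mu * `|eps|).
pose c1' := dim%:R * compare_const dim (dim%:R * (N / kap ^+ 2)) T.
pose c11 := compare_const ((1 + d) + (1 + d)) (N / kap ^+ 2) T.
pose c22 := compare_const (n2 + n2) (N / kap ^+ 2) T.
have D0 : 0 <= D by exact: sqrtr_ge0.
have near_small c eta : 0 < eta -> \forall eps \near (0 : R), CB * `|eps| `^ be * c < eta.
  move=> eta0; apply: filterS (pow_small be0 (mulr_ge0 CB0 (normr_ge0 c)) eta0) => eps.
  by apply: le_lt_trans; rewrite mulrAC ler_wpM2r ?powR_ge0// ler_wpM2l// ler_norm.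
have nearB : \forall eps \near (0 : R), forall s, (0 < s)%N ->
    tfbounded rho' sigma' rad' (g s eps (qstar eps)) (2 * E * (mu * `|eps|) ^+ s).
  apply: filterS near_order => eps h s s0; rewrite -mulrA.
  have e0 : 0 <= E * (mu * `|eps|) ^+ s by rewrite mulr_ge0 ?exprn_ge0 ?mulr_ge0 ?(ltW mu0) ?(ltW E0).
  apply: (tfbounded_parts (ltW rho'0) (ltW rad'0) e0) => l.
  by rewrite mulrAC; exact: h.
(* [H^(r)] is real on real points because it is [H^(0)], which is, composed with a transformation
   preserving real points. *)
have near_real : \forall eps \near (0 : R), forall w, polydomain rho' sigma' rad' w ->
    real_point w -> complex.Im (ham omega Omega g0 (fun s => g s eps (qstar eps)) w) = 0.
  apply: filterS3 (nf_transformation hnormal) (nf_composition hnormal) (oh_real horiginal).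
  move=> eps ht hcomp hr0 w wd wr; have ct := ht (qstar eps).
  apply: etrans (congr1 (@complex.Im R) (hcomp (qstar eps) w wd)) _.
  by apply: hr0; [exact: ct_maps ct _ wd|exact: ct_real ct _ wd wr].
(* All the smallness requirements ask that a constant times a positive power of [|eps|] stay below a
   threshold; the constants depend on neither [eps] nor [q^*], so one neighbourhood of 0 serves all
   entries and both claims. *)
have key : \forall eps \near (0 : R), [/\
    forall i j, normc (monodromy eps i j - expLT eps i j) <= CB * `|eps| `^ be * MC,
    forall i j, normc (expLT eps i j - unperturbed_flow Omega C T i j) <= rate eps * c1',
    forall i j, normc (expL11T eps i j - twist_flow C T i j) <= rate eps * c11,
    forall i j, normc (expL22T eps i j - oscillator_flow Omega T i j) <= rate eps * c22 &
    [/\ (monodromy eps)^T *m Jmx R d n2 *m monodromy eps = Jmx R d n2,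
      monodromy eps *m conj_mx R d n2 = conj_mx R d n2 *m map_mx (@conjc R) (monodromy eps) &
      (1 : R[i]) \in spectrum (monodromy eps)]].
  near=> eps.
  have e1 : `|eps| <= 1.
    by apply: ltW; near: eps; apply: filterS (norm_small (ler01 : 0 <= 1 :> R) ltr01) => ?; rewrite mul1r.
  have x2 : mu * `|eps| <= 2^-1.
    by apply: ltW; near: eps; apply: norm_small; rewrite ?(ltW mu0)// invr_gt0.
  have x0 : 0 <= mu * `|eps| by rewrite mulr_ge0 ?(ltW mu0).
  pose b := CB * `|eps| `^ be.
  have b0 : 0 <= b by rewrite mulr_ge0 ?powR_ge0.
  have fB : forall s, (0 < s)%N ->
      tfbounded rho' sigma' rad' (g s eps (qstar eps)) (2 * E * (mu * `|eps|) ^+ s).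
    by near: eps.
  have fN : forall s, (1 <= s <= r)%N -> normalized rho' sigma' rad' (qstar eps) (g s eps (qstar eps)).
    by near: eps; apply: filterS (nf_normalized hnormal) => eps h s; exact: h.
  have st : forall j : 'I_d, \sum_(1 <= s < r.+1)
      partial (idx_qhat n2 (other_idx j)) (tfeval (tfpart 0 (g s eps (qstar eps))))
        (torus_point n2 (qstar eps) q10) = 0.
    by near: eps; exact: hqstar.
  (* For [|eps| <= 1] the order [r + 1] of the tail is absorbed by the order [r + 1 - alpha] of the
     initial deviation. *)
  have pe : `|eps| ^+ r.+1 <= `|eps| `^ be by apply: expr_le_powR.
  have b1 : 128 * E / kap * (mu * `|eps|) ^+ r.+1 <= b.
    rewrite [(mu * _) ^+ _]exprMn mulrA -/K1; apply: le_trans (ler_wpM2l K10 pe) _.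
    by apply: ler_wpM2r; rewrite ?powR_ge0// /CB -addrA lerDl addr_ge0.
  have b2 : 128 * E / kap ^+ 2 * (mu * `|eps|) ^+ r.+1 <= b.
    rewrite [(mu * _) ^+ _]exprMn mulrA -/K2; apply: le_trans (ler_wpM2l K20 pe) _.
    by apply: ler_wpM2r; rewrite ?powR_ge0// /CB addrAC lerDr addr_ge0.
  have [[xr xd] xU _] : [/\ real_reduced (xpo eps) /\
      l2norm (xpo eps - xstar n2 qstar eps) <= c0 * `|eps| `^ be,
      Upsilon omega orb eps (xpo eps) = 0 & True].
    by near: eps; apply: filterS hxpo => eps [h1 h2 _].
  have xdelta : l2norm (xpo eps - xstar n2 qstar eps) < delta.
    by apply: le_lt_trans xd _; near: eps; exact: pow_small (ltW hc0) delta0.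
  have [orbit z0] : is_orbit (ham omega Omega g0 (fun s => g s eps (qstar eps)))
      (polydomain rho' sigma' rad') T (orb eps (xpo eps)) /\ orb eps (xpo eps) 0 = insert_q1 q10 (xpo eps).
    have : forall x, real_reduced x -> l2norm (x - xstar n2 qstar eps) < delta ->
      is_orbit (ham omega Omega g0 (fun s => g s eps (qstar eps)))
      (polydomain rho' sigma' rad') T (orb eps x) /\ orb eps x 0 = insert_q1 q10 x.
      by near: eps; exact: near_orb.
    by apply.
  have z0b : l1norm (orb eps (xpo eps) 0 - torus_point n2 (qstar eps) q10) <= b.
    rewrite z0 -xstar_torus; apply: le_trans (l1norm_insert_q1 _ _ _) _.
    apply: le_trans (ler_wpM2l (ler0n _ _) xd) _.
    by rewrite mulrA; apply: ler_wpM2r; rewrite ?powR_ge0// /CB lerDr addr_ge0.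
  have fund : is_fundamental_matrix (ham omega Omega g0 (fun s => g s eps (qstar eps))) T
      (orb eps (xpo eps)) (M eps).
    by near: eps; exact: hM.
  have small1 : b * D < kap by rewrite /b; near: eps; exact: (near_small D _ kap0).
  have small2 : b * (2 * D) <= kap by apply: ltW; rewrite /b; near: eps; exact: (near_small (2 * D) _ kap0).
  have small3 : b * RC < omega by rewrite /b; near: eps; exact: (near_small RC _ omega0).
  have H_real : forall w, polydomain rho' sigma' rad' w -> real_point w ->
      complex.Im (ham omega Omega g0 (fun s => g s eps (qstar eps)) w) = 0.
    by near: eps; exact: near_real.
  split.
  - move=> i j; rewrite /expLT Lmx_torus.
    exact: (fixed_monodromy (ltW rho'0) (ltW rad'0) kap0 krho ksigma krad omega0 (ltW E0) x0 x2 b0 g0B fB g0split fN st b1 b2 orbit z0b fund small1).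
  - move=> i j; rewrite /expLT Lmx_torus.
    exact: (fixed_limit r (ltW rho'0) (ltW rad'0) kap0 krho ksigma krad Omega (qstar eps) q10 omega0 (ltW E0) x0 x2 g0B fB g0split).
  - move=> i j; rewrite /expL11T L11_torus.
    exact: (fixed_limit11 r (ltW rho'0) (ltW rad'0) kap0 krho ksigma krad Omega (qstar eps) q10 omega0 (ltW E0) x0 x2 g0B fB g0split).
  - move=> i j; rewrite /expL22T L22_torus.
    exact: (fixed_limit22 r (ltW rho'0) (ltW rad'0) kap0 krho ksigma krad Omega (qstar eps) q10 omega0 (ltW E0) x0 x2 g0B fB g0split).
  split.
  - exact: (fixed_symplectic (ltW rho'0) (ltW rad'0) kap0 krho ksigma krad omega0 (ltW E0) x0 x2 b0 g0B fB g0split fN st b1 orbit z0b fund small1).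
  - exact: (fixed_real (ltW rho'0) (ltW rad'0) kap0 krho ksigma krad omega0 (ltW E0) x0 x2 b0 g0B fB g0split fN st b1 orbit z0b fund small1 H_real).
  - exact: (fixed_one (ltW rho'0) (ltW rad'0) kap0 krho ksigma krad omega0 (ltW E0) x0 x2 b0 g0B fB g0split fN st b1 orbit z0b fund xU small1 small2 small3).
split.
  (* The two factors [dim%:R] convert entrywise bounds into the operator norm; the absolute value of
     [MC] and the added 1 make the constant positive whatever the sign of [MC]. *)
  pose cA := dim%:R * (dim%:R * (CB * `|MC|)).
  have cA0 : 0 <= cA by rewrite /cA !mulr_ge0.
  exists (cA + 1); first by rewrite ltr_wpDl.
  apply: filterS key => eps [h1 _ _ _ _]; exists (monodromy eps - expLT eps).
  split; first by rewrite addrC subrK.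
  have h2 i j : normc ((monodromy eps - expLT eps) i j) <= CB * `|MC| * `|eps| `^ be.
    rewrite mx_subE; apply: le_trans (h1 i j) _; rewrite mulrAC.
    by apply: ler_wpM2r; rewrite ?powR_ge0// ler_wpM2l// ler_norm.
  apply: le_trans (opnorm_le h2) _; rewrite [leRHS]mulrDl mul1r.
  have -> : dim%:R * (dim%:R * (CB * `|MC| * `|eps| `^ be)) = cA * `|eps| `^ be by rewrite /cA; ring.
  by rewrite lerDl powR_ge0.
have rate_cvg (c : R) (e : R) : 0 < e -> \forall eps \near (0 : R), rate eps * c < e.
  move=> e0; pose k := 128 * E / kap ^+ 2 * mu.
  have k0 : 0 <= k by rewrite /k mulr_ge0 ?(ltW mu0)// divr_ge0 ?exprn_ge0 ?(ltW kap0)// mulr_ge0 ?(ltW E0).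
  apply: filterS (norm_small (mulr_ge0 k0 (normr_ge0 c)) e0) => eps.
  have -> : rate eps * c = k * `|eps| * c by rewrite /rate /limit_rate /k; ring.
  apply: le_lt_trans; rewrite mulrAC; apply: ler_wpM2r => //.
  by apply: ler_wpM2l; rewrite ?ler_norm.
apply: (spectral_splitting (C := C) omega0 hOmega (oh_melnikov1 horiginal) (oh_melnikov2 horiginal)).
(* The monodromy reaches the unperturbed flow through [exp (L T)]: the first claim gives one half of
   the distance, the limit of [L] the other. *)
- move=> e e0; have e20 : 0 < e / 2 by rewrite divr_gt0.
  apply: filterS3 key (near_small MC _ e20) (rate_cvg c1' _ e20) => eps [h1 h2 _ _ _] s1 s2 i j.
  apply: le_lt_trans (normc_tri (expLT eps i j) _ _) _; rewrite [e]splitr.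
  by apply: ltrD; [exact: le_lt_trans (h1 i j) s1|exact: le_lt_trans (h2 i j) s2].
- move=> e e0; apply: filterS2 key (rate_cvg c11 _ e0) => eps [_ _ h _ _] s1 i j.
  exact: le_lt_trans (h i j) s1.
- move=> e e0; apply: filterS2 key (rate_cvg c22 _ e0) => eps [_ _ _ h _] s1 i j.
  exact: le_lt_trans (h i j) s1.
- by apply: filterS key => eps [].
Unshelve. all: by end_near.
Qed.
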